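(* Let $F=(f_1,\ldots,f_r)$ be a collection of linear forms on $X=\mathbb{C}^n$ defining mutually distinct hyperplanes. Let $f=\prod_{i=1}^r f_i$ and $U=X\setminus f^{-1}(0)$. Then, as subsets of $M_B(U)=(\mathbb{C}^* )^r$, $$\mathcal{V}(U,X)=\mathcal{Z}\left(\prod_W\Big(\prod_{i\,:\,f_i(W)=0}t_i-1\Big)\right),$$ where the first product is over the dense edges $W$ of $f=\prod_i f_i$, and $\mathcal{Z}$ denotes the zero locus in $(\mathbb{C}^* )^r$.
   Context: For a topological space $T$, $M_B(T)$ denotes the moduli space of rank one $\mathbb{C}$-local systems on $T$, and $$\mathcal{V}(T)=\{L\in M_B(T)\mid H^{k}(T,L)\neq 0\text{ for some }k\}.$$ For $x\in f^{-1}(0)$, let $U_x$ be the complement of $f^{-1}(0)$ in a small ball in $X$ centered at $x$, let $res_x:M_B(U)\to M_B(U_x)$ be restriction of local systems, and set $$\mathcal{V}(U,X)=\bigcup_{x\in f^{-1}(0)}res_x^{-1}(\mathcal{V}(U_x))\subset M_B(U).$$ Here $M_B(U)$ is identified with $(\mathbb{C}^* )^r$, with coordinates $t_1,\ldots,t_r$, where $t_i$ is the monodromy of the local system around the hyperplane $\{f_i=0\}$. An edge of the arrangement is a (nonempty) intersection $W$ of some (at least one) of the hyperplanes $\{f_i=0\}$. For an edge $W$, consider the arrangement in the quotient $X/W$ induced by the hyperplanes $\{f_i=0\}$ containing $W$ (i.e. defined by $f_W=\prod_{i: f_i(W)=0}f_i$). The edge $W$ is dense if this arrangement is indecomposable,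 that is, there is no linear change of coordinates on $X/W$ after which $f_W$ is a product of two non-constant polynomials in disjoint sets of variables. *)

(* Defs.v *)
From HB Require Import structures.
From mathcomp.multinomials Require mpoly.
Import -(notations) mpoly.
From mathcomp Require Import all_boot all_order all_algebra generic_quotient.
From mathcomp Require Import all_classical all_reals all_analysis.
From mathcomp Require Import complex.

Set Implicit Arguments.
Unset Strict Implicit.
Unset Printing Implicit Defensive.

Import Order.TTheory GRing.Theory Num.Theory.
Import numFieldNormedType.Exports.

Local Open Scope classical_set_scope.
Local Open Scope quotient_scope.
Local Open Scope complex_scope.
Local Open Scope ring_scope.

(* The usual topology of the complex numbers, induced by the modulus. *)
HB.instance Definition _ (R : realType) :=
  PseudoPointedMetric.copy R[i] (R[i])^o.

Section LocalSystems.
Variable R : realType.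
Local Notation C := R[i].

Definition unit_interval : set R := `[0, 1]%classic.

Definition cpath (T : topologicalType) : Type :=
  continuousType (unit_interval : Type) T.

Lemma unit_interval0 : (0 : R) \in unit_interval.
Proof. by rewrite inE /unit_interval/= in_itv /= lexx ler01. Qed.

Lemma unit_interval1 : (1 : R) \in unit_interval.
Proof. by rewrite inE /unit_interval/= in_itv /= lexx ler01. Qed.

Definition I0 : unit_interval := exist _ 0 unit_interval0.
Definition I1 : unit_interval := exist _ 1 unit_interval1.

Definition homotopic (T : topologicalType) (a b : cpath T) : Prop :=
  exists H : continuousType (unit_interval * unit_interval)%type T,
    [/\ forall s, H (s, I0) = a s,
        forall s, H (s, I1) = b s,
        forall u, H (I0, u) = a I0 &
        forall u, H (I1, u) = a I1].

(* [c] runs through [a] on [0, 1/2], then through [b] on [1/2, 1]; evaluating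
   both clauses at 1/2 forces [a I1 = b I0]. *)
Definition is_concat (T : topologicalType) (a b c : cpath T) : Prop :=
  (forall s u : unit_interval, val u = 2 * val s -> c s = a u) /\
  (forall s u : unit_interval, val u = 2 * val s - 1 -> c s = b u).

(* A rank one local system, presented as a functor from the fundamental
   groupoid to lines: a basis vector has been chosen in every stalk, so that
   parallel transport along a path is a nonzero number. Changing the basis
   vectors is the relation [isomorphic] below. *)
Record local_system (T : topologicalType) := LocalSystem {
  transport :> cpath T -> C;
  transport_neq0 : forall a, transport a != 0;
  transport_homotopic :
    forall a b, homotopic a b -> transport a = transport b;
  transport_concat :
    forall a b c, is_concat a b c -> transport c = transport b * transport a
}.

HB.instance Definition _ T := gen_eqMixin (local_system T).
HB.instance Definition _ T := gen_choiceMixin (local_system T).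

Definition isomorphic (T : topologicalType) (L L' : local_system T) : Prop :=
  exists g : T -> C, (forall x, g x != 0) /\
    forall a : cpath T, L' a * g (a I0) = g (a I1) * L a.

Definition isomorphicb (T : topologicalType) (L L' : local_system T) : bool :=
  `[< isomorphic L L' >].

Lemma isomorphicb_refl (T : topologicalType) : reflexive (@isomorphicb T).
Proof.
move=> L; apply/asboolP; exists (fun=> 1).
by split=> [_|a]; [exact: oner_neq0|rewrite mulr1 mul1r].
Qed.

Lemma isomorphicb_sym (T : topologicalType) : symmetric (@isomorphicb T).
Proof.
suff sym (K K' : local_system T) : isomorphicb K K' -> isomorphicb K' K.
  by move=> L L'; apply/idP/idP; exact: sym.
move=> /asboolP[g [g0 gE]]; apply/asboolP; exists (fun x => (g x)^-1).
split=> [x|a]; first by rewrite invr_eq0.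
apply: (mulIf (g0 (a I0))); rewrite mulfVK//.
by rewrite -mulrA gE mulKf.
Qed.

Lemma isomorphicb_trans (T : topologicalType) : transitive (@isomorphicb T).
Proof.
move=> L2 L1 L3 /asboolP[g [g0 gE]] /asboolP[h [h0 hE]]; apply/asboolP.
exists (fun x => h x * g x); split=> [x|a]; first by rewrite mulf_neq0.
by rewrite mulrA hE -mulrA gE mulrA.
Qed.

Canonical isomorphicb_rel (T : topologicalType) :=
  EquivRel (@isomorphicb T) (@isomorphicb_refl T) (@isomorphicb_sym T)
    (@isomorphicb_trans T).

Definition M_B (T : topologicalType) := {eq_quot (@isomorphicb T)}.

Definition pullback_transport (S T : topologicalType) (h : continuousType S T)
    (L : local_system T) (a : cpath S) : C := L (h \o a).

Fact pullback_neq0 (S T : topologicalType) (h : continuousType S T)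
  (L : local_system T) a : pullback_transport h L a != 0.
Proof. exact: transport_neq0. Qed.

Fact pullback_homotopic (S T : topologicalType) (h : continuousType S T)
  (L : local_system T) a b :
  homotopic a b -> pullback_transport h L a = pullback_transport h L b.
Proof.
move=> [H [H0 H1 Hl Hr]]; apply: transport_homotopic; exists (h \o H).
by split=> u /=; rewrite ?H0 ?H1 ?Hl ?Hr.
Qed.

Fact pullback_concat (S T : topologicalType) (h : continuousType S T)
  (L : local_system T) a b c : is_concat a b c ->
  pullback_transport h L c =
    pullback_transport h L b * pullback_transport h L a.
Proof.
move=> [ca cb]; apply: transport_concat.
by split=> s u su /=; [rewrite (ca s u)|rewrite (cb s u)].
Qed.

Definition pullback (S T : topologicalType) (h : continuousType S T)
    (L : local_system T) : local_system S :=
  LocalSystem (pullback_neq0 h L) (@pullback_homotopic _ _ h L)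
    (@pullback_concat _ _ h L).

Lemma subtype_continuous (S X : topologicalType) (A : set X) (h : S -> A) :
  continuous (fun x => val (h x) : X) -> continuous h.
Proof. by move=> hc; apply: continuous_comp_initial. Qed.

Lemma row_continuous (S : topologicalType) (k : nat) (h : S -> 'rV[R]_k) :
  (forall j, continuous (fun x => h x 0 j)) -> continuous h.
Proof.
move=> hc x A [P xP PA].
have : \forall y \near x, forall j, P 0 j (h y 0 j).
  by apply: filter_forall => j; exact: hc (xP 0 j).
by apply: filterS => y Py; apply: PA => i j; rewrite (ord1 i).
Qed.

Definition incl_sub (X : topologicalType) (A B : set X) (AB : A `<=` B)
  (x : A) : B := exist _ (val x) (mem_set (AB _ (set_mem (valP x)))).

Lemma incl_sub_continuous (X : topologicalType) (A B : set X) (AB : A `<=` B) :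
  continuous (incl_sub AB).
Proof. by apply: subtype_continuous; exact: initial_continuous. Qed.

HB.instance Definition _ (X : topologicalType) (A B : set X) (AB : A `<=` B) :=
  @isContinuous.Build A B (incl_sub AB) (@incl_sub_continuous X A B AB).

Definition restriction (X : topologicalType) (A B : set X) (AB : A `<=` B)
  (l : M_B B) : M_B A := \pi_(M_B A) (pullback (incl_sub AB) (repr l)).

Definition std_simplex (k : nat) : set 'rV[R]_k.+1 :=
  [set v | (forall i, 0 <= v 0 i) /\ \sum_i v 0 i = 1].

Arguments std_simplex k : clear implicits.

Definition simplex (k : nat) (T : topologicalType) : Type :=
  continuousType (std_simplex k : Type) T.

Definition coface_row (k : nat) (i : 'I_k.+2) (v : 'rV[R]_k.+1) :
  'rV[R]_k.+2 :=
  \row_j (if unlift i j is Some j' then v 0 j' else 0).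

Lemma coface_std (k : nat) (i : 'I_k.+2) (v : std_simplex k) :
  coface_row i (val v) \in std_simplex k.+1.
Proof.
have [v0 v1] := set_mem (valP v); apply/mem_set; split.
  by move=> j; rewrite mxE; case: unliftP.
rewrite (bigD1_ord i)//= mxE unlift_none add0r -[RHS]v1.
by apply: eq_bigr => j _; rewrite mxE liftK.
Qed.

Definition coface (k : nat) (i : 'I_k.+2) (v : std_simplex k) :
  std_simplex k.+1 :=
  exist _ (coface_row i (val v)) (coface_std i v).

Lemma coface_continuous (k : nat) (i : 'I_k.+2) : continuous (@coface k i).
Proof.
apply: subtype_continuous; apply: row_continuous => j /=.
under eq_fun do rewrite mxE.
case: unlift => [j'|]; last exact: cst_continuous.
have vc : continuous (fun v : std_simplex k => val v : 'rV[R]_k.+1).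
  exact: initial_continuous.
have cc := @coord_continuous R 1 k.+1 0 j'.
by move=> v; exact: (continuous_comp (vc v) (cc _)).
Qed.

Definition edge01_row (k : nat) (s : R) : 'rV[R]_k.+2 :=
  \row_j (if j == 0 then 1 - s else if j == 1 then s else 0).

Lemma edge01_std (k : nat) (s : unit_interval) :
  edge01_row k (val s) \in std_simplex k.+1.
Proof.
have := set_mem (valP s); rewrite /unit_interval/= in_itv/= => /andP[s0 s1].
apply/mem_set; split=> [j|].
  by rewrite mxE; case: ifP => _; [rewrite subr_ge0|case: ifP].
rewrite big_ord_recl mxE eqxx big_ord_recl mxE/= big1 ?addr0 ?subrK// => j _.
by rewrite mxE.
Qed.

Definition edge01 (k : nat) (s : unit_interval) : std_simplex k.+1 :=
  exist _ (edge01_row k (val s)) (edge01_std k s).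

Lemma edge01_continuous (k : nat) : continuous (@edge01 k).
Proof.
apply: subtype_continuous; apply: row_continuous => j /=.
under eq_fun do rewrite mxE.
have vc : continuous (fun s : unit_interval => val s : R).
  exact: initial_continuous.
case: (j == 0); last by case: (j == 1); [exact: vc|exact: cst_continuous].
by move=> s; exact: (@cvgB _ R _ _ _ (cst 1) _ _ _ (cvg_cst _) (vc s)).
Qed.

HB.instance Definition _ (k : nat) (i : 'I_k.+2) :=
  @isContinuous.Build _ _ (@coface k i) (@coface_continuous k i).

HB.instance Definition _ (k : nat) :=
  @isContinuous.Build _ _ (@edge01 k) (@edge01_continuous k).

Section Cohomology.
Variables (T : topologicalType) (L : local_system T).

Definition cochain (k : nat) : Type := simplex k T -> C.

(* The value of a cochain at [sigma] lies in the stalk at the initial vertex of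
   [sigma]. The first face starts at the second vertex instead, so its value is
   transported back along the edge joining the first two vertices. *)
Definition coboundary (k : nat) (c : cochain k) : cochain k.+1 :=
  fun sigma : simplex k.+1 T =>
    (L (sigma \o edge01 k))^-1 * c (sigma \o coface ord0)
    + \sum_(i < k.+1) (-1) ^+ i.+1 * c (sigma \o coface (lift ord0 i)).

Definition cocycles (k : nat) : set (cochain k) :=
  [set c | coboundary c = fun=> 0].

Definition coboundaries (k : nat) : set (cochain k) :=
  match k return set (cochain k) with
  | 0 => [set fun=> 0]
  | k'.+1 => range (@coboundary k')
  end.

Arguments cocycles k : clear implicits.
Arguments coboundaries k : clear implicits.

Definition cohomology_neq0 (k : nat) : Prop :=
  exists c, cocycles k c /\ ~ coboundaries k c.

End Cohomology.

Definition V_locus (T : topologicalType) : set (M_B T) :=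
  [set l | exists k, cohomology_neq0 (repr l) k].

Section Arrangement.
Variables (n r : nat).
Local Notation X := 'rV[C]_n.
Variable F : 'I_r -> {scalar X}.

Definition hyperplane (i : 'I_r) : set X := [set x | F i x = 0].

Definition arr_poly (x : X) : C := \prod_i F i x.

Definition arr_complement : set X := ~` [set x | arr_poly x = 0].

Definition euclid_ball (x : X) (e : R) : set X :=
  [set y | \sum_j `|y 0 j - x 0 j| ^+ 2 < (e ^+ 2)%:C].

Definition loc_complement (x : X) (e : R) : set X :=
  euclid_ball x e `\` [set y | arr_poly y = 0].

Lemma loc_complement_sub x e : loc_complement x e `<=` arr_complement.
Proof. by move=> y []. Qed.

(* All sufficiently small balls around [x] are required to work; the local
   complements of small radii are homotopy equivalent by inclusion. *)
Definition V_UX : set (M_B arr_complement) :=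
  \bigcup_(x in [set x | arr_poly x = 0])
    [set l | \forall e \near 0^'+,
      V_locus (restriction (@loc_complement_sub x e) l)].

(* The boundary circle of a closed disc that meets the arrangement only at its
   centre, a point lying on the i-th hyperplane and on no other one. *)
Definition is_meridian (i : 'I_r) (a : cpath arr_complement) : Prop :=
  exists p v : X,
    [/\ F i p = 0, F i v != 0,
        forall j z, j != i -> `|z| <= 1 -> F j (p + z *: v) != 0 &
        forall s : unit_interval,
          val (a s) = p + (cos (2 * pi * val s) +i* sin (2 * pi * val s)) *: v].

Definition monodromy (g : 'I_r -> cpath arr_complement)
    (l : M_B arr_complement) : 'I_r -> C := fun i => repr l (g i).

Definition vanishes_on (i : 'I_r) (W : {vspace X}) : bool :=
  `[< forall w, w \in W -> F i w = 0 >].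

Definition edge (W : {vspace X}) : Prop :=
  exists S : {set 'I_r}, S != finset.set0 /\
    forall x, x \in W <-> forall i, i \in S -> F i x = 0.

Definition nonconstant (m : nat) (p : mpoly m C) : Prop :=
  forall c, p <> mpolyC m c.

Definition only_in (m : nat) (A : {set 'I_m}) (p : mpoly m C) : Prop :=
  forall e j, e \in msupp p -> j \notin A -> e j = 0%N.

Definition edge_poly (W : {vspace X}) (x : X) : C :=
  \prod_(i | vanishes_on i W) F i x.

(* A linear coordinate system on the quotient of X by W is the same as a
   surjective linear map [y] out of X with kernel W. The base field is infinite,
   so polynomials on the quotient may be compared by their values. *)
Definition decomposable (W : {vspace X}) : Prop :=
  exists (m : nat) (y : {linear X -> 'rV[C]_m}),
    [/\ forall u, exists x, y x = u,
        forall x, y x = 0 <-> x \in W &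
        exists (A : {set 'I_m}) (p q : mpoly m C),
          [/\ nonconstant p, nonconstant q,
              only_in A p, only_in (finset.setC A) q &
              forall x, edge_poly W x =
                meval (fun j => y x 0 j) p * meval (fun j => y x 0 j) q]].

Definition dense_edge (W : {vspace X}) : Prop := edge W /\ ~ decomposable W.

Definition dense_equation (t : 'I_r -> C) : C :=
  \big[*%R/1]_(W \in [set W | dense_edge W])
    (\prod_(i | vanishes_on i W) t i - 1).

Definition torus : set ('I_r -> C) := [set t | forall i, t i != 0].

Definition zero_locus (P : ('I_r -> C) -> C) : set ('I_r -> C) :=
  torus `&` [set t | P t = 0].

End Arrangement.
End LocalSystems.

Arguments hyperplane {R n r} F i _.
Arguments V_locus {R} T _.
Arguments V_UX {R n r} F _.
Arguments dense_equation {R n r} F t.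

(* Main.v *)
Require Import Defs.
From HB Require Import structures.
From mathcomp.multinomials Require mpoly.
Import -(notations) mpoly.
From mathcomp Require Import all_boot all_order all_algebra generic_quotient.
From mathcomp Require Import all_classical all_reals all_analysis.
From mathcomp Require Import complex ring lra zify.

Set Implicit Arguments.
Unset Strict Implicit.
Unset Printing Implicit Defensive.

Import Order.TTheory GRing.Theory Num.Theory.
Import numFieldNormedType.Exports.

Local Open Scope classical_set_scope.
Local Open Scope complex_scope.
Local Open Scope ring_scope.

Local Notation Re := (@complex.Re _).
Local Notation Im := (@complex.Im _).

(** * Paths and parallel transport in convex sets *)

(** A small ball around [x] meets only the hyperplanes through [x], so local cohomology is governed
    by a central arrangement, and the rank function [rkF] of its linear forms decides everything. An
    edge is dense exactly when the set [above F W] of hyperplanes containing it does not split into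
    two nonempty parts whose ranks add up ([separable_decomposable], [decomposable_separable]).

    Suppose that cohomology near [x] does not vanish. Among the forms vanishing at [x] choose a
    smallest nonempty direct summand [A]; it is inseparable, so its common zeros form a dense edge
    ([minimal_summand]). Multiplying the block of coordinates belonging to [A] by unit complex
    numbers, and rescaling to keep the distance to [x], gives a loop of self-maps of the local
    complement based at the identity. Every point then runs through a loop of monodromy [tau], the
    product of the [t_i] over [A]. The prism operator of this homotopy makes [tau^-1 - 1] act as
    zero on cohomology, hence [tau = 1] ([cohomology_monodromy_vanish], [no_cohomology],
    [cohomology_dense_edge]).

    Conversely, let the product over a dense edge [W] be 1, and let [x] lie in [W] and on no
    hyperplane that does not contain [W]. A full turn about [x] now has trivial monodromy, so the
    local system on the local complement is, up to isomorphism, pulled back from the slice where one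
    form [F i0] equals 1 ([rotation_isomorphic]). This slice is a retract, and cohomology of the
    slice injects ([cohomology_retract]). On the slice an Euler characteristic argument applies: it
    is the same for every rank one local system and obeys deletion and restriction ([eulerS_chi]);
    it is, up to sign, the beta invariant of a matroid ([chi_chiM]), which is nonzero because an
    inseparable set of forms is a connected matroid ([chiM_sign], [local_cohomology_neq0]).

    Two tools support both halves. Singular cohomology with local coefficients needs homotopy
    invariance ([prism_homotopyS]), small simplices ([small_acyclic]) and [mayer_vietoris]. The
    monodromy along a round circle in a complex line is the product of the meridian monodromies of
    the hyperplanes that the line meets inside the circle ([mono_prod]); this rests on comparing two
    circles that differ by one intersection point ([crossing]). *)

Lemma sub_in (T : Type) (A : set T) (x : A) : A (val x).
Proof. exact: set_mem (valP x). Qed.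

Definition mksub (T : Type) (A : set T) (x : T) (Ax : A x) : A :=
  exist _ x (mem_set Ax).

Lemma val_continuous (T : topologicalType) (A : set T) :
  continuous (fun x : A => val x : T).
Proof. exact: initial_continuous. Qed.

Lemma pair_continuous (S T U : topologicalType) (f : S -> T) (g : S -> U) :
  continuous f -> continuous g -> continuous (fun x => (f x, g x)).
Proof. by move=> cf cg x; apply: cvg_pair; [exact: cf|exact: cg]. Qed.

Lemma comp_continuous (S T U : topologicalType) (f : S -> T) (g : T -> U) :
  continuous f -> continuous g -> continuous (fun x => g (f x)).
Proof. by move=> cf cg x; apply: continuous_comp; [exact: cf|exact: cg]. Qed.

Definition cmap (S T : topologicalType) (f : S -> T) (fc : continuous f) :
  continuousType S T := mkcts fc.

Section RealPaths.
Variable R : realType.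
Local Notation I := (@unit_interval R).

Lemma unitP (s : I) : 0 <= val s <= 1.
Proof. by have := sub_in s; rewrite /unit_interval/= in_itv. Qed.

Lemma clamp_subproof (s : R) : I (Num.max 0 (Num.min 1 s)).
Proof.
rewrite /unit_interval/= in_itv/= le_max lexx/=.
by rewrite ge_max ler01 ge_min lexx.
Qed.

(** Extends path parameters to the whole real line, so that concatenations and local arguments need
    no case distinction at the ends. *)
Definition clamp (s : R) : I := mksub (clamp_subproof s).

Lemma clamp_id (s : R) : 0 <= s <= 1 -> val (clamp s) = s.
Proof. by move=> /andP[s0 s1] /=; rewrite min_r // max_r. Qed.

Lemma clamp_val (s : I) : clamp (val s) = s.
Proof. by apply: val_inj; rewrite clamp_id // unitP. Qed.

Lemma clamp_le0 (s : R) : s <= 0 -> val (clamp s) = 0.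
Proof.
move=> s0 /=; rewrite min_r ?(le_trans s0)//.
by rewrite max_l.
Qed.

Lemma clamp_ge1 (s : R) : 1 <= s -> val (clamp s) = 1.
Proof. by move=> s1 /=; rewrite min_l // max_r. Qed.

Lemma clamp_continuous : continuous clamp.
Proof.
apply: subtype_continuous => s /=.
by apply: continuous_max; [exact: cvg_cst|apply: continuous_min; [exact: cvg_cst|exact: cvg_id]].
Qed.

Lemma uvalc : continuous (fun s : I => val s : R).
Proof. exact: val_continuous. Qed.

Lemma lineE (K : ringType) (W : lmodType K) (t : K) (p q : W) :
  p + t *: (q - p) = (1 - t) *: p + t *: q.
Proof. by rewrite scalerBr scalerBl scale1r addrCA addrC. Qed.

Section Lines.
Variables (S : topologicalType) (V : normedModType R).

Lemma addc (f g : S -> V) : continuous f -> continuous g ->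
  continuous (fun x => f x + g x).
Proof. by move=> cf cg x; apply: cvgD; [exact: cf|exact: cg]. Qed.

Lemma scalec (f : S -> R) (g : S -> V) : continuous f -> continuous g ->
  continuous (fun x => f x *: g x).
Proof. by move=> cf cg x; apply: cvgZ; [exact: cf|exact: cg]. Qed.

Lemma subc (f g : S -> V) : continuous f -> continuous g ->
  continuous (fun x => f x - g x).
Proof. by move=> cf cg x; apply: cvgB; [exact: cf|exact: cg]. Qed.

Lemma cstc (U : topologicalType) (c : U) : continuous (fun _ : S => c).
Proof. by move=> x; exact: cvg_cst. Qed.

Lemma radd (f g : S -> R) : continuous f -> continuous g ->
  continuous (fun x => f x + g x).
Proof. by move=> cf cg x; apply: cvgD; [exact: cf|exact: cg]. Qed.

Lemma rsub (f g : S -> R) : continuous f -> continuous g ->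
  continuous (fun x => f x - g x).
Proof. by move=> cf cg x; apply: cvgB; [exact: cf|exact: cg]. Qed.

Lemma rmul (f g : S -> R) : continuous f -> continuous g ->
  continuous (fun x => f x * g x).
Proof. by move=> cf cg x; apply: cvgM; [exact: cf|exact: cg]. Qed.

End Lines.


Section Convex.
Variable V : normedModType R.

Definition cvx (A : set V) := forall x y t, A x -> A y -> 0 <= t <= 1 ->
  A ((1 - t) *: x + t *: y).

Variables (A : set V) (cA : cvx A).

Lemma seg_subproof (p q : A) (s : I) :
  A ((1 - val s) *: val p + val s *: val q).
Proof. by apply: cA; rewrite ?unitP //; exact: sub_in. Qed.

Definition segf (p q : A) (s : I) : A := mksub (seg_subproof p q s).

Lemma segf_continuous p q : continuous (segf p q).
Proof.
apply: subtype_continuous => /=.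
apply: addc; apply: scalec; try exact: cstc; last exact: uvalc.
by apply: rsub; [exact: cstc|exact: uvalc].
Qed.

Definition seg (p q : A) : cpath R A := cmap (@segf_continuous p q).

Lemma seg0 p q : seg p q (@I0 R) = p.
Proof. by apply: val_inj => /=; rewrite subr0 scale1r scale0r addr0. Qed.

Lemma seg1 p q : seg p q (@I1 R) = q.
Proof. by apply: val_inj => /=; rewrite subrr scale1r scale0r add0r. Qed.

(** Straight-line interpolation stays in [A] by convexity and fixes the common endpoints. *)
Lemma convex_homotopic (a b : cpath R A) :
  a (@I0 R) = b (@I0 R) -> a (@I1 R) = b (@I1 R) -> homotopic a b.
Proof.
move=> ab0 ab1.
have hc : continuous (fun su : I * I => segf (a su.1) (b su.1) su.2).
  apply: subtype_continuous => /=.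
  have c1 : continuous (fun su : I * I => val su.2 : R).
    by apply: comp_continuous uvalc => x; exact: cvg_snd.
  have ca (f : cpath R A) : continuous (fun su : I * I => val (f su.1) : V).
    apply: (@comp_continuous _ _ _ (fun su : I * I => f su.1)).
      apply: (@comp_continuous _ _ _ fst f); first by move=> x; exact: cvg_fst.
      exact: cts_fun.
    exact: val_continuous.
  apply: addc; apply: scalec; [|exact: ca|exact: c1|exact: ca].
  by apply: rsub => //; exact: cstc.
exists (cmap hc); split=> [s|s|u|u] /=.
- by apply: val_inj => /=; rewrite subr0 scale1r scale0r addr0.
- by apply: val_inj => /=; rewrite subrr scale1r scale0r add0r.
- by apply: val_inj => /=; rewrite ab0 -scalerDl subrK scale1r.
- by apply: val_inj => /=; rewrite ab1 -scalerDl subrK scale1r.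
Qed.

(** The first clamped term moves from [p] to [q] up to time 1/2, the second from [q] to [r]
    afterwards; a single continuous formula thus describes the concatenation. *)
Lemma concat_subproof (p q r : A) (s : I) :
  A (val p + val (clamp (2 * val s)) *: (val q - val p)
     + val (clamp (2 * val s - 1)) *: (val r - val q)).
Proof.
have /andP[s0 s1] := unitP s.
have [h|h] := lerP (2 * val s) 1.
  rewrite (clamp_le0 (s := _ - 1)) ?subr_le0// scale0r addr0.
  rewrite lineE.
  by apply: cA; rewrite ?unitP//; exact: sub_in.
rewrite (clamp_ge1 (s := 2 * _)) ?ltW// scale1r [val p + _]addrC subrK.
rewrite lineE.
by apply: cA; rewrite ?unitP//; exact: sub_in.
Qed.

Definition concatf p q r (s : I) : A := mksub (concat_subproof p q r s).

Lemma concatf_continuous p q r : continuous (concatf p q r).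
Proof.
apply: subtype_continuous => /=.
have c2 : continuous (fun s : I => 2 * val s : R).
  by apply: rmul; [exact: cstc|exact: uvalc].
have cl (f : I -> R) : continuous f ->
    continuous (fun s => val (clamp (f s)) : R).
  move=> cf; apply: (comp_continuous _ uvalc).
  exact: comp_continuous clamp_continuous.
apply: addc; [apply: addc; [exact: cstc|]|]; apply: scalec; try exact: cstc;
  apply: cl => //.
by apply: rsub => //; exact: cstc.
Qed.

Lemma seg_concat p q r :
  is_concat (seg p q) (seg q r) (cmap (@concatf_continuous p q r)).
Proof.
split=> s u su; apply: val_inj;
  rewrite -[LHS]/(val p + val (clamp (2 * val s)) *: (val q - val p)
     + val (clamp (2 * val s - 1)) *: (val r - val q)).
  have /andP[u0 u1] := unitP u.
  by rewrite -su clamp_val clamp_le0 ?subr_le0// scale0r addr0 lineE.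
have /andP[u0 u1] := unitP u.
have e : 2 * val s = val u + 1 by rewrite su subrK.
rewrite -su clamp_val (clamp_ge1 (s := 2 * val s)); last by rewrite e lerDr.
by rewrite scale1r [val p + _]addrC subrK lineE.
Qed.

Variable L : local_system R A.

Lemma convex_transport (a : cpath R A) : L a = L (seg (a (@I0 R)) (a (@I1 R))).
Proof.
by apply: transport_homotopic; apply: convex_homotopic; rewrite ?seg0 ?seg1.
Qed.

(** The cocycle rule that trivialises a local system on a convex set. Transports in simplices,
    cylinders and squares are all computed through it. *)
Lemma seg_transport p q r : L (seg p r) = L (seg q r) * L (seg p q).
Proof.
rewrite -(transport_concat L (seg_concat p q r)) [RHS]convex_transport.
have e x : val (concatf p q r x) = val p + val (clamp (2 * val x)) *: (val q - val p)
     + val (clamp (2 * val x - 1)) *: (val r - val q) by [].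
congr (transport L (seg _ _)); apply: val_inj; rewrite /cmap/mkcts e.
  rewrite -[val (@I0 R)]/0 !clamp_le0 ?mulr0 ?sub0r ?oppr_le0//.
  by rewrite !scale0r !addr0.
have h1 : 1 <= 2 * 1 - 1 :> R by lra.
have h2 : 1 <= 2 * 1 :> R by lra.
rewrite -[val (@I1 R)]/1 (clamp_ge1 h1) (clamp_ge1 h2).
by rewrite !scale1r [val p + _]addrC subrK addrC subrK.
Qed.

Lemma seg_transport_refl p : L (seg p p) = 1.
Proof.
apply: (mulfI (transport_neq0 L (seg p p))).
by rewrite mulr1 -seg_transport.
Qed.

End Convex.

End RealPaths.

(** * Subdivision of cochains *)

Section SeqCochains.
Variable K : comNzRingType.

Section Differential.
Variable X : Type.
Implicit Types (c : seq X -> K) (s : seq X).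

(** The simplicial coboundary for functions of vertex lists, by recursion on the first vertex; [sdE]
    recovers the alternating sum. Lists turn the usual sign computations into short inductions. *)
Fixpoint sd c s : K :=
  if s is v :: vs then c vs - sd (fun ws => c (v :: ws)) vs else 0.

Fixpoint pall (P : X -> Prop) s : Prop :=
  if s is v :: vs then P v /\ pall P vs else True.

Lemma pallW (P Q : X -> Prop) s : (forall x, P x -> Q x) -> pall P s -> pall Q s.
Proof. by move=> PQ; elim: s => //= v vs IH [/PQ Pv /IH]. Qed.

Lemma sd_eq (P : X -> Prop) c c' n s :
  (forall ws, size ws = n -> pall P ws -> c ws = c' ws) ->
  size s = n.+1 -> pall P s -> sd c s = sd c' s.
Proof.
elim: s c c' n => //= v vs IH c c' n cc' [svs] [Pv Pvs].
rewrite cc'//; congr (_ - _).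
case: n svs cc' => [/size0nil -> //|n] svs cc'.
by apply: (IH _ _ n) => // ws sws Pws; apply: cc'; rewrite /= ?sws.
Qed.

Lemma sd_eq_size c c' n s :
  (forall ws, size ws = n -> c ws = c' ws) -> size s = n.+1 -> sd c s = sd c' s.
Proof.
move=> cc' ss; apply: (@sd_eq (fun=> True) _ _ n) => // [ws sws _|]; first exact: cc'.
by elim: s {ss}.
Qed.

Lemma sdD c c' s : sd (fun ws => c ws + c' ws) s = sd c s + sd c' s.
Proof.
elim: s c c' => [|v vs IH] c c' /=; first by rewrite addr0.
by rewrite (IH (fun ws => c (v :: ws))) opprD addrACA.
Qed.

Lemma sdZ a c s : sd (fun ws => a * c ws) s = a * sd c s.
Proof.
elim: s c => [|v vs IH] c /=; first by rewrite mulr0.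
by rewrite (IH (fun ws => c (v :: ws))) mulrBr.
Qed.

Lemma sdB c c' s : sd (fun ws => c ws - c' ws) s = sd c s - sd c' s.
Proof.
rewrite -[X in _ - X]mul1r -mulNr -sdZ -sdD; congr (sd _ _).
by apply: funext => ws; rewrite mulN1r.
Qed.

Lemma sd0 s : sd (fun=> 0) s = 0.
Proof. by elim: s => //= v vs ->; rewrite subr0. Qed.

Lemma sd_sum (J : Type) (r : seq J) (f : J -> seq X -> K) s :
  sd (fun ws => \sum_(j <- r) f j ws) s = \sum_(j <- r) sd (f j) s.
Proof.
elim: r => [|j r IH].
  rewrite big_nil -[RHS](sd0 s); congr (sd _ s).
  by apply: funext => ws; rewrite big_nil.
rewrite big_cons -IH -sdD; congr (sd _ s).
by apply: funext => ws; rewrite big_cons.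
Qed.

Lemma sdK c s : sd (sd c) s = 0.
Proof.
elim: s c => //= v vs IH c; rewrite sdB IH subr0 subrr //.
Qed.

Definition del (i : nat) s := take i s ++ drop i.+1 s.

Lemma sdE c s : sd c s = \sum_(i < size s) (-1) ^+ i * c (del i s).
Proof.
elim: s c => [|v vs IH] c /=; first by rewrite big_ord0.
rewrite big_ord_recl/= expr0 mul1r /del/= drop0; congr (_ + _).
rewrite IH -sumrN; apply: eq_bigr => i _.
by rewrite /bump /= add1n exprS mulN1r mulNr.
Qed.

End Differential.

(** * The prism operator on vertex lists *)

Section Prism.
Variables (X Y : Type) (al be : X -> Y).
Implicit Types (c : seq Y -> K) (s : seq X).

(** The alternating sum over [i] of [c] on [al v_0, ..., al v_i, be v_i, ..., be v_n]: the standard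
    triangulation of the prism between the [al] and [be] images of a simplex. *)
Fixpoint prism c s : K :=
  if s is v :: vs then
    c (al v :: be v :: map be vs) - prism (fun ws => c (al v :: ws)) vs
  else 0.

Lemma prismD c c' s : prism (fun ws => c ws + c' ws) s = prism c s + prism c' s.
Proof.
elim: s c c' => [|v vs IH] c c' /=; first by rewrite addr0.
by rewrite (IH (fun ws => c (al v :: ws))) opprD addrACA.
Qed.

Lemma prismZ a c s : prism (fun ws => a * c ws) s = a * prism c s.
Proof.
elim: s c => [|v vs IH] c /=; first by rewrite mulr0.
by rewrite (IH (fun ws => c (al v :: ws))) mulrBr.
Qed.

Lemma prismB c c' s : prism (fun ws => c ws - c' ws) s = prism c s - prism c' s.
Proof.
rewrite -[X in _ - X]mul1r -mulNr -prismZ -prismD; congr (prism _ _).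
by apply: funext => ws; rewrite mulN1r.
Qed.

Lemma sd_map c s : sd (fun ws => c (map be ws)) s = sd c (map be s).
Proof. by elim: s c => //= v vs IH c; rewrite (IH (fun ws => c (be v :: ws))). Qed.

(** The faces interior to the prism cancel in pairs, which leaves top minus bottom. *)
Lemma prism_homotopy c s :
  sd (prism c) s + prism (sd c) s = c (map be s) - c (map al s).
Proof.
elim: s c => [|v vs IH] c /=; first by rewrite addr0 subrr.
rewrite prismB sdB /=.
rewrite -(sd_map (fun ws => c (al v :: be v :: ws))).
have := IH (fun ws => c (al v :: ws)).
move=> /(canRL (addKr _)) ->.
by ring.
Qed.

End Prism.

(** * Barycentric subdivision on vertex lists *)

Section Subdivision.
Variables (X : Type) (b : seq X -> X).
Implicit Types (c : seq X -> K) (s : seq X).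

(** Dual form of barycentric subdivision: the barycentre [b s] is coned onto the subdivided
    boundary. The counter [n] stands for [size s], which makes the recursion structural. *)
Fixpoint subdivN n c s : K :=
  if n is n'.+1 then sd (subdivN n' (fun ws => c (b s :: ws))) s else c s.

(** The homotopy from the identity to subdivision: the cone from the barycentre over the simplex,
    corrected by the homotopy on its boundary. *)
Fixpoint subhomN n c s : K :=
  if n is n'.+1 then
    c (b s :: s) - sd (subhomN n' (fun ws => c (b s :: ws))) s
  else 0.

Lemma subdivNB n c c' s :
  subdivN n (fun ws => c ws - c' ws) s = subdivN n c s - subdivN n c' s.
Proof.
elim: n c c' s => //= n IH c c' s; rewrite -sdB; congr (sd _ s).
by apply: funext => ws; rewrite -IH.
Qed.

Lemma subdivNZ n a c s : subdivN n (fun ws => a * c ws) s = a * subdivN n c s.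
Proof.
elim: n c s => //= n IH c s; rewrite -sdZ; congr (sd _ s).
by apply: funext => ws; rewrite -IH.
Qed.

Lemma subhomNB n c c' s :
  subhomN n (fun ws => c ws - c' ws) s = subhomN n c s - subhomN n c' s.
Proof.
elim: n c c' s => [|n IH] c c' s /=; first by rewrite subrr.
have -> : sd (subhomN n (fun ws => c (b s :: ws) - c' (b s :: ws))) s =
    sd (subhomN n (fun ws => c (b s :: ws))) s
    - sd (subhomN n (fun ws => c' (b s :: ws))) s.
  by rewrite -sdB; congr (sd _ s); apply: funext => ws; rewrite -IH.
by ring.
Qed.

Lemma subhomNZ n a c s : subhomN n (fun ws => a * c ws) s = a * subhomN n c s.
Proof.
elim: n c s => [|n IH] c s /=; first by rewrite mulr0.
rewrite mulrBr -sdZ; congr (_ - sd _ s).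
by apply: funext => ws; rewrite -IH.
Qed.

Lemma subdivN_eq (P : X -> Prop) c c' n s :
  (forall s, pall P s -> (0 < size s)%N -> P (b s)) ->
  (forall ws, size ws = n -> pall P ws -> c ws = c' ws) ->
  size s = n -> pall P s -> subdivN n c s = subdivN n c' s.
Proof.
move=> Pb; elim: n c c' s => [|n IH] c c' s cc' ss Ps /=; first exact: cc'.
apply: (sd_eq _ ss Ps) => ws sws Pws; apply: IH => // us sus Pus.
by apply: cc'; rewrite /= ?sus//; split=> //; apply: Pb; rewrite ?ss.
Qed.

Lemma subhomN_eq (P : X -> Prop) c c' n s :
  (forall s, pall P s -> (0 < size s)%N -> P (b s)) ->
  (forall ws, size ws = n.+1 -> pall P ws -> c ws = c' ws) ->
  size s = n -> pall P s -> subhomN n c s = subhomN n c' s.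
Proof.
move=> Pb; elim: n c c' s => //= n IH c c' s cc' ss Ps.
rewrite cc' /= ?ss//; last by split=> //; apply: Pb; rewrite ?ss.
congr (_ - _); apply: (sd_eq _ ss Ps) => ws sws Pws; apply: IH => // us sus Pus.
by apply: cc'; rewrite /= ?sus//; split=> //; apply: Pb; rewrite ?ss.
Qed.

Lemma sd_subdivN n c s : size s = n.+1 ->
  sd (subdivN n c) s = subdivN n.+1 (sd c) s.
Proof.
elim: n c s => [|n IH] c s ss.
  case: s ss => // v [] //= _; rewrite !subr0 //.
pose cb us := c (b s :: us).
have -> : subdivN n.+2 (sd c) s =
    sd (fun ws => subdivN n.+1 c ws - sd (subdivN n cb) ws) s.
  apply: (sd_eq_size _ ss) => ws sws.
  by rewrite (IH cb ws sws) -subdivNB.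
by rewrite sdB sdK subr0.
Qed.

Lemma subhomN_homotopy n c s : size s = n.+1 ->
  sd (subhomN n c) s + subhomN n.+1 (sd c) s = c s - subdivN n.+1 c s.
Proof.
elim: n c s => [|n IH] c s ss.
  case: s ss => // v [] //= _; ring.
rewrite [subhomN _.+2 _ _]/= [subdivN _.+2 _ _]/=.
pose cb us := c (b s :: us).
rewrite -/cb.
have -> : sd (subhomN n.+1 (fun ws => c ws - sd (fun us => c (b s :: us)) ws)) s =
   sd (subhomN n.+1 c) s - sd (subhomN n.+1 (sd cb)) s.
  by rewrite -sdB; apply: (sd_eq_size _ ss) => ws sws; rewrite -subhomNB.
(* Induction hypothesis on the faces of [s], for the cochain coned with the barycentre of [s]. *)
have -> : sd (subhomN n.+1 (sd cb)) s =
    sd cb s - sd (subdivN n.+1 cb) s - sd (sd (subhomN n cb)) s.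
  rewrite -!sdB; apply: (sd_eq_size _ ss) => ws sws.
  by rewrite -(IH cb ws sws) addrC addKr.
by rewrite sdK; ring.
Qed.

End Subdivision.

Section SubdivisionNatural.
Variables (X Y : Type) (b : seq X -> X) (b' : seq Y -> Y) (f : X -> Y).
Hypothesis fb : forall s, (0 < size s)%N -> f (b s) = b' (map f s).

(** Compatibility [fb] is asked for nonempty lists only: the barycentre of the empty list is a
    default point, which cofaces do not respect. *)
Lemma subdivN_map n c s : size s = n ->
  subdivN b n (fun ws => c (map f ws)) s = subdivN b' n c (map f s).
Proof.
elim: n c s => //= n IH c s ss; rewrite -sd_map.
apply: (sd_eq_size _ ss) => ws sws.
by rewrite (IH (fun us => c (f (b s) :: us)))// fb ?ss.
Qed.

Lemma subhomN_map n c s : size s = n ->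
  subhomN b n (fun ws => c (map f ws)) s = subhomN b' n c (map f s).
Proof.
elim: n c s => //= n IH c s ss; rewrite fb ?ss//; congr (_ - _).
rewrite -sd_map; apply: (sd_eq_size _ ss) => ws sws.
by rewrite (IH (fun us => c (b' (map f s) :: us))).
Qed.

End SubdivisionNatural.

Lemma prism_map (X Y X' Y' : Type) (al be : X -> Y) (al' be' : X' -> Y')
    (f : X -> X') (g : Y -> Y') c s :
  (forall x, g (al x) = al' (f x)) -> (forall x, g (be x) = be' (f x)) ->
  prism al be (fun ws => c (map g ws)) s = prism al' be' c (map f s).
Proof.
move=> ga gb; elim: s c => //= v vs IH c.
rewrite ga gb -!map_comp (IH (fun ws => c (al' (f v) :: ws))).
by congr (c (_ :: _ :: _) - _); apply: eq_map => x /=.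
Qed.

End SeqCochains.

(** * Affine simplices in convex sets *)

Section ConvexSums.
Variables (R : realType) (V : normedModType R) (A : set V) (cA : cvx A).

(** Binary convexity iterates: the first weight is split off and the others are divided by their
    sum, unless that sum is zero. *)
Lemma cvx_sum (k : nat) (t : 'I_k.+1 -> R) (x : 'I_k.+1 -> V) :
  (forall i, 0 <= t i) -> \sum_i t i = 1 -> (forall i, A (x i)) ->
  A (\sum_i t i *: x i).
Proof.
elim: k t x => [|k IH] t x t0 t1 Ax.
  by move: t1; rewrite !big_ord1 => ->; rewrite scale1r.
rewrite big_ord_recl in t1; rewrite big_ord_recl.
set u := \sum_(i < k.+1) t (lift ord0 i) in t1.
have u0 : 0 <= u by apply: sumr_ge0 => i _.
have [u_eq0|u_neq0] := eqVneq u 0.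
  rewrite u_eq0 addr0 in t1; rewrite t1 scale1r big1 ?addr0// => i _.
  have /eqP := u_eq0; rewrite /u psumr_eq0// => /allP/(_ i).
  by rewrite mem_index_enum => /(_ isT)/= /eqP ->; rewrite scale0r.
have := IH (fun i => t (lift ord0 i) / u) (fun i => x (lift ord0 i)).
rewrite -mulr_suml divff// => /(_ _ erefl) IH'.
have {}IH' : A (\sum_(i < k.+1) (t (lift ord0 i) / u) *: x (lift ord0 i)).
  by apply: IH' => // i; rewrite divr_ge0.
have e : \sum_(i < k.+1) t (lift ord0 i) *: x (lift ord0 i) =
    u *: \sum_(i < k.+1) (t (lift ord0 i) / u) *: x (lift ord0 i).
  rewrite scaler_sumr; apply: eq_bigr => i _.
  by rewrite scalerA mulrC divfK.
rewrite e (_ : t ord0 = 1 - u); last by rewrite -t1 addrK.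
by apply: cA => //; rewrite u0/= -t1 lerDr.
Qed.

Lemma lin_subproof k (p : A) (s : seq A) (t : @std_simplex R k) :
  A (\sum_i val t 0 i *: val (nth p s i)).
Proof. by have [t0 t1] := sub_in t; apply: cvx_sum => // i; exact: sub_in. Qed.

Definition linf k p s (t : @std_simplex R k) : A := mksub (lin_subproof p s t).

Lemma simplex_coord k (i : 'I_k.+1) :
  continuous (fun t : @std_simplex R k => val t 0 i : R).
Proof.
have cc := @coord_continuous R 1 k.+1 0 i.
by move=> v; exact: (continuous_comp (@val_continuous _ _ v) (cc _)).
Qed.

Lemma sumc (S : topologicalType) (I : Type) (r : seq I) (f : I -> S -> V) :
  (forall i, continuous (f i)) -> continuous (fun x => \sum_(i <- r) f i x).
Proof.
move=> fc; elim: r => [|i r IH].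
  by under eq_fun do rewrite big_nil; exact: cstc.
by under eq_fun do rewrite big_cons; apply: addc.
Qed.

Lemma linf_continuous k p s : continuous (@linf k p s).
Proof.
apply: subtype_continuous => /=; apply: sumc => i; apply: scalec.
  exact: simplex_coord.
exact: cstc.
Qed.

Definition lin k p s : simplex R k A := cmap (@linf_continuous k p s).

Lemma nth_del (T : Type) (p : T) i j (s : seq T) : (i < size s)%N ->
  nth p (del i s) j = nth p s (bump i j).
Proof.
move=> si; rewrite /del nth_cat size_take si; case: ltnP => ij.
  by rewrite nth_take// /bump leqNgt ij.
by rewrite nth_drop /bump ij add1n addSn subnKC.
Qed.

Lemma size_del (T : Type) i (s : seq T) : (i < size s)%N ->
  size (del i s) = (size s).-1.
Proof.
by move=> si; rewrite size_cat size_take si size_drop; lia.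
Qed.

Lemma lin_coface k p (s : seq A) (i : 'I_k.+2) t : size s = k.+2 ->
  lin k.+1 p s (coface i t) = lin k p (del i s) t.
Proof.
move=> ss; apply: val_inj => /=.
rewrite (bigD1_ord i)//= mxE unlift_none scale0r add0r.
apply: eq_bigr => j _; rewrite mxE liftK nth_del ?ss//.
Qed.

Lemma lin_edge01 k p (s : seq A) t :
  lin k.+1 p s (edge01 k t) = seg cA (nth p s 0) (nth p s 1) t.
Proof.
apply: val_inj => /=; rewrite big_ord_recl big_ord_recl mxE eqxx mxE/= big1 ?addr0//.
by move=> i _; rewrite mxE/= scale0r.
Qed.

End ConvexSums.

(** * Singular cochains as functions of vertex lists *)

Section Pull.
Variables (R : realType) (V : normedModType R) (A : set V) (cA : cvx A).
Variables (T : topologicalType) (L : local_system R T).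
Variable Psi : continuousType A T.

Definition tr (p q : A) : R[i] := pullback Psi L (seg cA p q).

Lemma tr_neq0 p q : tr p q != 0. Proof. exact: transport_neq0. Qed.

Lemma trM p q r : tr p r = tr q r * tr p q.
Proof. exact: seg_transport. Qed.

Lemma tr_refl p : tr p p = 1.
Proof. exact: seg_transport_refl. Qed.

(** Bringing all values to the stalk at one base point [p] removes the twist: the twisted
    [coboundary] becomes the plain [sd] ([sd_pull]). Lists of the wrong length get 0. *)
Definition pull k (c : cochain R T k) (p : A) (s : seq A) : R[i] :=
  if size s == k.+1 then (tr p (nth p s 0))^-1 * c (Psi \o lin cA k p s) else 0.

Lemma pull_size k (c : cochain R T k) p s : size s != k.+1 -> pull c p s = 0.
Proof. by rewrite /pull => /negbTE ->. Qed.

Lemma pull_base k (c : cochain R T k) p q s : pull c p s = (tr p q)^-1 * pull c q s.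
Proof.
rewrite /pull; case: eqP => [ss|]; last by rewrite mulr0.
rewrite mulrA -invfM.
have e : nth p s 0 = nth q s 0 by apply: set_nth_default; rewrite ss.
rewrite e (trM p q (nth q s 0)) [tr p q * _]mulrC; congr (_^-1 * c _).
apply/continuousEP => t /=; congr (Psi _); apply: val_inj => /=.
by apply: eq_bigr => i _; congr (_ *: val _); apply: set_nth_default; rewrite ss.
Qed.

Lemma sd_pull k (c : cochain R T k) p s :
  sd (pull c p) s = pull (coboundary L c) p s.
Proof.
rewrite sdE {2}/pull; case: eqP => [ss|ss]; last first.
  rewrite big1// => i _; rewrite pull_size ?mulr0// size_del//.
  by apply: contra_notN ss => /eqP; have := ltn_ord i; lia.
rewrite ss big_ord_recl /coboundary mulrDr mulr_sumr; congr (_ + _).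
  rewrite expr0 mul1r /pull size_del ss// eqxx mulrA -invfM; congr (_^-1 * c _).
    rewrite nth_del ?ss//=.
    rewrite (trM p (nth p s 0)) mulrC; congr (_ * _).
    rewrite /tr /=; congr (transport L _); apply/continuousEP => t /=.
    congr (Psi _); exact: esym (@lin_edge01 _ _ _ cA k p s t).
  apply/continuousEP => t /=; congr (Psi _).
  exact: esym (@lin_coface _ _ _ cA k p s ord0 t ss).
apply: eq_bigr => i _; rewrite /pull size_del ss// eqxx.
rewrite mulrCA (_ : nth p (del (lift ord0 i) s) 0 = nth p s 0); last first.
  by rewrite nth_del ?ss.
congr (_ * (_ * c _)).
apply/continuousEP => t /=; congr (Psi _).
exact: esym (@lin_coface _ _ _ cA k p s (lift ord0 i) t ss).
Qed.

End Pull.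

Section PullMap.
Variables (R : realType) (V W : normedModType R).
Variables (A : set V) (cA : cvx A) (B : set W) (cB : cvx B).
Variables (G : V -> W) (Glin : linear G).
Variables (g : continuousType A B) (gE : forall x, val (g x) = G (val x)).
Variables (T : topologicalType) (L : local_system R T).
Variable Psi : continuousType B T.

Lemma lin_map k p s t : size s = k.+1 ->
  g (lin cA k p s t) = lin cB k (g p) (map g s) t.
Proof.
move=> ss; apply: val_inj; rewrite gE /=.
pose GL : {linear V -> W} := HB.pack G (GRing.isLinear.Build _ _ _ _ G Glin).
rewrite -[G]/(GL : V -> W) linear_sum; apply: eq_bigr => i _.
by rewrite linearZ/= (nth_map p) ?ss// gE.
Qed.

Lemma seg_map p q t : g (seg cA p q t) = seg cB (g p) (g q) t.
Proof.
apply: val_inj; rewrite gE /= !gE.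
pose GL : {linear V -> W} := HB.pack G (GRing.isLinear.Build _ _ _ _ G Glin).
by rewrite -[G]/(GL : V -> W) linearD !linearZ.
Qed.

Lemma tr_map p q : tr cA L (Psi \o g) p q = tr cB L Psi (g p) (g q).
Proof.
congr (transport L _); apply/continuousEP => t /=; congr (Psi _).
exact: seg_map.
Qed.

Lemma pull_map k (c : cochain R T k) p s :
  pull cA L (Psi \o g) c p s = pull cB L Psi c (g p) (map g s).
Proof.
rewrite /pull size_map; case: eqP => // ss; congr (_^-1 * c _).
  by rewrite tr_map (nth_map p) ?ss.
by apply/continuousEP => t /=; congr (Psi _); exact: lin_map.
Qed.

End PullMap.

(** * The standard simplex and its vertices *)

Section Vertices.
Variable R : realType.

Lemma std_simplex_cvx k : cvx (@std_simplex R k).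
Proof.
move=> x y t [x0 x1] [y0 y1] /andP[t0 t1]; split=> [i|].
  by rewrite !mxE addr_ge0// mulr_ge0// subr_ge0.
under eq_bigr do rewrite !mxE.
by rewrite big_split/= -!mulr_sumr x1 y1 !mulr1 subrK.
Qed.

Lemma vtx_subproof k (i : 'I_k.+1) : @std_simplex R k (delta_mx 0 i).
Proof.
split=> [j|]; first by rewrite mxE ler0n.
rewrite (bigD1 i)//= mxE !eqxx big1 ?addr0// => j /negbTE ji.
by rewrite mxE ji andbF.
Qed.

Definition vtx k i : @std_simplex R k := mksub (vtx_subproof i).

Definition verts k : seq (@std_simplex R k) := map (@vtx k) (enum 'I_k.+1).

Lemma size_verts k : size (verts k) = k.+1.
Proof. by rewrite size_map size_enum_ord. Qed.

Lemma nth_verts k p (i : 'I_k.+1) : nth p (verts k) i = vtx i.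
Proof. by rewrite (nth_map i) ?size_enum_ord// nth_ord_enum. Qed.

Lemma lin_verts k p t : lin (@std_simplex_cvx k) k p (verts k) t = t.
Proof.
apply: val_inj => /=.
rewrite [RHS]matrix_sum_delta big_ord1; apply: eq_bigr => i _.
by rewrite nth_verts.
Qed.

Lemma coface_linear k (i : 'I_k.+2) : linear (@coface_row R k i).
Proof.
move=> a u v; apply/rowP => j; rewrite !mxE.
by case: unlift => [j'|]; rewrite ?mxE// mulr0 addr0.
Qed.

Lemma coface_vtx k (i : 'I_k.+2) (j : 'I_k.+1) : coface i (vtx j) = vtx (lift i j).
Proof.
apply: val_inj; apply/rowP => l /=; rewrite !mxE !eqxx/=.
case: unliftP => [l'|] -> ; first by rewrite mxE eqxx/= (inj_eq lift_inj).
by rewrite (negbTE (neq_lift _ _)).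
Qed.

Lemma map_coface_verts k (i : 'I_k.+2) :
  map (coface i) (verts k) = del i (verts k.+1).
Proof.
apply: (@eq_from_nth _ (vtx ord0)).
  by rewrite size_map size_del ?size_verts.
move=> j; rewrite size_map size_verts => jk.
rewrite nth_del ?size_verts// (nth_map (vtx ord0)) ?size_verts//.
have -> : j = Ordinal jk :> nat by [].
by rewrite nth_verts coface_vtx -(nth_verts (vtx ord0)).
Qed.

Variables (T : topologicalType) (L : local_system R T).

(* The cochain seen from the simplex [sigma]: its values on the affine simplices
   of the standard simplex, all brought to the stalk at the first vertex. *)
Definition spull k (sigma : simplex R k T) m (c : cochain R T m) :=
  pull (@std_simplex_cvx k) L (sigma : continuousType _ _) c (vtx ord0).

Lemma spull_verts k (sigma : simplex R k T) (c : cochain R T k) :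
  spull sigma c (verts k) = c sigma.
Proof.
rewrite /spull /pull size_verts eqxx.
rewrite [nth _ _ 0](nth_verts _ ord0) tr_refl invr1 mul1r.
by congr c; apply/continuousEP => t /=; rewrite lin_verts.
Qed.

(** Passing from the first vertex of a face to the first vertex of the simplex costs a transport,
    which is along a nonconstant edge only for the face [ord0]. *)
Lemma spull_coface k (i : 'I_k.+2) (sigma : simplex R k.+1 T) m (c : cochain R T m) s :
  spull (sigma \o coface i) c s =
  (tr (@std_simplex_cvx k.+1) L sigma (vtx (lift i ord0)) (vtx ord0))^-1 *
   spull sigma c (map (coface i) s).
Proof.
rewrite /spull (pull_map (@std_simplex_cvx k) (@std_simplex_cvx k.+1)
  (@coface_linear k i))//.
by rewrite -coface_vtx; exact: pull_base.
Qed.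

Lemma sd_spull k (sigma : simplex R k T) m (c : cochain R T m) s :
  sd (spull sigma c) s = spull sigma (coboundary L c) s.
Proof. exact: sd_pull. Qed.

End Vertices.

(** * Barycentres and the mesh of a subdivision *)

Section Mesh.
Variables (R : realType) (V : normedModType R) (A : set V) (cA : cvx A).
Variable p0 : A.
Variable K : comNzRingType.

Lemma pallP (X : eqType) (P : X -> Prop) (s : seq X) :
  pall P s <-> forall x, x \in s -> P x.
Proof.
elim: s => //= v vs IH; split=> [[Pv /IH Pvs] x|Ps].
  by rewrite inE => /predU1P[->|/Pvs].
split; first by apply: Ps; rewrite inE eqxx.
by apply/IH => x xvs; apply: Ps; rewrite inE xvs orbT.
Qed.

Definition bary_val (s : seq A) : V := (size s)%:R^-1 *: \sum_(x <- s) val x.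

Lemma bary_val_in (B : set V) s : cvx B -> (0 < size s)%N ->
  pall (fun x : A => B (val x)) s -> B (bary_val s).
Proof.
move=> cB; case: s => // v vs _ Bs; set s := v :: vs.
rewrite /bary_val (big_nth v) big_mkord scaler_sumr.
apply: (cvx_sum cB) => [i||i]; first by rewrite invr_ge0.
  by rewrite sumr_const card_ord -[_^-1]mulr1 -mulrnAr mulVf ?pnatr_eq0.
by move/pallP: Bs; apply; rewrite mem_nth.
Qed.

Lemma bary_subproof s : A (if (0 < size s)%N then bary_val s else val p0).
Proof.
case: ifPn => [s0|_]; last exact: sub_in.
by apply: bary_val_in => //; apply/pallP => x _; exact: sub_in.
Qed.

Definition bary s : A := mksub (bary_subproof s).

Lemma baryE s : (0 < size s)%N -> val (bary s) = bary_val s.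
Proof. by move=> /= ->. Qed.

Lemma bary_in (B : set V) s : cvx B -> (0 < size s)%N ->
  pall (fun x : A => B (val x)) s -> B (val (bary s)).
Proof. by move=> cB s0 Bs; rewrite baryE//; exact: bary_val_in. Qed.

Definition diam_le (d : R) (s : seq A) :=
  forall x y, x \in s -> y \in s -> `|val x - val y| <= d.

(** The vector from [x] to the barycentre is the average of the vectors from [x] to all vertices,
    and the one to [x] itself is zero; hence the factor (n - 1) / n. *)
Lemma bary_dist (d : R) s x : 0 <= d -> diam_le d s -> x \in s ->
  `|val (bary s) - val x| <= (size s)%:R^-1 * (size s).-1%:R * d.
Proof.
move=> d0 ds xs; have s0 : (0 < size s)%N by case: (s) xs.
have sn0 : (size s)%:R != 0 :> R by rewrite pnatr_eq0 -lt0n.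
rewrite baryE// /bary_val.
have -> : (size s)%:R^-1 *: \sum_(x <- s) val x - val x =
    (size s)%:R^-1 *: \sum_(y <- rem x s) (val y - val x).
  rewrite (_ : \sum_(y <- rem x s) _ = \sum_(y <- s) (val y - val x)).
    rewrite sumrB scalerBr; congr (_ - _).
    rewrite big_const_seq count_predT iter_addr_0 -[val x *+ _]scaler_nat scalerA mulVf//.
    by rewrite scale1r.
  rewrite [RHS](perm_big _ (perm_to_rem xs)) big_cons subrr. exact: esym (add0r _).
rewrite normrZ ger0_norm ?invr_ge0// -mulrA ler_wpM2l ?invr_ge0//.
apply: le_trans (ler_norm_sum _ _ _) _.
rewrite -(size_rem xs) mulrC.
elim: (rem x s) (@mem_rem _ x s) => [|y r IH] rs; first by rewrite big_nil mulr0.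
rewrite big_cons /= -natr1 mulrDr mulr1 [d * _ + d]addrC lerD ?IH//.
  by apply: ds => //; apply: rs; rewrite mem_head.
by move=> z zr; apply: rs; rewrite inE zr orbT.
Qed.

Lemma mem_del (X : eqType) i (s : seq X) x : x \in del i s -> x \in s.
Proof.
by rewrite /del mem_cat => /orP[/mem_take|/mem_drop].
Qed.

(** Subdivision shrinks diameters by the factor [q], phrased for cochains. That [ws] lies in the
    convex hull of [s] is expressed by quantifying over the convex sets [B] that contain [s]. *)
Lemma subdivN_mesh n (c : seq A -> K) s (d q : R) :
  size s = n -> 0 <= d -> 0 <= q -> diam_le d s ->
  (forall m, (m <= n)%N -> m%:R^-1 * m.-1%:R <= q) ->
  (forall ws, size ws = n ->
     (forall B : set V, cvx B -> pall (fun x : A => B (val x)) s ->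
        pall (fun x : A => B (val x)) ws) ->
     diam_le (q * d) ws -> c ws = 0) ->
  subdivN bary n c s = 0.
Proof.
move=> + d0 q0; elim: n c s => [|n IH] c s ss ds nq H /=.
  by apply: H => //; move/size0nil: ss => -> x.
rewrite sdE big1// => i _.
have i_s := ltn_ord i.
rewrite (IH (fun ws => c (bary s :: ws))) ?mulr0//.
- by rewrite size_del ?ss.
- by move=> x y /mem_del xs /mem_del ys; apply: ds.
- by move=> m mn; apply: nq; exact: leqW.
- move=> ws sws Bws dws; apply: H; first by rewrite /= sws.
    move=> B cB Bs /=; split; first by apply: bary_in => //; rewrite ss.
    by apply: Bws => //; apply/pallP => x /mem_del xs; move/pallP: Bs; apply.
  have bw w : w \in ws -> `|val (bary s) - val w| <= q * d.
    move=> w_ws.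
    (* This ball about the barycentre is convex and contains the vertices of [s], hence also every
       list supported in the hull of a face. *)
    have cB : cvx [set y | `|val (bary s) - y| <= q * d].
      move=> x y t /= hx hy /andP[t0 t1].
      have -> : val (bary s) - ((1 - t) *: x + t *: y) =
          (1 - t) *: (val (bary s) - x) + t *: (val (bary s) - y).
        rewrite !scalerBr addrACA -scalerDl subrK scale1r opprD//.
      apply: le_trans (ler_normD _ _) _.
      rewrite !normrZ [`|t|]ger0_norm// [`|1 - t|]ger0_norm ?subr_ge0//.
      rewrite (_ : q * d = (1 - t) * (q * d) + t * (q * d)); last by ring.
      by rewrite lerD// ler_wpM2l// subr_ge0.
    have := Bws _ cB; move=> /(_ _)/pallP; apply=> //.
    apply/pallP => x /mem_del xs /=.
    apply: le_trans (bary_dist d0 ds xs) _.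
    by rewrite ler_wpM2r// nq// ss.
  move=> x y; rewrite !inE => /predU1P[->|xw] /predU1P[->|yw].
  - by rewrite subrr normr0 mulr_ge0.
  - exact: bw.
  - by rewrite distrC bw.
  - exact: dws.
Qed.

End Mesh.

Section IterSubdivision.
Variables (K : comNzRingType) (X : Type) (b : seq X -> X).
Implicit Types (c : seq X -> K) (s : seq X).

Definition subdivI n m c := iter m (fun f => subdivN b n f) c.

Definition subhomI n m c s := \sum_(j < m) subdivI n j (subhomN b n c) s.

Lemma subdivN0 n s : subdivN b n (fun=> 0) s = 0 :> K.
Proof.
elim: n s => //= n IH s; rewrite -[RHS](sd0 _ s); congr (sd _ s).
exact: funext.
Qed.

Lemma subhomN0 n s : subhomN b n (fun=> 0) s = 0 :> K.
Proof.
elim: n s => //= n IH s; apply/eqP; rewrite sub0r oppr_eq0; apply/eqP.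
by rewrite -[RHS](sd0 K s); congr (sd _ s); exact: funext.
Qed.

Lemma subdivI_eq n m c c' s :
  (forall ws, size ws = n -> c ws = c' ws) -> size s = n ->
  subdivI n m c s = subdivI n m c' s.
Proof.
move=> cc'; elim: m s => [|m IH] s ss /=; first exact: cc'.
apply: (@subdivN_eq _ _ _ (fun=> True)) => // [ws sws _|]; first exact: IH.
by elim: (s).
Qed.

Lemma subdivIB n m c c' s : subdivI n m (fun ws => c ws - c' ws) s =
  subdivI n m c s - subdivI n m c' s.
Proof.
elim: m s => //= m IH s; rewrite -subdivNB; congr (subdivN b n _ s).
exact: funext.
Qed.

Lemma sd_subdivI n m c s : size s = n.+1 ->
  sd (subdivI n m c) s = subdivI n.+1 m (sd c) s.
Proof.
elim: m s => //= m IH s ss; rewrite sd_subdivN//.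
apply: (@subdivN_eq _ _ _ (fun=> True)) => // [ws sws _|]; first exact: IH.
by elim: (s).
Qed.

Lemma subdivI_shift n m c s :
  subdivI n m (subdivN b n c) s = subdivI n m.+1 c s.
Proof. by rewrite /subdivI -iterSr. Qed.

(** The homotopies of a single subdivision, composed with the iterates, telescope. *)
Lemma subhomI_homotopy n m c s : size s = n.+1 ->
  sd (subhomI n m c) s + subhomI n.+1 m (sd c) s = c s - subdivI n.+1 m c s.
Proof.
move=> ss; rewrite /subhomI sd_sum -big_split/=.
transitivity (\sum_(j < m) (subdivI n.+1 j c s - subdivI n.+1 j.+1 c s)).
  apply: eq_bigr => j _; rewrite sd_subdivI// -subdivI_shift -subdivIB.
  have -> : subdivI n.+1 j (sd (subhomN b n c)) s =
    subdivI n.+1 j (fun ws => c ws - subdivN b n.+1 c ws - subhomN b n.+1 (sd c) ws) s.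
    by apply: subdivI_eq => // ws sws; rewrite -subhomN_homotopy// addrK.
  by rewrite (subdivIB _ _ (fun ws => c ws - subdivN b n.+1 c ws)) subrK.
elim: m => [|m IH]; first by rewrite big_ord0 subrr.
by rewrite big_ord_recr/= IH; ring.
Qed.

Lemma subdivIZ n m a c s : subdivI n m (fun ws => a * c ws) s = a * subdivI n m c s.
Proof.
elim: m s => //= m IH s; rewrite -subdivNZ; congr (subdivN b n _ s).
exact: funext.
Qed.

Lemma subhomIZ n m a c s : subhomI n m (fun ws => a * c ws) s = a * subhomI n m c s.
Proof.
rewrite /subhomI mulr_sumr; apply: eq_bigr => j _; rewrite -subdivIZ.
by congr (subdivI n j _ s); apply: funext => ws; exact: subhomNZ.
Qed.

End IterSubdivision.

Section IterSubdivisionNatural.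
Variables (K : comNzRingType) (X Y : Type) (b : seq X -> X) (b' : seq Y -> Y) (f : X -> Y).
Hypothesis fb : forall s, (0 < size s)%N -> f (b s) = b' (map f s).

Lemma subdivI_map n m (c : seq Y -> K) s : size s = n ->
  subdivI b n m (fun ws => c (map f ws)) s = subdivI b' n m c (map f s).
Proof.
elim: m s => //= m IH s ss; rewrite -(subdivN_map fb)//.
apply: (@subdivN_eq _ _ _ (fun=> True)) => // [ws sws _|]; first exact: IH.
by elim: (s).
Qed.

Lemma subhomI_map n m (c : seq Y -> K) s : size s = n ->
  subhomI b n m (fun ws => c (map f ws)) s = subhomI b' n m c (map f s).
Proof.
move=> ss; apply: eq_bigr => j _; rewrite -subdivI_map//.
by apply: subdivI_eq => // ws sws; exact: subhomN_map.
Qed.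

End IterSubdivisionNatural.

(** * Lebesgue numbers for singular simplices *)

Section Lebesgue.
Variables (R : realType) (k : nat).

Lemma std_simplex_compact : compact (@std_simplex R k).
Proof.
apply: (@subclosed_compact _ _ [set v : 'rV[R]_k.+1 | forall i, `[0, 1]%classic (v ord0 i)]).
- have -> : @std_simplex R k = (\bigcap_(i : 'I_k.+1) [set v : 'rV[R]_k.+1 | 0 <= v 0 i]) `&`
     [set v | \sum_i v 0 i = 1].
    by apply/seteqP; split=> v [v0 v1]; split=> // i; [move=> _; exact: v0|exact: (v0 i I)].
  apply: closedI.
    apply: closed_bigI => i _.
    apply: (@closed_comp _ _ (fun v : 'rV[R]_k.+1 => v 0 i) [set x | 0 <= x]).
      by move=> v _; exact: coord_continuous.
    exact: closed_ge.
  apply: (@closed_comp _ _ (fun v : 'rV[R]_k.+1 => \sum_i v 0 i) [set x | x = 1]).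
    move=> v _; apply: (@sumc _ R^o _ _ _ (fun i (v : 'rV[R]_k.+1) => v 0 i)) => i.
    exact: coord_continuous.
  exact: closed_eq.
- exact: rV_compact (fun=> @segment_compact _ _ _).
- move=> v [v0 v1] i; rewrite /= in_itv/= v0/= -v1 (bigD1 i)//= lerDl.
  by apply: sumr_ge0.
Qed.

Lemma simplex_lebesgue (T : topologicalType) (sigma : simplex R k T) (O1 O2 : set T) :
  open O1 -> open O2 -> (forall t, O1 (sigma t) \/ O2 (sigma t)) ->
  exists2 e : R, 0 < e & forall x : @std_simplex R k,
    (forall y, `|val x - val y| < e -> O1 (sigma y)) \/
    (forall y, `|val x - val y| < e -> O2 (sigma y)).
Proof.
move=> o1 o2 o12.
pose P (e : R) (x : 'rV[R]_k.+1) :=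
  (forall y, `|x - val y| < e -> O1 (sigma y)) \/
  (forall y, `|x - val y| < e -> O2 (sigma y)).
have key (O : set T) (x : @std_simplex R k) : open O -> O (sigma x) ->
    exists2 r : R, 0 < r & forall y, `|val x - val y| < r -> O (sigma y).
  move=> oO Ox.
  have : nbhs x (sigma @^-1` O).
    by apply: (@cts_fun _ _ sigma); exact: open_nbhs_nbhs.
  move=> /nbhs_ballP[r /= r0 rO]; exists r => // y xy.
  apply: rO; have xy' : ball (val x) r (val y) by rewrite -ball_normE.
  exact: xy'.
have H x : (@std_simplex R k) x -> \forall x' \near x & e \near 0^'+, P e x'.
  move=> Dx; pose x0 := mksub Dx; rewrite -[x]/(val x0); move: x0 => {Dx}x0; move: x0 => {}x.
  have [ O1x [Os [r r0 rO]]] : exists O : set T, (O = O1 \/ O = O2) /\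
      exists2 r : R, 0 < r & forall y, `|val x - val y| < r -> O (sigma y).
    have [Ox|Ox] := o12 x; [exists O1|exists O2]; split; by [left|right|exact: key].
  (* Half of the good radius leaves room to move the centre and then to go a distance [e] from
     it. *)
  exists (ball (val x) (r / 2), [set e | e < r / 2]).
    split; first by apply: nbhsx_ballx; rewrite divr_gt0.
    by apply: nbhs_right_lt; rewrite divr_gt0.
  move=> [x' e] [/= ]; rewrite -ball_normE /= => xx' er.
  have : forall y, `|x' - val y| < e -> O1x (sigma y).
    move=> y x'y; apply: rO.
    rewrite -(subrK x' (val x)) -addrA (le_lt_trans (ler_normD _ _))//.
    by rewrite [r]splitr ltrD// (lt_trans x'y).
  by case: Os => ->; [left|right].
have /compact_near_coveringP/(_ R 0^'+ P _ H) h := std_simplex_compact.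
have [e he e0] : exists2 e : R, (@std_simplex R k `<=` P e) & 0 < e.
  near (0 : R)^'+ => e; exists e; [near: e; exact: h|near: e; exact: nbhs_right_gt].
by exists e => // x; apply: he; exact: sub_in.
Unshelve. all: by end_near.
Qed.


End Lebesgue.

Section Glue.
Variables (R : realType) (T : topologicalType) (L : local_system R T).

Lemma tr_edge01 k (sigma : simplex R k.+1 T) :
  L (sigma \o edge01 k) =
  tr (@std_simplex_cvx R k.+1) L sigma (vtx R ord0) (vtx R (lift ord0 ord0)).
Proof.
rewrite /tr/pullback/=/pullback_transport; congr (transport L _).
apply/continuousEP => t /=; congr (sigma _).
rewrite -[LHS](lin_verts (vtx R ord0)) [LHS](@lin_edge01 _ _ _ (@std_simplex_cvx R k.+1)).
by congr (seg _ _ _ t); [exact: (nth_verts _ ord0)|exact: (nth_verts _ (lift ord0 ord0))].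
Qed.

(** The transport for the face [ord0] cancels the one built into [coboundary], and for the other
    faces it is 1. A cochain defined face by face through one function [f] of vertex lists thus has
    coboundary [sd f]. *)
Lemma coboundary_glue k (E : cochain R T k) (sigma : simplex R k.+1 T) f :
  (forall i : 'I_k.+2, E (sigma \o coface i) =
     (tr (@std_simplex_cvx R k.+1) L sigma (vtx R (lift i ord0)) (vtx R ord0))^-1
     * f (del i (verts R k.+1))) ->
  coboundary L E sigma = sd f (verts R k.+1).
Proof.
move=> Ef; rewrite sdE size_verts big_ord_recl expr0 mul1r /coboundary Ef.
rewrite tr_edge01 mulrA -invfM -trM tr_refl invr1 mul1r; congr (_ + _).
apply: eq_bigr => i _; rewrite Ef.
rewrite (_ : lift (lift ord0 i) ord0 = ord0); last exact: val_inj.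
by rewrite tr_refl invr1 mul1r.
Qed.

End Glue.

(** * Acyclicity of cochains that vanish on small simplices *)

Section Small.
Variables (R : realType) (T : topologicalType) (L : local_system R T).

Definition inS (A : set T) k (sigma : simplex R k T) : Prop := forall t, A (sigma t).

Local Notation D k := (@std_simplex_cvx R k).
Local Notation bary k := (bary (D k) (vtx R ord0)).

Variables (Y O1 O2 : set T) (oO1 : open O1) (oO2 : open O2).
Hypothesis Y12 : Y `<=` O1 `|` O2.

(** A convex witness [B] is inherited by subdivided lists, whose barycentres stay in [B]. *)
Definition small_seq k (sigma : simplex R k T) (s : seq (@std_simplex R k)) :=
  exists B : set 'rV[R]_k.+1, [/\ cvx B, pall (fun x : @std_simplex R k => B (val x)) s &
    (forall x : @std_simplex R k, B (val x) -> O1 (sigma x)) \/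
    (forall x : @std_simplex R k, B (val x) -> O2 (sigma x))].

Definition kills_small k (sigma : simplex R k T) n (g : seq (@std_simplex R k) -> R[i]) :=
  forall s, size s = n -> small_seq sigma s -> g s = 0.

Lemma spull_small k (sigma : simplex R k T) m (c : cochain R T m) n :
  inS Y sigma ->
  (forall rho, inS (Y `&` O1) rho \/ inS (Y `&` O2) rho -> c rho = 0) ->
  kills_small sigma n (spull L sigma c).
Proof.
move=> sY c0 s _ [B [cB Bs sB]]; rewrite /spull /pull.
case: eqP => // ss; rewrite c0 ?mulr0//.
have Bl t : B (val (lin (D k) m (vtx R ord0) s t)).
  have [t0 t1] := sub_in t; apply: cvx_sum => // i.
  by move/pallP: Bs; apply; rewrite mem_nth// ss ltn_ord.
by case: sB => sB; [left|right] => t; split; by [exact: sY|exact: sB (Bl t)].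
Qed.

Lemma kills_subdivI k (sigma : simplex R k T) n m g :
  kills_small sigma n g -> kills_small sigma n (subdivI (bary k) n m g).
Proof.
move=> g0; elim: m => [|m IH] //= s ss [B [cB Bs sB]].
rewrite -[RHS](subdivN0 _ (bary k) n s).
apply: (@subdivN_eq _ _ _ (fun x : @std_simplex R k => B (val x))) => //.
  by move=> ws Bws ws0; exact: bary_in.
by move=> ws sws Bws; apply: IH => //; exists B.
Qed.

Lemma kills_subhomN k (sigma : simplex R k T) n g :
  kills_small sigma n.+1 g -> kills_small sigma n (subhomN (bary k) n g).
Proof.
move=> g0 s ss [B [cB Bs sB]].
rewrite -[RHS](subhomN0 _ (bary k) n s).
apply: (@subhomN_eq _ _ _ (fun x : @std_simplex R k => B (val x))) => //.
  by move=> ws Bws ws0; exact: bary_in.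
by move=> ws sws Bws; apply: g0 => //; exists B.
Qed.

Lemma simplex_norm_le1 k (x : @std_simplex R k) : `|val x| <= 1.
Proof.
have [x0 x1] := sub_in x.
rewrite [`|_|]mx_normrE; apply: bigmax_le => // -[i j] _ /=.
rewrite (ord1 i) ger0_norm// -x1 (bigD1 j)//= lerDl.
by apply: sumr_ge0.
Qed.

(** Each subdivision multiplies the diameter by at most [k / (k + 1)], so finitely many bring it
    below a Lebesgue number of the cover pulled back by [sigma]. *)
Lemma exists_fine k (sigma : simplex R k T) : inS Y sigma ->
  exists m, forall M, (m <= M)%N -> forall g, kills_small sigma k.+1 g ->
    subdivI (bary k) k.+1 M g (verts R k) = 0.
Proof.
move=> sY.
have [e e0 He] := simplex_lebesgue oO1 oO2 (fun t => Y12 (sY t)).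
pose q : R := k%:R / k.+1%:R.
have q0 : 0 <= q by rewrite divr_ge0.
have q1 : q < 1 by rewrite ltr_pdivrMr// mul1r ltr_nat.
have mq m : (m <= k.+1)%N -> m%:R^-1 * m.-1%:R <= q.
  case: m => [|m] mk /=; first by rewrite mulr0.
  rewrite mulrC ler_pdivrMr// mulrAC ler_pdivlMr// -!natrM ler_nat; nia.
(* Two points of the standard simplex are at distance at most 2, as each has norm at most 1. *)
have [m Hm] : exists m, q ^+ m * 2 < e.
  have e2 : 0 < e / 2 by rewrite divr_gt0.
  have /cvgrPdist_lt/(_ _ e2) : @GRing.exp R q @ \oo --> 0.
    by apply: cvg_expr; rewrite ger0_norm.
  move=> [m _ /(_ m (leqnn m))]; rewrite sub0r normrN ger0_norm ?exprn_ge0// => h.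
  by exists m; rewrite -ltr_pdivlMr.
exists m => M mM g g0.
have {}Hm : q ^+ M * 2 < e.
  apply: le_lt_trans Hm; rewrite ler_wpM2r//.
  by rewrite ler_wiXn2l// ltW.
have key j d s : size s = k.+1 -> 0 <= d -> diam_le d s -> q ^+ j * d < e ->
    subdivI (bary k) k.+1 j g s = 0.
  elim: j d s => [|j IH] d s ss d0 ds jd.
    rewrite expr0 mul1r in jd; apply: g0 => //.
    case: s ss ds => // v s ss ds.
    have cB : cvx [set y | `|val v - y| < e].
      move=> x y t /= hx hy /andP[t0 t1].
      have -> : val v - ((1 - t) *: x + t *: y) =
          (1 - t) *: (val v - x) + t *: (val v - y).
        by rewrite !scalerBr addrACA -scalerDl subrK scale1r opprD.
      apply: le_lt_trans (ler_normD _ _) _.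
      rewrite !normrZ [`|t|]ger0_norm// [`|1 - t|]ger0_norm ?subr_ge0//.
      have [t_eq0|t_neq0] := eqVneq t 0; first by rewrite t_eq0 subr0 mul1r mul0r addr0.
      rewrite [ltRHS](_ : e = (1 - t) * e + t * e); last by ring.
      rewrite ler_ltD// ?ler_wpM2l ?subr_ge0// 1?ltW//.
      by rewrite ltr_pM2l// lt_neqAle eq_sym t_neq0.
    exists [set y | `|val v - y| < e]; split=> //.
      apply/pallP => x xs /=; apply: le_lt_trans jd.
      by apply: ds; rewrite // mem_head.
    exact: He.
  rewrite /subdivI iterS.
  apply: (@subdivN_mesh _ _ _ (D k) (vtx R ord0) _ k.+1 _ s d q) => //.
  move=> ws sws _ dws; apply: (IH (q * d)) => //; first exact: mulr_ge0.
  by rewrite mulrA -exprSr.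
apply: (key _ 2) => //; first exact: size_verts.
move=> x y _ _; apply: le_trans (ler_normB _ _) _.
by rewrite [2](_ : 2 = 1 + 1)// lerD// simplex_norm_le1.
Qed.

Lemma coface_bary k (i : 'I_k.+2) s : (0 < size s)%N ->
  coface i (bary k s) = bary k.+1 (map (coface i) s).
Proof.
move=> s0; apply: val_inj; rewrite baryE ?size_map// /bary_val big_map.
rewrite -[LHS]/(coface_row i (val (bary k s))) baryE// /bary_val size_map.
pose GL : {linear _ -> _} :=
  HB.pack (@coface_row R k i) (GRing.isLinear.Build _ _ _ _ _ (@coface_linear R k i)).
by rewrite -[coface_row i]/(GL : _ -> _) linearZ linear_sum.
Qed.

(** Enough subdivisions kill such a cocycle on any given simplex, and the subdivision homotopy then
    is a primitive. Together with [mayer_vietoris] this replaces excision. *)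
Lemma small_acyclic k (c : cochain R T k.+1) :
  (forall rho, inS (Y `&` O1) rho \/ inS (Y `&` O2) rho -> c rho = 0) ->
  (forall rho, inS Y rho -> coboundary L c rho = 0) ->
  exists e : cochain R T k,
    (forall rho, inS (Y `&` O1) rho \/ inS (Y `&` O2) rho -> e rho = 0) /\
    (forall rho, inS Y rho -> coboundary L e rho = c rho).
Proof.
move=> c0 dc0.
have [m Hm] : exists m : simplex R k T -> nat, forall sigma, inS Y sigma ->
    forall M, (m sigma <= M)%N -> forall g, kills_small sigma k.+1 g ->
    subdivI (bary k) k.+1 M g (verts R k) = 0.
  have H (sigma : simplex R k T) : exists m, inS Y sigma ->
      forall M, (m <= M)%N -> forall g, kills_small sigma k.+1 g ->
      subdivI (bary k) k.+1 M g (verts R k) = 0.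
    have [sY|nsY] := pselect (inS Y sigma); last by exists 0%N.
    by have [m Hm] := exists_fine sY; exists m.
  by exists (fun sigma => projT1 (cid (H sigma))) => sigma; exact: (projT2 (cid (H sigma))).
pose e : cochain R T k := fun sigma =>
  if `[< inS Y sigma >] then subhomI (bary k) k.+1 (m sigma) (spull L sigma c) (verts R k)
  else 0.
(* The number of subdivisions depends on the simplex, but the terms of the homotopy beyond [m sigma]
   vanish; faces may therefore share the larger number chosen for the whole simplex. *)
have eE sigma M : inS Y sigma -> (m sigma <= M)%N ->
    e sigma = subhomI (bary k) k.+1 M (spull L sigma c) (verts R k).
  move=> sY mM; rewrite /e asboolT// /subhomI.
  rewrite -!(big_mkord xpredT (fun j => subdivI _ _ j _ _)).
  rewrite [RHS](big_cat_nat _ mM)//= -[LHS]addr0; congr (_ + _).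
  apply/esym; rewrite big_nat_cond big1// => j.
  rewrite andbT => /andP[mj _]; apply: (Hm sigma) => //.
  by apply: kills_subhomN; exact: spull_small.
have face_Y (sigma : simplex R k.+1 T) i : inS Y sigma -> inS Y (sigma \o coface i).
  by move=> sY t; exact: sY.
exists e; split=> [rho rs|sigma sY].
  rewrite /e; case: asboolP => // rY; rewrite /subhomI big1// => j _.
  apply: kills_subdivI (size_verts _ _) _.
    by apply: kills_subhomN; exact: spull_small.
  exists setT; split=> //; first by apply/pallP.
  by case: rs => rs; [left|right] => x _; case: (rs x).
have [n mn mi] : exists2 n, forall g, kills_small sigma k.+2 g ->
    subdivI (bary k.+1) k.+2 n g (verts R k.+1) = 0 &
    forall i : 'I_k.+2, (m (sigma \o coface i) <= n)%N.
  have [m' Hm'] := exists_fine sY.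
  exists (maxn m' (\max_(i < k.+2) m (sigma \o coface i))).
    by move=> g; apply: Hm'; exact: leq_maxl.
  by move=> i; rewrite leq_max (leq_bigmax (F := fun i : 'I_k.+2 => m (sigma \o coface i))) ?orbT.
rewrite (@coboundary_glue _ _ _ _ _ _ (subhomI (bary k.+1) k.+1 n (spull L sigma c))); last first.
  move=> i; rewrite (eE _ n)//; last exact: face_Y.
  rewrite -map_coface_verts -(subhomI_map (@coface_bary k i)) ?size_verts//.
  rewrite -subhomIZ; congr (subhomI _ _ _ _ _); apply: funext => s.
  exact: spull_coface.
have := subhomI_homotopy (bary k.+1) n (spull L sigma c) (size_verts R k.+1).
rewrite spull_verts mn ?subr0; last by apply: spull_small.
rewrite (_ : sd (spull L sigma c) = fun=> 0 * 0); last first.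
  apply: funext => s; rewrite sd_spull mulr0 /spull /pull; case: eqP => // ss.
  by rewrite dc0 ?mulr0// => t; exact: sY.
by rewrite subhomIZ mul0r addr0.
Qed.

End Small.

(** * Homotopies and the prism operator with local coefficients *)

Section Homotopy.
Variables (R : realType) (S T : topologicalType) (L : local_system R T).
Local Notation I := (@unit_interval R).
Variables (h : continuousType (S * I)%type T) (f0 f1 : continuousType S T).
Hypotheses (h0 : forall x, h (x, @I0 R) = f0 x) (h1 : forall x, h (x, @I1 R) = f1 x).

Lemma track_continuous (x : S) : continuous (fun s : I => h (x, s)).
Proof.
apply: (@comp_continuous _ _ _ (fun s : I => (x, s)) h); last exact: cts_fun.
by apply: pair_continuous; [exact: cst_continuous|move=> s; exact: cvg_id].
Qed.

Definition track (x : S) : cpath R T := cmap (@track_continuous x).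

Definition cylinder k : set ('rV[R]_k.+1 * R)%type :=
  [set p | (@std_simplex R k) p.1 /\ I p.2].

Lemma cylinder_cvx k : cvx (@cylinder k).
Proof.
move=> [x1 x2] [y1 y2] t /= [/= X1 X2] [/= Y1 Y2] t01; split=> /=.
  exact: std_simplex_cvx.
move: X2 Y2; rewrite /unit_interval/= !in_itv/=.
move: t01 => /andP[t0 t1] /andP[a0 a1] /andP[b0 b1].
rewrite addr_ge0 ?mulr_ge0// ?subr_ge0//=.
rewrite [leRHS](_ : 1 = (1 - t) * 1 + t * 1); last by ring.
by rewrite lerD// ler_wpM2l// subr_ge0.
Qed.

Definition cyl1 k (p : @cylinder k) : @std_simplex R k := mksub (sub_in p).1.
Definition cyl2 k (p : @cylinder k) : I := mksub (sub_in p).2.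

Lemma cyl_continuous k (sigma : simplex R k S) :
  continuous (fun p : @cylinder k => h (sigma (cyl1 p), cyl2 p)).
Proof.
apply: (@comp_continuous _ _ _ (fun p : @cylinder k => (sigma (cyl1 p), cyl2 p)) h);
  last exact: cts_fun.
apply: pair_continuous.
  apply: (@comp_continuous _ _ _ (@cyl1 k) sigma); last exact: cts_fun.
  apply: subtype_continuous => /=.
  apply: (@comp_continuous _ _ _ (fun p : @cylinder k => val p) fst).
    exact: val_continuous.
  by move=> p; exact: cvg_fst.
apply: subtype_continuous => /=.
apply: (@comp_continuous _ _ _ (fun p : @cylinder k => val p) snd).
  exact: val_continuous.
by move=> p; exact: cvg_snd.
Qed.

Definition cylmap k sigma : continuousType (@cylinder k) T :=
  cmap (@cyl_continuous k sigma).

Lemma cylinder_at_subproof k (s : I) (x : @std_simplex R k) :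
  (@cylinder k) (val x, val s).
Proof. by split; exact: sub_in. Qed.

Definition cylinder_at k s x : @cylinder k := mksub (@cylinder_at_subproof k s x).

Lemma cylmap_at k sigma s x : @cylmap k sigma (cylinder_at s x) = h (sigma x, s).
Proof. by rewrite /cylmap/cmap/mkcts; congr (h (sigma _, _)); exact: val_inj. Qed.

Local Notation Q := (@cylinder_cvx _).
Local Notation al := (@cylinder_at _ (@I0 R)).
Local Notation be := (@cylinder_at _ (@I1 R)).

Definition cpull k (sigma : simplex R k S) m (c : cochain R T m) :=
  pull (@cylinder_cvx k) L (cylmap sigma) c (al (vtx R ord0)).

Definition prism_op k (c : cochain R T k.+1) : cochain R S k :=
  fun sigma => prism al be (cpull sigma c) (verts R k).

Lemma lin_at k m p (s : I) (vs : seq (@std_simplex R k)) t : size vs = m.+1 ->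
  lin (@cylinder_cvx k) m (cylinder_at s p) (map (cylinder_at s) vs) t =
  cylinder_at s (lin (@std_simplex_cvx R k) m p vs t).
Proof.
move=> ss; apply: val_inj.
have [t0 t1] := sub_in t.
rewrite -[RHS]/(\sum_(i < m.+1) val t 0 i *: val (nth p vs i), val s).
have -> : val s = \sum_(i < m.+1) val t 0 i * val s by rewrite -mulr_suml t1 mul1r.
rewrite -[LHS]/(\sum_(i < m.+1) val t 0 i *:
  val (nth (cylinder_at s p) (map (cylinder_at s) vs) i)).
transitivity (\sum_(i < m.+1) (val t 0 i *: val (nth p vs i), val t 0 i * val s)).
  by apply: eq_bigr => i _; rewrite (nth_map p) ?ss ?ltn_ord.
move: (index_enum _) => r.
elim: r => [|i r IH]; first by rewrite !big_nil.
by rewrite !big_cons IH.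
Qed.

Lemma tr_at k sigma (p q : @std_simplex R k) :
  tr (@cylinder_cvx k) L (cylmap sigma) (al p) (al q) =
  tr (@std_simplex_cvx R k) (pullback f0 L) sigma p q.
Proof.
rewrite /tr/pullback/=/pullback_transport; congr (transport L _).
apply/continuousEP => t.
rewrite -[RHS]h0 /= -[(_, I0 R)]/(sigma _, I0 R) -cylmap_at; congr (cylmap _ _).
apply: val_inj; rewrite /= -[LHS]/((1 - val t) *: val p + val t *: val q, (1 - val t) * 0 + val t * 0).
by rewrite !mulr0 addr0.
Qed.

Lemma tr_up k sigma (p : @std_simplex R k) :
  tr (@cylinder_cvx k) L (cylmap sigma) (al p) (be p) = L (track (sigma p)).
Proof.
rewrite /tr/pullback/=/pullback_transport; congr (transport L _).
apply/continuousEP => t.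
rewrite -[RHS]/(h (sigma p, t)) -cylmap_at; congr (cylmap _ _).
apply: val_inj; rewrite /= -[LHS]/((1 - val t) *: val p + val t *: val p, (1 - val t) * 0 + val t * 1).
by rewrite mulr0 add0r mulr1 -scalerDl subrK scale1r.
Qed.

Lemma cpull_coface k (sigma : simplex R k.+1 S) (i : 'I_k.+2) m (c : cochain R T m) s :
  cpull (sigma \o coface i) c s =
  (tr (@std_simplex_cvx R k.+1) (pullback f0 L) sigma (vtx R (lift i ord0)) (vtx R ord0))^-1 *
  cpull sigma c (map (fun p : @cylinder k => cylinder_at (cyl2 p) (coface i (cyl1 p))) s).
Proof.
have gc : continuous (fun p : @cylinder k => cylinder_at (cyl2 p) (coface i (cyl1 p))).
  apply: subtype_continuous.
  have Gc : continuous (fun p : 'rV[R]_k.+1 * R => (coface_row i p.1, p.2)).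
    apply: pair_continuous; last by move=> p; exact: cvg_snd.
    apply: row_continuous => j /=.
    under eq_fun do rewrite mxE.
    case: unlift => [j'|]; last exact: cst_continuous.
    apply: (@comp_continuous _ _ _ fst (fun v : 'rV[R]_k.+1 => v 0 j')).
      by move=> p; exact: cvg_fst.
    exact: coord_continuous.
  exact: (comp_continuous (@val_continuous _ (@cylinder k)) Gc).
have Glin : linear (fun p : 'rV[R]_k.+1 * R => (coface_row i p.1, p.2)).
  move=> a u v /=; rewrite coface_linear//.
rewrite /cpull.
have e : cylmap (sigma \o coface i) = cylmap sigma \o cmap gc.
  by apply/continuousEP => p; rewrite /= cylmap_at.
rewrite e (pull_map (@cylinder_cvx k) (@cylinder_cvx k.+1) Glin)//.
rewrite (pull_base _ _ _ _ _ (al (vtx R ord0))).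
rewrite -tr_at; congr (_^-1 * _).
rewrite -[vtx R (lift i ord0)]coface_vtx.
by congr (tr _ _ _ _ _); apply: val_inj.
Qed.

Lemma prism_op_face k (c : cochain R T k.+1) (sigma : simplex R k.+1 S) :
  coboundary (pullback f0 L) (prism_op c) sigma =
  sd (prism al be (cpull sigma c)) (verts R k.+1).
Proof.
apply: coboundary_glue => i; rewrite /prism_op -map_coface_verts.
rewrite -(prism_map (al := al) (be := be)
  (g := fun p : @cylinder k => cylinder_at (cyl2 p) (coface i (cyl1 p)))).
- rewrite -prismZ; congr (prism _ _ _ _); apply: funext => s; exact: cpull_coface.
- by move=> x; apply: val_inj.
- by move=> x; apply: val_inj.
Qed.

Lemma cpull_ends k (c : cochain R T k) (sigma : simplex R k S) :
  (cpull sigma c (map al (verts R k)) = c (f0 \o sigma)) *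
  (cpull sigma c (map be (verts R k)) = (L (track (sigma (vtx R ord0))))^-1 * c (f1 \o sigma)).
Proof.
have nth0 s : nth (al (vtx R ord0)) (map (@cylinder_at k s) (verts R k)) 0 =
    cylinder_at s (vtx R ord0).
  rewrite (nth_map (vtx R ord0)) ?size_verts//; congr cylinder_at.
  exact: (nth_verts _ ord0).
have ends s (f : continuousType S T) : (forall x, h (x, s) = f x) ->
    (cylmap sigma \o lin (@cylinder_cvx k) k (al (vtx R ord0)) (map (cylinder_at s) (verts R k))
      : simplex R k T) = (f \o sigma : simplex R k T).
  move=> hs; apply/continuousEP => t.
  have e : lin (@cylinder_cvx k) k (al (vtx R ord0)) (map (cylinder_at s) (verts R k)) t =
      cylinder_at s t.
    rewrite -[in RHS](lin_verts (vtx R ord0) t) -lin_at ?size_verts//.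
    apply: val_inj => /=; apply: eq_bigr => i _; congr (_ *: val _).
    by apply: set_nth_default; rewrite size_map size_verts.
  by rewrite -[LHS]/(cylmap sigma (lin _ _ _ _ t)) e cylmap_at hs.
split; rewrite /cpull /pull size_map size_verts eqxx nth0.
  by rewrite tr_refl invr1 mul1r (ends _ f0).
by rewrite tr_up (ends _ f1).
Qed.

Lemma cpull_sd k (sigma : simplex R k S) m (c : cochain R T m) :
  sd (cpull sigma c) = cpull sigma (coboundary L c).
Proof. by apply: funext => s; exact: sd_pull. Qed.

(** The list identity [prism_homotopy] on the cylinder over [sigma]. The top end lives in a
    different stalk and is brought back along the track of the first vertex. *)
Lemma prism_homotopyS k (c : cochain R T k.+1) sigma :
  coboundary (pullback f0 L) (prism_op c) sigma + prism_op (coboundary L c) sigma =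
  (L (track (sigma (vtx R ord0))))^-1 * c (f1 \o sigma) - c (f0 \o sigma).
Proof.
rewrite prism_op_face /prism_op -cpull_sd prism_homotopy.
by rewrite !cpull_ends.
Qed.

(** In degree 0 there is no coboundary of a prism operator, so one term of the homotopy formula is
    absent. *)
Lemma prism_homotopy0 (c : cochain R T 0) sigma :
  prism_op (coboundary L c) sigma =
  (L (track (sigma (vtx R ord0))))^-1 * c (f1 \o sigma) - c (f0 \o sigma).
Proof.
rewrite -!cpull_ends -prism_homotopy /prism_op -cpull_sd -[LHS]add0r; congr (_ + _).
case: (verts R 0) (size_verts R 0) => // v [] //= _.
by rewrite subr0.
Qed.

End Homotopy.

(** * Transport around squares and free homotopies *)

Section Squares.
Variables (R : realType) (T : topologicalType) (L : local_system R T).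
Local Notation I := (@unit_interval R).

(** A constant path is its own concatenation with itself, so its transport is a nonzero
    idempotent. *)
Lemma transport_const (y : T) (a : cpath R T) : (forall s, a s = y) -> L a = 1.
Proof.
move=> ay; apply: (mulfI (transport_neq0 L a)); rewrite mulr1.
by rewrite -(@transport_concat _ _ L a a a)//; split=> s u _; rewrite !ay.
Qed.

Lemma transport_ext (a b : cpath R T) : a =1 b -> L a = L b.
Proof. by move=> /continuousEP ->. Qed.

Definition unit_square : set (R * R)%type := [set p | I p.1 /\ I p.2].

Lemma unit_square_cvx : cvx unit_square.
Proof.
have aux (x y t : R) : I x -> I y -> 0 <= t <= 1 -> I ((1 - t) * x + t * y).
  rewrite /unit_interval/= !in_itv/= => /andP[a0 a1] /andP[b0 b1] /andP[t0 t1].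
  rewrite addr_ge0 ?mulr_ge0// ?subr_ge0//=.
  rewrite [leRHS](_ : 1 = (1 - t) * 1 + t * 1); last by ring.
  by rewrite lerD// ler_wpM2l// subr_ge0.
by move=> [x1 x2] [y1 y2] t /= [/= X1 X2] [/= Y1 Y2] t01; split; apply: aux.
Qed.

Lemma square_at_subproof (s u : I) : unit_square (val s, val u).
Proof. by split; exact: sub_in. Qed.

Definition square_at s u : unit_square := mksub (square_at_subproof s u).

Lemma square_at_continuous (S : topologicalType) (f g : S -> I) :
  continuous f -> continuous g -> continuous (fun x => square_at (f x) (g x)).
Proof.
move=> cf cg; apply: subtype_continuous => /=.
by apply: pair_continuous; apply: comp_continuous (@uvalc R).
Qed.

Variable H : continuousType (I * I)%type T.

Lemma square_fst_continuous (u : I) : continuous (fun s : I => H (s, u)).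
Proof.
apply: (@comp_continuous _ _ _ (fun s : I => (s, u)) H); last exact: cts_fun.
by apply: pair_continuous; [move=> s; exact: cvg_id|exact: cst_continuous].
Qed.

Lemma square_snd_continuous (s : I) : continuous (fun u : I => H (s, u)).
Proof.
apply: (@comp_continuous _ _ _ (fun u : I => (s, u)) H); last exact: cts_fun.
by apply: pair_continuous; [exact: cst_continuous|move=> u; exact: cvg_id].
Qed.

(** Both ways around are transports in a convex square between the same opposite corners. *)
Lemma square_transport :
  L (cmap (@square_fst_continuous (@I1 R))) * L (cmap (@square_snd_continuous (@I0 R))) =
  L (cmap (@square_snd_continuous (@I1 R))) * L (cmap (@square_fst_continuous (@I0 R))).
Proof.
pose fs (p : unit_square) : I := mksub (sub_in p).1.
pose sn (p : unit_square) : I := mksub (sub_in p).2.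
have Pc : continuous (fun p : unit_square => H (fs p, sn p)).
  apply: (@comp_continuous _ _ _ (fun p => (fs p, sn p)) H); last exact: cts_fun.
  apply: pair_continuous; apply: subtype_continuous => /=.
    apply: (@comp_continuous _ _ _ (fun p : unit_square => val p) fst).
      exact: val_continuous.
    by move=> p; exact: cvg_fst.
  apply: (@comp_continuous _ _ _ (fun p : unit_square => val p) snd).
    exact: val_continuous.
  by move=> p; exact: cvg_snd.
pose Psi : continuousType unit_square T := cmap Pc.
have PsiE s u : Psi (square_at s u) = H (s, u).
  by rewrite /Psi/cmap/mkcts; congr (H (_, _)); exact: val_inj.
have path_tr (a : cpath R unit_square) (b : cpath R T) : (forall s, Psi (a s) = b s) ->
    L b = tr unit_square_cvx L Psi (a (@I0 R)) (a (@I1 R)).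
  move=> ab; rewrite /tr -convex_transport /=.
  by apply: transport_ext => s; rewrite -ab.
have c_id : continuous (fun s : I => s) by move=> s; exact: cvg_id.
have c_cst (u : I) : continuous (fun s : I => u) by exact: cst_continuous.
rewrite (path_tr (cmap (square_at_continuous c_id (c_cst (@I1 R))))
  (cmap (@square_fst_continuous (@I1 R))))//.
rewrite (path_tr (cmap (square_at_continuous c_id (c_cst (@I0 R))))
  (cmap (@square_fst_continuous (@I0 R))))//.
rewrite (path_tr (cmap (square_at_continuous (c_cst (@I0 R)) c_id))
  (cmap (@square_snd_continuous (@I0 R))))//.
rewrite (path_tr (cmap (square_at_continuous (c_cst (@I1 R)) c_id))
  (cmap (@square_snd_continuous (@I1 R))))//.
pose sq := square_at; pose o := @I0 R; pose e := @I1 R.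
apply: (etrans (esym (trM unit_square_cvx L Psi (sq o o) (sq o e) (sq e e)))).
exact: (trM unit_square_cvx L Psi (sq o o) (sq e o) (sq e e)).
all: by move=> s; exact: PsiE.
Qed.

(** The two lateral sides are the same path; as transports are scalars they commute and cancel. The
    base point of a loop may thus move. *)
Lemma free_homotopy (a b : cpath R T) :
  (forall s, H (s, @I0 R) = a s) -> (forall s, H (s, @I1 R) = b s) ->
  (forall u, H (@I0 R, u) = H (@I1 R, u)) -> L a = L b.
Proof.
move=> Ha Hb Hl.
have -> : L a = L (cmap (@square_fst_continuous (@I0 R))).
  by apply: transport_ext => s; exact: esym (Ha s).
have -> : L b = L (cmap (@square_fst_continuous (@I1 R))).
  by apply: transport_ext => s; exact: esym (Hb s).
apply: (mulIf (transport_neq0 L (cmap (@square_snd_continuous (@I0 R))))).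
rewrite square_transport mulrC; congr (_ * _); apply: transport_ext => u.
exact: Hl.
Qed.

End Squares.

(** * Invariance of cohomology under isomorphisms, retracts and homotopies *)

Section Consequences.
Variable R : realType.
Local Notation I := (@unit_interval R).

Lemma track_natural (S T : topologicalType) (L : local_system R T)
    (h : continuousType (S * I)%type T) (f0 f1 : continuousType S T) (a : cpath R S) :
  (forall x, h (x, @I0 R) = f0 x) -> (forall x, h (x, @I1 R) = f1 x) ->
  L (f1 \o a) * L (track h (a (@I0 R))) = L (track h (a (@I1 R))) * L (f0 \o a).
Proof.
move=> h0 h1.
have Hc : continuous (fun su : I * I => h (a su.1, su.2)).
  apply: (@comp_continuous _ _ _ (fun su : I * I => (a su.1, su.2)) h); last exact: cts_fun.
  apply: pair_continuous; last by move=> p; exact: cvg_snd.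
  apply: (@comp_continuous _ _ _ fst a); last exact: cts_fun.
  by move=> p; exact: cvg_fst.
transitivity (L (cmap (@square_fst_continuous _ _ (cmap Hc) (@I1 R))) *
              L (cmap (@square_snd_continuous _ _ (cmap Hc) (@I0 R)))).
  by congr (_ * _); apply: transport_ext => s //; exact: esym (h1 _).
rewrite square_transport; congr (_ * _); apply: transport_ext => s //.
exact: h0.
Qed.

Lemma isomorphic_pullback_homotopy (S T : topologicalType) (L : local_system R T)
    (h : continuousType (S * I)%type T) (f0 f1 : continuousType S T) :
  (forall x, h (x, @I0 R) = f0 x) -> (forall x, h (x, @I1 R) = f1 x) ->
  isomorphic (pullback f0 L) (pullback f1 L).
Proof.
move=> h0 h1; exists (fun x => L (track h x)); split=> [x|a].
  exact: transport_neq0.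
exact: track_natural.
Qed.

Lemma coboundary_ext (T : topologicalType) (L L' : local_system R T) k
    (c : cochain R T k) sigma :
  L =1 L' -> coboundary L c sigma = coboundary L' c sigma.
Proof. by move=> LL; rewrite /coboundary LL. Qed.

Lemma cohomology_iso (T : topologicalType) (L L' : local_system R T) k :
  isomorphic L L' -> cohomology_neq0 L k -> cohomology_neq0 L' k.
Proof.
move=> [g [g0 gE]].
(* An isomorphism of local systems acts on a cochain through the stalk at the initial vertex. *)
pose tw m (u : T -> R[i]) (c : cochain R T m) : cochain R T m :=
  fun sigma => u (sigma (vtx R ord0)) * c sigma.
have twd (M M' : local_system R T) (u : T -> R[i]) : (forall x, u x != 0) ->
    (forall a : cpath R T, M' a * u (a (@I0 R)) = u (a (@I1 R)) * M a) ->
    forall m (c : cochain R T m), coboundary M' (tw m u c) = tw m.+1 u (coboundary M c).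
  move=> u0 uE m c; apply: funext => sigma.
  have ev (i : 'I_m.+2) : ((sigma \o coface i : simplex R m T) (vtx R ord0))
      = sigma (vtx R (lift i ord0)) by rewrite -coface_vtx.
  have e0 : edge01 m (@I0 R) = vtx R ord0.
    apply: val_inj; apply/rowP => j.
    by rewrite /= !mxE eqxx/= subr0; case: eqP => // _; rewrite if_same.
  have e1 : edge01 m (@I1 R) = vtx R (lift ord0 ord0).
    apply: val_inj; apply/rowP => j.
    rewrite /= !mxE eqxx/= subrr; case: eqP => [->//|_].
    have -> : lift ord0 ord0 = 1 :> 'I_m.+2 by apply: val_inj.
    by case: (j == 1).
  have e : M' (sigma \o edge01 m) * u (sigma (vtx R ord0)) =
      u (sigma (vtx R (lift ord0 ord0))) * M (sigma \o edge01 m).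
    by rewrite -e0 -e1; exact: uE.
  rewrite /coboundary /tw mulrDr mulr_sumr; congr (_ + _).
    rewrite ev; apply: (mulfI (transport_neq0 M' (sigma \o edge01 m))).
    rewrite mulrA divff ?transport_neq0// mul1r mulrA e.
    by rewrite mulrA mulfK// transport_neq0.
  apply: eq_bigr => i _; rewrite ev mulrCA.
  by have -> : lift (lift ord0 i) ord0 = ord0 :> 'I_m.+2 by apply: val_inj.
have tw_inv m u (c : cochain R T m) : (forall x, u x != 0) ->
    tw m (fun x => (u x)^-1) (tw m u c) = c.
  by move=> u0; apply: funext => sigma; rewrite /tw mulKf.
move=> [c [dc nc]]; exists (tw k g c); split.
  by rewrite /cocycles/= (twd L L')// dc; apply: funext => sigma; rewrite /tw mulr0.
case: k c dc nc => [|k] c dc nc /=.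
  move=> c0; apply: nc; rewrite /= -(tw_inv 0%N g c g0) c0.
  by apply: funext => sigma; rewrite /tw mulr0.
move=> [e _ eE]; apply: nc; exists (tw k (fun x => (g x)^-1) e) => //.
rewrite (twd L' L)// ?eE ?tw_inv//; first by move=> x; rewrite invr_eq0.
by move=> a; apply: (mulfI (g0 (a (@I1 R)))); rewrite mulrA -gE mulfK// mulVKf.
Qed.

(** Restriction along [i] is a left inverse of pullback along [p], so the latter is injective on
    cohomology. *)
Lemma cohomology_retract (M T : topologicalType) (L : local_system R M) k
    (i : continuousType M T) (p : continuousType T M) :
  (forall x, p (i x) = x) -> cohomology_neq0 L k ->
  cohomology_neq0 (pullback p L) k.
Proof.
move=> pi [c [dc nc]].
have pd (X Y : topologicalType) (f : continuousType X Y) (K : local_system R Y) m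
    (u : cochain R Y m) : coboundary (pullback f K) (fun sigma => u (f \o sigma)) =
    fun sigma => coboundary K u (f \o sigma).
  apply: funext => sigma; rewrite /coboundary /=.
  congr (_^-1 * u _ + _); [exact: transport_ext|exact/continuousEP|].
  by apply: eq_bigr => j _; congr (_ * u _); exact/continuousEP.
have pif m (sigma : simplex R m M) : (p \o (i \o sigma) : simplex R m M) = sigma.
  by apply/continuousEP => t /=; rewrite pi.
exists (fun sigma : simplex R k T => c (p \o sigma)); split.
  by rewrite /cocycles/= pd dc.
case: k c dc nc => [|k] c dc nc.
  move=> /= c0; apply: nc; apply: funext => sigma.
  by have := congr1 (fun u : cochain R T 0 => u (i \o sigma)) c0; rewrite /= pif.
move=> [e _ eE]; apply: nc; exists (fun sigma : simplex R k M => e (i \o sigma)) => //.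
apply: funext => sigma.
rewrite (@coboundary_ext _ _ (pullback i (pullback p L))) => [|a]; last first.
  by apply: transport_ext => s; rewrite /= pi.
by rewrite (pd _ _ i (pullback p L)) eE pif.
Qed.

(* The homotopy [h] makes the scalar [tau - 1] act as zero on cohomology. *)
Lemma cohomology_monodromy_vanish (T : topologicalType) (L : local_system R T)
    (h : continuousType (T * I)%type T) (tau : R[i]) k :
  (forall x, h (x, @I0 R) = x) -> (forall x, h (x, @I1 R) = x) ->
  (forall x, L (track h x) = tau) -> tau != 1 -> ~ cohomology_neq0 L k.
Proof.
move=> h0 h1 ht t1 [c [dc nc]]; apply: nc.
have t0 : tau^-1 - 1 != 0.
  by rewrite subr_eq0 -invr1 (inj_eq invr_inj).
have idE m (sigma : simplex R m T) : (idfun \o sigma : simplex R m T) = sigma by exact/continuousEP.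
have P0 sigma : prism_op L h (coboundary L c) sigma = 0.
  rewrite dc /prism_op; have -> : cpull L h sigma ((fun=> 0) : cochain R T k.+1) = (fun=> 0 * 0).
    by apply: funext => s; rewrite /cpull/pull mulr0; case: ifP => //; rewrite mulr0.
  by rewrite prismZ mul0r.
case: k c dc P0 => [|k] c dc P0.
  apply: funext => sigma.
  have := prism_homotopy0 L (f0 := idfun) (f1 := idfun) h0 h1 c sigma.
  rewrite P0 !idE ht -[X in _ - X]mul1r -mulrBl => /esym/eqP.
  by rewrite mulf_eq0 (negbTE t0) => /eqP.
(* For a cocycle the prism homotopy says that [(tau^-1 - 1) * c] is the coboundary of
   [prism_op L h c]. *)
exists (fun sigma => (tau^-1 - 1)^-1 * prism_op L h c sigma) => //.
apply: funext => sigma.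
have := prism_homotopyS L (f0 := idfun) (f1 := idfun) h0 h1 c sigma.
rewrite P0 addr0 !idE ht -[X in _ - X]mul1r -mulrBl => e.
apply: (mulfI t0); rewrite -e.
rewrite (@coboundary_ext _ _ (pullback idfun L)) => [|a]; last first.
  by apply: transport_ext.
rewrite /coboundary mulrDr mulr_sumr; congr (_ + _).
  by rewrite mulrCA mulVKf.
by apply: eq_bigr => i _; rewrite mulrCA mulVKf.
Qed.

End Consequences.

(** * Euler characteristics by Mayer-Vietoris *)

(* Equations between sums of atoms in an abelian group, decided by comparing the
   integer coefficients of the atoms. *)
Module ZmodReflection.

Inductive zexp := ZAtom of nat | ZAdd of zexp & zexp | ZOpp of zexp | ZZero.

Fixpoint zeval (V : zmodType) (env : seq V) e : V :=
  match e with
  | ZAtom n => nth 0 env n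
  | ZAdd a b => zeval env a + zeval env b
  | ZOpp a => - zeval env a
  | ZZero => 0
  end.

Fixpoint zcoef e (i : nat) : int :=
  match e with
  | ZAtom n => (n == i)%:R
  | ZAdd a b => zcoef a i + zcoef b i
  | ZOpp a => - zcoef a i
  | ZZero => 0
  end.

Lemma zevalE (V : zmodType) (env : seq V) e :
  zeval env e = \sum_(i < size env) env`_i *~ zcoef e i.
Proof.
elim: e => /= [n|a -> b ->|a ->|].
- have [ns|sn] := ltnP n (size env); last first.
    by rewrite nth_default// big1// => i _; rewrite (gtn_eqF (leq_trans (ltn_ord i) sn)).
  rewrite (bigD1 (Ordinal ns))//= eqxx big1 ?addr0// => i.
  by rewrite -val_eqE/= eq_sym => /negbTE ->.
- by rewrite -big_split; apply: eq_bigr => i _; rewrite mulrzDr.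
- by rewrite -sumrN; apply: eq_bigr => i _; rewrite mulrNz.
- by rewrite big1.
Qed.

Lemma zevalP (V : zmodType) (env : seq V) e e' :
  all (fun i => zcoef e i == zcoef e' i) (iota 0 (size env)) ->
  zeval env e = zeval env e'.
Proof.
move=> /allP h; rewrite !zevalE; apply: eq_bigr => i _.
by rewrite (eqP (h i _))// mem_iota /=.
Qed.

Ltac find_atom x env :=
  match env with
  | ?y :: _ => let _ := match goal with _ => unify x y end in constr:(0%N)
  | _ :: ?env' => let n := find_atom x env' in constr:(n.+1)
  end.

Ltac add_atom x env :=
  match env with
  | _ => let _ := find_atom x env in env
  | _ => constr:(x :: env)
  end.

Ltac atoms e env :=
  lazymatch e with
  | ?a + ?b => let env' := atoms a env in atoms b env'
  | - ?a => atoms a env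
  | 0 => env
  | _ => add_atom e env
  end.

Ltac reify e env :=
  lazymatch e with
  | ?a + ?b => let a' := reify a env in let b' := reify b env in constr:(ZAdd a' b')
  | - ?a => let a' := reify a env in constr:(ZOpp a')
  | 0 => constr:(ZZero)
  | _ => let n := find_atom e env in constr:(ZAtom n)
  end.

Ltac zmod :=
  lazymatch goal with
  | |- @eq ?T ?x ?y =>
    let env0 := atoms x (@nil T) in
    let env := atoms y env0 in
    let x' := reify x env in
    let y' := reify y env in
    exact: (@zevalP _ env x' y' isT)
  end.

End ZmodReflection.
Ltac zmod := ZmodReflection.zmod.

(** * Dimensions of subquotients *)

Section QuotientDimension.
Variable K : fieldType.

Definition subspace_prop (V : lmodType K) (Z : set V) :=
  Z 0 /\ forall a x y, Z x -> Z y -> Z (a *: x + y).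

Definition linear_on (V W : lmodType K) (Z : set V) (f : V -> W) :=
  forall a x y, Z x -> Z y -> f (a *: x + y) = a *: f x + f y.

(* The subspace [B] of [Z] has codimension [n]. *)
Definition qdim (V : lmodType K) (Z B : set V) (n : nat) :=
  exists f : V -> 'rV[K]_n, [/\ linear_on Z f,
    forall u, exists2 z, Z z & f z = u & forall z, Z z -> f z = 0 <-> B z].

Section Subspaces.
Variables (V : lmodType K) (Z : set V) (sZ : subspace_prop Z).

Lemma subD x y : Z x -> Z y -> Z (x + y).
Proof. by move=> Zx Zy; rewrite -[x]scale1r; apply: sZ.2. Qed.

Lemma subZ a x : Z x -> Z (a *: x).
Proof. by move=> Zx; rewrite -[_ *: _]addr0; apply: sZ.2 => //; exact: sZ.1. Qed.

Lemma subN x : Z x -> Z (- x).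
Proof. by move=> Zx; rewrite -scaleN1r; exact: subZ. Qed.

Lemma subB x y : Z x -> Z y -> Z (x - y).
Proof. by move=> Zx Zy; apply: subD => //; exact: subN. Qed.

Lemma sub_sum (I : Type) (r : seq I) (F : I -> V) :
  (forall i, Z (F i)) -> Z (\sum_(i <- r) F i).
Proof.
move=> ZF; elim: r => [|i r IH]; first by rewrite big_nil; exact: sZ.1.
by rewrite big_cons; apply: subD.
Qed.

Variables (W : lmodType K) (f : V -> W) (fl : linear_on Z f).

Lemma lin_on0 : f 0 = 0.
Proof.
have := fl (-1) sZ.1 sZ.1; rewrite scaler0 addr0 => ->.
by rewrite scaleN1r addNr.
Qed.

Lemma lin_onZ a x : Z x -> f (a *: x) = a *: f x.
Proof. by move=> Zx; rewrite -[a *: x]addr0 fl ?lin_on0 ?addr0//; exact: sZ.1. Qed.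

Lemma lin_onD x y : Z x -> Z y -> f (x + y) = f x + f y.
Proof. by move=> Zx Zy; rewrite -[x in LHS]scale1r fl// scale1r. Qed.

Lemma lin_onB x y : Z x -> Z y -> f (x - y) = f x - f y.
Proof.
move=> Zx Zy; rewrite lin_onD//; last exact: subN.
by rewrite -scaleN1r lin_onZ// scaleN1r.
Qed.

Lemma lin_on_sum (I : Type) (r : seq I) (F : I -> V) :
  (forall i, Z (F i)) -> f (\sum_(i <- r) F i) = \sum_(i <- r) f (F i).
Proof.
move=> ZF; elim: r => [|i r IH]; first by rewrite !big_nil lin_on0.
by rewrite !big_cons lin_onD ?IH//; exact: sub_sum.
Qed.

End Subspaces.

(** Lifts of the standard basis vectors are chosen once and extended linearly. *)
Lemma qdim_section (V : lmodType K) (Z : set V) n (f : V -> 'rV[K]_n) :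
  subspace_prop Z -> linear_on Z f -> (forall u, exists2 z, Z z & f z = u) ->
  exists s : 'rV[K]_n -> V, [/\ linear_on setT s, forall u, Z (s u) & forall u, f (s u) = u].
Proof.
move=> sZ fl fs.
have H (i : 'I_n) : exists z, Z z /\ f z = delta_mx 0 i.
  by have [z] := fs (delta_mx 0 i); exists z.
pose z i := projT1 (cid (H i)).
have [Zz fz] : (forall i, Z (z i)) /\ (forall i, f (z i) = delta_mx 0 i).
  by split=> i; have [] := projT2 (cid (H i)).
exists (fun u => \sum_i u 0 i *: z i); split=> [a x y _ _|u|u].
- rewrite scaler_sumr -big_split/=; apply: eq_bigr => i _.
  by rewrite !mxE scalerDl scalerA.
- by apply: sub_sum => // i; exact: subZ.
rewrite (lin_on_sum sZ fl) => [|i]; last exact: subZ.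
rewrite [RHS]matrix_sum_delta big_ord1; apply: eq_bigr => i _.
by rewrite (lin_onZ sZ fl)// fz.
Qed.

(** Subtracting a section of the first coordinate map moves an element of [Z] into [B'], where the
    second coordinate map applies. *)
Lemma qdim_trans (V : lmodType K) (Z B' B : set V) p q :
  subspace_prop Z -> subspace_prop B' -> B' `<=` Z -> B `<=` B' ->
  qdim Z B' p -> qdim B' B q -> qdim Z B (p + q)%N.
Proof.
move=> sZ sB' B'Z BB' [f1 [l1 s1 k1]] [f2 [l2 s2 k2]].
have [s [sl sZ' fs]] := qdim_section sZ l1 s1.
have inB' z : Z z -> B' (z - s (f1 z)).
  move=> Zz; apply/k1; first exact: subB.
  by rewrite (lin_onB sZ l1)// fs subrr.
have f1B' b : B' b -> f1 b = 0 by move=> Bb; apply/k1 => //; exact: B'Z.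
have s0 : s 0 = 0.
  have := sl (-1) 0 0 I I; rewrite scaler0 addr0 => ->.
  by rewrite scaleN1r addNr.
exists (fun z => row_mx (f1 z) (f2 (z - s (f1 z)))); split=> [a x y Zx Zy|u|z Zz].
- rewrite l1// scale_row_mx add_row_mx sl//; congr row_mx.
  rewrite -l2; [|exact: inB'|exact: inB'].
  by congr f2; rewrite scalerBr opprD addrACA.
- have [b Bb fb] := s2 (rsubmx u).
  have f1s : f1 (s (lsubmx u) + b) = lsubmx u.
    by rewrite (lin_onD l1) ?fs ?f1B' ?addr0//; exact: B'Z.
  exists (s (lsubmx u) + b); first by apply: subD => //; exact: B'Z.
  by rewrite f1s addrC addKr fb hsubmxK.
split=> [|Bz].
  rewrite -[0]row_mx0 => /eq_row_mx[f1z f2z].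
  by rewrite f1z s0 subr0 in f2z; apply/k2 => //; apply/k1.
have B'z := BB' _ Bz.
rewrite f1B'// s0 subr0 (_ : f2 z = 0) ?row_mx0//.
by apply/k2.
Qed.

Lemma qdim_ker (V : lmodType K) (Z B : set V) m c (phi : V -> 'rV[K]_m) (M : 'M[K]_(m, c)) :
  linear_on Z phi -> (forall z, Z z -> phi z *m M = 0) ->
  (forall u, u *m M = 0 -> exists2 z, Z z & phi z = u) ->
  (forall z, Z z -> phi z = 0 <-> B z) -> qdim Z B (m - \rank M)%N.
Proof.
move=> pl pM ps pk; rewrite -mxrank_ker; set Kb := row_base (kermx M).
have KbP z : Z z -> phi z *m pinvmx Kb *m Kb = phi z.
  move=> Zz; apply: mulmxKpV; rewrite eq_row_base; apply/sub_kermxP; exact: pM.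
exists (fun z => phi z *m pinvmx Kb); split=> [a x y Zx Zy|u|z Zz].
- by rewrite pl// mulmxDl -scalemxAl.
- have [|z Zz pz] := ps (u *m Kb).
    by apply/sub_kermxP; rewrite -(eq_row_base (kermx M)) submxMl.
  exists z => //; rewrite pz; apply: (row_free_inj (row_base_free (kermx M))).
  by rewrite -/Kb -pz KbP.
rewrite -pk//; split=> [e|->]; last by rewrite mul0mx.
by rewrite -KbP// e mul0mx.
Qed.

(** Linearity of [psi] is asked modulo the row space of [M], because [psi] will be a connecting map
    built from arbitrary choices. *)
Lemma qdim_coker (V : lmodType K) (Z B : set V) m c (psi : V -> 'rV[K]_c) (M : 'M[K]_(m, c)) :
  (forall a x y, Z x -> Z y -> ((psi (a *: x + y) - (a *: psi x + psi y))%R <= M)%MS) ->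
  (forall u, exists2 z, Z z & (psi z - u <= M)%MS) ->
  (forall z, Z z -> (psi z <= M)%MS <-> B z) -> qdim Z B (c - \rank M)%N.
Proof.
move=> pl ps pk; rewrite -mxrank_coker.
pose Q := col_base (cokermx M).
have QP (u : 'rV_c) : u *m Q = 0 <-> (u <= M)%MS.
  have e : u *m cokermx M = (u *m Q) *m row_base (cokermx M).
    by rewrite -mulmxA mulmx_base.
  rewrite submxE e; split=> [->|/eqP]; first by rewrite mul0mx.
  rewrite -[X in _ = X -> _](mul0mx _ (row_base (cokermx M))).
  by apply: row_free_inj; exact: row_base_free.
exists (fun z => psi z *m Q); split=> [a x y Zx Zy|u|z Zz].
- apply/eqP; rewrite scalemxAl -mulmxDl -subr_eq0 -mulmxBl; apply/eqP/QP; exact: pl.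
- have /submxP[w wu] : (u <= Q)%MS by apply: submx_full; exact: col_base_full.
  have [z Zz pz] := ps w; exists z => //.
  by apply/eqP; rewrite wu -subr_eq0 -mulmxBl; apply/eqP/QP.
by rewrite QP; exact: pk.
Qed.

Lemma qdim_eq (V : lmodType K) (Z B : set V) n n' : n = n' -> qdim Z B n -> qdim Z B n'.
Proof. by move=> ->. Qed.

Lemma qdim0 (V : lmodType K) (Z B : set V) : Z 0 -> Z `<=` B -> qdim Z B 0.
Proof.
move=> Z0 ZB; exists (fun=> 0); split=> [a x y _ _|u|z /ZB//].
  by rewrite scaler0 addr0.
by exists 0 => //; apply/rowP; case.
Qed.

Lemma qdim_gt0 (V : lmodType K) (Z B : set V) n : subspace_prop Z ->
  qdim Z B n -> Z `<=` B -> n = 0%N.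
Proof.
move=> sZ [f [fl fs fk]] ZB; case: n f fl fs fk => // n f fl fs fk.
have [z Zz fz] := fs (delta_mx 0 0).
have /rowP/(_ 0) : f z = 0 by apply/fk => //; exact: ZB.
by rewrite fz !mxE !eqxx => /eqP; rewrite oner_eq0.
Qed.

End QuotientDimension.

(** * Mayer-Vietoris for quotients of one complex *)

Section MayerVietoris.
Variables (K : fieldType) (V : nat -> lmodType K) (d : forall k, {linear V k -> V k.+1}).
Hypothesis dd : forall k (x : V k), d k.+1 (d k x) = 0.

Definition subcomplex (N : forall k, set (V k)) :=
  (forall k, subspace_prop (N k)) /\ (forall k x, N k x -> N k.+1 (d k x)).

(* Cocycles and coboundaries of the quotient of [V] by the subcomplex [N]. *)
Definition ZN (N : forall k, set (V k)) k : set (V k) := [set c | N k.+1 (d k c)].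

Definition BN (N : forall k, set (V k)) k : set (V k) :=
  match k return set (V k) with
  | 0 => N 0
  | k'.+1 => [set c | exists e, N k'.+1 (c - d k' e)]
  end.

Definition euler (N : forall k, set (V k)) (e : int) :=
  exists (h : nat -> nat) (m : nat), [/\ forall k, qdim (@ZN N k) (@BN N k) (h k),
    forall k, (m <= k)%N -> h k = 0%N & e = \sum_(k < m) (-1) ^+ k * (h k)%:Z].

Lemma euler_sum (h : nat -> nat) m m' : (m <= m')%N ->
  (forall k, (m <= k)%N -> h k = 0%N) ->
  \sum_(k < m) (-1) ^+ k * (h k)%:Z = \sum_(k < m') (-1) ^+ k * (h k)%:Z.
Proof.
move=> mm' h0; rewrite -!(big_mkord xpredT (fun k => (-1) ^+ k * (h k)%:Z)).
rewrite [RHS](big_cat_nat _ mm')//= -[LHS]addr0; congr (_ + _).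
apply/esym; rewrite big_nat_cond big1// => k; rewrite andbT => /andP[mk _].
by rewrite h0 ?mulr0.
Qed.

Section Subcomplex.
Variable N : forall k, set (V k).
Arguments N : clear implicits.
Hypothesis sN : subcomplex N.

Lemma ZN_sub k : subspace_prop (@ZN N k).
Proof.
have [N0 NL] := sN.1 k.+1.
split=> [|a x y]; rewrite /ZN/= ?linear0// linearP => Zx Zy.
exact: NL.
Qed.

Lemma N_BN k : N k `<=` @BN N k.
Proof. by case: k => // k x Nx; exists 0; rewrite linear0 subr0. Qed.

Lemma d_BN k e : @BN N k.+1 (d k e).
Proof. by exists e; rewrite subrr; exact: (sN.1 _).1. Qed.

Lemma BN_sub k : subspace_prop (@BN N k).
Proof.
case: k => [|k]; first exact: sN.1.
split=> [|a x y [e He] [e' He']]; first by apply: N_BN; exact: (sN.1 _).1.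
exists (a *: e + e'); rewrite linearP opprD addrACA -scalerBr.
exact: (sN.1 _).2.
Qed.

Lemma BN_ZN k : @BN N k `<=` @ZN N k.
Proof.
case: k => [|k] x; first exact: sN.2.
by move=> [e /sN.2]; rewrite linearB/= dd subr0.
Qed.

End Subcomplex.

Variables N1 N2 : forall k, set (V k).
Arguments N1 : clear implicits.
Arguments N2 : clear implicits.
Hypotheses (sN1 : subcomplex N1) (sN2 : subcomplex N2).

Definition NI k : set (V k) := N1 k `&` N2 k.
Definition ND k : set (V k) := [set x | exists u v, [/\ N1 k u, N2 k v & x = u + v]].

Arguments NI : clear implicits.
Arguments ND : clear implicits.

Lemma NI_sub : subcomplex NI.
Proof.
split=> [k|k x [X1 X2]]; last by split; [exact: sN1.2|exact: sN2.2].
split; first by split; [exact: (sN1.1 k).1|exact: (sN2.1 k).1].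
by move=> a x y [X1 X2] [Y1 Y2]; split; [exact: (sN1.1 k).2|exact: (sN2.1 k).2].
Qed.

Lemma N1D k : N1 k `<=` ND k.
Proof. by move=> x X; exists x, 0; split=> //; [exact: (sN2.1 k).1|rewrite addr0]. Qed.

Lemma N2D k : N2 k `<=` ND k.
Proof. by move=> x X; exists 0, x; split=> //; [exact: (sN1.1 k).1|rewrite add0r]. Qed.

Lemma ND_sub : subcomplex ND.
Proof.
split=> [k|k x [u [v [U W ->]]]]; last first.
  by exists (d k u), (d k v); rewrite linearD; split=> //; [exact: sN1.2|exact: sN2.2].
split; first by apply: N1D; exact: (sN1.1 k).1.
move=> a x y [u [v [U W ->]]] [u' [v' [U' W' ->]]].
exists (a *: u + u'), (a *: v + v'); split; [exact: (sN1.1 k).2|exact: (sN2.1 k).2|].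
by rewrite scalerDr addrACA.
Qed.

Lemma ZN_mono (N N' : forall k, set (V k)) k : (forall k, N k `<=` N' k) ->
  @ZN N k `<=` @ZN N' k.
Proof. by move=> NN' x; exact: NN'. Qed.

Lemma BN_mono (N N' : forall k, set (V k)) k : (forall k, N k `<=` N' k) ->
  @BN N k `<=` @BN N' k.
Proof.
by move=> NN'; case: k => [|k] x; [exact: NN'|move=> [e /NN']; exists e].
Qed.

(** The quotient by the intersection embeds in the sum of the quotients by [N1] and [N2], with
    cokernel the quotient by [N1 + N2]. The long exact sequence of this short exact one is worked
    out through ranks of matrices. *)
Lemma mayer_vietoris e1 e2 e12 : euler N1 e1 -> euler N2 e2 -> euler ND e12 ->
  euler NI (e1 + e2 - e12).
Proof.
move=> [a [m1 [qa a0 ->]]] [b [m2 [qb b0 ->]]] [c [m12 [qc c0 ->]]].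
have Z1D k : @ZN N1 k `<=` @ZN ND k by apply: ZN_mono => j; exact: N1D.
have Z2D k : @ZN N2 k `<=` @ZN ND k by apply: ZN_mono => j; exact: N2D.
have B1D k : @BN N1 k `<=` @BN ND k by apply: BN_mono => j; exact: N1D.
have B2D k : @BN N2 k `<=` @BN ND k by apply: BN_mono => j; exact: N2D.
have sZ1 k : subspace_prop (@ZN N1 k) by exact: ZN_sub.
have sZ2 k : subspace_prop (@ZN N2 k) by exact: ZN_sub.
have sZD k : subspace_prop (@ZN ND k) by apply: ZN_sub; exact: ND_sub.
(* [rho k] is the rank of the difference map from the sum of the two outer
   cohomology spaces in degree [k] to the cohomology of the intersection. *)
have [rho [rc rab qI]] : exists rho : nat -> nat,
    [/\ forall k, (rho k <= c k)%N, forall k, (rho k <= a k + b k)%N &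
     forall k, qdim (@ZN NI k) (@BN NI k)
       ((a k + b k - rho k) + if k is k'.+1 then c k' - rho k' else 0)%N].
  have H k : exists M : 'M[K]_(a k + b k, c k),
      qdim (@ZN NI k) [set z | @ZN NI k z /\ (@BN N1 k z /\ @BN N2 k z)] (a k + b k - \rank M) /\
      qdim [set z | @ZN NI k.+1 z /\ (@BN N1 k.+1 z /\ @BN N2 k.+1 z)] (@BN NI k.+1) (c k - \rank M).
    have [f1 [l1 s1 k1]] := qa k; have [f2 [l2 s2 k2]] := qb k.
    have [f [l s kk]] := qc k.
    have [t1 [tl1 tZ1 ft1]] := qdim_section (sZ1 k) l1 s1.
    have [t2 [tl2 tZ2 ft2]] := qdim_section (sZ2 k) l2 s2.
    have [t [tl tZ ft]] := qdim_section (sZD k) l s.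
    (* [A1] and [A2] are the matrices, in the chosen coordinates, of the maps on cohomology from the
       quotients by [N1] and [N2] to the quotient by [ND]; the difference map is
       [col_mx A1 (- A2)]. *)
    pose A1 : 'M[K]_(a k, c k) := \matrix_(i, j) f (t1 (delta_mx 0 i)) 0 j.
    pose A2 : 'M[K]_(b k, c k) := \matrix_(i, j) f (t2 (delta_mx 0 i)) 0 j.
    have rep n (g : V k -> 'rV[K]_n) (Z : set (V k)) B' (tt : 'rV[K]_n -> V k) (A : 'M[K]_(n, c k)) :
        subspace_prop Z -> linear_on Z g -> linear_on setT tt -> (forall u, Z (tt u)) ->
        (forall u, g (tt u) = u) -> Z `<=` @ZN ND k -> B' `<=` @BN ND k ->
        (forall z, Z z -> g z = 0 <-> B' z) ->
        A = \matrix_(i, j) f (tt (delta_mx 0 i)) 0 j ->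
        forall z, Z z -> f z = g z *m A.
      move=> sZ gl ttl ttZ gtt ZD BD gB -> z Zz.
      have -> : f z = f (tt (g z)).
        apply/eqP; rewrite -subr_eq0 -(lin_onB (sZD k) l); try by apply: ZD.
        apply/eqP/kk; first by apply: ZD; apply: subB.
        apply: BD; apply/gB; first exact: subB.
        by rewrite (lin_onB sZ gl)// gtt subrr.
      rewrite {1}[g z]matrix_sum_delta big_ord1.
      have sT : subspace_prop [set: 'rV[K]_n] by [].
      rewrite (lin_on_sum sT ttl)// (lin_on_sum (sZD k) l) => [|i]; last first.
        by apply: ZD; exact: ttZ.
      apply/rowP => j; rewrite summxE !mxE; apply: eq_bigr => i _.
      rewrite (lin_onZ sT ttl)// (lin_onZ (sZD k) l) ?mxE//.
      by apply: ZD; exact: ttZ.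
    have f_1 := rep _ _ _ _ _ A1 (sZ1 k) l1 tl1 tZ1 ft1 (@Z1D k) (@B1D k) k1 erefl.
    have f_2 := rep _ _ _ _ _ A2 (sZ2 k) l2 tl2 tZ2 ft2 (@Z2D k) (@B2D k) k2 erefl.
    clear rep; exists (col_mx A1 (- A2)).
    have fM z1 z2 : @ZN N1 k z1 -> @ZN N2 k z2 ->
        f (z1 - z2) = row_mx (f1 z1) (f2 z2) *m col_mx A1 (- A2).
      move=> Z1 Z2; rewrite mul_row_col mulmxN -f_1// -f_2// (lin_onB (sZD k) l)//.
        exact: Z1D.
      exact: Z2D.
    (* A coboundary modulo [ND] is a true coboundary [g] plus corrections from [N1] and [N2]; in
       degree 0 one takes [g = 0]. *)
    have BD_split y : @BN ND k y -> exists (g : V k) (n1 n2 : V k),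
        [/\ N1 k n1, N2 k n2, y = g + (n1 + n2) & d k g = 0 /\
          (@BN N1 k g /\ @BN N2 k g)].
      case: k y {A1 A2 f1 l1 s1 k1 f2 l2 s2 k2 f l s kk t1 tl1 tZ1 ft1 t2 tl2 tZ2 ft2 t tl tZ ft f_1 f_2 fM} => [|k] y.
        move=> [n1 [n2 [h1 h2 ->]]]; exists 0, n1, n2; rewrite add0r linear0; split=> //.
        by split=> //; split; [exact: (sN1.1 0).1|exact: (sN2.1 0).1].
      move=> [e [n1 [n2 [h1 h2 en]]]]; exists (d k e), n1, n2.
      split=> //; first by rewrite -en addrC subrK.
      by split; [exact: dd|split; exact: d_BN].
    split.
      apply: (@qdim_ker _ _ _ _ _ _ (fun z => row_mx (f1 z) (f2 z))).
      - move=> x z w [Z1 Z2] [W1 W2].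
        by rewrite l1// l2// scale_row_mx add_row_mx.
      - move=> z [Z1 Z2]; rewrite -fM// subrr; exact: (lin_on0 (sZD k) l).
      - move=> u; rewrite -[u]hsubmxK -{1}[lsubmx u]ft1 -{1}[rsubmx u]ft2 -fM// => f0.
        have : @BN ND k (t1 (lsubmx u) - t2 (rsubmx u)).
          apply/kk => //; apply: subB => //; [exact: Z1D|exact: Z2D].
        move=> /BD_split[g [n1 [n2 [h1 h2 e [dg [g1 g2]]]]]].
        (* Both sides describe one element, which represents both classes at once and is a cocycle
           modulo [N1] and modulo [N2]. *)
        have e' : t1 (lsubmx u) - g - n1 = t2 (rsubmx u) + n2.
          rewrite -[t1 _](subrK (t2 (rsubmx u))) e; zmod.
        have Z1z : @ZN N1 k (t1 (lsubmx u) - g - n1).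
          apply: subB => //; last by apply: BN_ZN => //; exact: N_BN.
          by apply: subB => //; exact: BN_ZN.
        have Z2z : @ZN N2 k (t1 (lsubmx u) - g - n1).
          by rewrite e'; apply: subD => //; apply: BN_ZN => //; exact: N_BN.
        exists (t1 (lsubmx u) - g - n1); first by split.
        congr row_mx.
          rewrite -{2}[lsubmx u]ft1; apply/eqP; rewrite -subr_eq0 -(lin_onB (sZ1 k) l1)//.
          apply/eqP/k1; first exact: subB.
          rewrite (_ : _ - t1 _ = - (g + n1)); last zmod.
          apply: subN; first exact: BN_sub.
          by apply: subD => //; [exact: BN_sub|exact: N_BN].
        rewrite e' -{2}[rsubmx u]ft2; apply/eqP; rewrite -subr_eq0 -(lin_onB (sZ2 k) l2)//; last by rewrite -e'.
        apply/eqP/k2; first by apply: subB => //; rewrite -e'.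
        by rewrite (_ : _ - t2 _ = n2); [exact: N_BN|zmod].
      move=> z [Z1 Z2]; split=> [|[_ [B1 B2]]].
        by rewrite -[0]row_mx0 => /eq_row_mx[/k1 h1 /k2 h2]; split=> //; split; [exact: h1|exact: h2].
      have -> : f1 z = 0 by apply/k1.
      have -> : f2 z = 0 by apply/k2.
      by rewrite row_mx0.
    (* The connecting map inverted: a class that dies on both sides has two primitives, and their
       difference is a cocycle modulo [ND]. *)
    have Hw z : exists w : V k * V k, (@BN N1 k.+1 z /\ @BN N2 k.+1 z) ->
        N1 k.+1 (z - d k w.1) /\ N2 k.+1 (z - d k w.2).
      have [[[u hu] [v hv]]|nB] := pselect (@BN N1 k.+1 z /\ @BN N2 k.+1 z).
        by exists (u, v).
      by exists (0, 0).
    have [w wP] : exists w : V k.+1 -> V k * V k, forall z, (@BN N1 k.+1 z /\ @BN N2 k.+1 z) ->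
        N1 k.+1 (z - d k (w z).1) /\ N2 k.+1 (z - d k (w z).2).
      by exists (fun z => projT1 (cid (Hw z))) => z; exact: (projT2 (cid (Hw z))).
    have wZ z : (@BN N1 k.+1 z /\ @BN N2 k.+1 z) -> @ZN ND k ((w z).1 - (w z).2).
      move=> /wP[h1 h2]; rewrite /ZN/= linearB.
      exists (- (z - d k (w z).1)), (z - d k (w z).2); split=> //.
        by apply: subN => //; exact: sN1.1.
      by rewrite opprB addrA subrK.
    have fMle z1 z2 : @ZN N1 k z1 -> @ZN N2 k z2 -> (f (z1 - z2) <= col_mx A1 (- A2))%MS.
      by move=> Z1 Z2; rewrite fM// submxMl.
    apply: (@qdim_coker _ _ _ _ _ _ (fun z => f ((w z).1 - (w z).2))).
    - move=> x y z [_ By] [_ Bz].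
      have Byz : @BN N1 k.+1 (x *: y + z) /\ @BN N2 k.+1 (x *: y + z).
        by case: By Bz => [? ?] [? ?]; split; apply: (BN_sub _ _).2.
      rewrite -l; try exact: wZ.
      rewrite -(lin_onB (sZD k) l); [|exact: wZ|by apply: (sZD k).2; exact: wZ].
      rewrite (_ : _ - _ = ((w (x *: y + z)).1 - (x *: (w y).1 + (w z).1))
         - ((w (x *: y + z)).2 - (x *: (w y).2 + (w z).2))); last first.
        rewrite scalerBr; zmod.
      have [y1 y2] := wP _ By; have [z1 z2] := wP _ Bz; have [yz1 yz2] := wP _ Byz.
      apply: fMle; rewrite /ZN/= linearB linearP.
        rewrite (_ : _ - _ = (x *: (y - d k (w y).1) + (z - d k (w z).1)) - (x *: y + z - d k (w (x *: y + z)).1)).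
          by apply: subB; [exact: sN1.1|apply: (sN1.1 _).2|].
        rewrite scalerBr; zmod.
      rewrite (_ : _ - _ = (x *: (y - d k (w y).2) + (z - d k (w z).2)) - (x *: y + z - d k (w (x *: y + z)).2)).
        by apply: subB; [exact: sN2.1|apply: (sN2.1 _).2|].
      rewrite scalerBr; zmod.
    - move=> u; have [n1 [n2 [h1 h2 dt]]] := tZ u.
      have Bn : @BN N1 k.+1 n2 /\ @BN N2 k.+1 n2.
        split; last exact: N_BN.
        exists (t u); rewrite dt opprD addrC subrK; apply: subN => //; exact: sN1.1.
      have dn : N1 k.+2 (d k.+1 n2).
        have := dd (t u); rewrite dt linearD => /eqP; rewrite addrC addr_eq0 => /eqP ->.
        by apply: subN; [exact: sN1.1|exact: sN1.2].
      exists n2; first by split=> //; split=> //; exact: sN2.2.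
      have [w1 w2] := wP _ Bn.
      rewrite -[u]ft -(lin_onB (sZD k) l)//; last exact: wZ.
      rewrite addrAC; apply: fMle; rewrite /ZN/= ?linearB.
        rewrite dt (_ : _ - _ = - (n2 - d k (w n2).1) - n1).
          by apply: subB => //; [exact: sN1.1|apply: subN => //; exact: sN1.1].
        zmod.
      rewrite (_ : d k _ = n2 - (n2 - d k (w n2).2)).
        by apply: subB => //; exact: sN2.1.
      zmod.
    move=> z [[Z1 Z2] Bz]; have [w1 w2] := wP _ Bz; split.
      move=> /submxP[u]; rewrite -[u]hsubmxK -{1}[lsubmx u]ft1 -{1}[rsubmx u]ft2 -fM// => fw.
      have : @BN ND k ((w z).1 - (w z).2 - (t1 (lsubmx u) - t2 (rsubmx u))).
        have Zt : @ZN ND k (t1 (lsubmx u) - t2 (rsubmx u)).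
          by apply: subB => //; [exact: Z1D|exact: Z2D].
        apply/kk; first by apply: subB => //; exact: wZ.
        by rewrite (lin_onB (sZD k) l)// ?fw ?subrr//; exact: wZ.
      move=> /BD_split[g [n1 [n2 [h1 h2 e [dg _]]]]].
      have e' : (w z).1 - t1 (lsubmx u) - g - n1 = (w z).2 - t2 (rsubmx u) + n2.
        apply/eqP; rewrite -subr_eq0; apply/eqP.
        rewrite [X in X = _](_ : _ = ((w z).1 - (w z).2 - (t1 (lsubmx u) - t2 (rsubmx u))) - (g + (n1 + n2))).
          by rewrite e subrr.
        zmod.
      exists ((w z).1 - t1 (lsubmx u) - g - n1); split.
        rewrite !linearB/= dg.
        rewrite (_ : z + _ = (z - d k (w z).1) + (d k (t1 (lsubmx u)) + d k n1)).
          apply: subD => //; first exact: sN1.1.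
          by apply: subD; [exact: sN1.1|exact: tZ1|exact: sN1.2].
        zmod.
      rewrite e' linearD linearB/=.
      rewrite (_ : z + _ = (z - d k (w z).2) + (d k (t2 (rsubmx u)) - d k n2)).
        apply: subD => //; first exact: sN2.1.
        by apply: subB; [exact: sN2.1|exact: tZ2|exact: sN2.2].
      zmod.
    move=> [e [h1 h2]].
    rewrite (_ : (w z).1 - _ = ((w z).1 - e) - ((w z).2 - e)); last zmod.
    apply: fMle; rewrite /ZN/= linearB.
      rewrite (_ : _ - _ = (z - d k e) - (z - d k (w z).1)); last zmod.
      by apply: subB => //; exact: sN1.1.
    rewrite (_ : _ - _ = (z - d k e) - (z - d k (w z).2)); last zmod.
    by apply: subB => //; exact: sN2.1.
  pose M k := projT1 (cid (H k)).
  exists (fun k => \rank (M k)); split=> [k|k|k].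
  - exact: rank_leq_col.
  - exact: rank_leq_row.
  have [q1 _] := projT2 (cid (H k)); rewrite -/(M k) in q1.
  have sub' : subspace_prop [set z | @ZN NI k z /\ (@BN N1 k z /\ @BN N2 k z)].
    have sI := ZN_sub NI_sub k; have s1 := BN_sub sN1 k; have s2 := BN_sub sN2 k.
    split; first by split; [exact: sI.1|split; [exact: s1.1|exact: s2.1]].
    move=> x y z [yI [y1 y2]] [zI [z1 z2]].
    by split; [exact: sI.2|split; [exact: s1.2|exact: s2.2]].
  apply: qdim_trans q1 _ => //; first exact: ZN_sub NI_sub k.
  - by move=> z [].
  - move=> z Bz; split; first by apply: BN_ZN => //; exact: NI_sub.
    by split; move: Bz; apply: BN_mono => j x [].
  case: k sub' => [|k] sub'; first by apply: qdim0; [exact: sub'.1|move=> z [_ []]].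
  by have [_] := projT2 (cid (H k)).
pose m := maxn m1 (maxn m2 m12).
have [m1m m2m m12m] : [/\ (m1 <= m)%N, (m2 <= m)%N & (m12 <= m)%N].
  by rewrite /m !leq_max !leqnn !orbT.
exists (fun k => (a k + b k - rho k) + if k is k'.+1 then c k' - rho k' else 0)%N, m.+1.
split=> // [k mk|].
  rewrite a0 ?(leq_trans m1m) ?(ltnW mk)// b0 ?(leq_trans m2m) ?(ltnW mk)//.
  by case: k mk => // k mk; rewrite c0 ?(leq_trans m12m).
rewrite (euler_sum (leqW m1m) a0) (euler_sum (leqW m2m) b0) (euler_sum m12m c0).
have rho_m : rho m = 0%N by have := rc m; rewrite c0// leqn0 => /eqP.
(* In the alternating sum [rho k] enters in degrees [k] and [k + 1] and cancels; the range is one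
   longer because of the shift of [c]. *)
transitivity (\sum_(k < m.+1) ((-1) ^+ k * (a k)%:Z + (-1) ^+ k * (b k)%:Z - (-1) ^+ k * (rho k)%:Z)
   + \sum_(k < m.+1) (-1) ^+ k * ((if (k : nat) is k'.+1 then c k' - rho k' else 0)%N%:Z)).
  rewrite [X in _ = _ + X]big_ord_recl/= mulr0 add0r.
  rewrite [X in _ = _ + X](_ : _ = \sum_(k < m) (-1) ^+ k * (rho k)%:Z - \sum_(k < m) (-1) ^+ k * (c k)%:Z).
    rewrite sumrB big_split/= [X in _ = _ - X + _]big_ord_recr/= rho_m mulr0 addr0.
    by rewrite addrA subrK.
  rewrite -sumrB; apply: eq_bigr => k _.
  by rewrite -subzn ?rc// exprS; ring.
rewrite -big_split/=; apply: eq_bigr => k _.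
by rewrite PoszD -subzn ?rab// PoszD; ring.
Qed.

End MayerVietoris.

(** * Euler characteristics of subspaces with local coefficients *)

Section CochainComplex.
Variables (R : realType) (T : topologicalType) (L : local_system R T).

Definition cochains k : lmodType R[i] := (simplex R k T -> R[i]^o).

Lemma coboundary_linear k : linear (@coboundary R T L k : cochains k -> cochains k.+1).
Proof.
move=> a x y; apply: funext => s.
rewrite -[RHS]/(a * coboundary L (x : cochain R T k) s + coboundary L (y : cochain R T k) s).
rewrite /coboundary.
rewrite (_ : (a *: x + y) _ = a * x (s \o coface ord0) + y (s \o coface ord0))//.
under eq_bigr => i _ do
  rewrite (_ : (a *: x + y) _ = a * x (s \o coface (lift ord0 i)) + y (s \o coface (lift ord0 i)))// mulrDr mulrCA.
by rewrite big_split/= -mulr_sumr; ring.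
Qed.

Definition cobd k : {linear cochains k -> cochains k.+1} :=
  HB.pack (@coboundary R T L k : cochains k -> cochains k.+1)
    (GRing.isLinear.Build _ _ _ _ _ (@coboundary_linear k)).

(** Seen from one simplex, both coboundaries are [sd] of functions of vertex lists, so [sdK]
    applies. *)
Lemma cobdK k (c : cochains k) : cobd k.+1 (cobd k c) = 0.
Proof.
apply: funext => s; rewrite -[LHS](spull_verts L) -sd_spull.
rewrite (_ : spull L s (cobd k c) = sd (spull L s (c : cochain R T k))); first exact: sdK.
by apply: funext => ws; rewrite sd_spull.
Qed.

(** Cochains on [A] are the quotient of all cochains by these, so that all subspaces share a single
    complex and intersections become sums of subcomplexes. *)
Definition vanishing (A : set T) k : set (cochains k) :=
  [set c | forall s, inS A s -> c s = 0].
Arguments vanishing : clear implicits.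

Lemma inS_face (A : set T) k (s : simplex R k.+1 T) i : inS A s -> inS A (s \o coface i : simplex R k T).
Proof. by move=> As t; exact: As. Qed.

Lemma vanishing_sub A : subcomplex cobd (vanishing A).
Proof.
split=> [k|k x x0 s As]; last first.
  rewrite -[LHS]/(coboundary L (x : cochain R T k) s) /coboundary x0 ?mulr0 ?add0r; last exact: inS_face.
  by rewrite big1// => i _; rewrite x0 ?mulr0//; exact: inS_face.
split=> [//|a x y x0 y0 s As].
by rewrite -[LHS]/(a * x s + y s) x0// y0// mulr0 addr0.
Qed.

Definition eulerS (A : set T) e := euler cobd (vanishing A) e.

(** The quotient by the intersection sees only simplices inside one of the two open sets;
    [small_acyclic] shows that forgetting the others preserves cohomology. *)
Lemma eulerS_small (Y O1 O2 : set T) e : open O1 -> open O2 -> Y `<=` O1 `|` O2 ->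
  euler cobd (NI (vanishing (Y `&` O1)) (vanishing (Y `&` O2))) e -> eulerS Y e.
Proof.
move=> oO1 oO2 Y12 [h [m [q h0 ->]]]; exists h, m; split=> // k.
set N' := NI _ _ in q.
have sub k' : vanishing Y k' `<=` N' k'.
  by move=> c c0; split=> s ss; apply: c0 => t; have [] := ss t.
have N'P k' c : N' k' c -> forall s, inS (Y `&` O1) s \/ inS (Y `&` O2) s -> c s = 0.
  by move=> [c1 c2] s [/c1|/c2].
have PN' k' c : (forall s, inS (Y `&` O1) s \/ inS (Y `&` O2) s -> c s = 0) -> N' k' c.
  by move=> c0; split=> s ss; apply: c0; [left|right].
have key k' (c : cochains k'.+1) : N' k'.+1 c -> vanishing Y k'.+2 (cobd _ c) ->
    exists2 u : cochains k', N' k' u & vanishing Y k'.+1 (c - cobd _ u).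
  move=> /N'P c1 c2.
  have [u [u1 u2]] := @small_acyclic _ _ L Y O1 O2 oO1 oO2 Y12 k' c c1 c2.
  by exists u; [exact: PN'|move=> s Ys; rewrite -[LHS]/(c s - coboundary L u s) u2 ?subrr].
have sN' : subcomplex cobd N' by apply: NI_sub; exact: vanishing_sub.
have [f [fl fs fk]] := q k.
have ZZ : ZN cobd (vanishing Y) (k := k) `<=` ZN cobd N' (k := k) by move=> z; exact: sub.
exists f; split=> [a x y /ZZ Zx /ZZ Zy|u|z Zz]; first exact: fl.
  have [z Zz <-] := fs u.
  have [||w w1 w2] := key k (cobd _ z) => //.
    by move=> s _; rewrite cobdK.
  have Nw : ZN cobd N' w by apply: (BN_ZN cobdK sN'); apply: N_BN.
  exists (z - w); first by move: w2; rewrite -linearB.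
  rewrite (lin_onB (ZN_sub sN' k) fl)// [X in _ - X](_ : f w = 0) ?subr0//.
  by apply/fk => //; apply: N_BN.
split=> [/(fk _ (ZZ _ Zz))|Bz]; last first.
  apply/fk; first exact: ZZ.
  by move: Bz; apply: BN_mono.
case: k z f fl fs fk ZZ Zz => [|k] z f fl fs fk ZZ Zz.
  move=> /N'P z0 s Ys; apply: z0.
  have c0 t : s t = s (vtx R ord0).
    congr (s _); apply: val_inj; apply/rowP => j; rewrite (ord1 j).
    have [_] := sub_in t; have [_] := sub_in (vtx R (ord0 : 'I_1)).
    by rewrite !big_ord1 => -> ->.
  by have [h1|h1] := Y12 _ (Ys (vtx R ord0)); [left|right] => t; rewrite c0; split.
move=> [u Nu].
have [|w w1 w2] := key k _ Nu.
  by move=> s Ys; rewrite linearB cobdK subr0; exact: Zz.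
exists (u + w); rewrite linearD opprD addrA //.
Qed.

Lemma eulerS_cover (Y O1 O2 : set T) e1 e2 e12 : open O1 -> open O2 ->
  Y `<=` O1 `|` O2 -> eulerS (Y `&` O1) e1 -> eulerS (Y `&` O2) e2 ->
  eulerS (Y `&` (O1 `&` O2)) e12 -> eulerS Y (e1 + e2 - e12).
Proof.
move=> o1 o2 Y12 E1 E2 E12; apply: (eulerS_small o1 o2 Y12).
apply: mayer_vietoris => //; [exact: cobdK|exact: vanishing_sub|exact: vanishing_sub|].
rewrite (_ : ND _ _ = vanishing (Y `&` (O1 `&` O2)))//.
apply: functional_extensionality_dep => k; apply/seteqP; split=> c.
  move=> [u [v [u0 v0 ->]]] s ss; rewrite -[LHS]/(u s + v s) u0 ?v0 ?addr0//.
    by move=> t; have [? []] := ss t.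
  by move=> t; have [? []] := ss t.
(* Cutting [c] off on the first piece writes it as a sum of two cochains, each vanishing on one
   piece. *)
move=> c0; pose u : cochains k := fun s => if `[< inS (Y `&` O1) s >] then 0 else c s.
exists u, (c - u); split; last by rewrite addrC subrK.
  by move=> s ss; rewrite /u asboolT.
move=> s ss; rewrite -[LHS]/(c s - u s) /u; case: asboolP => [s1|_]; last by rewrite subrr.
by rewrite subr0 c0// => t; have [? ?] := ss t; have [? ?] := s1 t.
Qed.

Lemma eulerS0 : eulerS set0 0.
Proof.
exists (fun=> 0%N), 0%N; split=> // [k|]; last by rewrite big_ord0.
apply: qdim0; first by move=> s ss; case: (ss (vtx R ord0)).
by move=> z _; apply: N_BN => s ss; case: (ss (vtx R ord0)).
Qed.

Lemma eulerS_neq0 e : eulerS setT e -> e != 0 -> exists k, cohomology_neq0 L k.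
Proof.
move=> [h [m [q h0 ->]]]; apply: contra_neqP => nH.
apply: big1 => k _; rewrite (_ : h k = 0%N) ?mulr0//.
apply: qdim_gt0 (q k) _; first exact: (ZN_sub (vanishing_sub setT)).
move=> c Zc; apply: contrapT => nB; apply: nH; exists k; exists c; split.
  by apply: funext => s; exact: Zc.
case: (k : nat) c Zc nB => [|j] c Zc nB /=; first by move=> c0; apply: nB; rewrite c0.
by move=> [u _ uc]; apply: nB; exists u; rewrite -uc => s _; exact: subrr.
Qed.

Section Contractible.
Local Notation I := (@unit_interval R).
Variables (A : set T) (y0 : A) (h : continuousType (A * I)%type T).
Hypotheses (h0 : forall x, h (x, @I0 R) = val x) (h1 : forall x, h (x, @I1 R) = val y0).
Hypothesis hA : forall p, A (h p).

Definition incl : continuousType A T := cmap (@val_continuous T A).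

Lemma lift_simplex_continuous k (s : simplex R k T) (As : inS A s) :
  continuous (fun t => mksub (As t)).
Proof. by apply: subtype_continuous; exact: (@cts_fun _ _ s). Qed.

Definition lift_simplex k (s : simplex R k T) (As : inS A s) : simplex R k A :=
  cmap (@lift_simplex_continuous k s As).

Definition push k (u : cochain R A k) : cochain R T k := fun s =>
  if pselect (inS A s) is left As then u (lift_simplex As) else 0.

Lemma pushE k (u : cochain R A k) (s : simplex R k A) : push u (incl \o s) = u s.
Proof.
rewrite /push; case: pselect => [As|[]]; last by move=> t; exact: sub_in.
by congr u; apply/continuousEP => t; exact: val_inj.
Qed.

Lemma coboundary_push k (u : cochain R A k) (s : simplex R k.+1 A) :
  coboundary L (push u) (incl \o s) = coboundary (pullback incl L) u s.
Proof.
have e j (ph : continuousType (@std_simplex R j) (@std_simplex R k.+1)) :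
    ((incl \o s) \o ph : simplex R j T) = (incl \o (s \o ph) : simplex R j T).
  exact/continuousEP.
rewrite /coboundary; congr (_^-1 * _ + _).
- exact: transport_ext.
- by rewrite e pushE.
- by apply: eq_bigr => i _; rewrite e pushE.
Qed.

Lemma lift_incl k (s : simplex R k T) (As : inS A s) : (incl \o lift_simplex As : simplex R k T) = s.
Proof. exact/continuousEP. Qed.

Let y : T := val y0.
Let const k : simplex R k T := cst y.

Lemma const_in k : inS A (const k).
Proof. by move=> t; exact: sub_in. Qed.

Let tau (x : A) : R[i] := L (track h x).

Let f1 : continuousType A T := cst y.

Lemma const_comp k (s : simplex R k A) : (f1 \o s : simplex R k T) = const k.
Proof. exact/continuousEP. Qed.

(** All faces of a constant simplex are equal, so its coboundary is this alternating count times a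
    single value. *)
Let sign_sum m : R[i] := \sum_(i < m) (-1) ^+ i.

Lemma sign_sumE m : sign_sum m = (odd m)%:R.
Proof.
rewrite /sign_sum; elim: m => [|m IH]; first by rewrite big_ord0.
rewrite big_ord_recr/= IH -signr_odd; case: (odd m) => /=; last by rewrite add0r.
by rewrite expr1 subrr.
Qed.

Lemma coboundary_const k (c : cochain R T k) :
  coboundary L c (const k.+1) = sign_sum k.+2 * c (const k).
Proof.
have e j (ph : continuousType (@std_simplex R j) (@std_simplex R k.+1)) :
    (const k.+1 \o ph : simplex R j T) = const j by exact/continuousEP.
rewrite /coboundary (transport_const L (y := y)) // e invr1 mul1r.
rewrite /sign_sum [in RHS]big_ord_recl expr0 mulrDl mul1r mulr_suml; congr (_ + _).
by apply: eq_bigr => i _; rewrite e.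
Qed.

Lemma coboundary_tau k (ga : R[i]) (s : simplex R k.+1 A) :
  coboundary (pullback incl L) (fun s : simplex R k A => (tau (s (vtx R ord0)))^-1 * ga) s =
  sign_sum k.+2 * ((tau (s (vtx R ord0)))^-1 * ga).
Proof.
have ev (i : 'I_k.+2) : ((s \o coface i : simplex R k A) (vtx R ord0))
    = s (vtx R (lift i ord0)) by rewrite -coface_vtx.
rewrite /coboundary /sign_sum [in RHS]big_ord_recl expr0 mulrDl mul1r mulr_suml; congr (_ + _).
  rewrite ev mulrA -invfM; congr (_^-1 * _).
  have e0 : edge01 k (@I0 R) = vtx R ord0.
    apply: val_inj; apply/rowP => j.
    by rewrite /= !mxE eqxx/= subr0; case: eqP => // _; rewrite if_same.
  have e1 : edge01 k (@I1 R) = vtx R (lift ord0 ord0).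
    apply: val_inj; apply/rowP => j.
    rewrite /= !mxE eqxx/= subrr; case: eqP => [->//|_].
    have -> : lift ord0 ord0 = 1 :> 'I_k.+2 by apply: val_inj.
    by case: (j == 1).
  have : L (f1 \o (s \o edge01 k)) * tau (s (vtx R ord0)) =
      tau (s (vtx R (lift ord0 ord0))) * L (incl \o (s \o edge01 k)).
    by rewrite -e0 -e1; exact: track_natural.
  by rewrite (transport_const L (y := y))// mul1r mulrC => ->.
apply: eq_bigr => i _; rewrite ev.
by have -> : lift (lift ord0 i) ord0 = ord0 :> 'I_k.+2 by apply: val_inj.
Qed.

Lemma prism_vanish k (c : cochain R T k) (s : simplex R k A) :
  ZN cobd (vanishing A) (c : cochains k) -> prism_op L h (coboundary L c) s = 0.
Proof.
move=> Zc; rewrite /prism_op.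
have -> : cpull L h s (coboundary L c) = (fun=> 0 * 0).
  apply: funext => ws; rewrite /cpull/pull mulr0; case: ifP => // _.
  by rewrite [X in _ * X]Zc ?mulr0// => t; exact: hA.
by rewrite prismZ mul0r.
Qed.

(** The prism operator of the contraction compares every cochain with its value on constant
    simplices at [y0]. In degree 0 that value is a coordinate; in higher degrees it leaves no
    cohomology. *)
Lemma eulerS_contractible : eulerS A 1.
Proof.
exists (fun k => (k == 0)%N : nat), 1%N; split=> [k|[|k]//|]; last by rewrite big_ord1.
case: k => [|k] /=.
  exists (fun c => const_mx (c (const 0))); split=> [a x z _ _|u|z Zz].
  - by apply/rowP => j; rewrite !mxE.
  - pose w : cochain R A 0 := fun s : simplex R 0 A =>
      (tau (s (vtx R ord0)))^-1 * (tau y0 * u 0 0).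
    exists (push w : cochains 0).
      move=> s As; rewrite -[LHS]/(coboundary L (push w) s) -(lift_incl As) coboundary_push.
      by rewrite coboundary_tau sign_sumE mul0r.
    apply/rowP => j; rewrite mxE (ord1 j).
    have -> : const 0 = incl \o (cst y0 : simplex R 0 A) by exact/continuousEP.
    by rewrite pushE /w /= mulKf// transport_neq0.
  split=> [/rowP/(_ 0)|z0]; last by apply/rowP => j; rewrite !mxE z0//; exact: const_in.
  rewrite !mxE => z0 s As.
  have := prism_homotopy0 L (f0 := incl) (f1 := f1) h0 h1 (z : cochain R T 0) (lift_simplex As).
  rewrite prism_vanish// const_comp z0 mulr0 sub0r lift_incl => /esym/eqP.
  by rewrite oppr_eq0 => /eqP.
apply: qdim0 => [|c Zc]; first by apply: (ZN_sub (vanishing_sub A) k.+1).1.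
pose ga : R[i] := c (const k.+1).
(* If [k] is odd the count is 1; if [k] is even the cocycle condition on the constant simplex gives
   [ga = 0]. *)
have ga1 : sign_sum k.+2 * ga = ga.
  have := coboundary_const (c : cochain R T k.+1).
  rewrite [LHS]Zc; last exact: const_in.
  rewrite !sign_sumE /= negbK -/ga; case: (odd k) => /=; first by rewrite mul1r.
  by rewrite mul1r => <-; rewrite mulr0.
(* The prism operator is a primitive up to sign and up to the constant part, for which the first
   term is a primitive by [ga1]. *)
pose u : cochain R A k := fun s => (tau (s (vtx R ord0)))^-1 * ga - prism_op L h (c : cochain R T k.+1) s.
exists (push u : cochains k) => s As.
rewrite -[LHS]/(c s - coboundary L (push u) s) -(lift_incl As) coboundary_push.
set s' := lift_simplex As.
have -> : coboundary (pullback incl L) u s' =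
   sign_sum k.+2 * ((tau (s' (vtx R ord0)))^-1 * ga)
   - coboundary (pullback incl L) (prism_op L h (c : cochain R T k.+1)) s'.
  rewrite -coboundary_tau /coboundary /u.
  rewrite (_ : \sum_(i < k.+1) _ = \sum_(i < k.+1)
     ((-1) ^+ i.+1 * ((tau ((s' \o coface (lift ord0 i) : simplex R k A) (vtx R ord0)))^-1 * ga)
      - (-1) ^+ i.+1 * prism_op L h (c : cochain R T k.+1) (s' \o coface (lift ord0 i)))); last first.
    by apply: eq_bigr => i _; rewrite -mulrBr.
  by rewrite sumrB; ring.
rewrite mulrCA ga1.
have := prism_homotopyS L (f0 := incl) (f1 := f1) h0 h1 (c : cochain R T k.+1) s'.
rewrite prism_vanish// addr0 const_comp -/ga -/(tau _) => ->.
by ring.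
Qed.

End Contractible.

End CochainComplex.

(** * Euler characteristics of affine arrangement complements *)

Section ComplexContinuity.
Variable R : realType.
Local Notation C := R[i].

Lemma gaddc (K : numFieldType) (V : normedModType K) (S : topologicalType) (f g : S -> V) :
  continuous f -> continuous g -> continuous (fun x => f x + g x).
Proof. by move=> cf cg x; apply: cvgD; [exact: cf|exact: cg]. Qed.

Lemma gsubc (K : numFieldType) (V : normedModType K) (S : topologicalType) (f g : S -> V) :
  continuous f -> continuous g -> continuous (fun x => f x - g x).
Proof. by move=> cf cg x; apply: cvgB; [exact: cf|exact: cg]. Qed.

Lemma gscalec (K : numFieldType) (V : normedModType K) (S : topologicalType) (f : S -> K^o) (g : S -> V) :
  continuous f -> continuous g -> continuous (fun x => f x *: g x).
Proof. by move=> cf cg x; apply: cvgZ; [exact: cf|exact: cg]. Qed.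

Lemma ReB (x y : C) : Re (x - y) = Re x - Re y.
Proof. by case: x y => [a b] [c d]; simpc. Qed.

Lemma ImB (x y : C) : Im (x - y) = Im x - Im y.
Proof. by case: x y => [a b] [c d]; simpc. Qed.

Lemma normc_le_ReIm (z : C) : `|z| <= (`|Re z| + `|Im z|)%:C.
Proof.
case: z => a b; rewrite normc_def /= lecR.
have ab0 : 0 <= `|a| + `|b| by rewrite addr_ge0.
rewrite -[leRHS]ger0_norm// -sqrtr_sqr ler_wsqrtr//.
rewrite sqrrD !real_normK ?num_real// lerD2r lerDl.
by rewrite mulrn_wge0// mulr_ge0.
Qed.

Lemma normc_lt (z : C) (e : R) : `|Re z| < e / 2 -> `|Im z| < e / 2 -> `|z| < e%:C.
Proof.
move=> hr hi; apply: le_lt_trans (normc_le_ReIm z) _; rewrite ltcR; lra.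
Qed.

Lemma normc_ge_Im (z : C) : `|Im z|%:C <= `|z|.
Proof.
case: z => a b; rewrite normc_def /= lecR -sqrtr_sqr ler_wsqrtr// lerDr sqr_ge0//.
Qed.

Lemma Re_ball (x y : C) (e : R) : @ball C C^o x e%:C y -> ball (Re x) e (Re y).
Proof.
rewrite -(@ball_normE C C^o) -ball_normE /ball_/= => xy.
by rewrite -ltcR -ReB (le_lt_trans (normc_ge_Re _)).
Qed.

Lemma Im_ball (x y : C) (e : R) : @ball C C^o x e%:C y -> ball (Im x) e (Im y).
Proof.
rewrite -(@ball_normE C C^o) -ball_normE /ball_/= => xy.
by rewrite -ltcR -ImB (le_lt_trans (normc_ge_Im _)).
Qed.

Lemma Re_continuous : continuous (fun z : C => Re z : R).
Proof.
move=> x A /nbhs_ballP[e /= e0 eA].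
apply/(@nbhs_ballP _ C^o); exists e%:C; first by rewrite /= ltcR.
by move=> y xy; apply: eA; exact: Re_ball xy.
Qed.

Lemma Im_continuous : continuous (fun z : C => Im z : R).
Proof.
move=> x A /nbhs_ballP[e /= e0 eA].
apply/(@nbhs_ballP _ C^o); exists e%:C; first by rewrite /= ltcR.
by move=> y xy; apply: eA; exact: Im_ball xy.
Qed.

Lemma cplx_continuousP (S : topologicalType) (f : S -> C) :
  continuous f <-> continuous (fun x => Re (f x)) /\ continuous (fun x => Im (f x)).
Proof.
split=> [fc|[rc ic] x A].
  by split; apply: (comp_continuous fc); [exact: Re_continuous|exact: Im_continuous].
move=> /(@nbhs_ballP _ C^o)[e /= e0 eA].
have [er ep] : e = (Re e)%:C /\ 0 < Re e.
  by case: e e0 {eA} => a b; rewrite ltcE /= => /andP[/eqP -> ->].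
have e2 : 0 < Re e / 2 by rewrite divr_gt0.
have r_near : \forall y \near x, ball (Re (f x)) (Re e / 2) (Re (f y)).
  by apply: rc; exact: nbhsx_ballx.
have i_near : \forall y \near x, ball (Im (f x)) (Re e / 2) (Im (f y)).
  by apply: ic; exact: nbhsx_ballx.
have : \forall y \near x, A (f y); last by [].
apply: filterS2 r_near i_near => y.
rewrite -!ball_normE/= => hr hi; apply: eA.
rewrite -(@ball_normE C C^o) /ball_/= er.
by apply: normc_lt; rewrite ?ReB ?ImB.
Qed.

Lemma caddc (S : topologicalType) (f g : S -> C) :
  continuous f -> continuous g -> continuous (fun x => f x + g x).
Proof. exact: (@gaddc C C^o). Qed.

Lemma cmulc (S : topologicalType) (f g : S -> C) :
  continuous f -> continuous g -> continuous (fun x => f x * g x).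
Proof. exact: (@gscalec C C^o). Qed.

Lemma xaddc n (S : topologicalType) (f g : S -> 'rV[C]_n) :
  continuous f -> continuous g -> continuous (fun x => f x + g x).
Proof. exact: gaddc. Qed.

Lemma xscalec n (S : topologicalType) (f : S -> C) (g : S -> 'rV[C]_n) :
  continuous f -> continuous g -> continuous (fun x => f x *: g x).
Proof. exact: gscalec. Qed.

Lemma xcoordc n (j : 'I_n) : continuous (fun x : 'rV[C]_n => x 0 j : C).
Proof. exact: (@coord_continuous C^o). Qed.

End ComplexContinuity.

(** * Half spaces, deletion and restriction *)

Section ArrangementEuler.
Variables (R : realType) (n r : nat).
Local Notation C := R[i].
Local Notation X := 'rV[C]_n.
Local Notation I := (@unit_interval R).
Variable F : 'I_r -> {scalar X}.

(* Convex sets that are relatively open in their complex affine span. *)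
Definition good (K : set X) :=
  (forall x y (t : R), K x -> K y -> 0 <= t <= 1 -> K ((1 - t)%:C *: x + t%:C *: y)) /\
  (forall p q (z : C), K p -> K q -> exists2 e : R, 0 < e &
     forall e' : R, 0 <= e' <= e -> K (p + (e'%:C * z) *: (q - p))).

(** For the four fourth roots of unity [w] these sets cover the complement of the i-th hyperplane,
    and they are convex. *)
Definition half (w : C) (i : 'I_r) : set X := [set x | 0 < Re (w * F i x)].

Lemma FP i (a : C) x y : F i (a *: x + y) = a * F i x + F i y.
Proof. exact: linearP. Qed.
Lemma FD i x y : F i (x + y) = F i x + F i y. Proof. exact: linearD. Qed.
Lemma FB i x y : F i (x - y) = F i x - F i y. Proof. exact: linearB. Qed.
Lemma FZ i (a : C) x : F i (a *: x) = a * F i x. Proof. exact: linearZ. Qed.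

Lemma ReD (x y : C) : Re (x + y) = Re x + Re y.
Proof. by case: x y => [a b] [c d]. Qed.
Lemma ReM (a : R) (x : C) : Re (a%:C * x) = a * Re x.
Proof. by case: x => [c d]; simpc. Qed.

Lemma good_hyperplane K i : good K -> good (K `&` hyperplane F i).
Proof.
move=> [Kc Ko]; split=> [x y t [Kx /= Fx] [Ky /= Fy] t01|p q z [Kp /= Fp] [Kq /= Fq]].
  by split; [exact: Kc|rewrite /hyperplane/= FP FZ Fx Fy !mulr0 addr0].
have [e e0 He] := Ko p q z Kp Kq; exists e => // e' e'e; split; first exact: He.
by rewrite /hyperplane/= FD FZ FB Fp Fq subrr mulr0 addr0.
Qed.

Lemma half_open K w i p q (z : C) : good K -> (K `&` half w i) p -> K q ->
  exists2 e : R, 0 < e &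
    forall e' : R, 0 <= e' <= e -> (K `&` half w i) (p + (e'%:C * z) *: (q - p)).
Proof.
move=> [Kc Ko] [Kp /= Fp] Kq.
have [e e0 He] := Ko p q z Kp Kq.
set u := Re (w * F i p) in Fp.
set v := Re (w * (z * F i (q - p))).
pose e2 := Num.min e (u / (1 + `|v|)).
have v1 : 0 < 1 + `|v| by rewrite ltr_wpDr.
exists e2; first by rewrite lt_min e0 divr_gt0.
move=> e' /andP[e'0 e'e2]; split.
  by apply: He; rewrite e'0 (le_trans e'e2)// ge_min lexx.
rewrite /half/= FD FZ mulrDr -mulrA mulrCA ReD ReM -/u -/v.
have : e' <= u / (1 + `|v|) by rewrite (le_trans e'e2)// ge_min lexx orbT.
rewrite ler_pdivlMr// => h.
have hv : 0 <= e' * (`|v| + v).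
  by rewrite mulr_ge0// -lerBlDr sub0r -normrN ler_norm.
have [e'_eq0|e'_neq0] := eqVneq e' 0; first by rewrite e'_eq0 mul0r addr0.
have e'_gt0 : 0 < e' by rewrite lt_neqAle eq_sym e'_neq0.
nra.
Qed.

Lemma good_half K w i : good K -> good (K `&` half w i).
Proof.
move=> gK; have [Kc Ko] := gK; split=> [x y t [Kx /= Fx] [Ky /= Fy] t01|p q z Kp [Kq _]]; last exact: half_open.
split; first exact: Kc.
rewrite /half/= FP FZ mulrDr !(mulrCA w) ReD !ReM.
move: t01 => /andP[t0 t1].
have [->|tn0] := eqVneq t 0; first by rewrite subr0 mul1r mul0r addr0.
rewrite ltr_wpDl ?mulr_ge0 ?subr_ge0//; [exact: ltW|by rewrite mulr_gt0// lt_neqAle eq_sym tn0].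
Qed.

Definition nonempty01 (K : set X) : int := (`[< K !=set0 >] : nat)%:Z.

(** Deletion-restriction for the Euler characteristic of [K] minus the hyperplanes in [s]; a convex
    set counts 1 unless it is empty. *)
Fixpoint chi (K : set X) (s : seq 'I_r) : int :=
  if s is i :: s' then chi K s' - chi (K `&` hyperplane F i) s' else nonempty01 K.

Lemma nonempty011 K x : K x -> nonempty01 K = 1.
Proof. by move=> Kx; rewrite /nonempty01 asboolT//; exists x. Qed.

Lemma nonempty010 K : (forall x, ~ K x) -> nonempty01 K = 0.
Proof. by move=> nK; rewrite /nonempty01 asboolF// => -[x /nK]. Qed.

Lemma nonempty01P (K : set X) : (exists2 x, K x & nonempty01 K = 1) \/ ((forall x, ~ K x) /\ nonempty01 K = 0).
Proof.
have [[x Kx]|nK] := pselect (K !=set0).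
  by left; exists x => //; exact: nonempty011 Kx.
right; have nK' x : ~ K x by move=> Kx; apply: nK; exists x.
by split=> //; exact: nonempty010.
Qed.

(* For a real functional with no zero on a convex set, exactly one sign occurs. *)
Lemma nonempty_sign (K : set X) w i :
  (forall x y (t : R), K x -> K y -> 0 <= t <= 1 -> K ((1 - t)%:C *: x + t%:C *: y)) -> K !=set0 -> (forall x, K x -> Re (w * F i x) != 0) ->
  nonempty01 (K `&` half w i) + nonempty01 (K `&` half (- w) i) = 1.
Proof.
move=> Kc [x Kx] nz.
have halfN y : half (- w) i y <-> Re (w * F i y) < 0.
  by rewrite /half/= mulNr -oppr_gt0; case: (w * _) => a b /=.
have [[a [Ka /= ua]]|[nh e1]] := nonempty01P (K `&` half w i); last first.
  rewrite e1 add0r; apply: (@nonempty011 _ x); split=> //; apply/halfN.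
  rewrite lt_neqAle nz//= leNgt; apply/negP => h.
  by apply: (nh x).
move=> ->; rewrite nonempty010 ?addr0// => b [Kb /halfN hb].
rewrite /half/= in ua.
set u := Re (w * F i a) in ua; set v := Re (w * F i b) in hb.
pose t := u / (u - v).
have uv : 0 < u - v by rewrite subr_gt0 (lt_trans hb).
have t01 : 0 <= t <= 1.
  apply/andP; split; first by apply: divr_ge0; exact: ltW.
  by rewrite ler_pdivrMr// mul1r lerDl oppr_ge0 ltW.
have := nz _ (Kc _ _ _ Ka Kb t01).
rewrite FP FZ mulrDr !(mulrCA w) ReD !ReM -/u -/v => /eqP; apply.
by rewrite /t; field; rewrite gt_eqF.
Qed.

(** [F i] is not constant on [K], so openness in complex directions lets its value leave [F i p] in
    any direction, in particular to both sides of the real hyperplane. *)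
Lemma nonempty_sign0 K w i p q : good K -> K p -> Re (w * F i p) = 0 ->
  K q -> F i p != F i q -> w != 0 ->
  nonempty01 (K `&` half w i) + nonempty01 (K `&` half (- w) i) = 2.
Proof.
move=> [Kc Ko] Kp up Kq uq w0.
have nz : F i q - F i p != 0 by rewrite subr_eq0 eq_sym.
have halfs c : (c = 1 \/ c = -1) -> K `&` half (c * w) i !=set0.
  (* This direction makes [c * w * F i] grow by exactly the step length [e], since [c ^+ 2 = 1]. *)
  move=> c1; have [e e0 He] := Ko p q (c / w / (F i q - F i p)) Kp Kq.
  exists (p + (e%:C * (c / w / (F i q - F i p))) *: (q - p)).
  split; first by apply: He; rewrite lexx ltW.
  rewrite /half/= FD FZ FB mulrDr ReD -[e%:C * _ * _]mulrA divfK//.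
  rewrite (_ : c * w * (e%:C * (c / w)) = e%:C); last first.
    by case: c1 => ->; field.
  by case: c1 => ->; rewrite ?mul1r ?mulN1r ?mulNr; move: up e0; case: (w * _) => a b /= -> e0; rewrite ?oppr0 add0r.
have [x hx] := halfs 1 (or_introl erefl); have [y hy] := halfs (-1) (or_intror erefl).
rewrite mul1r in hx; rewrite mulN1r in hy.
by rewrite (nonempty011 hx) (nonempty011 hy).
Qed.


Local Notation ii := (0 +i* 1 : C).

Lemma Re_units (z : C) : [/\ Re (1 * z) = Re z, Re (- 1 * z) = - Re z,
  Re (- ii * z) = Im z & Re (- - ii * z) = - Im z].
Proof. by case: z => a b; split; simpc. Qed.

(** Inclusion-exclusion for the cover of [K] minus a hyperplane by the parts where the real,
    respectively the imaginary, part of [F i] is nonzero; the overlap consists of four quadrants. *)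
Lemma chi_quad_nil K i : good K ->
  nonempty01 (K `&` half 1 i) + nonempty01 (K `&` half (- 1) i)
  + (nonempty01 (K `&` half (- ii) i) + nonempty01 (K `&` half (- - ii) i))
  - (nonempty01 (K `&` half 1 i `&` half (- ii) i)
     + nonempty01 (K `&` half 1 i `&` half (- - ii) i)
     + (nonempty01 (K `&` half (- 1) i `&` half (- ii) i)
     + nonempty01 (K `&` half (- 1) i `&` half (- - ii) i)))
  = nonempty01 K - nonempty01 (K `&` hyperplane F i).
Proof.
move=> gK; have [Kc Ko] := gK.
have [[x0 Kx0 ->]|[K0 e0]] := nonempty01P K; last first.
  by rewrite !nonempty010 // => x; case=> [] //; try case; move=> /K0.
(* If [K] meets the hyperplane, then either [F i] vanishes on [K] and all pieces are empty, or it
   takes small values in every direction and all eight are nonempty; both give 0. *)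
have [[p [Kp /= Fp] ->]|[K0 ->]] := nonempty01P (K `&` hyperplane F i).
  have [[q Kq Fq]|F0] := pselect (exists2 q, K q & F i q != 0); last first.
    have {}F0 x : K x -> F i x = 0.
      by move=> Kx; apply/eqP; apply: contrapT => /negP h; apply: F0; exists x.
    have nh w x : K x -> ~ half w i x by move=> /F0 e; rewrite /half/= e mulr0 ltxx.
    by rewrite !nonempty010 // => x; [case=> [[/nh h _ /h]]|case=> [[/nh h _ /h]]|case=> [[/nh h _ /h]]|case=> [[/nh h _ /h]]|case=> /nh h /h|case=> /nh h /h|case=> /nh h /h|case=> /nh h /h].
  have hit c : exists2 e : R, 0 < e & exists2 x, K x & F i x = e%:C * c.
    have [e e_gt0 He] := Ko p q (c / F i q) Kp Kq.
    exists e => //; exists (p + (e%:C * (c / F i q)) *: (q - p)).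
      by apply: He; rewrite lexx ltW.
    by rewrite FD FZ FB Fp subr0 add0r -mulrA divfK.
  have hw w c : 0 < Re (w * c) -> forall e x, 0 < e -> F i x = e%:C * c -> half w i x.
    by move=> wc e x e_gt0 Fx; rewrite /half/= Fx mulrCA ReM mulr_gt0.
  have one w c : 0 < Re (w * c) -> nonempty01 (K `&` half w i) = 1.
    move=> wc; have [e e_gt0 [x Kx Fx]] := hit c.
    by apply: (@nonempty011 _ x); split=> //; exact: hw wc e x e_gt0 Fx.
  have two w w' c : 0 < Re (w * c) -> 0 < Re (w' * c) ->
      nonempty01 (K `&` half w i `&` half w' i) = 1.
    move=> wc wc'; have [e e_gt0 [x Kx Fx]] := hit c.
    apply: (@nonempty011 _ x); split; first by split=> //; exact: hw wc e x e_gt0 Fx.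
    exact: hw wc' e x e_gt0 Fx.
  rewrite (one 1 1) ?(one (- 1) (- 1)) ?(one (- ii) ii) ?(one (- - ii) (- ii))
    ?(two 1 (- ii) (1 +i* 1)) ?(two 1 (- - ii) (1 +i* -1))
    ?(two (- 1) (- ii) ((-1) +i* 1)) ?(two (- 1) (- - ii) ((-1) +i* -1))//;
    by simpc => /=; lra.
have {K0} F0 x : K x -> F i x != 0.
  by move=> Kx; apply/eqP => Fx; apply: (K0 x).
rewrite subr0.
have [[q Kq Fq]|Fc] := pselect (exists2 q, K q & F i q != F i x0); last first.
  have {}Fc x : K x -> F i x = F i x0.
    by move=> Kx; apply/eqP; apply: contrapT => /negP h; apply: Fc; exists x.
  have one w : nonempty01 (K `&` half w i) = ((0 < Re (w * F i x0))%R : nat)%:Z.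
    case: ltP => h; first by apply: (@nonempty011 _ x0).
    by apply: nonempty010 => x [/Fc e]; rewrite /half/= e ltNge h.
  have two w w' : nonempty01 (K `&` half w i `&` half w' i) =
      (((0 < Re (w * F i x0)) && (0 < Re (w' * F i x0)))%R : nat)%:Z.
    case: ltP => h /=; last first.
      by apply: nonempty010 => x [[/Fc e]]; rewrite /half/= e ltNge h.
    case: ltP => h' /=; first by apply: (@nonempty011 _ x0).
    by apply: nonempty010 => x [[/Fc e]] _; rewrite /half/= e ltNge h'.
  rewrite !one !two; have := F0 _ Kx0; case: (F i x0) => a b; rewrite eq_complex => ab.
  rewrite /= in ab.
  have reE := Re_units (a +i* b).
  case: reE => -> -> -> ->; rewrite !oppr_gt0.
  by move: ab; case: (ltgtP a 0) => //=; case: (ltgtP b 0).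
(* Remaining case: [F i] is nonconstant without zeros. The two signs of a real functional then count
   1, plus 1 if it has a zero; the zeros of the imaginary part split according to the sign of the
   real part. *)
pose zer (K' : set X) w := K' `&` [set x | Re (w * F i x) = 0].
have split_sign K' w : good K' -> w != 0 ->
    (forall x, K' x -> exists2 y, K' y & F i x != F i y) ->
    nonempty01 (K' `&` half w i) + nonempty01 (K' `&` half (- w) i) =
    nonempty01 K' + nonempty01 (zer K' w).
  move=> gK' w0 nc; have [[x Kx ->]|[K'0 ->]] := nonempty01P K'; last first.
    by rewrite !nonempty010// => x [/K'0].
  have [[p [Kp /= Fp] ->]|[nz ->]] := nonempty01P (zer K' w).
    by have [y Ky pq] := nc _ Kp; rewrite (nonempty_sign0 gK' Kp Fp Ky pq w0).
  rewrite addr0 nonempty_sign//; [exact: gK'.1|by exists x|].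
  by move=> y Ky; apply/eqP => Fy; apply: (nz y).
have ncK x : K x -> exists2 y, K y & F i x != F i y.
  move=> Kx; have [e|ne] := eqVneq (F i x) (F i x0); last by exists x0.
  by exists q => //; rewrite e eq_sym.
have nch w x : (K `&` half w i) x -> exists2 y, (K `&` half w i) y & F i x != F i y.
  move=> hx; have [y Ky xy] := ncK x hx.1.
  have [e e_gt0 He] := half_open 1 gK hx Ky.
  exists (x + (e%:C * 1) *: (y - x)); first by apply: He; rewrite lexx ltW.
  rewrite FD FZ FB mulr1 -subr_eq0 opprD addrA subrr sub0r oppr_eq0 mulf_neq0//.
    by rewrite eq_complex /= eqxx andbT gt_eqF.
  by rewrite subr_eq0 eq_sym.
have i0 : - ii != 0 :> C by rewrite oppr_eq0 eq_complex /= oner_eq0 andbF.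
rewrite (split_sign _ _ gK i0 ncK) (split_sign _ _ (good_half 1 i gK) i0 (nch 1)).
rewrite (split_sign _ _ (good_half (-1) i gK) i0 (nch (-1))).
have zc : zer K (- ii) = zer K (- ii) by [].
have -> : nonempty01 (zer K (- ii)) =
    nonempty01 (zer (K `&` half 1 i) (- ii)) + nonempty01 (zer (K `&` half (-1) i) (- ii)).
  rewrite /zer [_ `&` half 1 i `&` _]setIAC [_ `&` half (-1) i `&` _]setIAC -/(zer K _).
  have [[x Zx ->]|[Z0 ->]] := nonempty01P (zer K (- ii)); last first.
    by rewrite !nonempty010// => x [/Z0].
  rewrite nonempty_sign//; last 2 first.
  - by exists x.
  - move=> y [Ky /= Fy]; apply: contra_neq (F0 _ Ky) => Ry.
    by move: Fy Ry; case: (F i y) => a b; simpc => /= -> ->.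
  move=> y z t [Ky /= Fy] [Kz /= Fz] t01; split; first exact: Kc.
  by rewrite /= FP FZ mulrDr !(mulrCA (- ii)) ReD !ReM Fy Fz !mulr0 addr0.
by rewrite (nonempty011 Kx0); ring.
Qed.

Lemma chi_quad K i s : good K ->
  chi (K `&` half 1 i) s + chi (K `&` half (- 1) i) s
  + (chi (K `&` half (- ii) i) s + chi (K `&` half (- - ii) i) s)
  - (chi (K `&` half 1 i `&` half (- ii) i) s
     + chi (K `&` half 1 i `&` half (- - ii) i) s
     + (chi (K `&` half (- 1) i `&` half (- ii) i) s
     + chi (K `&` half (- 1) i `&` half (- - ii) i) s))
  = chi K s - chi (K `&` hyperplane F i) s.
Proof.
elim: s K => [|j s IH] K gK /=; first exact: chi_quad_nil.
have := IH _ gK; have := IH _ (good_hyperplane j gK).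
have e1 w : K `&` half w i `&` hyperplane F j = K `&` hyperplane F j `&` half w i.
  exact: setIAC.
have e2 w w' : K `&` half w i `&` half w' i `&` hyperplane F j =
    K `&` hyperplane F j `&` half w i `&` half w' i by rewrite setIAC e1.
rewrite !e2 !e1 [K `&` hyperplane F i `&` _]setIAC; lra.
Qed.

Section Topology.
Variables (Y : set X) (L : local_system R Y).

Lemma F_continuous i : continuous (fun x : X => F i x : C).
Proof.
pose g (s : seq 'I_n) (x : X) : C := \sum_(j <- s) x 0 j * F i (delta_mx 0 j).
have gc s : continuous (g s).
  elim: s => [|j s IH].
    by rewrite (_ : g [::] = cst 0); [exact: cst_continuous|apply: funext => x; exact: big_nil].
  rewrite (_ : g (j :: s) = fun x => x 0 j * F i (delta_mx 0 j) + g s x); last first.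
    by apply: funext => x; exact: big_cons.
  by apply: caddc => //; apply: cmulc; [exact: xcoordc|exact: cst_continuous].
rewrite (_ : (fun x : X => F i x : C) = g (index_enum _))//.
apply: funext => x; rewrite {1}[x]matrix_sum_delta big_ord1 linear_sum.
by apply: eq_bigr => j _; exact: FZ.
Qed.

Definition part (A : set X) : set Y := [set y | A (val y)].

Lemma open_half w i : open (part (half w i)).
Proof.
have hc : continuous (fun y : Y => Re (w * F i (val y)) : R).
  apply: (comp_continuous _ (@Re_continuous R)); apply: cmulc; first exact: cst_continuous.
  exact: (comp_continuous (@val_continuous _ Y) (@F_continuous i)).
rewrite (_ : part _ = (fun y : Y => Re (w * F i (val y))) @^-1` [set x | 0 < x]) //.
by apply: open_comp => //; exact: open_gt.
Qed.

Definition off (s : seq 'I_r) : set X := [set x | forall i, i \in s -> F i x != 0].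

Lemma convex_contractible_map (K : set X) (y0 : X) :
  good K -> K y0 -> K `<=` Y ->
  exists (a0 : part K) (h : continuousType (part K * I)%type Y),
  [/\ forall x, h (x, @I0 R) = val x, forall x, h (x, @I1 R) = val a0 & forall p, part K (h p)].
Proof.
move=> [Kc _] Ky0 KY.
have a0Y : part K (mksub (KY _ Ky0)) by [].
pose H (p : part K * I) : X :=
  (1 - val p.2)%:C *: val (val p.1) + (val p.2)%:C *: y0.
have HK p : K (H p) by apply: Kc; rewrite ?unitP//; exact: (sub_in p.1).
have RC : continuous (fun a : R => a%:C : C).
  by apply/cplx_continuousP; split; [move=> a; exact: cvg_id|exact: cst_continuous].
have c2 : continuous (fun p : part K * I => val p.2 : R).
  by apply: (@comp_continuous _ _ _ snd (fun s : I => val s : R)); [move=> p; exact: cvg_snd|exact: uvalc].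
have c1 : continuous (fun p : part K * I => val (val p.1) : X).
  apply: (@comp_continuous _ _ _ fst (fun y : part K => val (val y) : X)).
    by move=> p; exact: cvg_fst.
  exact: (comp_continuous (@val_continuous _ (part K)) (@val_continuous _ Y)).
have Hc : continuous H.
  apply: xaddc; apply: xscalec; [|exact: c1|exact: (comp_continuous c2 RC)|exact: cst_continuous].
  by apply: (comp_continuous _ RC); apply: rsub => //; exact: cst_continuous.
have hc : continuous (fun p : part K * I => mksub (KY _ (HK p)) : Y).
  by apply: subtype_continuous; exact: Hc.
exists (mksub a0Y), (cmap hc); split=> [x|x|p] //; last exact: HK.
  by apply: val_inj; rewrite /= /H/= subr0 scale1r scale0r addr0.
by apply: val_inj; rewrite /= /H/= subrr scale1r scale0r add0r.
Qed.

(** Induction on the hyperplanes: Mayer-Vietoris for the four half spaces of the first one, with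
    [chi_quad] doing the bookkeeping. The base case is a contractible convex set, so the answer does
    not involve [L]. *)
Lemma eulerS_chi (K : set X) s : good K -> K `&` off s `<=` Y ->
  eulerS L (part (K `&` off s)) (chi K s).
Proof.
elim: s K => [|i s IH] K gK KY.
  have KY' : K `<=` Y by move=> x Kx; apply: KY.
  rewrite (_ : part _ = part K); last first.
    by apply/seteqP; split=> y; [case|move=> Ky; split].
  rewrite /=; have [[x Kx ->]|[K0 ->]] := nonempty01P K; last first.
    by rewrite (_ : part K = set0); [exact: eulerS0|apply/seteqP; split=> y // /K0].
  have [a0 [h [h0 h1 hK]]] := convex_contractible_map gK Kx KY'.
  exact: eulerS_contractible h0 h1 hK.
rewrite /= -chi_quad//.
have sub_piece A : K `&` A `<=` [set x | F i x != 0] -> K `&` A `&` off s `<=` Y.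
  move=> Ai x [KAx sx]; apply: KY; split; first exact: KAx.1.
  by move=> j; rewrite inE => /predU1P[->|/sx]; [exact: (Ai _ KAx)|].
have half_nz w x : half w i x -> F i x != 0.
  by rewrite /half/=; apply: contraTneq => ->; rewrite mulr0 ltxx.
have piece w : eulerS L (part (K `&` half w i `&` off s)) (chi (K `&` half w i) s).
  by apply: IH; [exact: good_half|apply: sub_piece => x [_ /half_nz]].
have piece2 w w' : eulerS L (part (K `&` half w i `&` half w' i `&` off s))
    (chi (K `&` half w i `&` half w' i) s).
  apply: IH; first by do 2!apply: good_half.
  by rewrite -[K `&` half w i `&` _]setIA; apply: sub_piece => x [_ [/half_nz]].
have halfN w x : half (- w) i x <-> Re (w * F i x) < 0.
  by rewrite /half/= mulNr -oppr_gt0; case: (w * _) => a b /=.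
(* The pieces on both sides of a real hyperplane are disjoint. *)
have two_sides (A : set X) w e1 e2 :
    eulerS L (part (A `&` half w i)) e1 -> eulerS L (part (A `&` half (- w) i)) e2 ->
    eulerS L (part (A `&` (half w i `|` half (- w) i))) (e1 + e2).
  move=> E1 E2; rewrite -[e1 + e2]subr0.
  apply: (@eulerS_cover _ _ _ _ (part (half w i)) (part (half (- w) i))).
  - exact: open_half.
  - exact: open_half.
  - by move=> y [].
  - rewrite (_ : _ `&` _ = part (A `&` half w i))//.
    by apply/seteqP; split=> y [h1 h2]; [case: h1|split=> //; split=> //; left].
  - rewrite (_ : _ `&` _ = part (A `&` half (- w) i))//.
    by apply/seteqP; split=> y [h1 h2]; [case: h1|split=> //; split=> //; right].
  rewrite (_ : _ `&` _ = set0); first exact: eulerS0.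
  apply/seteqP; split=> y // [_ [h /halfN]].
  by move: h; rewrite /part/= /half/= => h /(lt_trans h); rewrite ltxx.
pose B := K `&` off s.
have swap A : K `&` A `&` off s = B `&` A by rewrite /B setIAC.
have swap2 A A' : K `&` A `&` A' `&` off s = B `&` A `&` A' by rewrite /B -!setIA; congr (_ `&` _); rewrite setIA setIC.

have E1 : eulerS L (part (B `&` (half 1 i `|` half (- 1) i)))
    (chi (K `&` half 1 i) s + chi (K `&` half (- 1) i) s).
  by apply: two_sides; rewrite -swap; exact: piece.
have E2 : eulerS L (part (B `&` (half (- ii) i `|` half (- - ii) i)))
    (chi (K `&` half (- ii) i) s + chi (K `&` half (- - ii) i) s).
  by apply: two_sides; rewrite -swap; exact: piece.
have E3 : eulerS L (part (B `&` (half (- ii) i `|` half (- - ii) i) `&` (half 1 i `|` half (- 1) i)))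
    (chi (K `&` half 1 i `&` half (- ii) i) s
     + chi (K `&` half 1 i `&` half (- - ii) i) s
     + (chi (K `&` half (- 1) i `&` half (- ii) i) s
     + chi (K `&` half (- 1) i `&` half (- - ii) i) s)).
  by apply: (two_sides); rewrite setIAC; apply: (two_sides); rewrite -swap2; exact: piece2.
have oU w w' : open (part (half w i `|` half w' i)).
  by apply: openU; exact: open_half.
have nz x : F i x != 0 -> (half 1 i `|` half (- 1) i) x \/ (half (- ii) i `|` half (- - ii) i) x.
  rewrite -[X in _ -> X]/(((0 < Re (1 * F i x)) \/ (0 < Re (- 1 * F i x))) \/
    ((0 < Re (- ii * F i x)) \/ (0 < Re (- - ii * F i x)))).
  have [-> -> -> ->] := Re_units (F i x).
  case: (F i x) => a b; rewrite eq_complex /= !oppr_gt0.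
  case: (ltgtP a 0) => //= [h|h|_ bn0]; [by left; right|by left; left|right].
  by move: bn0; case: (ltgtP b 0) => // _; [right|left].
(* Outer cover: real part nonzero, or imaginary part nonzero. [E1], [E2] and [E3] give the two
   members and their overlap. *)
apply: (@eulerS_cover _ _ _ _ (part (half 1 i `|` half (- 1) i)) (part (half (- ii) i `|` half (- - ii) i))).
- exact: oU.
- exact: oU.
- by move=> y [_ /(_ i)]; rewrite inE eqxx => /(_ isT)/nz[]; [left|right].
- rewrite (_ : _ `&` _ = part (B `&` (half 1 i `|` half (- 1) i)))//.
  apply/seteqP; split=> y [[Ky sy] h]; split=> //; split=> // j.
    by move=> js; apply: sy; rewrite inE js orbT.
  by rewrite inE => /predU1P[->|/sy//]; case: h => /half_nz.
- rewrite (_ : _ `&` _ = part (B `&` (half (- ii) i `|` half (- - ii) i)))//.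
  apply/seteqP; split=> y [[Ky sy] h]; split=> //; split=> // j.
    by move=> js; apply: sy; rewrite inE js orbT.
  by rewrite inE => /predU1P[->|/sy//]; case: h => /half_nz.
rewrite (_ : _ `&` _ = part (B `&` (half (- ii) i `|` half (- - ii) i) `&` (half 1 i `|` half (- 1) i)))//.
apply/seteqP; split=> y.
  by move=> [[Ky sy] [h1 h2]]; split=> //; split=> //; split=> // j js; apply: sy; rewrite inE js orbT.
move=> [[[Ky sy] h2] h1]; split; last by split.
by split=> // j; rewrite inE => /predU1P[->|/sy//]; case: h1 => /half_nz.
Qed.

End Topology.

End ArrangementEuler.

(** * Rank functions of connected matroids *)

Section Matroid.
Variables (E : finType) (rk : {set E} -> nat).
Hypothesis rk_mono : forall A B : {set E}, A \subset B -> (rk A <= rk B)%N.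
Hypothesis rk_submod : forall A B : {set E},
  (rk (A :|: B) + rk (A :&: B) <= rk A + rk B)%N.
Hypothesis rk_step : forall x (A : {set E}), (rk (x |: A) <= (rk A).+1)%N.

Variable x : E.
Implicit Types (A B S T : {set E}) (s : seq E).

(** The recursion of [chi] for a matroid with the set [S] contracted. The base case is 1 when [x] is
    independent of [S] and 0 otherwise. *)
Fixpoint chiM S s : int :=
  if s is i :: s' then chiM S s' - chiM (i |: S) s'
  else (rk (x |: S))%:Z - (rk S)%:Z.

Definition span_seq s S : {set E} := [set z | (z \in s) || (z \in S)]%SET.

Lemma rk_eq (A B : {set E}) : A =i B -> rk A = rk B.
Proof. by move=> AB; congr rk; apply/finset.setP. Qed.

Lemma rk_le (A B : {set E}) : {subset A <= B} -> (rk A <= rk B)%N.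
Proof. by move=> AB; apply: rk_mono; apply/fintype.subsetP. Qed.

Lemma rk_submod' A B (U V : {set E}) : {subset U <= [predU A & B]} -> {subset V <= [predI A & B]} ->
  (rk U + rk V <= rk A + rk B)%N.
Proof.
move=> hU hV; apply: leq_trans (rk_submod A B); apply: leq_add; apply: rk_le => z.
  by move=> /hU; rewrite !inE.
by move=> /hV; rewrite !inE.
Qed.

(** By submodularity a loop over [S] is a loop over every larger set, so it never changes a rank. *)
Lemma chiM_loop i S s : rk (i |: S) = rk S -> chiM (i |: S) s = chiM S s.
Proof.
have up A B : {subset A <= B} -> rk (i |: A) = rk A -> rk (i |: B) = rk B.
  move=> AB e; apply/eqP; rewrite eqn_leq; apply/andP; split; last first.
    by apply: rk_le => z; rewrite !inE => ->; rewrite orbT.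
  have := @rk_submod' (i |: A) B (i |: B) A; rewrite e => h.
  have : (rk (i |: B) + rk A <= rk A + rk B)%N.
    apply: h => z; rewrite !inE; first by case/orP=> ->; rewrite ?orbT.
    by move=> zA; rewrite zA orbT AB.
  by lia.
elim: s S => [|j s IH] S e /=.
  have e1 := up _ (x |: S) _ e; rewrite e.
  rewrite -e1; last by move=> z zS; rewrite !inE zS orbT.
  by congr (Posz _ - _); apply: rk_eq => z; rewrite !inE orbCA.
rewrite IH//; congr (_ - _).
have -> : j |: (i |: S) = i |: (j |: S).
  by apply/finset.setP => z; rewrite !inE orbCA.
by apply: IH; apply: up e => z zS; rewrite !inE zS orbT.
Qed.

(** By submodularity a coloop adds exactly 1 to the rank of every smaller set, and the differences
    in the base case do not notice. *)
Lemma chiM_coloop i S s : rk (i |: (x |: span_seq s S)) = (rk (x |: span_seq s S)).+1 ->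
  chiM (i |: S) s = chiM S s.
Proof.
have down A B : {subset A <= B} -> rk (i |: B) = (rk B).+1 -> rk (i |: A) = (rk A).+1.
  move=> AB e; apply/eqP; rewrite eqn_leq rk_step/=.
  have := @rk_submod' (i |: A) B (i |: B) A; rewrite e => h.
  have : ((rk B).+1 + rk A <= rk (i |: A) + rk B)%N.
    apply: h => z; rewrite !inE; first by case/orP=> ->; rewrite ?orbT.
    by move=> zA; rewrite zA orbT AB.
  by lia.
elim: s S => [|j s IH] S e /=.
  rewrite (down S _ _ e); last by move=> z zS; rewrite !inE zS !orbT.
  have -> : x |: (i |: S) = i |: (x |: S) by apply/finset.setP => z; rewrite !inE orbCA.
  rewrite (down (x |: S) _ _ e); last by move=> z; rewrite !inE => /orP[->//|->]; rewrite ?orbT.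
  by lia.
rewrite IH; last first.
  by apply: down e => z; rewrite !inE => /or3P[->|->|->]; rewrite ?orbT.
congr (_ - _).
have -> : j |: (i |: S) = i |: (j |: S).
  by apply/finset.setP => z; rewrite !inE orbCA.
apply: IH; apply: down e => z; rewrite !inE.
by do ![case/orP] => ->; rewrite ?orbT.
Qed.

(** Two separations and two submodular inequalities bound four ranks by [2 * (m + k) + 1], while two
    connectivity inequalities demand at least [2 * (m + k) + 2]. *)
Lemma crossing_absurd (a b c d p np q nq m k : nat) :
  (a + b <= m + k -> c + d <= m + k.+1 -> nq + p <= a + c -> np + q <= b + d ->
  m + k < p + np -> m + k < q + nq -> False)%N.
Proof. lia. Qed.

(* The minor on [x] and the elements of [s], with [S] contracted, is connected. *)
Definition connectedM S s :=
  (rk S < rk (x |: S))%N /\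
  forall A, {subset A <= x :: s} -> (exists z, z \in A) -> (exists2 z, z \in x :: s & z \notin A) ->
    (rk (span_seq (x :: s) S) + rk S <
     rk (A :|: S) + rk (span_seq [seq z <- x :: s | z \notin A] S))%N.

Definition excess S s : nat := (rk (span_seq (x :: s) S) - rk S)%N.

(** Tutte's theorem that deleting or contracting an element keeps a matroid connected in at least
    one of the two cases. Separations of both minors would cross, and uncrossing them by
    submodularity contradicts connectedness. *)
Lemma connectedM_cons i S s : uniq (x :: i :: s) ->
  rk (i |: S) = (rk S).+1 ->
  rk (span_seq (x :: i :: s) S) = rk (span_seq (x :: s) S) ->
  connectedM S (i :: s) -> connectedM S s \/ connectedM (i |: S) s.
Proof.
move=> us hi hx [nl conn].
have [xs [xi [is_ us']]] : x \notin s /\ x != i /\ i \notin s /\ uniq s.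
  by move: us; rewrite /= inE negb_or => /andP[/andP[-> ->] /andP[-> ->]].
have [|nc1] := pselect (connectedM S s); first by left.
have [|nc2] := pselect (connectedM (i |: S) s); first by right.
exfalso.
have [A [sA [a aA] [b bs bA] hA]] : exists A, [/\ {subset A <= x :: s}, exists z, z \in A,
    exists2 z, z \in x :: s & z \notin A &
    (rk (A :|: S) + rk (span_seq [seq z <- x :: s | z \notin A] S) <=
      rk (span_seq (x :: s) S) + rk S)%N].
  apply: contrapT => nA; apply: nc1; split=> // A sA ne nf.
  by rewrite ltnNge; apply/negP => h; apply: nA; exists A.
have [D [sD [c cD] [d ds dD] hD]] : exists A, [/\ {subset A <= x :: s}, exists z, z \in A,
    exists2 z, z \in x :: s & z \notin A &
    (rk (A :|: (i |: S)) + rk (span_seq [seq z <- x :: s | z \notin A] (i |: S)) <=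
      rk (span_seq (x :: s) (i |: S)) + rk (i |: S))%N].
  (* If [x] becomes a loop in the contraction, the set of [x] alone is a separation. *)
  have [xl|xnl] := leqP (rk (x |: (i |: S))) (rk (i |: S)); last first.
    apply: contrapT => nA; apply: nc2; split=> // D sD ne nf.
    by rewrite ltnNge; apply/negP => h; apply: nA; exists D.
  exists [set z | z == x]%SET; split.
  - by move=> z; rewrite !inE => ->.
  - by exists x; rewrite inE.
  - exists (if a == x then b else a); first by case: eqP => // _; exact: sA.
    by rewrite inE; case: (eqVneq a x) => // ax; apply: contraNneq bA => ->; rewrite -ax.
  rewrite addnC leq_add//.
    by apply: rk_le => z; rewrite !inE mem_filter !inE => /orP[/andP[_ /orP[]->]|->]; rewrite ?orbT.
  by apply: leq_trans xl; apply: rk_le => z; rewrite !inE.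
pose U (P : pred E) : {set E} := [set z | ((z \in x :: i :: s) && P z) || (z \in S)]%SET.
have UU (P Q P' Q' : pred E) : (forall z, z \in x :: i :: s -> P' z -> P z || Q z) ->
    (forall z, z \in x :: i :: s -> Q' z -> P z && Q z) ->
    (rk (U P') + rk (U Q') <= rk (U P) + rk (U Q))%N.
  move=> h1 h2; apply: rk_submod' => z; rewrite !inE => /orP[/andP[zs h]|->]; rewrite ?orbT//.
    by move: (h1 z); rewrite !inE zs h => /(_ isT isT)/orP[]->; rewrite ?orbT.
  by move: (h2 z); rewrite !inE zs h => /(_ isT isT)/andP[-> ->].
have connU (P : pred E) : (exists2 z, z \in x :: i :: s & P z) ->
    (exists2 z, z \in x :: i :: s & ~~ P z) ->
    (rk (U predT) + rk S < rk (U P) + rk (U (predC P)))%N.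
  move=> [z zs Pz] [w ws nPw].
  have := conn [set z | (z \in x :: i :: s) && P z]%SET; rewrite (_ : span_seq (x :: i :: s) S = U predT); last first.
    by apply/finset.setP => v; rewrite !inE andbT.
  rewrite (_ : _ :|: S = U P); last by apply/finset.setP => v; rewrite !inE.
  rewrite (_ : span_seq _ S = U (predC P)); last first.
    by apply/finset.setP => v; rewrite inE mem_filter !inE; case: (v \in S); rewrite ?orbT// !orbF; case: (_ || _); rewrite ?andbT ?andbF.
  apply.
  - by move=> v; rewrite !inE => /andP[].
  - by exists z; rewrite inE zs.
  - by exists w; rewrite // inE ws.
have is' z : z \in x :: s -> z != i.
  by rewrite inE => /predU1P[->//|zs]; apply: contraNneq is_ => <-.
have sub z : z \in x :: s -> z \in x :: i :: s.
  by rewrite !inE => /orP[]->; rewrite ?orbT.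
(* [a'] and [b'] are the sides for the deletion, neither containing [i]; [c'] and [d'] are those for
   the contraction, both containing [i]. *)
pose a' z := z \in A. pose b' z := (z != i) && (z \notin A).
pose c' z := (z \in D) || (z == i). pose d' z := z \notin D.
have eA : rk (A :|: S) = rk (U a').
  by apply: rk_eq => z; rewrite !inE /a'; case zA: (z \in A); rewrite ?andbF//= andbT; move: (sub _ (sA _ zA)); rewrite !inE => ->.
have eB : rk (span_seq [seq z <- x :: s | z \notin A] S) = rk (U b').
  apply: rk_eq => z; rewrite /b' !inE mem_filter !inE.
  case: (eqVneq z i) => [->|zi] /=; last by case: (z \in A); rewrite ?andbF ?andbT.
  by rewrite eq_sym (negbTE xi) (negbTE is_) !andbF.
have eC : rk (D :|: (i |: S)) = rk (U c').
  apply: rk_eq => z; rewrite !inE /c'; case zD: (z \in D) => /=; rewrite ?andbT.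
    by move: (sub _ (sD _ zD)); rewrite !inE => ->.
  by case: (z == i); rewrite ?andbF ?orbT.
have eD : rk (span_seq [seq z <- x :: s | z \notin D] (i |: S)) = rk (U d').
  apply: rk_eq => z; rewrite /d' !inE mem_filter !inE.
  case: (eqVneq z i) => [->|zi] /=; last by case: (z \in D); rewrite ?andbF ?andbT.
  have -> : i \notin D by apply/negP => /sD/is'; rewrite eqxx.
  by rewrite !orbT.
have eX : rk (span_seq (x :: s) (i |: S)) = rk (U predT).
  by apply: rk_eq => z; rewrite !inE andbT; case: (z == x); case: (z == i); case: (z \in s); case: (z \in S).
have eX' : rk (span_seq (x :: s) S) = rk (U predT).
  by rewrite -hx; apply: rk_eq => z; rewrite !inE andbT.
rewrite eA eB eX' in hA; rewrite eC eD eX hi in hD.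
pose p z := a' z && c' z. pose q z := b' z && d' z.
(* Two opposite corners of the crossing cannot both be inhabited; [AD] treats the other pair. *)
have AC : ~ ((exists2 z, z \in x :: s & (z \in A) && (z \in D)) /\
             (exists2 z, z \in x :: s & (z \notin A) && (z \notin D))).
  move=> [[z zs /andP[zA zD]] [w ws /andP[wA wD]]].
  have zi := is' _ zs; have wi := is' _ ws.
  have h1 : (rk (U (predC q)) + rk (U p) <= rk (U a') + rk (U c'))%N.
    apply: UU => v vs; last by [].
    rewrite /q /b' /d' /a' /c' /= !negb_and !negbK.
    by case: (v == i); case: (v \in A); case: (v \in D).
  have h2 : (rk (U (predC p)) + rk (U q) <= rk (U b') + rk (U d'))%N.
    apply: UU => v vs; last by [].
    rewrite /p /b' /d' /a' /c' /= !negb_and !negb_or.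
    have := sA v; have := sD v.
    case: (eqVneq v i) => [->|_] sD' sA'; last by case: (v \in A); case: (v \in D).
    by rewrite /= andbF orbF => /negbTE iA; apply/negP => /sD/is'; rewrite eqxx.
  have h3 := connU p; have h4 := connU q.
  have {}h3 : (rk (U predT) + rk S < rk (U p) + rk (U (predC p)))%N.
    apply: h3; first by exists z; [exact: sub|rewrite /p /a' /c' zA zD].
    by exists w; [exact: sub|rewrite /p /a' /c' (negbTE wA)].
  have {}h4 : (rk (U predT) + rk S < rk (U q) + rk (U (predC q)))%N.
    apply: h4; first by exists w; [exact: sub|rewrite /q /b' /d' wi wA wD].
    by exists z; [exact: sub|rewrite /q /b' /d' zA andbF].
  exact: crossing_absurd hA hD h1 h2 h3 h4.
pose p2 z := a' z && d' z. pose q2 z := b' z && c' z.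
have AD : ~ ((exists2 z, z \in x :: s & (z \in A) && (z \notin D)) /\
             (exists2 z, z \in x :: s & (z \notin A) && (z \in D))).
  move=> [[z zs /andP[zA zD]] [w ws /andP[wA wD]]].
  have zi := is' _ zs; have wi := is' _ ws.
  have h1 : (rk (U (predC q2)) + rk (U p2) <= rk (U a') + rk (U d'))%N.
    apply: UU => v vs; last by [].
    rewrite /q2 /b' /d' /a' /c' /= !negb_and !negb_or !negbK.
    case: (eqVneq v i) => [->|_]; last by case: (v \in A); case: (v \in D).
    by move=> _; apply/orP; right; apply/negP => /sD/is'; rewrite eqxx.
  have h2 : (rk (U (predC p2)) + rk (U q2) <= rk (U b') + rk (U c'))%N.
    apply: UU => v vs; last by [].
    rewrite /p2 /b' /d' /a' /c' /= !negb_and !negbK.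
    by case: (v == i); case: (v \in A); case: (v \in D).
  have h3 := connU p2; have h4 := connU q2.
  have {}h3 : (rk (U predT) + rk S < rk (U p2) + rk (U (predC p2)))%N.
    apply: h3; first by exists z; [exact: sub|rewrite /p2 /a' /d' zA zD].
    by exists w; [exact: sub|rewrite /p2 /a' /d' (negbTE wA)].
  have {}h4 : (rk (U predT) + rk S < rk (U q2) + rk (U (predC q2)))%N.
    apply: h4; first by exists w; [exact: sub|rewrite /q2 /b' /c' wi wA wD].
    by exists z; [exact: sub|rewrite /q2 /b' /c' zA andbF].
  by rewrite addnC in hD; exact: crossing_absurd hA hD h1 h2 h3 h4.
(* All four sides are inhabited, which forces one of the two pairs of opposite corners to be
   inhabited. *)
have [aD|aD] := boolP (a \in D).
  have nBD : ~ (exists2 z, z \in x :: s & (z \notin A) && (z \notin D)).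
    by move=> h; apply: AC; split=> //; exists a; [exact: sA|rewrite aA].
  have bD : b \in D by apply/negPn/negP => h; apply: nBD; exists b; rewrite // bA.
  have dA : d \in A by apply/negPn/negP => h; apply: nBD; exists d; rewrite // h.
  by apply: AD; split; [exists d; rewrite // dA|exists b; rewrite // bA].
have nBC : ~ (exists2 z, z \in x :: s & (z \notin A) && (z \in D)).
  by move=> h; apply: AD; split=> //; exists a; [exact: sA|rewrite aA].
have bD : b \notin D by apply/negP => h; apply: nBC; exists b; rewrite // bA.
have cA : c \in A by apply/negPn/negP => h; apply: nBC; exists c; [exact: sD|rewrite h].
by apply: AC; split; [exists c; [exact: sD|rewrite cA]|exists b; rewrite // bA].
Qed.

(* This is the beta invariant of Crapo, up to sign. *)
Lemma chiM_sign S s : uniq (x :: s) ->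
  0 <= (-1) ^+ (excess S s).+1 * chiM S s /\ (connectedM S s -> chiM S s != 0).
Proof.
elim: s S => [|i s IH] S us /=.
  have -> : excess S [::] = (rk (x |: S) - rk S)%N.
    by congr (_ - _)%N; apply: rk_eq => z; rewrite !inE.
  have := rk_step x S; have : (rk S <= rk (x |: S))%N.
    by apply: rk_le => z; rewrite !inE => ->; rewrite orbT.
  move=> h1 h2; split; last by move=> [h _]; rewrite subr_eq0 eqz_nat gtn_eqF.
  have [e|e] : rk (x |: S) = rk S \/ rk (x |: S) = (rk S).+1 by lia.
    by rewrite e subrr mulr0.
  by rewrite e subSnn expr2; lia.
have us' : uniq (x :: s) by move: us; rewrite /= inE negb_or -andbA => /and4P[_ -> _ ->].
have Si : (rk S <= rk (i |: S))%N by apply: rk_le => z; rewrite !inE => ->; rewrite orbT.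
have Sx : (rk (span_seq (x :: s) S) <= rk (span_seq (x :: i :: s) S))%N.
  by apply: rk_le => z; rewrite !inE => /orP[/orP[]|]->; rewrite ?orbT.
have xE : rk (span_seq (x :: i :: s) S) = rk (i |: (x |: span_seq s S)).
  by apply: rk_eq => z; rewrite !inE -!orbA orbCA.
have xE' : rk (span_seq (x :: s) S) = rk (x |: span_seq s S).
  by apply: rk_eq => z; rewrite !inE -!orbA.
have is_ : i \notin x :: s.
  by move: us; rewrite /= inE negb_or => /andP[/andP[xi _] /andP[is_ _]]; rewrite inE negb_or eq_sym xi.
(* Connectedness tested on the set of [i] alone: it excludes that [i] is a loop or a coloop. *)
have only_i : (rk (span_seq (x :: i :: s) S) + rk S < rk (i |: S) + rk (span_seq (x :: s) S))%N \/
    ~ connectedM S (i :: s).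
  have [c|] := pselect (connectedM S (i :: s)); last by right.
  left; have [_ /(_ [set z | z == i]%SET)] := c.
  rewrite (_ : [set z | z == i]%SET :|: S = i |: S); last by apply/finset.setP => z; rewrite !inE.
  rewrite (_ : rk (span_seq [seq z <- x :: i :: s | _] S) = rk (span_seq (x :: s) S)); last first.
    apply: rk_eq => z; rewrite inE mem_filter !inE; congr (_ || _).
    have [->|_] := eqVneq z i => //=; rewrite ?andTb//.
    by move: is_; rewrite inE => /negbTE ->.
  apply; first by move=> z; rewrite !inE => ->; rewrite orbT.
    by exists i; rewrite inE.
  by exists x; rewrite !inE ?eqxx//; move: is_; rewrite inE negb_or eq_sym => /andP[].
have [e|nloop] := eqVneq (rk (i |: S)) (rk S).
  rewrite chiM_loop// subrr mulr0; split=> // c.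
  by case: only_i => // h; lia.
have hi : rk (i |: S) = (rk S).+1 by have := rk_step i S; move: nloop Si; lia.
have [e|ncoloop] := eqVneq (rk (span_seq (x :: i :: s) S)) (rk (span_seq (x :: s) S)).+1.
  rewrite chiM_coloop ?subrr ?mulr0; last by rewrite -xE -xE'.
  split=> // c; case: only_i => // h; lia.
have hx : rk (span_seq (x :: i :: s) S) = rk (span_seq (x :: s) S).
  have := rk_step i (x |: span_seq s S); rewrite -xE -xE'; move: ncoloop Sx; lia.
have [p1 n1] := IH S us'; have [p2 n2] := IH (i |: S) us'.
have ge1 : (rk (i |: S) <= rk (span_seq (x :: i :: s) S))%N.
  by apply: rk_le => z; rewrite !inE => /orP[]->; rewrite ?orbT.
have d1 : excess S (i :: s) = excess S s by rewrite /excess hx.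
have d2 : excess S (i :: s) = (excess (i |: S) s).+1.
  rewrite /excess (_ : rk (span_seq (x :: s) (i |: S)) = rk (span_seq (x :: i :: s) S)).
    by rewrite hi; move: ge1; rewrite hi; lia.
  by apply: rk_eq => z; rewrite !inE; case: (z == x); case: (z == i); case: (z \in s); case: (z \in S).
rewrite mulrBr {1}d1 {1}d2 [in X in _ - X]exprS mulN1r mulNr opprK.
split; first exact: addr_ge0.
move=> /(connectedM_cons us hi hx) cc.
(* Contraction lowers the excess by one, so the two terms enter with equal sign and cannot cancel;
   by [connectedM_cons] one of them is nonzero. *)
have key : 0 < (-1) ^+ (excess S s).+1 * chiM S s + (-1) ^+ (excess (i |: S) s).+1 * chiM (i |: S) s.
  case: cc => [/n1 h|/n2 h]; [apply: ltr_pwDl => //|apply: ltr_wpDl => //];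
    by rewrite lt_neqAle eq_sym mulf_neq0 // signr_eq0.
apply: contraTneq key => h.
have e : chiM S s = chiM (i |: S) s by apply/eqP; rewrite -subr_eq0 h.
have : excess S s = (excess (i |: S) s).+1 by rewrite -d1 d2.
by move=> ->; rewrite e exprS mulN1r mulNr addNr ltxx.
Qed.

End Matroid.

(** * Dense edges and inseparable sets of forms *)

Section PolynomialFunctions.
Variable K : numFieldType.

(** In characteristic zero there are more natural numbers than roots. *)
Lemma poly_nonroot (P : {poly K}) : P != 0 -> exists a : nat, P.[a%:R] != 0.
Proof.
move=> P0; apply: contrapT => nh.
have := @max_poly_roots _ P [seq i%:R | i <- iota 0 (size P)] P0.
rewrite size_map size_iota ltnn => h; apply: notF; apply: h.
  apply/allP => z /mapP[i _ ->]; rewrite rootE; apply/eqP; apply: contrapT => /eqP hi.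
  by apply: nh; exists i.
rewrite map_inj_uniq ?iota_uniq// => i j /eqP.
by rewrite eqr_nat => /eqP.
Qed.

Lemma base_inj (N n : nat) (a b : 'I_n -> nat) :
  (forall i, a i < N)%N -> (forall i, b i < N)%N ->
  (\sum_i a i * N ^ i = \sum_i b i * N ^ i)%N -> forall i, a i = b i.
Proof.
elim: n a b => [|n IH] a b aN bN; first by move=> _ [].
have shift (c : 'I_n.+1 -> nat) : (\sum_i c i * N ^ i =
    (\sum_(i < n) c (lift ord0 i) * N ^ i) * N + c ord0)%N.
  rewrite big_ord_recl muln1 addnC big_distrl/=; congr (_ + _)%N.
  by apply: eq_bigr => i _; rewrite /bump add1n expnSr mulnA.
rewrite !shift => e.
have N0 : (0 < N)%N by apply: leq_ltn_trans (aN ord0).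
have e0 : a ord0 = b ord0.
  by have := congr1 (modn^~ N) e; rewrite !modnMDl !modn_small.
have es : (\sum_(i < n) a (lift ord0 i) * N ^ i = \sum_(i < n) b (lift ord0 i) * N ^ i)%N.
  by have := congr1 (divn^~ N) e; rewrite !divnMDl// !divn_small// !addn0.
have {}IH := IH _ _ (fun i => aN (lift ord0 i)) (fun i => bN (lift ord0 i)) es.
by move=> i; case: (unliftP ord0 i) => [j|] ->.
Qed.

Section Line.
Variables (n : nat) (p : mpoly n K).

Lemma meval_line (a b : 'I_n -> K) :
  exists P : {poly K}, forall s, P.[s] = meval (fun j => a j + s * b j) p.
Proof.
exists (\sum_(e <- msupp p) (mcoeff e p)%:P * \prod_i ((a i)%:P + (b i)%:P * 'X) ^+ e i) => s.
rewrite mevalE horner_sum; apply: eq_bigr => e _.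
rewrite hornerM hornerC horner_prod; congr (_ * _); apply: eq_bigr => i _.
by rewrite horner_exp !hornerE mulrC.
Qed.

(* Kronecker substitution: variable [i] is replaced by the power [N ^ i] of a
   single one, [N] exceeding all exponents. *)
Lemma mpoly_eval_neq0 : p != 0 -> exists v, meval v p != 0.
Proof.
move=> p0.
pose N := (\max_(e <- msupp p) \max_(i < n) e i).+1.
have eN e i : e \in msupp p -> (e i < N)%N.
  move=> ep; rewrite ltnS (big_rem _ ep)/= leq_max; apply/orP; left.
  exact: (leq_bigmax (F := fun i => e i)).
pose key (e : multinom n) := (\sum_i e i * N ^ i)%N.
pose P : {poly K} := \sum_(e <- msupp p) mcoeff e p *: 'X^(key e).
have key_inj : {in msupp p &, injective key}.
  move=> e e' ep ep' ee; apply/mnmP.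
  by apply: (@base_inj N n e e') => // i; apply: eN.
have P0 : P != 0.
  have [e ep] : exists e, e \in msupp p.
    by exists (mlead p); exact: mlead_supp.
  apply/eqP => /polyP/(_ (key e)); rewrite coef0 coef_sum.
  rewrite (bigD1_seq e)//= ?msupp_uniq// coefZ coefXn eqxx mulr1 big_seq_cond big1 ?addr0.
    by move=> e0; move: ep; rewrite mcoeff_msupp e0 eqxx.
  move=> e' /andP[e'p e'e]; rewrite coefZ coefXn; case: eqP => [ee|]; last by rewrite mulr0.
  by move: e'e; rewrite (key_inj _ _ e'p ep) ?eqxx.
have [a Pa] := poly_nonroot P0.
exists (fun i => a%:R ^+ (N ^ i)); apply: contra_neq Pa => <-.
rewrite mevalE horner_sum; apply: eq_bigr => e _.
rewrite hornerZ hornerXn /key; congr (_ * _).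
rewrite expr_sum.
by apply: eq_bigr => i _; rewrite -exprM mulnC.
Qed.

End Line.

Lemma meval_constant n (p : mpoly n K) :
  (forall v w, meval v p = meval w p) -> exists c, p = mpolyC n c.
Proof.
move=> pc; exists (meval (fun=> 0) p); apply/eqP; rewrite -subr_eq0.
apply: contrapT => /negP/mpoly_eval_neq0[v]; rewrite mevalB mevalC.
by rewrite (pc v (fun=> 0)) subrr eqxx.
Qed.

End PolynomialFunctions.

Section OnlyIn.
Variables (R : realType).
Local Notation C := R[i].

Lemma only_in_meval m (A : {set 'I_m}) (p : mpoly m C) (v w : 'I_m -> C) :
  only_in A p -> (forall j, j \in A -> v j = w j) -> meval v p = meval w p.
Proof.
move=> pA vw; rewrite !mevalE; apply: eq_big_seq => e ep; congr (_ * _).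
apply: eq_bigr => j _; have [jA|jA] := boolP (j \in A); first by rewrite vw.
by rewrite (pA e j ep jA) !expr0.
Qed.

Lemma only_in_prod m (A : {set 'I_m}) (J : finType) (P : pred J) (q : J -> mpoly m C) :
  (forall j, P j -> only_in A (q j)) -> only_in A (\prod_(j | P j) q j).
Proof.
move=> qA; elim/big_ind: _ => [e j|p p' pA pA' e j|//].
  by rewrite msupp1 inE => /eqP ->; rewrite mnm0E.
move=> /msuppM_le/allpairsP[[e1 e2] [/= h1 h2 ->]] jA.
by rewrite mnmDE (pA e1)// (pA' e2).
Qed.

Lemma only_in_linear m (A : {set 'I_m}) (c : 'I_m -> C) :
  (forall j, j \notin A -> c j = 0) -> only_in A (\sum_j c j *: mpolyX _ (mnm1 j)).
Proof.
move=> cA e j ep jA; apply/eqP; apply: contraTT ep => ej.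
rewrite mcoeff_msupp negbK raddf_sum/= big1// => k _.
rewrite mcoeffZ mcoeffX; case: eqP => [ke|]; last by rewrite mulr0.
move: ej; rewrite -ke mnm1E; case: (eqVneq k j) => // kj _.
by rewrite kj cA ?mul0r.
Qed.

End OnlyIn.

(** * Ranks of sets of linear forms *)

Section Forms.
Variables (R : realType) (n r : nat).
Local Notation C := R[i].
Local Notation X := 'rV[C]_n.
Variable F : 'I_r -> {scalar X}.
Hypothesis F_neq0 : forall i, exists x, F i x != 0.
Implicit Types (S A B : {set 'I_r}).

Definition grad i : X := \row_j F i (delta_mx 0 j).

Lemma grad_mul i x : (grad i *m x^T) 0 0 = F i x.
Proof.
rewrite [in RHS](row_sum_delta x) linear_sum mxE; apply: eq_bigr => j _.
by rewrite !mxE FZ mulrC.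
Qed.

Lemma grad_kermx i x : (grad i <= kermx x^T)%MS <-> F i x = 0.
Proof.
split=> [/sub_kermxP e|e]; first by rewrite -grad_mul e mxE.
apply/sub_kermxP; apply/matrixP => a b.
by rewrite (ord1 a) (ord1 b) grad_mul e mxE.
Qed.

Definition spanF S : 'M[C]_n := (\sum_(i in S) <<grad i>>)%MS.
Definition rkF S : nat := \rank (spanF S).

Lemma spanF_le S m (V : 'M[C]_(m, n)) :
  (spanF S <= V)%MS <-> (forall i, i \in S -> (grad i <= V)%MS).
Proof.
split=> [/sumsmx_subP h i iS|h]; last by apply/sumsmx_subP => i iS; rewrite genmxE h.
by rewrite -(genmxE (grad i)) h.
Qed.

Lemma grad_spanF S i : i \in S -> (grad i <= spanF S)%MS.
Proof. by move: i; apply/spanF_le. Qed.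

Lemma spanF_sub S A : S \subset A -> (spanF S <= spanF A)%MS.
Proof.
by move=> /fintype.subsetP SA; apply/spanF_le => i /SA; exact: grad_spanF.
Qed.

Lemma spanFU A B : (spanF (A :|: B) == spanF A + spanF B)%MS.
Proof.
apply/andP; split.
  apply/spanF_le => i; rewrite !inE => /orP[]/grad_spanF h; apply: submx_trans h _.
    exact: addsmxSl.
  exact: addsmxSr.
by rewrite addsmx_sub !spanF_sub ?finset.subsetUl ?finset.subsetUr.
Qed.

Lemma rkF_mono A B : A \subset B -> (rkF A <= rkF B)%N.
Proof. by move=> AB; apply: mxrankS; exact: spanF_sub. Qed.

Lemma rkFU A B : rkF (A :|: B) = \rank (spanF A + spanF B)%MS.
Proof. exact/eqmx_rank/spanFU. Qed.

Lemma rkF_submod A B : (rkF (A :|: B) + rkF (A :&: B) <= rkF A + rkF B)%N.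
Proof.
rewrite rkFU -(mxrank_sum_cap (spanF A) (spanF B)) leq_add2l.
by apply: mxrankS; rewrite sub_capmx !spanF_sub ?finset.subsetIl ?finset.subsetIr.
Qed.

Lemma rkF_step i A : (rkF (i |: A) <= (rkF A).+1)%N.
Proof.
apply: (@leq_trans (\rank (grad i + spanF A)%MS)).
  apply: mxrankS; apply/spanF_le => j; rewrite !inE => /predU1P[->|/grad_spanF h].
    exact: addsmxSl.
  by apply: submx_trans h _; exact: addsmxSr.
apply: leq_trans (mxrank_adds_leqif _ _) _.
exact: (leq_add (rank_leq_row (grad i)) (leqnn _)).
Qed.

Lemma rkF0 : rkF finset.set0 = 0%N.
Proof. by rewrite /rkF /spanF big_set0 mxrank0. Qed.

(** The columns of the cokernel matrix of the span are common zeros of the forms in [S], and testing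
    a form on them detects membership in the span. *)
Lemma dualF S i : (grad i <= spanF S)%MS <->
  forall x, (forall j, j \in S -> F j x = 0) -> F i x = 0.
Proof.
split=> [h x Fx|h].
  apply/grad_kermx; apply: submx_trans h _; apply/spanF_le => j jS.
  by apply/grad_kermx; exact: Fx.
rewrite submxE; apply/eqP/matrixP => a k; rewrite (ord1 a) [RHS]mxE.
pose x : X := (col k (cokermx (spanF S)))^T.
have key j : F j x = (grad j *m cokermx (spanF S)) 0 k.
  rewrite -grad_mul trmxK [LHS]mxE [RHS]mxE; apply: eq_bigr => b _.
  by congr (_ * _); rewrite mxE.
rewrite -key; apply: h => j jS; rewrite key.
by have /eqP -> : grad j *m cokermx (spanF S) == 0; [rewrite -submxE grad_spanF|rewrite mxE].
Qed.

Lemma rkF_indep A B : (rkF A + rkF B <= rkF (A :|: B))%N -> (spanF A :&: spanF B = 0)%MS.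
Proof.
rewrite rkFU -(mxrank_sum_cap (spanF A) (spanF B)) -{2}[\rank (_ + _)%MS]addn0 leq_add2l leqn0.
by rewrite mxrank_eq0 => /eqP.
Qed.

(** Additive ranks make the two spans independent; the projection onto the first along the second
    acts on forms, and its transpose on points. *)
Lemma split_proj A B : (rkF A + rkF B <= rkF (A :|: B))%N ->
  exists P : 'M[C]_n, (forall i, i \in A -> forall x, F i (x *m P) = F i x) /\
    (forall i, i \in B -> forall x, F i (x *m P) = 0).
Proof.
move=> /rkF_indep dAB; exists (proj_mx (spanF A) (spanF B))^T; split=> i iS x.
  by rewrite -!grad_mul trmx_mul trmxK mulmxA proj_mx_id// grad_spanF.
by rewrite -!grad_mul trmx_mul trmxK mulmxA proj_mx_0// ?mul0mx ?mxE// grad_spanF.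
Qed.

(** Forms are treated one by one: the point is moved along a line on which none of the forms treated
    so far vanishes identically, to a parameter that is no root of their product. *)
Lemma forms_common_nonzero (W : set X) (s : seq 'I_r) : W 0 ->
  (forall (t : C) x y, W x -> W y -> W (x + t *: y)) ->
  (forall i, i \in s -> exists2 w, W w & F i w != 0) ->
  exists2 w, W w & forall i, i \in s -> F i w != 0.
Proof.
move=> W0 WL; elim: s => [|j s IH] H; first by exists 0.
have [|w Ww wF] := IH; first by move=> i js; apply: H; rewrite inE js orbT.
have [w' Ww' w'F] := H j (mem_head _ _).
pose P : {poly C} := \prod_(i <- j :: s) ((F i w)%:P + F i w' *: 'X).
have P0 : P != 0.
  rewrite prodf_seq_neq0; apply/allP => i; rewrite inE /= => ijs.
  apply/eqP => /polyP e; have := e 0%N; have := e 1%N.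
  rewrite !coef0 !coefD !coefC !coefZ !coefX/= !mulr1 !mulr0 addr0 add0r => e1 e0.
  case/predU1P: ijs => [ij|/wF]; last by rewrite e0 eqxx.
  by move: w'F; rewrite -ij e1 eqxx.
have [t tP] := poly_nonroot P0.
exists (w + t%:R *: w'); first exact: WL.
move=> i ijs; rewrite FD FZ; apply: contraNneq tP => e.
rewrite /P horner_prod (big_rem i)//=.
by rewrite !hornerE mulrC [_ * t%:R]mulrC e mulr0.
Qed.

Lemma generic_point : exists x, forall i, F i x != 0.
Proof.
have [|||x _ xF] := @forms_common_nonzero setT (enum 'I_r) => //.
  by move=> i _; have [x Fx] := F_neq0 i; exists x.
by exists x => i; apply: xF; rewrite mem_enum.
Qed.

(** The recursions agree, and so do the base cases: the affine set is nonempty precisely when [F i0]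
    is not in the span of the forms in [S]. *)
Lemma chi_chiM (i0 : 'I_r) S s :
  chi F [set x | F i0 x = 1 /\ forall j, j \in S -> F j x = 0] s = chiM rkF i0 S s.
Proof.
elim: s S => [|i s IH] S /=.
  have le := rkF_mono (finset.subsetUr [set i0]%SET S).
  have step := rkF_step i0 S.
  have [h|h] := boolP (grad i0 <= spanF S)%MS.
    rewrite nonempty010 => [|x [Fx /(iffLR (dualF S i0) h)]]; last first.
      by rewrite Fx => /eqP; rewrite oner_eq0.
    have -> : rkF (i0 |: S) = rkF S; last by rewrite subrr.
    apply/eqP; rewrite eqn_leq; apply/andP; split=> //.
    apply: mxrankS; apply/spanF_le => j; rewrite !inE => /predU1P[->//|]; exact: grad_spanF.
  have [x Fx xS] : exists2 x, F i0 x != 0 & forall j, j \in S -> F j x = 0.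
    apply: contrapT => nx; move/negP: h; apply; apply/dualF => x xS.
    by apply/eqP; apply: contrapT => /negP Fx; apply: nx; exists x.
  rewrite (@nonempty011 _ _ _ ((F i0 x)^-1 *: x)); last first.
    by split=> [|j jS]; [rewrite FZ mulVf|rewrite FZ (xS j jS); exact: mulr0].
  suff -> : rkF (i0 |: S) = (rkF S).+1 by lia.
  apply/eqP; rewrite eqn_leq step/= ltn_neqAle le andbT.
  apply: contraNneq h => e.
  have /eqmxP/eqmx_sym e' : (spanF S == spanF (i0 |: S))%MS.
    by rewrite -(geq_leqif (mxrank_leqif_eq (spanF_sub (finset.subsetUr [set i0]%SET S)))) -[X in (X <= _)%N]/(rkF (i0 |: S)) -e.
  by rewrite -e' grad_spanF// !inE eqxx.
rewrite IH; congr (_ - _); rewrite -IH; congr (chi F _ s); apply/seteqP; split=> x.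
  by move=> [[Fx xS] Fi]; split=> // j; rewrite !inE => /predU1P[->|/xS].
move=> [Fx xS]; split; last by apply: xS; rewrite !inE eqxx.
by split=> // j jS; apply: xS; rewrite !inE jS orbT.
Qed.

(** Ranks being subadditive, the inequality says that the spans of the two parts are independent: a
    direct sum of matroids. *)
Definition separable A := exists B : {set 'I_r},
  [/\ {subset B <= A}, exists i, i \in B, exists2 i, i \in A & i \notin B &
      (rkF B + rkF (A :\: B) <= rkF A)%N].

Definition above (W : {vspace X}) : {set 'I_r} := [set i | vanishes_on F i W]%SET.

Lemma aboveP (W : {vspace X}) i : reflect (forall w, w \in W -> F i w = 0) (i \in above W).
Proof. by rewrite inE; exact: asboolP. Qed.

Lemma edgeP (W : {vspace X}) x : edge F W -> (x \in W <-> forall i, i \in above W -> F i x = 0).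
Proof.
move=> [S [_ SW]]; split=> [xW i /aboveP|h]; first exact.
by apply/SW => i iS; apply: h; apply/aboveP => w /SW; exact.
Qed.

Lemma edge_neq0 (W : {vspace X}) : edge F W -> exists i, i \in above W.
Proof.
move=> [S [/set0Pn[i iS] SW]]; exists i; apply/aboveP => w /SW; exact.
Qed.

(** Bases of the two independent spans together are linear coordinates on the quotient by [W], and
    each form uses the coordinates of its own part. *)
Lemma separable_decomposable (W : {vspace X}) : edge F W -> separable (above W) -> decomposable F W.
Proof.
move=> eW [B [BA [i1 i1B] [i2 i2A i2B] rkB]].
set A := above W in BA i2A rkB; set D := A :\: B in rkB.
have AE : A = B :|: D.
  apply/finset.setP => i; rewrite finset.in_setU finset.in_setD.
  by case: (boolP (i \in B)) => //= /BA ->.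
have dBD : (spanF B :&: spanF D = 0)%MS by apply: rkF_indep; rewrite -AE.
pose b := rkF B; pose d := rkF D.
pose MB : 'M[C]_(b, n) := row_base (spanF B).
pose MD : 'M[C]_(d, n) := row_base (spanF D).
pose M := col_mx MB MD.
have freeM : row_free M.
  rewrite -row_leq_rank /M -addsmxE.
  rewrite (adds_eqmx (eq_row_base _) (eq_row_base _)).
  by rewrite -(mxrank_disjoint_sum dBD) ?leqnn.
have coordB i : i \in B -> exists u : 'rV[C]_b, grad i = u *m MB.
  by move=> iB; apply/submxP; rewrite eq_row_base grad_spanF.
have coordD i : i \in D -> exists u : 'rV[C]_d, grad i = u *m MD.
  by move=> iD; apply/submxP; rewrite eq_row_base grad_spanF.
pose y : {linear X -> 'rV[C]_(b + d)} := mulmxr M^T.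
have yE x : y x = row_mx (x *m MB^T) (x *m MD^T) by rewrite /= tr_col_mx mul_mx_row.
have [uB uBP] : exists u : 'I_r -> 'rV[C]_b, forall i, i \in B -> grad i = u i *m MB.
  have H i : exists u : 'rV[C]_b, i \in B -> grad i = u *m MB.
    by have [iB|_] := boolP (i \in B); [have [u] := coordB i iB; exists u|exists 0].
  by exists (fun i => projT1 (cid (H i))) => i; exact: (projT2 (cid (H i))).
have [uD uDP] : exists u : 'I_r -> 'rV[C]_d, forall i, i \in D -> grad i = u i *m MD.
  have H i : exists u : 'rV[C]_d, i \in D -> grad i = u *m MD.
    by have [iD|_] := boolP (i \in D); [have [u] := coordD i iD; exists u|exists 0].
  by exists (fun i => projT1 (cid (H i))) => i; exact: (projT2 (cid (H i))).
have FB_ i x : i \in B -> F i x = \sum_j uB i 0 j * y x 0 (lshift d j).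
  move=> iB; rewrite -grad_mul (uBP _ iB) -mulmxA mxE; apply: eq_bigr => j _.
  by rewrite yE row_mxEl -[x *m _]trmxK trmx_mul trmxK [in RHS]mxE.
have FD_ i x : i \in D -> F i x = \sum_j uD i 0 j * y x 0 (rshift b j).
  move=> iD; rewrite -grad_mul (uDP _ iD) -mulmxA mxE; apply: eq_bigr => j _.
  by rewrite yE row_mxEr -[x *m _]trmxK trmx_mul trmxK [in RHS]mxE.
exists (b + d)%N, y; split.
- move=> u; have /row_fullP[N NM] : row_full M^T by rewrite /row_full mxrank_tr.
  by exists (u *m N); rewrite /= -mulmxA NM mulmx1.
- move=> x; rewrite (edgeP x eW) -/A; split=> [yx i|Fx].
    rewrite AE inE => /orP[iB|iD]; [rewrite FB_|rewrite FD_] => //; rewrite big1// => j _;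
      by rewrite yx mxE mulr0.
  have kB : x *m MB^T = 0.
    rewrite -[LHS]trmxK trmx_mul trmxK; apply/eqP; rewrite trmx_eq0; apply/eqP.
    apply/sub_kermxP; rewrite eq_row_base; apply/spanF_le => i iB.
    by apply/grad_kermx/Fx; exact: BA.
  have kD : x *m MD^T = 0.
    rewrite -[LHS]trmxK trmx_mul trmxK; apply/eqP; rewrite trmx_eq0; apply/eqP.
    apply/sub_kermxP; rewrite eq_row_base; apply/spanF_le => i; rewrite inE => /andP[_ iA].
    by apply/grad_kermx/Fx.
  by rewrite yE kB kD row_mx0.
have splitl (j : 'I_b) : fintype.split (lshift d j) = inl j by exact: (unsplitK (inl j)).
have splitr (j : 'I_d) : fintype.split (rshift b j) = inr j by exact: (unsplitK (inr j)).
pose cB (i : 'I_r) (j : 'I_(b + d)) : C := if fintype.split j is inl j' then uB i 0 j' else 0.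
pose cD (i : 'I_r) (j : 'I_(b + d)) : C := if fintype.split j is inr j' then uD i 0 j' else 0.
pose lB i : mpoly (b + d) C := \sum_j cB i j *: mpolyX _ (mnm1 j).
pose lD i : mpoly (b + d) C := \sum_j cD i j *: mpolyX _ (mnm1 j).
have lBE i v : meval v (lB i) = \sum_j uB i 0 j * v (lshift d j).
  rewrite /lB raddf_sum/= big_split_ord/= [X in _ + X]big1 ?addr0 => [|j _].
    by apply: eq_bigr => j _; rewrite mevalZ mevalXU /cB splitl.
  by rewrite mevalZ /cB splitr mul0r.
have lDE i v : meval v (lD i) = \sum_j uD i 0 j * v (rshift b j).
  rewrite /lD raddf_sum/= big_split_ord/= [X in X + _]big1 ?add0r => [|j _].
    by apply: eq_bigr => j _; rewrite mevalZ mevalXU /cD splitr.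
  by rewrite mevalZ /cD splitl mul0r.
have [x0 x0F] := generic_point.
have nonc (J : {set 'I_r}) (l : 'I_r -> mpoly (b + d) C) i : i \in J ->
    (forall j, j \in J -> forall x, meval (fun k => y x 0 k) (l j) = F j x) ->
    nonconstant (\prod_(j in J) l j).
  move=> iJ lF c e.
  have ev x : meval (fun k => y x 0 k) (\prod_(j in J) l j) = \prod_(j in J) F j x.
    by rewrite rmorph_prod/=; apply: eq_bigr => j jJ; exact: lF.
  have := ev 0; have := ev x0; rewrite e !mevalC => -> /eqP.
  rewrite [X in _ == X](bigD1 i)//= linear0 mul0r; apply/negP.
  by apply/prodf_neq0 => j _.
pose AB : {set 'I_(b + d)} := [set j : 'I_(b + d) | if fintype.split j is inl _ then true else false]%SET.
exists AB, (\prod_(i in B) lB i), (\prod_(i in D) lD i); split.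
- by apply: (nonc _ _ i1) => // j jB x; rewrite lBE FB_.
- by apply: (nonc _ _ i2) => [|j jD x]; [rewrite inE i2B|rewrite lDE FD_].
- apply: only_in_prod => i _; apply: only_in_linear => j; rewrite inE /cB.
  by case: fintype.split.
- apply: only_in_prod => i _; apply: only_in_linear => j; rewrite !inE negbK /cD.
  by case: fintype.split.
move=> x; rewrite !rmorph_prod/= /edge_poly.
rewrite (eq_bigl [predU B & D]) => [|i]; last first.
  by rewrite inE -finset.in_setU -AE inE.
rewrite bigU/=; last first.
  by rewrite -setI_eq0; apply/eqP/finset.setP => i; rewrite !inE; case: (i \in B).
by congr (_ * _); apply: eq_bigr => i iJ; [rewrite lBE FB_|rewrite lDE FD_].
Qed.

(** Each linear factor of a product in disjoint variables depends on one group of variables only.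
    The factors are sorted accordingly, and neither class is empty because [p] and [q] are not
    constant. *)
Lemma decomposable_separable (W : {vspace X}) : edge F W -> decomposable F W -> separable (above W).
Proof.
move=> eW [m [y [ys yk [D [p [q [pn qn pD qD pq]]]]]]].
have [s sP] : exists s : 'rV[C]_m -> X, forall u, y (s u) = u.
  by exists (fun u => projT1 (cid (ys u))) => u; exact: (projT2 (cid (ys u))).
pose msk (E : {set 'I_m}) (u : 'rV[C]_m) : 'rV[C]_m := \row_j (if j \in E then u 0 j else 0).
pose l i u := F i (s u).
have lF i x : i \in above W -> F i x = l i (y x).
  move=> /aboveP h; apply/eqP; rewrite -subr_eq0 -FB; apply/eqP/h/yk.
  by rewrite linearB/= sP subrr.
have lD i (a : C) u v : i \in above W -> l i (u + a *: v) = l i u + a * l i v.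
  move=> iA; transitivity (F i (s u + a *: s v)); last by rewrite FD FZ.
  by rewrite [RHS]lF// linearD linearZ/= !sP.
have mskD u : u = msk D u + msk (~: D)%SET u.
  by apply/rowP => j; rewrite !mxE inE; case: (j \in D); rewrite ?addr0 ?add0r.
have pv (u v : 'rV[C]_m) : (forall j, j \in D -> u 0 j = v 0 j) ->
    meval (fun j => u 0 j) p = meval (fun j => v 0 j) p by exact: only_in_meval.
have qv (u v : 'rV[C]_m) : (forall j, j \notin D -> u 0 j = v 0 j) ->
    meval (fun j => u 0 j) q = meval (fun j => v 0 j) q.
  by move=> uv; apply: only_in_meval qD _ => j; rewrite inE => /uv.
have pqE u : \prod_(i in above W) l i u =
    meval (fun j => u 0 j) p * meval (fun j => u 0 j) q.
  rewrite -[u in RHS]sP -pq /edge_poly.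
  by apply: eq_bigl => i; rewrite inE.
have [x0 x0F] := generic_point.
pose u0 := y x0.
have pq0 : meval (fun j => u0 0 j) p * meval (fun j => u0 0 j) q != 0.
  by rewrite -pqE; apply/prodf_neq0 => i iA; rewrite -lF.
have one_side i : i \in above W ->
    (forall u, l i (msk D u) = 0) \/ (forall u, l i (msk (~: D)%SET u) = 0).
  (* If [l i] depended on both groups, some line [u0 + t a + (k - t) c] would lie in its zero set.
     Along it [p] and [q] restrict to polynomials in [t] that are nonzero, by their values at [0]
     and at [k]. *)
  move=> iA; apply: contrapT => /not_orP[/existsNP[u1 /eqP h1] /existsNP[w1 /eqP h2]].
  pose a := (l i (msk D u1))^-1 *: msk D u1.
  pose c := (l i (msk (~: D)%SET w1))^-1 *: msk (~: D)%SET w1.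
  have lZ b v : l i (b *: v) = b * l i v.
    have l0 : l i 0 = 0 by have := lD i (-1) 0 0 iA; rewrite scaler0 addr0 mulN1r subrr.
    by have := lD i b 0 v iA; rewrite !add0r l0 add0r.
  have la : l i a = 1 by rewrite lZ mulVf.
  have lc : l i c = 1 by rewrite lZ mulVf.
  pose k := - l i u0.
  have [P PE] := meval_line p (fun j => u0 0 j) (fun j => a 0 j).
  have [Q QE] := meval_line q (fun j => (u0 + k *: c) 0 j) (fun j => - c 0 j).
  have [P0 Q0] : P != 0 /\ Q != 0.
    move: pq0; rewrite mulf_eq0 negb_or => /andP[hp hq]; split.
      apply: contra_neq hp => P0; have := PE 0; rewrite P0 horner0 => ->.
      by apply: meval_eq => j; rewrite mul0r addr0.
    apply: contra_neq hq => Q0; have := QE k; rewrite Q0 horner0 => ->.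
    by apply: meval_eq => j; rewrite !mxE mulrN addrK.
  have [t] := poly_nonroot (mulf_neq0 P0 Q0).
  rewrite hornerM PE QE => /negP; apply; apply/eqP.
  pose u : 'rV[C]_m := u0 + t%:R *: a + (k - t%:R) *: c.
  have rowD (v w : 'rV[C]_m) j : (v + w) 0 j = v 0 j + w 0 j by rewrite mxE.
  have rowZ b (v : 'rV[C]_m) j : (b *: v) 0 j = b * v 0 j by rewrite mxE.
  have uE j : u 0 j = u0 0 j + t%:R * a 0 j + (k - t%:R) * c 0 j.
    by rewrite /u !rowD !rowZ.
  have aD j : j \notin D -> a 0 j = 0.
    by move=> jD; rewrite !mxE (negbTE jD) mulr0.
  have cD j : j \in D -> c 0 j = 0.
    by move=> jD; rewrite !mxE inE jD /= mulr0.
  transitivity (meval (fun j => u 0 j) p * meval (fun j => u 0 j) q).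
    congr (_ * _).
      apply: only_in_meval pD _ => j jD.
      by rewrite uE cD// mulr0 addr0.
    apply: only_in_meval qD _ => j; rewrite inE => jD.
    by rewrite uE aD// mulr0 addr0 rowD rowZ; ring.
  rewrite -pqE (bigD1 i)//= /u !lD// la lc !mulr1 /k.
  have -> : l i u0 + t%:R + (- l i u0 - t%:R) = 0 by ring.
  exact: mul0r.
pose B : {set 'I_r} := [set i in above W | `[< forall u, l i (msk (~: D)%SET u) = 0 >]]%SET.
have BP i : i \in B -> i \in above W /\ forall u, l i (msk (~: D)%SET u) = 0.
  by rewrite inE => /andP[iA /asboolP].
have nBP i : i \in above W -> i \notin B -> forall u, l i (msk D u) = 0.
  move=> iA; rewrite inE iA /= => /asboolPn nB.
  by have [|/nB] := one_side i iA.
have lsum i u : i \in above W -> l i u = l i (msk D u) + l i (msk (~: D)%SET u).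
  by move=> iA; rewrite {1}(mskD u) -{1}[msk (~: D)%SET u]scale1r lD// mul1r.
exists B; split.
- by move=> i /BP[].
(* Without factors in the variables of [D] the product ignores these variables, which makes [p]
   constant. *)
- apply: contrapT => nB; have {}nB i : i \notin B by apply/negP => iB; apply: nB; exists i.
  have [c pc] : exists c, p = mpolyC m c.
    apply: meval_constant => v w.
    suff pconst (v' : 'I_m -> C) : meval v' p = meval (fun j => u0 0 j) p by rewrite !pconst.
    pose z : 'rV[C]_m := msk D (\row_j v' j) + msk (~: D)%SET u0.
    have := pqE z; rewrite (_ : \prod_(i in _) _ = \prod_(i in above W) l i u0).
      rewrite pqE (qv z u0) => [|j jD]; last by rewrite !mxE inE jD (negbTE jD) add0r.
      move: pq0; rewrite mulf_eq0 negb_or => /andP[_ q0] /(mulIf q0) ->.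
      by apply: only_in_meval pD _ => j jD; rewrite !mxE inE jD addr0.
    apply: eq_bigr => i iA; rewrite lsum// [RHS]lsum// !nBP//; congr (_ + l i _).
    by apply/rowP => j; rewrite !mxE inE; case: (j \in D) => //=; rewrite add0r.
  exact: (pn c).
- apply: contrapT => nB.
  have {}nB i : i \in above W -> i \in B.
    by move=> iA; apply/negPn/negP => iB; apply: nB; exists i.
  have [c qc] : exists c, q = mpolyC m c.
    apply: meval_constant => v w.
    suff qconst (v' : 'I_m -> C) : meval v' q = meval (fun j => u0 0 j) q by rewrite !qconst.
    pose z : 'rV[C]_m := msk D u0 + msk (~: D)%SET (\row_j v' j).
    have := pqE z; rewrite (_ : \prod_(i in _) _ = \prod_(i in above W) l i u0).
      rewrite pqE (pv z u0) => [|j jD]; last by rewrite !mxE inE jD addr0.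
      move: pq0; rewrite mulf_eq0 negb_or => /andP[p0 _] /(mulfI p0) ->.
      by apply: only_in_meval qD _ => j; rewrite inE => jD; rewrite !mxE inE (negbTE jD) add0r.
    apply: eq_bigr => i iA; have [_ h] := BP _ (nB i iA); rewrite lsum// [RHS]lsum// !h; congr (l i _ + _).
    by apply/rowP => j; rewrite !mxE inE; case: (j \in D) => //=; rewrite addr0.
  exact: (qn c).
(* A form in both spans vanishes on either block of coordinates, hence everywhere. *)
have cap0 : (spanF B :&: spanF (above W :\: B) = 0)%MS.
  apply/eqP; rewrite -submx0; apply/rV_subP => v; rewrite sub_capmx => /andP[vB vD].
  have ker S (x : X) : (v <= spanF S)%MS -> (forall i, i \in S -> F i x = 0) -> v *m x^T = 0.
    move=> vS FS; apply/sub_kermxP; apply: submx_trans vS _; apply/spanF_le => i iS.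
    by apply/grad_kermx; exact: FS.
  suff vx (x : X) : v *m x^T = 0.
    rewrite submx0; apply/eqP/rowP => j.
    have /matrixP/(_ 0 0) := vx (delta_mx 0 j).
    by rewrite trmx_delta -colE !mxE.
  pose x1 := s (msk D (y x)); pose x2 := s (msk (~: D)%SET (y x)).
  have -> : v *m x^T = v *m x1^T + v *m (x - x1)^T by rewrite -mulmxDr -linearD/= addrC subrK.
  rewrite (ker (above W :\: B) x1)// ?add0r => [|i]; last first.
    by rewrite inE => /andP[iB iA]; rewrite lF// /x1 sP nBP.
  apply: (ker B) => // i /BP[iA iB].
  rewrite lF// linearB/= /x1 sP (_ : _ - _ = msk (~: D)%SET (y x)) ?iB//.
  by rewrite {1}[y x]mskD addrC addKr.
rewrite /rkF -(mxrank_disjoint_sum cap0); apply: mxrankS.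
rewrite addsmx_sub; apply/andP; split; apply: spanF_sub.
  by apply/fintype.subsetP => i iB; have [] := BP i iB.
by apply/fintype.subsetP => i; rewrite finset.in_setD => /andP[].
Qed.

End Forms.

(** * Monodromy along circles in complex lines *)

Section LoopFunctions.
Variables (R : realType) (X : topologicalType) (Y : set X) (L : local_system R Y).
Local Notation C := R[i].
Local Notation I := (@unit_interval R).

Lemma path_in_continuous (f : I -> X) (fY : forall s, Y (f s)) :
  continuous f -> continuous (fun s => mksub (fY s)).
Proof. by move=> fc; apply: subtype_continuous. Qed.

(* Transport along a path given by its values in the ambient space. *)
Definition lp (f : I -> X) : C :=
  match pselect (exists a : cpath R Y, forall s, val (a s) = f s) with
  | left H => L (projT1 (cid H))
  | right _ => 1
  end.

Lemma lpE (a : cpath R Y) (f : I -> X) : (forall s, val (a s) = f s) -> L a = lp f.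
Proof.
move=> af; rewrite /lp; case: pselect => [H|[]]; last by exists a.
apply: transport_ext => s; apply: val_inj.
by rewrite af (projT2 (cid H)).
Qed.

Lemma lp_ext f g : f =1 g -> lp f = lp g.
Proof. by move=> /funext ->. Qed.

Lemma lp_free (H : I * I -> X) f g : continuous H -> (forall x, Y (H x)) ->
  (forall u, H (@I0 R, u) = H (@I1 R, u)) ->
  (forall s, H (s, @I0 R) = f s) -> (forall s, H (s, @I1 R) = g s) ->
  lp f = lp g.
Proof.
move=> Hc HY H01 Hf Hg.
have hc : continuous (fun x => mksub (HY x)) by apply: subtype_continuous.
have fc u : continuous (fun s : I => mksub (HY (s, u))).
  apply: (comp_continuous _ hc); apply: pair_continuous; last exact: cst_continuous.
  by move=> s; exact: cvg_id.
rewrite -(@lpE (cmap (fc (@I0 R)))); last exact: Hf.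
rewrite -(@lpE (cmap (fc (@I1 R)))); last exact: Hg.
apply: (@free_homotopy _ _ L (cmap hc)) => // u; apply: val_inj.
exact: H01.
Qed.

Section Curve.
Variables (f : R -> X) (lo hi : R).
Hypotheses (fc : continuous f) (fY : forall t, lo <= t <= hi -> Y (f t)).

Definition tp (a b : R) : C := lp (fun s : I => f ((1 - val s) * a + val s * b)).

Let J : set R := [set t | lo <= t <= hi].

Let J_cvx : cvx J.
Proof.
move=> x y t /andP[a0 a1] /andP[b0 b1] /andP[t0 t1].
by rewrite /J/= /GRing.scale/=; apply/andP; split; nra.
Qed.

Let PsiY (t : J) : Y (f (val t)).
Proof. by apply: fY; exact: sub_in t. Qed.

Let Psi_c : continuous (fun t : J => mksub (PsiY t)).
Proof. by apply: subtype_continuous; apply: comp_continuous fc; exact: val_continuous. Qed.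

Let tpE (a b : J) : tp (val a) (val b) = tr J_cvx L (cmap Psi_c) a b.
Proof. by apply/esym; apply: lpE => s. Qed.

(** Invariance under reparametrisation, because the parameter interval is convex. *)
Lemma tp_path (al : I -> R) : continuous al -> (forall s, lo <= al s <= hi) ->
  lp (fun s => f (al s)) = tp (al (@I0 R)) (al (@I1 R)).
Proof.
move=> alc alJ; have aJ s : J (al s) by exact: alJ.
have ac : continuous (fun s => mksub (aJ s)) by apply: subtype_continuous.
rewrite -[al (@I0 R)]/(val (cmap ac (@I0 R))) -[al (@I1 R)]/(val (cmap ac (@I1 R))) tpE.
rewrite /tr -convex_transport; apply/esym; exact: lpE.
Qed.

Lemma tpM a b c : lo <= a <= hi -> lo <= b <= hi -> lo <= c <= hi ->
  tp a c = tp b c * tp a b.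
Proof.
move=> aJ bJ cJ; pose mk t (h : lo <= t <= hi) : J := @mksub _ J t h.
rewrite -[a]/(val (mk a aJ)) -[b]/(val (mk b bJ)) -[c]/(val (mk c cJ)) !tpE; exact: trM.
Qed.

Lemma tp_neq0 a b : lo <= a <= hi -> lo <= b <= hi -> tp a b != 0.
Proof.
move=> aJ bJ; pose mk t (h : lo <= t <= hi) : J := @mksub _ J t h.
rewrite -[a]/(val (mk a aJ)) -[b]/(val (mk b bJ)) !tpE; exact: tr_neq0.
Qed.

Lemma tp_refl a : lo <= a <= hi -> tp a a = 1.
Proof.
move=> aJ; pose mk t (h : lo <= t <= hi) : J := @mksub _ J t h.
rewrite -[a]/(val (mk a aJ)) !tpE; exact: tr_refl.
Qed.

End Curve.
End LoopFunctions.

(** * Squared moduli and the unit circle *)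

Section UnitCircle.
Variable R : realType.
Local Notation C := R[i].

Definition expi (t : R) : C := cos t +i* sin t.

Definition nsq (z : C) : R := Re z ^+ 2 + Im z ^+ 2.

Lemma nsqM z w : nsq (z * w) = nsq z * nsq w.
Proof. by case: z w => [a b] [c d]; rewrite /nsq; simpc => /=; ring. Qed.

Lemma nsq_expi t : nsq (expi t) = 1.
Proof. exact: cos2Dsin2. Qed.

Lemma nsq_ge0 z : 0 <= nsq z.
Proof. by rewrite addr_ge0 ?sqr_ge0. Qed.

Lemma nsq_eq0 z : (nsq z == 0) = (z == 0).
Proof.
case: z => a b; rewrite /nsq/= paddr_eq0 ?sqr_ge0// !sqrf_eq0.
by rewrite eq_complex /=.
Qed.

Lemma nsq_gt0 z : (0 < nsq z) = (z != 0).
Proof. by rewrite lt_neqAle nsq_ge0 andbT eq_sym nsq_eq0. Qed.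

Lemma nsq0 : nsq 0 = 0. Proof. by apply/eqP; rewrite nsq_eq0. Qed.

Lemma nsq_real (a : R) : nsq a%:C = a ^+ 2.
Proof. by rewrite /nsq/= expr0n/= addr0. Qed.

Lemma nsqN z : nsq (- z) = nsq z.
Proof. by case: z => a b; rewrite /nsq/= !sqrrN. Qed.

Lemma nsq_norm z : `|z| ^+ 2 = (nsq z)%:C.
Proof.
by case: z => a b; rewrite normc_def/= -rmorphXn/= sqr_sqrtr// addr_ge0 ?sqr_ge0.
Qed.

Lemma nsq_continuous (S : topologicalType) (f : S -> C) :
  continuous f -> continuous (fun x => nsq (f x)).
Proof.
move=> /cplx_continuousP[fr fi]; rewrite /nsq.
by apply: radd; under eq_fun do rewrite expr2; apply: rmul.
Qed.

Lemma expi_continuous (S : topologicalType) (f : S -> R) :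
  continuous f -> continuous (fun x => expi (f x)).
Proof.
move=> fc; apply/cplx_continuousP => /=; split; apply: comp_continuous fc _.
  exact: continuous_cos.
exact: continuous_sin.
Qed.

Lemma realC_continuous (S : topologicalType) (f : S -> R) :
  continuous f -> continuous (fun x => (f x)%:C).
Proof. by move=> fc; apply/cplx_continuousP; split=> //=; exact: cstc. Qed.

Lemma expiD s t : expi (s + t) = expi s * expi t.
Proof. by rewrite /expi cosD sinD; simpc; congr (_ +i* _); ring. Qed.

Lemma expi0 : expi 0 = 1.
Proof. by rewrite /expi cos0 sin0. Qed.

Lemma expi_2pi : expi (2 * pi) = 1.
Proof. by rewrite /expi (mulr_natl pi 2) cos2pi sin2pi. Qed.

Lemma expi_pi : expi pi = -1.
Proof. by rewrite /expi cospi sinpi; apply/eqP; rewrite eq_complex/= oppr0 !eqxx. Qed.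

Lemma expi_neq0 t : expi t != 0.
Proof. by rewrite -nsq_eq0 nsq_expi oner_eq0. Qed.

End UnitCircle.

(** * Round loops in complex lines *)

Section Loops.
Variables (R : realType) (n r : nat).
Local Notation C := R[i].
Local Notation X := 'rV[C]_n.
Local Notation I := (@unit_interval R).
Variable F : 'I_r -> {scalar X}.
Local Notation U := (arr_complement F).
Variable L : local_system R U.

Lemma arr_complementP x : U x <-> forall i, F i x != 0.
Proof.
rewrite /arr_complement/= /arr_poly; split=> [h i|h].
  by apply/eqP => Fx; apply: h; rewrite (bigD1 i)//= Fx mul0r.
by move=> /eqP/prodf_eq0[i _]; rewrite (negbTE (h i)).
Qed.

(** The vector [v] encodes the complex line through [p], the radius and the starting point all at
    once. *)
Definition mono (p v : X) : C := lp L (fun s => p + expi (2 * pi * val s) *: v).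

Lemma mono_homotopy (p v : R -> X) : continuous p -> continuous v ->
  (forall u z i, 0 <= u <= 1 -> nsq z = 1 -> F i (p u) + z * F i (v u) != 0) ->
  mono (p 0) (v 0) = mono (p 1) (v 1).
Proof.
move=> pc vc h.
pose H (x : I * I) := p (val x.2) + expi (2 * pi * val x.1) *: v (val x.2).
have c1 : continuous (fun x : I * I => val x.1 : R).
  by apply: (comp_continuous _ (@uvalc R)) => x; exact: cvg_fst.
have c2 : continuous (fun x : I * I => val x.2 : R).
  by apply: (comp_continuous _ (@uvalc R)) => x; exact: cvg_snd.
apply: (@lp_free _ _ _ L H) => //.
- apply: xaddc; first exact: comp_continuous c2 pc.
  apply: xscalec; last exact: comp_continuous c2 vc.
  by apply: expi_continuous; apply: rmul c1; exact: cstc.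
- move=> x; apply/arr_complementP => i; rewrite FD FZ; apply: h; last exact: nsq_expi.
  exact: unitP.
- by move=> u; rewrite /H /= mulr0 mulr1 expi0 expi_2pi.
Qed.

Lemma mono_segment p v p' v' :
  (forall (u : R) z i, 0 <= u <= 1 -> nsq z = 1 ->
     (1 - u)%:C * (F i p + z * F i v) + u%:C * (F i p' + z * F i v') != 0) ->
  mono p v = mono p' v'.
Proof.
move=> h; pose g (x y : X) (u : R) := (1 - u)%:C *: x + u%:C *: y.
have gc x y : continuous (g x y).
  apply: xaddc; apply: xscalec; try exact: cstc; apply: realC_continuous.
    by apply: rsub; [exact: cstc|move=> u; exact: cvg_id].
  by move=> u; exact: cvg_id.
have g0 x y : g x y 0 = x by rewrite /g subr0 scale1r scale0r addr0.
have g1 x y : g x y 1 = y by rewrite /g subrr scale1r scale0r add0r.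
rewrite -(g0 p p') -(g0 v v') -{2}(g1 p p') -{2}(g1 v v').
apply: mono_homotopy => // u z i u01 z1; rewrite /g !FD !FZ.
apply: contra (h u z i u01 z1) => /eqP e; apply/eqP; rewrite -[RHS]e; ring.
Qed.

(** Turning the starting point along the circle is a free homotopy. *)
Lemma mono_rotate p v a :
  (forall z i, nsq z = 1 -> F i p + z * F i v != 0) ->
  mono p (expi a *: v) = mono p v.
Proof.
move=> h; apply/esym.
have := @mono_homotopy (fun=> p) (fun u => expi (u * a) *: v).
rewrite /= mul0r mul1r expi0 scale1r; apply; first exact: cstc.
  apply: xscalec; last exact: cstc; apply: expi_continuous.
  by apply: rmul; [move=> u; exact: cvg_id|exact: cstc].
move=> u z i u01 z1; rewrite FZ mulrA; apply: h.
by rewrite nsqM z1 nsq_expi mul1r.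
Qed.

Lemma mono_contract p v :
  (forall z i, nsq z <= 1 -> F i p + z * F i v != 0) -> mono p v = 1.
Proof.
move=> h; transitivity (mono p 0).
  apply: mono_segment => u z i /andP[u0 u1] z1.
  have := h ((1 - u)%:C * z) i.
  rewrite nsqM nsq_real z1 mulr1 => /(_ _).
  rewrite !raddf0 mulr0 addr0.
  have -> : (1 - u)%:C * (F i p + z * F i v) + u%:C * F i p =
     F i p + (1 - u)%:C * z * F i v by rewrite rmorphB/=; ring.
  by apply; nra.
have pU : U p.
  apply/arr_complementP => i; have := h 0 i.
  by rewrite mul0r addr0 nsq0; apply; exact: ler01.
rewrite /mono.
rewrite -(@lpE _ _ _ L (cmap (@cstc _ _ (mksub pU)))) => [|s]; last by rewrite scaler0 addr0.
by apply: (@transport_const _ _ _ (mksub pU)).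
Qed.

Lemma mono_scale p v (c d : R) : 0 < c <= d ->
  (forall z i, c ^+ 2 <= nsq z <= d ^+ 2 -> F i p + z * F i v != 0) ->
  mono p (c%:C *: v) = mono p (d%:C *: v).
Proof.
move=> /andP[c0 cd] h; apply: mono_segment => u z i /andP[u0 u1] z1.
have := h (z * ((1 - u) * c + u * d)%:C) i.
rewrite nsqM nsq_real z1 mul1r !FZ => H.
have -> : (1 - u)%:C * (F i p + z * (c%:C * F i v)) + u%:C * (F i p + z * (d%:C * F i v)) =
   F i p + z * ((1 - u) * c + u * d)%:C * F i v.
  rewrite !rmorphD !rmorphM !rmorphB /=; ring.
apply: H.
have h1 : c <= (1 - u) * c + u * d by nra.
have h2 : (1 - u) * c + u * d <= d by nra.
by apply/andP; split; nra.
Qed.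

End Loops.

(** * The boundary of a square as a loop *)

Section SquareLoop.
Variable R : realType.
Implicit Types (a b s t : R).

Lemma rinv (S : topologicalType) (f : S -> R) :
  continuous f -> (forall x, f x != 0) -> continuous (fun x => (f x)^-1).
Proof. by move=> fc f0 x; apply: cvgV; [exact: f0|exact: fc]. Qed.

Lemma rnorm (S : topologicalType) (f : S -> R) :
  continuous f -> continuous (fun x => `|f x|).
Proof. by move=> fc x; apply: cvg_norm; exact: fc. Qed.

Lemma first_quadrant a : 0 <= a <= pi / 2 -> 0 <= cos a /\ 0 <= sin a.
Proof.
move=> /andP[a0 a1]; have := @pihalf_02 R => /andP[p0 _]; split.
  by apply: cos_ge0_pihalf; rewrite a1 andbT; lra.
by apply: sin_ge0_pi; rewrite a0/=; lra.
Qed.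

Definition sqm t : R := `|cos (2 * pi * t)| + `|sin (2 * pi * t)|.
(* As [t] runs from 0 to 1, [(sqA t, sqB t)] runs counterclockwise along the
   boundary of [-1, 1]^2 from the corner (-1, -1), turning at multiples of 1/4. *)
Definition sqA t : R := (sin (2 * pi * t) - cos (2 * pi * t)) / sqm t.
Definition sqB t : R := (- cos (2 * pi * t) - sin (2 * pi * t)) / sqm t.

Lemma sqm_gt0 t : 0 < sqm t.
Proof.
rewrite lt_neqAle addr_ge0// andbT eq_sym paddr_eq0// !normr_eq0.
apply/negP => /andP[/eqP c0 /eqP s0].
by have := cos2Dsin2 (2 * pi * t); rewrite c0 s0 expr0n/= addr0 => /eqP; rewrite eq_sym oner_eq0.
Qed.

Let trig_c (f : R -> R) : continuous f -> continuous (fun t => f (2 * pi * t)).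
Proof.
move=> fc; apply: comp_continuous fc; apply: rmul; first exact: cstc.
by move=> u; exact: cvg_id.
Qed.

Let cosc := trig_c (@continuous_cos R).
Let sinc := trig_c (@continuous_sin R).

Lemma sqm_continuous : continuous sqm.
Proof. by apply: radd; apply: rnorm. Qed.

Lemma sqA_continuous : continuous sqA.
Proof.
apply: rmul; first exact: rsub.
by apply: rinv; [exact: sqm_continuous|move=> x; rewrite gt_eqF ?sqm_gt0].
Qed.

Lemma sqB_continuous : continuous sqB.
Proof.
apply: rmul; last by apply: rinv; [exact: sqm_continuous|move=> x; rewrite gt_eqF ?sqm_gt0].
apply: rsub => //; under eq_fun do rewrite -sub0r; apply: rsub => //; exact: cstc.
Qed.

Lemma sqA_bound t : -1 <= sqA t <= 1.
Proof.
rewrite ler_pdivlMr ?sqm_gt0// ler_pdivrMr ?sqm_gt0// /sqm.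
have := ler_norm (cos (2 * pi * t)); have := ler_norm (- cos (2 * pi * t)).
have := ler_norm (sin (2 * pi * t)); have := ler_norm (- sin (2 * pi * t)).
rewrite !normrN; lra.
Qed.

Lemma sqB_bound t : -1 <= sqB t <= 1.
Proof.
rewrite ler_pdivlMr ?sqm_gt0// ler_pdivrMr ?sqm_gt0// /sqm.
have := ler_norm (cos (2 * pi * t)); have := ler_norm (- cos (2 * pi * t)).
have := ler_norm (sin (2 * pi * t)); have := ler_norm (- sin (2 * pi * t)).
rewrite !normrN; lra.
Qed.

Lemma sqA_sqm t : sqA t * sqm t = sin (2 * pi * t) - cos (2 * pi * t).
Proof. by rewrite divfK// gt_eqF ?sqm_gt0. Qed.

Lemma sqB_sqm t : sqB t * sqm t = - cos (2 * pi * t) - sin (2 * pi * t).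
Proof. by rewrite divfK// gt_eqF ?sqm_gt0. Qed.

Lemma sq_side1 t : 0 <= t <= 1 / 4 -> sqB t = -1.
Proof.
move=> /andP[t0 t1]; have p0 := @pi_gt0 R.
have [|c0 s0] := @first_quadrant (2 * pi * t); first by apply/andP; split; nra.
apply: (mulIf (lt0r_neq0 (sqm_gt0 t))); rewrite sqB_sqm /sqm (ger0_norm c0) (ger0_norm s0); ring.
Qed.

Lemma sq_side2 t : 1 / 4 <= t <= 1 / 2 -> sqA t = 1.
Proof.
move=> /andP[t0 t1]; have p0 := @pi_gt0 R.
have [|c0 s0] := @first_quadrant (2 * pi * t - pi / 2); first by apply/andP; split; nra.
rewrite cosBpihalf in c0; rewrite sinBpihalf oppr_ge0 in s0.
apply: (mulIf (lt0r_neq0 (sqm_gt0 t))); rewrite sqA_sqm /sqm (ger0_norm c0) (ler0_norm s0); ring.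
Qed.

Lemma sq_side3 t : 1 / 2 <= t <= 3 / 4 -> sqB t = 1.
Proof.
move=> /andP[t0 t1]; have p0 := @pi_gt0 R.
have [|c0 s0] := @first_quadrant (2 * pi * t - pi); first by apply/andP; split; nra.
rewrite cosB cospi sinpi mulr0 addr0 mulrN1 oppr_ge0 in c0.
rewrite sinB cospi sinpi mulr0 subr0 mulrN1 oppr_ge0 in s0.
apply: (mulIf (lt0r_neq0 (sqm_gt0 t))); rewrite sqB_sqm /sqm (ler0_norm c0) (ler0_norm s0); ring.
Qed.

Lemma sq_side4 t : 3 / 4 <= t <= 1 -> sqA t = -1.
Proof.
move=> /andP[t0 t1]; have p0 := @pi_gt0 R.
have [|c0 s0] := @first_quadrant (2 * pi * t - pi - pi / 2); first by apply/andP; split; nra.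
rewrite cosBpihalf sinB cospi sinpi mulr0 subr0 mulrN1 oppr_ge0 in c0.
rewrite sinBpihalf cosB cospi sinpi mulr0 addr0 mulrN1 opprK in s0.
apply: (mulIf (lt0r_neq0 (sqm_gt0 t))); rewrite sqA_sqm /sqm (ler0_norm c0) (ger0_norm s0); ring.
Qed.

Lemma sq_corner : [/\ sqA 0 = -1, sqA 1 = -1, sqB (1 / 4) = -1 & sqB (1 / 2) = 1] /\
  [/\ sqA (1 / 4) = 1, sqA (1 / 2) = 1, sqB (3 / 4) = 1 & sqB 1 = -1] /\ sqA (3 / 4) = -1.
Proof.
have a1 : sqA 1 = -1 by apply: sq_side4; lra.
have e1 : 2 * pi * 1 = pi *+ 2 :> R by rewrite mulr1 mulr_natl.
have [e2 e3] : sqA 0 = sqA 1 /\ sqB 0 = sqB 1.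
  by rewrite /sqA /sqB /sqm e1 mulr0 cos0 sin0 cos2pi sin2pi.
split; [split|split; [split|]].
- by rewrite e2.
- exact: a1.
- by apply: sq_side1; lra.
- by apply: sq_side3; lra.
- by apply: sq_side2; lra.
- by apply: sq_side2; lra.
- by apply: sq_side3; lra.
- by rewrite -e3; apply: sq_side1; lra.
- by apply: sq_side4; lra.
Qed.

End SquareLoop.

(** * Moving a circle across one hyperplane *)

Section Crossing.
Variables (R : realType) (n r : nat).
Local Notation C := R[i].
Local Notation X := 'rV[C]_n.
Local Notation I := (@unit_interval R).
Variable F : 'I_r -> {scalar X}.
Local Notation U := (arr_complement F).
Variable L : local_system R U.
Variables (i : 'I_r) (p v : X) (k : R) (tau : C).
Hypotheses (Fi : F i p = - F i v) (Fiv : F i v != 0) (k01 : 0 < k < 1).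
Hypothesis Fj : forall j z, j != i -> (1 - k) ^+ 2 <= nsq z <= (1 + k) ^+ 2 ->
  F j p + z * F j v != 0.
Hypothesis tau_mono : forall p0 v0, F i p0 = 0 -> F i v0 != 0 ->
  (forall j z, j != i -> nsq z <= 1 -> F j p0 + z * F j v0 != 0) -> mono L p0 v0 = tau.

(** Polar coordinates on an annulus around 0: the square [-1, 1]^2 covers it, with the sides
    [b = -1] and [b = 1] glued, and the centre goes to 1, where the line meets the i-th
    hyperplane. *)
Definition polar (a b : R) : C := (1 + k * a)%:C * expi (pi * b).

Lemma polar_continuous (S : topologicalType) (a b : S -> R) :
  continuous a -> continuous b -> continuous (fun x => polar (a x) (b x)).
Proof.
move=> ac bc; apply: cmulc.
  by apply: realC_continuous; apply: radd; [exact: cstc|apply: rmul => //; exact: cstc].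
by apply: expi_continuous; apply: rmul => //; exact: cstc.
Qed.

Lemma nsq_polar a b : nsq (polar a b) = (1 + k * a) ^+ 2.
Proof. by rewrite nsqM nsq_real nsq_expi mulr1. Qed.

Lemma sin_pi_sign (b : R) : -1 <= b <= 1 ->
  (0 < b -> 0 <= sin (pi * b)) /\ (b < 0 -> sin (pi * b) <= 0).
Proof.
move=> /andP[b0 b1]; have p0 := @pi_gt0 R; split=> hb.
  by apply: sin_ge0_pi; apply/andP; split; nra.
rewrite -oppr_ge0 -sinN; apply: sin_ge0_pi; apply/andP; split; nra.
Qed.

Lemma polar_eq1 a b : -1 <= a <= 1 -> -1 <= b <= 1 -> polar a b = 1 -> a = 0 /\ b = 0.
Proof.
move=> a1 b1 e; have p0 := @pi_gt0 R.
have a0 : a = 0.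
  have := nsq_polar a b; rewrite e /nsq/= => h; case/andP: k01 => k0 k1.
  have /eqP : (k * a) * (2 + k * a) = 0 by nra.
  rewrite mulf_eq0 mulf_eq0 (gt_eqF k0)/= => /orP[/eqP//|/eqP h2]; nra.
split=> //; move: e; rewrite /polar a0 mulr0 addr0 mul1r.
move=> /eqP; rewrite eq_complex/= => /andP[/eqP c1 /eqP s0].
have aux (x : R) : 0 < x <= 1 -> cos (pi * x) = 1 -> sin (pi * x) = 0 -> False.
  move=> /andP[x0 x1] cx sx.
  have [xe|xn] := eqVneq x 1; first by move: cx; rewrite xe mulr1 cospi; lra.
  have := @sin_gt0_pi R (pi * x); rewrite sx ltxx => /(_ _)/=.
  have x1' : x < 1 by rewrite lt_neqAle xn.
  have -> : 0 < pi * x < pi by apply/andP; split; nra.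
  by move=> /(_ isT).
have [h|h|//] := ltgtP b 0.
  by exfalso; apply: (aux (- b)); rewrite ?mulrN ?cosN ?sinN ?s0 ?oppr0//; lra.
by exfalso; apply: (aux b) => //; lra.
Qed.

Lemma polar_in a b : -1 <= a <= 1 -> -1 <= b <= 1 -> (a != 0) || (b != 0) ->
  U (p + polar a b *: v).
Proof.
move=> a1 b1 ab0; apply/arr_complementP => j; rewrite FD FZ.
have [->|ji] := eqVneq j i.
  rewrite Fi addrC -{2}[F i v]mul1r -mulrBl mulf_neq0//.
  rewrite subr_eq0; apply/eqP => /(polar_eq1 a1 b1)[ae be].
  by move: ab0; rewrite ae be eqxx.
apply: Fj => //; rewrite nsq_polar; case/andP: k01 => k0 k1.
have h : -k <= k * a <= k by case/andP: a1 => h1 h2; apply/andP; split; nra.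
by case/andP: h => h1 h2; apply/andP; split; nra.
Qed.

Let beta t := p + polar (sqA t) (sqB t) *: v.

Lemma line_continuous (S : topologicalType) (f : S -> C) :
  continuous f -> continuous (fun x => p + f x *: v).
Proof. by move=> fc; apply: xaddc; [exact: cstc|apply: xscalec => //; exact: cstc]. Qed.

Let beta_c : continuous beta.
Proof.
by apply: line_continuous; apply: polar_continuous; [exact: sqA_continuous|exact: sqB_continuous].
Qed.

Lemma sq_neq0 t (m : R) : m != 0 -> (m * sqA t != 0) || (m * sqB t != 0).
Proof.
move=> m0; rewrite (mulf_eq0 m (sqA t)) (mulf_eq0 m (sqB t)) (negbTE m0)/=; apply/norP => -[].
rewrite !negbK => /eqP A0 /eqP B0.
have := sqA_sqm t; have := sqB_sqm t; rewrite A0 B0 !mul0r => h1 h2.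
have := cos2Dsin2 (2 * pi * t); nra.
Qed.

Let beta_U t : U (beta t).
Proof.
apply: polar_in; [exact: sqA_bound|exact: sqB_bound|].
by have := @sq_neq0 t 1 (oner_neq0 _); rewrite !mul1r.
Qed.

Let horiz (a : R) := p + polar a (-1) *: v.
Let vert (a b : R) := p + polar a b *: v.

Lemma polarN a : polar a 1 = polar a (-1).
Proof. by rewrite /polar mulr1 mulrN1 /expi cosN sinN sinpi oppr0. Qed.

Let horiz_c : continuous horiz.
Proof.
apply: line_continuous; apply: polar_continuous; last exact: cstc.
by move=> u; exact: cvg_id.
Qed.

Let vert_c a : continuous (vert a).
Proof.
apply: line_continuous; apply: polar_continuous; first exact: cstc.
by move=> u; exact: cvg_id.
Qed.

Let horiz_U a : -1 <= a <= 1 -> U (horiz a).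
Proof. by move=> h; apply: polar_in; rewrite ?oppr_eq0 ?oner_eq0 ?orbT//; lra. Qed.

Let vert_U a b : a != 0 -> -1 <= a <= 1 -> -1 <= b <= 1 -> U (vert a b).
Proof. by move=> a0 h h'; apply: polar_in; rewrite ?a0. Qed.

Lemma sub_interval_continuous (a b : R) :
  continuous (fun s : I => (1 - val s) * a + val s * b).
Proof.
apply: radd; apply: rmul; try exact: cstc; last exact: uvalc.
by apply: rsub; [exact: cstc|exact: uvalc].
Qed.

Lemma circle_vert a : a != 0 -> -1 <= a <= 1 ->
  tp L (vert a) (-1) 1 = mono L p ((1 + k * a)%:C *: v).
Proof.
move=> a0 a1; rewrite -(@mono_rotate _ _ _ _ L p _ (- pi)).
  apply: lp_ext => s; rewrite /vert /polar !scalerA; congr (_ + _ *: _).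
  by rewrite -expiD mulrC; congr (expi _ * _); ring.
move=> z j z1; rewrite FZ mulrA; case/andP: k01 => k0 k1.
have ka : -k <= k * a <= k by case/andP: a1 => h1 h2; apply/andP; split; nra.
have [->|ji] := eqVneq j i.
  rewrite Fi addrC -{2}[F i v]mul1r -mulrBl mulf_neq0//.
  rewrite subr_eq0; apply/eqP => /(congr1 (@nsq R)); rewrite nsqM z1 nsq_real mul1r /nsq/=.
  case/andP: ka => h1 h2 h; have /eqP : (k * a) * (2 + k * a) = 0 by nra.
  rewrite !mulf_eq0 (gt_eqF k0) (negbTE a0)/= => /eqP; lra.
apply: Fj => //; rewrite nsqM z1 nsq_real mul1r.
by case/andP: ka => h1 h2; apply/andP; split; nra.
Qed.

Let telescope (x01 x0h xh1 xa xb xc xd hA hB vA vB v1 m1 m2 : C) :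
  x01 = xh1 * x0h -> x0h = xb * xa -> xh1 = xd * xc ->
  xa = hA -> xb = v1 -> xc = hB -> xd = vB -> hB * hA = 1 -> vB * vA = 1 ->
  m1 = vA -> m2 = v1 -> x01 * m1 = m2.
Proof.
move=> -> -> -> -> -> -> -> h1 h2 -> ->.
transitivity (vB * vA * (hB * hA) * v1); first ring.
by rewrite h1 h2 !mul1r.
Qed.

(** The four sides of the square are a radial segment, the outer circle, the same segment backwards,
    and the inner circle backwards; the two radial contributions cancel. *)
Lemma square_factor : tp L beta 0 1 * mono L p ((1 - k)%:C *: v) =
  mono L p ((1 + k)%:C *: v).
Proof.
have bU (t : R) : 0 <= t <= 1 -> U (beta t) by [].
have side (f : R -> X) (g : R -> R) (a b x y : R) : continuous f -> continuous g ->
    (forall t, -1 <= t <= 1 -> U (f t)) -> (forall t, -1 <= g t <= 1) -> a <= b ->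
    (forall t, a <= t <= b -> beta t = f (g t)) -> g a = x -> g b = y ->
    tp L beta a b = tp L f x y.
  move=> fc gc fU g1 ab bf <- <-.
  transitivity (lp L (fun s : I => f (g ((1 - val s) * a + val s * b)))).
    apply: lp_ext => s; apply: bf; have /andP[s0 s1] := unitP s.
    by apply/andP; split; nra.
  have gs : continuous (fun s : I => g ((1 - val s) * a + val s * b)).
    apply: (@comp_continuous _ _ _ (fun s : I => (1 - val s) * a + val s * b) g _ gc).
    exact: sub_interval_continuous.
  rewrite (tp_path L fc fU gs); last by move=> s; exact: g1.
  by rewrite subr0 mul1r mul0r addr0 subrr mul0r mul1r add0r.
have [[A0 A1 B14 B12] [[A14 A12 B34 B1] A34]] := sq_corner R.
have Ac := @sqA_continuous R; have Bc := @sqB_continuous R.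
have Ab := @sqA_bound R; have Bb := @sqB_bound R.
have c1 : 1 != 0 :> R by rewrite oner_neq0.
have cN1 : -1 != 0 :> R by rewrite oppr_eq0 oner_neq0.
have b1 : -1 <= (1 : R) <= 1 by lra.
have bN1 : -1 <= (-1 : R) <= 1 by lra.
have vU1 t : -1 <= t <= 1 -> U (vert 1 t) := vert_U c1 b1.
have vUN1 t : -1 <= t <= 1 -> U (vert (-1) t) := vert_U cN1 bN1.
have [l1 [l2 [l3 l4]]] : 0 <= 1 / 4 :> R /\ 1 / 4 <= 1 / 2 :> R /\
   1 / 2 <= 3 / 4 :> R /\ 3 / 4 <= 1 :> R by do !split; lra.
have s1 : tp L beta 0 (1 / 4) = tp L horiz (-1) 1.
  apply: (side _ _ _ _ _ _ horiz_c Ac horiz_U Ab l1 _ A0 A14).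
  by move=> t /sq_side1 e; rewrite /beta e.
have s2 : tp L beta (1 / 4) (1 / 2) = tp L (vert 1) (-1) 1.
  apply: (side _ _ _ _ _ _ (@vert_c 1) Bc vU1 Bb l2 _ B14 B12).
  by move=> t /sq_side2 e; rewrite /beta e.
have s3 : tp L beta (1 / 2) (3 / 4) = tp L horiz 1 (-1).
  apply: (side _ _ _ _ _ _ horiz_c Ac horiz_U Ab l3 _ A12 A34).
  by move=> t /sq_side3 e; rewrite /beta e polarN.
have s4 : tp L beta (3 / 4) 1 = tp L (vert (-1)) 1 (-1).
  apply: (side _ _ _ _ _ _ (@vert_c (-1)) Bc vUN1 Bb l4 _ B34 B1).
  by move=> t /sq_side4 e; rewrite /beta e.
have j0 : 0 <= (0 : R) <= 1 by lra.
have ja : 0 <= (1 / 4 : R) <= 1 by lra.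
have jb : 0 <= (1 / 2 : R) <= 1 by lra.
have jc : 0 <= (3 / 4 : R) <= 1 by lra.
have jd : 0 <= (1 : R) <= 1 by lra.
have T1 := tpM L beta_c bU j0 jb jd.
have T2 := tpM L beta_c bU j0 ja jb.
have T3 := tpM L beta_c bU jb jc jd.
have hh : tp L horiz 1 (-1) * tp L horiz (-1) 1 = 1.
  by rewrite -(tpM L horiz_c horiz_U bN1 b1 bN1) (tp_refl L horiz_c horiz_U bN1).
have vv : tp L (vert (-1)) 1 (-1) * tp L (vert (-1)) (-1) 1 = 1.
  by rewrite -(tpM L (@vert_c (-1)) vUN1 bN1 b1 bN1) (tp_refl L (@vert_c (-1)) vUN1 bN1).
have m1 : mono L p ((1 - k)%:C *: v) = tp L (vert (-1)) (-1) 1.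
  by rewrite (circle_vert cN1 bN1) mulrN1.
have m2 : mono L p ((1 + k)%:C *: v) = tp L (vert 1) (-1) 1.
  by rewrite (circle_vert c1 b1) mulr1.
exact: (telescope T1 T2 T3 s1 s2 s3 s4 hh vv m1 m2).
Qed.

Lemma small_polar (rho : R) : 0 < rho -> exists2 eta : R, 0 < eta <= 1 &
  forall a b, `|a| < eta -> `|b| < eta ->
    `|Re (polar a b - 1)| < rho /\ `|Im (polar a b - 1)| < rho.
Proof.
move=> rho0.
have ac : continuous (fun x : R * R => x.1) by move=> x; exact: cvg_fst.
have bc : continuous (fun x : R * R => x.2) by move=> x; exact: cvg_snd.
have gc : continuous (fun x : R * R => polar x.1 x.2 - 1 : C^o).
  by apply: gsubc; [exact: polar_continuous|exact: cst_continuous].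
have /cplx_continuousP[rc ic] := gc.
have e0 : polar 0 0 - 1 = 0 by rewrite /polar !mulr0 addr0 expi0 mulr1 subrr.
have hr : \forall x \near ((0, 0) : R * R), `|Re (polar x.1 x.2 - 1)| < rho.
  have hb : nbhs (Re (polar 0 0 - 1)) (ball (0 : R) rho) by rewrite e0; exact: nbhsx_ballx.
  have := rc (0, 0) _ hb.
  move=> h; apply: (@filterS _ (nbhs ((0, 0) : R * R)) _ _ _ _ h) => x /=.
  by rewrite -ball_normE/= sub0r normrN.
have hi : \forall x \near ((0, 0) : R * R), `|Im (polar x.1 x.2 - 1)| < rho.
  have hb : nbhs (Im (polar 0 0 - 1)) (ball (0 : R) rho) by rewrite e0; exact: nbhsx_ballx.
  have := ic (0, 0) _ hb.
  move=> h; apply: (@filterS _ (nbhs ((0, 0) : R * R)) _ _ _ _ h) => x /=.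
  by rewrite -ball_normE/= sub0r normrN.
have Fl : Filter (nbhs ((0, 0) : R * R)) by exact: (@nbhs_filter (R * R)%type (0, 0)).
have hri := @filterI _ (nbhs ((0, 0) : R * R)) Fl _ _ hr hi.
have [e /= e_gt0 he] := (proj1 (@nbhs_ballP R (R * R)%type _ _) hri).
exists (Num.min e 1); first by rewrite lt_min e_gt0 ltr01 ge_min lexx orbT.
move=> a b ha hb; apply: (he (a, b)); split; rewrite -ball_normE/= sub0r normrN.
  by rewrite (lt_le_trans ha)// ge_min lexx.
by rewrite (lt_le_trans hb)// ge_min lexx.
Qed.

Lemma near_root : exists2 rho : R, 0 < rho & forall j z, j != i ->
  `|Re (z - 1)| < rho -> `|Im (z - 1)| < rho -> F j p + z * F j v != 0.
Proof.
case/andP: k01 => k0 k1.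
exists (Num.min k 1 / 4); first by rewrite divr_gt0// lt_min k0 ltr01.
move=> j [x y] ji; rewrite ReB ImB/= subr0 min_l ?ltW// => hx hy; apply: Fj => //.
move: hx hy; rewrite !ltr_norml => /andP[hx1 hx2] /andP[hy1 hy2].
rewrite /nsq/=; apply/andP; split; nra.
Qed.

Let d := (-1) +i* (-1) : C.

(** The round circle started at [d] is a radial rescaling of the square loop, with the same
    parameter. *)
Lemma expi_d s : expi (2 * pi * s) * d = (sqA s * sqm s) +i* (sqB s * sqm s).
Proof. by rewrite sqA_sqm sqB_sqm /expi /d; simpc; congr (_ +i* _); ring. Qed.

Let mix (x y rho u : R) : 0 <= u <= 1 -> `|x| < rho -> -2 <= y <= 2 ->
  `|(1 - u) * x + u * (rho / 4) * y| < rho.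
Proof.
rewrite !ltr_norml => /andP[u0 u1] /andP[x0 x1] /andP[y0 y1].
have r0 : 0 < rho by lra.
have h1 : 0 <= (1 - u) * (rho - x) by apply: mulr_ge0; lra.
have h2 : 0 <= (1 - u) * (rho + x) by apply: mulr_ge0; lra.
have h3 : 0 <= u * rho * (2 - y) by rewrite !mulr_ge0//; lra.
have h4 : 0 <= u * rho * (2 + y) by rewrite !mulr_ge0//; lra.
have [u2|u2] := lerP u (1 / 2).
  have h5 : 0 < (1 - u) * (rho - x) by apply: mulr_gt0; lra.
  have h6 : 0 < (1 - u) * (rho + x) by apply: mulr_gt0; lra.
  have h7 : 0 <= u * rho by rewrite mulr_ge0//; lra.
  apply/andP; split; nra.
have h7 : 0 < u * rho by rewrite mulr_gt0//; lra.
apply/andP; split; nra.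
Qed.

Let sq_mul2 (a m : R) : -1 <= a <= 1 -> 0 < m -> m <= 2 -> -2 <= a * m <= 2.
Proof. by move=> /andP[a0 a1] m0 m1; apply/andP; split; nra. Qed.

(** Seen from the point 1, the polar image lies on the same side of the real axis as [b], and on the
    axis in the direction of [a]. It is thus never opposite to the vector [(a, b)]. *)
Lemma polar_axis a b m : -1 <= a <= 1 -> -1 <= b <= 1 -> 0 < m -> m <= 1 ->
  (m * a != 0) || (m * b != 0) ->
  let x := Re (polar (m * a) (m * b) - 1) in let y := Im (polar (m * a) (m * b) - 1) in
  ~ (x = 0 /\ y = 0) /\ (0 < b -> 0 <= y) /\ (b < 0 -> y <= 0) /\
  (b = 0 -> (exists2 c, 0 < c & x = c * a) /\ a != 0).
Proof.
move=> a1 b1 m0 m1 ab0 x y; case/andP: k01 => k0 k1.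
have ma : -1 <= m * a <= 1 by case/andP: a1 => ? ?; apply/andP; split; nra.
have mb : -1 <= m * b <= 1 by case/andP: b1 => ? ?; apply/andP; split; nra.
have yE : y = (1 + k * (m * a)) * sin (pi * (m * b)).
  by rewrite /y ImB /polar /expi /=; ring.
have xE : x = (1 + k * (m * a)) * cos (pi * (m * b)) - 1.
  by rewrite /x ReB /polar /expi /=; ring.
have k2 : 0 < 1 + k * (m * a) by case/andP: ma => ? ?; nra.
have [sp sn] := sin_pi_sign mb; split; [|split; [|split]].
- move=> [x0 y0]; have /(polar_eq1 ma mb)[a0 b0] : polar (m * a) (m * b) = 1.
    apply/eqP; rewrite -subr_eq0 eq_complex.
    by rewrite -/x -/y x0 y0 /= !eqxx.
  by move: ab0; rewrite a0 b0 eqxx.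
- by move=> b0; rewrite yE mulr_ge0 ?(ltW k2)// sp// mulr_gt0.
- by move=> b0; rewrite yE (pmulr_rle0 _ k2) sn// (pmulr_rlt0 _ m0).
- move=> b0; split; first by exists (k * m); rewrite ?mulr_gt0// xE b0 !mulr0 cos0; ring.
  by move: ab0; rewrite b0 mulr0 eqxx orbF mulf_eq0 negb_or => /andP[].
Qed.

(** The square is shrunk towards its centre and then moved linearly to a round circle about the
    intersection point, which is a meridian; [polar_axis] keeps the linear motion off that point. *)
Lemma square_loop_tau : tp L beta 0 1 = tau.
Proof.
have [rho rho0 hrho] := near_root.
have [eta /andP[eta0 eta1] heta] := small_polar rho0.
pose eta2 := eta / 2.
have e20 : 0 < eta2 by rewrite divr_gt0.
have e21 : eta2 <= 1 by rewrite /eta2; lra.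
pose H1 (x : I * I) := let m := (1 - val x.2) + val x.2 * eta2 in
  p + polar (m * sqA (val x.1)) (m * sqB (val x.1)) *: v.
have c1 : continuous (fun x : I * I => val x.1 : R).
  by apply: (comp_continuous _ (@uvalc R)) => x; exact: cvg_fst.
have c2 : continuous (fun x : I * I => val x.2 : R).
  by apply: (comp_continuous _ (@uvalc R)) => x; exact: cvg_snd.
have sq01 : sqA 0 = sqA 1 :> R /\ sqB 0 = sqB 1 :> R.
  have [[-> -> _ _] [[_ _ _ ->] _]] := sq_corner R; split=> //.
  by apply: sq_side1; lra.
have cA : continuous (fun x : I * I => sqA (val x.1)).
  exact: comp_continuous c1 (@sqA_continuous R).
have cB : continuous (fun x : I * I => sqB (val x.1)).
  exact: comp_continuous c1 (@sqB_continuous R).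
have inU1 t w : 0 <= w <= 1 ->
    U (p + polar (((1 - w) + w * eta2) * sqA t) (((1 - w) + w * eta2) * sqB t) *: v).
  move=> /andP[u0 u1]; set m := (1 - _) + _.
  have h5 : 0 <= (1 - w) * (1 - eta2) by apply: mulr_ge0; lra.
  have h6 : 0 <= w * (1 - eta2) by apply: mulr_ge0; lra.
  have m0 : 0 < m by rewrite /m; lra.
  have m1 : m <= 1 by rewrite /m; lra.
  have /andP[h1 h2] := sqA_bound t; have /andP[h3 h4] := sqB_bound t.
  apply: polar_in; [nra|nra|]; apply: sq_neq0; exact: lt0r_neq0.
have step1 : tp L beta 0 1 =
    lp L (fun s : I => p + polar (eta2 * sqA (val s)) (eta2 * sqB (val s)) *: v).
  apply: (@lp_free _ _ _ L H1).
  - apply: line_continuous.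
    have cm : continuous (fun x : I * I => (1 - val x.2) + val x.2 * eta2 : R).
      apply: radd; first by apply: rsub => //; exact: cstc.
      by apply: rmul => //; exact: cstc.
    by apply: polar_continuous; exact: rmul.
  - by move=> [s u]; exact: inU1 (unitP u).
  - by move=> u; rewrite /H1/= (sq01.1) (sq01.2).
  - move=> s; rewrite /H1/= subr0 mul0r addr0 !mul1r /beta.
    by rewrite mulr0 add0r mulr1.
  - by move=> s; rewrite /H1/= subrr mul1r add0r.
pose de := rho / 4.
have de0 : 0 < de by rewrite divr_gt0.
(* Linear motion from the shrunken square to the circle about 1 started in the direction [d]; the
   small [de] keeps it in a neighbourhood of 1 that the other hyperplanes avoid. *)
pose zz s u := (1 - u)%:C * polar (eta2 * sqA s) (eta2 * sqB s) +
   u%:C * (1 + expi (2 * pi * s) * (de%:C * d)).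
have zzE s u : zz s u - 1 =
  ((1 - u) * Re (polar (eta2 * sqA s) (eta2 * sqB s) - 1) + u * de * (sqA s * sqm s))
  +i* ((1 - u) * Im (polar (eta2 * sqA s) (eta2 * sqB s) - 1) + u * de * (sqB s * sqm s)).
  have e : zz s u - 1 = (1 - u)%:C * (polar (eta2 * sqA s) (eta2 * sqB s) - 1) +
      (u * de)%:C * (expi (2 * pi * s) * d) by rewrite /zz !rmorphM !rmorphB /=; ring.
  by rewrite e expi_d; case: (polar _ _ - 1) => x y; simpc.
have eA s : `|eta2 * sqA s| < eta.
  have := sqA_bound s; rewrite normrM (gtr0_norm e20) -ler_norml /eta2 => h; nra.
have eB s : `|eta2 * sqB s| < eta.
  have := sqB_bound s; rewrite normrM (gtr0_norm e20) -ler_norml /eta2 => h; nra.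
have m2 s : sqm s <= 2 :> R by have := cos_max (2 * pi * s); have := sin_max (2 * pi * s); rewrite /sqm; lra.
have inU2 s u : 0 <= u <= 1 -> U (p + zz s u *: v).
  move=> /andP[u0 u1].
  have s0 := sqm_gt0 s; have sm2 := m2 s.
  have /andP[A1 A2] := sqA_bound s; have /andP[B1 B2] := sqB_bound s.
  have [hr hi] := heta _ _ (eA s) (eB s).
  apply/arr_complementP => j; rewrite FD FZ.
  have [->|ji] := eqVneq j i; last first.
    apply: hrho => //; rewrite zzE; [rewrite [Re _]/=|rewrite [Im _]/=].
      by apply: (mix _ hr); rewrite ?u0 ?u1//; apply: sq_mul2 => //; rewrite ?A1 ?A2.
    by apply: (mix _ hi); rewrite ?u0 ?u1//; apply: sq_mul2 => //; rewrite ?B1 ?B2.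
  rewrite Fi addrC -{2}[F i v]mul1r -mulrBl mulf_neq0// zzE; apply/eqP => e0.
  have := polar_axis (sqA_bound s) (sqB_bound s) e20 e21 (sq_neq0 s (lt0r_neq0 e20)).
  move=> [xy [hpos [hneg hzero]]].
  set x := Re (polar _ _ - 1) in xy hzero e0; set y := Im (polar _ _ - 1) in xy hpos hneg e0.
  have hre : (1 - u) * x + u * de * (sqA s * sqm s) = 0 := congr1 Re e0.
  have him : (1 - u) * y + u * de * (sqB s * sqm s) = 0 := congr1 Im e0.
  have [u_eq0|u_neq0] := eqVneq u 0.
    by apply: xy; rewrite u_eq0 in hre him; split; lra.
  have u_gt0 : 0 < u by rewrite lt_neqAle eq_sym u_neq0.
  have dm : 0 < u * de * sqm s by rewrite !mulr_gt0.
  have [B_lt|B_gt|B_0] := ltgtP (sqB s) 0.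
  - by have := hneg B_lt; nra.
  - by have := hpos B_gt; nra.
  - have [[c c0 xA] A_neq0] := hzero B_0; rewrite xA in hre.
    have /eqP : ((1 - u) * c + u * de * sqm s) * sqA s = 0 by rewrite -hre; ring.
    rewrite mulf_eq0 (negbTE A_neq0) orbF => /eqP.
    have : 0 <= (1 - u) * c by apply: mulr_ge0; lra.
    lra.
pose H2 (x : I * I) := p + zz (val x.1) (val x.2) *: v.
rewrite step1; transitivity (mono L (p + v) ((de%:C * d) *: v)).
  apply: (@lp_free _ _ _ L H2).
  - apply: line_continuous; rewrite /zz; apply: caddc; apply: cmulc.
    + by apply: realC_continuous; apply: rsub => //; exact: cstc.
    + by apply: polar_continuous; apply: rmul => //; exact: cstc.
    + by apply: realC_continuous.
    + apply: caddc; first exact: cstc; apply: cmulc; last exact: cstc.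
      by apply: expi_continuous; apply: rmul => //; exact: cstc.
  - by move=> [s u]; exact: inU2 (unitP u).
  - by move=> u; rewrite /H2 /zz/= (sq01.1) (sq01.2) mulr0 mulr1 expi0 expi_2pi.
  - by move=> s; rewrite /H2 /zz/= subr0 mul0r addr0 mul1r.
  - move=> s; rewrite /H2 /zz/= subrr mul0r add0r mul1r scalerDl scale1r addrA.
    by rewrite scalerA.
apply: tau_mono.
- by rewrite FD Fi addNr.
- rewrite FZ mulf_neq0// mulf_neq0//.
    by rewrite eq_complex/= (gt_eqF de0).
  by rewrite eq_complex/= oppr_eq0 oner_eq0.
- move=> j [x y] ji z1; rewrite FD FZ.
  have -> : F j p + F j v + (x +i* y) * (de%:C * d * F j v) =
    F j p + (1 + (x +i* y) * (de%:C * d)) * F j v by ring.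
  have xy : x ^+ 2 + y ^+ 2 <= 1 by [].
  have hx : -1 <= x <= 1 by apply/andP; split; nra.
  have hy : -1 <= y <= 1 by apply/andP; split; nra.
  case/andP: hx hy => hx1 hx2 /andP[hy1 hy2].
  have -> : 1 + (x +i* y) * (de%:C * d) = (1 + de * (y - x)) +i* (- de * (x + y)).
    by rewrite /d; apply/eqP; rewrite eq_complex/=; apply/andP; split; apply/eqP; ring.
  apply: hrho => //; rewrite ?ReB ?ImB/= ltr_norml /de; apply/andP; split; nra.
Qed.

Lemma crossing : mono L p ((1 + k)%:C *: v) = tau * mono L p ((1 - k)%:C *: v).
Proof. by rewrite -square_loop_tau square_factor. Qed.

End Crossing.

(** * Meridians, and circles around several hyperplanes *)

Section MeridianProduct.
Variables (R : realType) (n r : nat).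
Local Notation C := R[i].
Local Notation X := 'rV[C]_n.
Local Notation I := (@unit_interval R).
Variable F : 'I_r -> {scalar X}.
Hypothesis F_neq0 : forall i, exists x, F i x != 0.
Hypothesis F_distinct : injective (hyperplane F).
Local Notation U := (arr_complement F).
Variable L : local_system R U.

Definition merid i p v := [/\ F i p = 0, F i v != 0 &
  forall j z, j != i -> nsq z <= 1 -> F j p + z * F j v != 0].

Lemma merid_scale i p v (d : R) : merid i p v -> 0 < d <= 1 ->
  mono L p v = mono L p (d%:C *: v).
Proof.
move=> [Fp Fv Fj] d01; rewrite -{1}[v]scale1r -[1]/(1%:C).
apply/esym; apply: mono_scale => // z j /andP[z0 z1].
have [->|ji] := eqVneq j i; last by apply: Fj => //; rewrite expr1n in z1.
rewrite Fp add0r mulf_neq0// -nsq_gt0 (lt_le_trans _ z0)// exprn_gt0//.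
by case/andP: d01.
Qed.

(** Among the parabolic arcs from 0 to 1 at most one, with parameter [bad ab], passes through the
    value forbidden by [ab]; any [k] beyond all of these works. *)
Lemma generic_arc (s : seq (C * C)) : (forall ab, ab \in s -> ab.1 != 0 /\ ab.2 != 0) ->
  exists k : R, forall ab (u : R), ab \in s -> 0 <= u <= 1 ->
    ab.1 + (u +i* (k * u * (1 - u))) * (ab.2 - ab.1) != 0.
Proof.
move=> s0; pose bad (ab : C * C) : R := let z := ab.1 / (ab.1 - ab.2) in
  Im z / (Re z * (1 - Re z)).
exists (1 + \sum_(ab <- s) `|bad ab|) => ab u abs /andP[u0 u1].
set k := 1 + _; have kbad : `|bad ab| < k.
  rewrite /k (big_rem ab)//=; have : 0 <= \sum_(y <- rem ab s) `|bad y| by apply: sumr_ge0.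
  lra.
have [a0 b0] := s0 _ abs; apply/negP => /eqP e.
have ab0 : ab.1 - ab.2 != 0.
  rewrite subr_eq0; apply: contra a0 => /eqP h; move: e.
  by rewrite h subrr mulr0 addr0 => ->.
have ze : u +i* (k * u * (1 - u)) = ab.1 / (ab.1 - ab.2).
  apply: (mulIf ab0); rewrite divfK//; apply/eqP; rewrite -subr_eq0 -oppr_eq0.
  by apply/eqP; rewrite -[RHS]e; ring.
have u_neq0 : u != 0.
  apply: contra a0 => /eqP ue; move: e; rewrite ue mulr0 mul0r -[0 +i* 0]/(0 : C).
  by rewrite mul0r addr0 => ->.
have u_neq1 : 1 - u != 0.
  apply: contra b0; rewrite subr_eq0 => /eqP ue; move: e.
  by rewrite -ue subrr mulr0 -[1 +i* 0]/(1 : C) mul1r addrCA subrr addr0 => ->.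
have kE : bad ab = k.
  by rewrite /bad -ze /= -mulrA mulfK// mulf_neq0.
by move: kbad; rewrite kE; have := ler_norm k; lra.
Qed.

Let shrunk_neq (w N M : R) : 0 < w -> w <= 1 -> 0 <= M -> 0 < N ->
  w * (1 + N + M) <= N -> N <> w ^+ 2 * M.
Proof.
move=> w0 w1 M0 N0 h e.
have h2 : 0 <= (1 - w) * (w * M) by rewrite !mulr_ge0//; lra.
have h3 : 0 < w * (1 + N) by rewrite mulr_gt0//; lra.
nra.
Qed.

(** Centres and directions move along a common generic arc, while the radius shrinks continuously so
    as to stay clear of the other hyperplanes. *)
Lemma meridian_mono i p v p' v' : merid i p v -> merid i p' v' ->
  mono L p v = mono L p' v'.
Proof.
move=> m m'; have [Fp Fv Fj] := m; have [Fp' Fv' Fj'] := m'.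
have Fjp j q w : (forall z, nsq z <= 1 -> F j q + z * F j w != 0) -> F j q != 0.
  by move=> /(_ 0); rewrite nsq0 mul0r addr0; apply.
pose s := (F i v, F i v') :: [seq (F j p, F j p') | j <- enum 'I_r & j != i].
have [|k hk] := @generic_arc s.
  move=> ab; rewrite inE => /orP[/eqP ->//|/mapP[j]].
  rewrite mem_filter => /andP[ji _] ->; split.
    by apply: (Fjp _ _ v) => z; exact: Fj.
  by apply: (Fjp _ _ v') => z; exact: Fj'.
pose arc (u : R) : C := u +i* (k * u * (1 - u)).
pose P u := p + arc u *: (p' - p); pose V u := v + arc u *: (v' - v).
have idc : continuous (fun u : R => u) by move=> u; exact: cvg_id.
have arcc : continuous arc.
  apply/cplx_continuousP; split=> //=; apply: rmul; first by apply: rmul => //; exact: cstc.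
  by apply: rsub => //; exact: cstc.
have linec (x y : X) : continuous (fun u => x + arc u *: y).
  by apply: xaddc; [exact: cstc|apply: xscalec => //; exact: cstc].
(* At radius [g j u] or less the circle misses the j-th hyperplane. The product [d] of these factors
   in (0, 1] is continuous and below each of them. *)
pose g j u := nsq (F j (P u)) / (1 + nsq (F j (P u)) + nsq (F j (V u))).
pose d u := \prod_(j | j != i) g j u.
have g_den j u : 0 < 1 + nsq (F j (P u)) + nsq (F j (V u)).
  have := nsq_ge0 (F j (P u)); have := nsq_ge0 (F j (V u)); lra.
have gc j : continuous (g j).
  have nc x y : continuous (fun u => nsq (F j (x + arc u *: y))).
    by apply: nsq_continuous; apply: (comp_continuous (linec x y) (@F_continuous _ _ _ F j)).
  apply: rmul; first exact: nc.
  apply: rinv; last by move=> u; rewrite gt_eqF.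
  by apply: radd; [apply: radd; [exact: cstc|exact: nc]|exact: nc].
have dc : continuous d.
  rewrite /d; elim: (index_enum _) => [|j t IH].
    by under eq_fun do rewrite big_nil; exact: cstc.
  under eq_fun do rewrite big_cons; case: (j != i) => //; exact: rmul.
have FPj j u : j != i -> 0 <= u <= 1 -> F j (P u) != 0.
  move=> ji u01; rewrite FD FZ FB; apply: (hk (F j p, F j p')) => //.
  rewrite inE; apply/orP; right; apply/mapP; exists j => //.
  by rewrite mem_filter ji mem_enum.
have FVi u : 0 <= u <= 1 -> F i (V u) != 0.
  by move=> u01; rewrite FD FZ FB; apply: (hk (F i v, F i v')); rewrite ?inE ?eqxx.
have FPi u : F i (P u) = 0 by rewrite FD FZ FB Fp Fp' subrr mulr0 addr0.
have g01 j u : j != i -> 0 <= u <= 1 -> 0 < g j u <= 1.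
  move=> ji u01; rewrite divr_gt0 ?nsq_gt0 ?FPj//= ler_pdivrMr// mul1r.
  have := nsq_ge0 (F j (P u)); have := nsq_ge0 (F j (V u)); lra.
have d01 u : 0 <= u <= 1 -> 0 < d u <= 1.
  move=> u01; apply/andP; split.
    by apply: prodr_gt0 => j ji; case/andP: (g01 j u ji u01).
  by apply: prodr_ile1 => j ji; case/andP: (g01 j u ji u01) => /ltW -> ->.
have dg j u : j != i -> 0 <= u <= 1 -> d u <= g j u.
  move=> ji u01; rewrite /d (bigD1 j)//= ler_piMr//.
    by case/andP: (g01 j u ji u01) => /ltW.
  apply: prodr_ile1 => j' /andP[j'i _].
  by case/andP: (g01 j' u j'i u01) => /ltW -> ->.
have dN j u : j != i -> 0 <= u <= 1 ->
    d u * (1 + nsq (F j (P u)) + nsq (F j (V u))) <= nsq (F j (P u)).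
  by move=> ji u01; have := dg j u ji u01; rewrite ler_pdivlMr.
have a0 : arc 0 = 0 by rewrite /arc mulr0 mul0r.
have a1 : arc 1 = 1 by rewrite /arc subrr mulr0.
have P0 : P 0 = p by rewrite /P a0 scale0r addr0.
have P1 : P 1 = p' by rewrite /P a1 scale1r addrC subrK.
have V0 : V 0 = v by rewrite /V a0 scale0r addr0.
have V1 : V 1 = v' by rewrite /V a1 scale1r addrC subrK.
have Pc : continuous P := linec p (p' - p).
have Vc : continuous V := linec v (v' - v).
clear dg g01 linec gc; clearbody d; clear g_den g; clearbody P V.
have z01 : 0 <= (0 : R) <= 1 by rewrite lexx ler01.
have o01 : 0 <= (1 : R) <= 1 by rewrite lexx ler01.
rewrite (merid_scale m (d01 0 z01)) (merid_scale m' (d01 1 o01)).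
rewrite -P0 -P1 -V0 -V1.
apply: (@mono_homotopy _ _ _ F L P (fun u => (d u)%:C *: V u)).
- exact: Pc.
- by apply: xscalec; [exact: realC_continuous|exact: Vc].
move=> u z j u01 z1; rewrite FZ mulrA.
have /andP[d0 d1] := d01 u u01.
have [->|ji] := eqVneq j i.
  rewrite FPi add0r !mulf_neq0//; [by rewrite -nsq_gt0 z1 ltr01| |exact: FVi].
  by rewrite eq_complex/= (gt_eqF d0).
apply/eqP => e.
have /(congr1 (@nsq R)) : F j (P u) = - (z * (d u)%:C * F j (V u)).
  by apply/eqP; rewrite -addr_eq0 e.
rewrite nsqN !nsqM z1 nsq_real mul1r.
have h := dN j u ji u01.
by apply: (shrunk_neq d0 d1 (nsq_ge0 (F j (V u))) _ h); rewrite nsq_gt0 FPj.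
Qed.

Lemma exists_small (T : finType) (P : T -> R -> Prop) :
  (forall j, exists2 e, 0 < e & forall k, 0 < k <= e -> P j k) ->
  exists2 e, 0 < e & forall j k, 0 < k <= e -> P j k.
Proof.
move=> h; suff [e e0 he] : exists2 e, 0 < e &
    forall j k, j \in enum T -> 0 < k <= e -> P j k.
  by exists e => // j k; apply: he; rewrite mem_enum.
elim: (enum T) => [|j s [e e0 he]]; first by exists 1.
have [e' e'0 he'] := h j; exists (Num.min e e'); first by rewrite lt_min e0.
move=> j' k; rewrite inE le_min => /orP[/eqP -> /and3P[k0 _ k1]|js /and3P[k0 k1 _]].
  by apply: he'; rewrite k0.
by apply: he; rewrite ?k0.
Qed.

Lemma unit_expi (w : C) : nsq w = 1 -> exists a, w = expi a.
Proof.
case: w => x y; rewrite /nsq/= => xy.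
have x1 : -1 <= x <= 1 by apply/andP; split; nra.
have sq : Num.sqrt (1 - x ^+ 2) = `|y| by rewrite -sqrtr_sqr -xy; congr Num.sqrt; ring.
have [y0|y0] := lerP 0 y.
  by exists (acos x); rewrite /expi acosK// sin_acos// sq ger0_norm.
by exists (- acos x); rewrite /expi cosN sinN acosK// sin_acos// sq ltr0_norm// opprK.
Qed.

Variable tau : 'I_r -> C.
Hypothesis tau_merid : forall i p v, merid i p v -> mono L p v = tau i.

Let shells (e R0 : R) : 0 < e -> e < 1 -> 0 < R0 ->
  ((1 - e) * R0) ^+ 2 < R0 ^+ 2 /\ R0 ^+ 2 < ((1 + e) * R0) ^+ 2.
Proof.
move=> e0 e1 R0_gt0; have := mulr_gt0 e0 R0_gt0; set x := e * R0 => x0.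
have x1 : x < R0 by rewrite /x gtr_pMl.
have -> : (1 - e) * R0 = R0 - x by rewrite /x; ring.
have -> : (1 + e) * R0 = R0 + x by rewrite /x; ring.
split; nra.
Qed.

Section Generic.
Variables p v : X.
Hypothesis p_neq0 : forall i, F i p != 0.
Hypothesis p_generic : forall i j, i != j -> F i v != 0 -> F j v != 0 ->
  nsq (F i p) * nsq (F j v) != nsq (F j p) * nsq (F i v).

(** When [F i v] is nonzero, the squared modulus of the parameter at which the line meets the i-th
    hyperplane. *)
Let rad i := nsq (F i p) / nsq (F i v).

Let inside (c : R) := [set i | nsq (F i p) < c ^+ 2 * nsq (F i v)]%SET.

Let inside_rad c i : F i v != 0 -> (i \in inside c) = (rad i < c ^+ 2).
Proof. by move=> Fv; rewrite inE ltr_pdivrMr ?nsq_gt0. Qed.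

Let root_rad j (z : C) : F j v != 0 -> F j p + z * F j v = 0 -> nsq z = rad j.
Proof.
move=> Fv /eqP; rewrite addr_eq0 => /eqP e.
by rewrite /rad e nsqN nsqM mulfK// nsq_eq0.
Qed.

Let inside0 c i : F i v = 0 -> (i \in inside c) = false.
Proof. by move=> Fv; rewrite inE Fv nsq0 mulr0 ltNge nsq_ge0. Qed.

(** Induction on the number of intersection points inside: the circle is shrunk to just within the
    outermost one, which costs one factor [tau] by [crossing]. Genericity makes their moduli
    distinct. *)
Lemma mono_prod_generic (c : R) : 0 < c ->
  (forall i, nsq (F i p) != c ^+ 2 * nsq (F i v)) ->
  mono L p (c%:C *: v) = \prod_(i in inside c) tau i.
Proof.
have [m] := ubnP #|inside c|; elim: m c => // m IH c; rewrite ltnS => cm c0 touch.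
have touch_rad i : F i v != 0 -> rad i != c ^+ 2.
  move=> Fv; apply: contra (touch i) => /eqP <-.
  by rewrite divfK// nsq_eq0.
have [/eqP emp|/set0Pn[i1 i1in]] := boolP (inside c == finset.set0).
  rewrite emp big_set0; apply: mono_contract => z i z1; rewrite FZ.
  have [Fv|Fv] := eqVneq (F i v) 0; first by rewrite Fv !mulr0 addr0.
  apply/eqP => e; rewrite mulrA in e; have := root_rad Fv e.
  rewrite nsqM nsq_real => h.
  have := finset.in_set0 i; rewrite -emp (inside_rad _ Fv) -h lt_neqAle h touch_rad//=.
  rewrite -h; have := sqr_ge0 c; nra.
have Fv_in i : i \in inside c -> F i v != 0.
  by move=> ic; apply/eqP => /(inside0 c) h; rewrite h in ic.
pose i0 := [arg max_(i > i1 in inside c) rad i]%O.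
have [i0in i0max] : i0 \in inside c /\ forall j, j \in inside c -> rad j <= rad i0.
  by rewrite /i0; case: arg_maxP.
have Fv0 := Fv_in _ i0in.
have r0 : 0 < rad i0 by apply: divr_gt0; rewrite nsq_gt0.
have r0c : rad i0 < c ^+ 2 by rewrite -inside_rad.
have distinct j : j != i0 -> F j v != 0 -> rad j != rad i0.
  move=> ji Fv; rewrite eqr_div ?nsq_eq0//; exact: p_generic.
have r4 : 0 < 4 * rad i0 by lra.
pose R0 := Num.sqrt (rad i0).
have R0_gt0 : 0 < R0 by rewrite sqrtr_gt0.
have R0E : R0 ^+ 2 = rad i0 by rewrite sqr_sqrtr// ltW.
have R0c : R0 < c by rewrite -(@ltr_pXn2r _ 2)// ?nnegrE ?ltW// R0E.
(* A relative width for which the annulus around the radius [R0] contains no other intersection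
   point and stays within radius [c]. *)
have [e e0 he] : exists2 e, 0 < e & forall j k, 0 < k <= e ->
    (1 + k) * R0 <= c /\ k < 1 /\ (j != i0 -> F j v != 0 ->
    rad j < ((1 - k) * R0) ^+ 2 \/ ((1 + k) * R0) ^+ 2 < rad j).
  apply: exists_small => j.
  pose e1 := Num.min (1 / 2) ((c - R0) / R0).
  have e1_gt0 : 0 < e1 by rewrite lt_min !divr_gt0// subr_gt0.
  have e1P k : 0 < k <= e1 -> (1 + k) * R0 <= c /\ k < 1.
    rewrite le_min => /and3P[k0 k1]; rewrite ler_pdivlMr// => k2; split; lra.
  have [ji|ji] := eqVneq j i0.
    exists e1 => // k /e1P[h1 h2]; split=> //; split=> //.
  have [Fv|Fv] := eqVneq (F j v) 0.
    by exists e1 => // k /e1P[h1 h2]; split=> //; split=> //; rewrite Fv.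
  have [lt|gt|eq] := ltgtP (rad j) (rad i0); last by have := distinct j ji Fv; rewrite eq eqxx.
    pose e2 := (rad i0 - rad j) / (4 * rad i0).
    exists (Num.min e1 e2).
      by rewrite lt_min e1_gt0 (divr_gt0 _ r4)// subr_gt0.
    move=> k; rewrite le_min => /and3P[k0 k1 k2].
    have [h1 h2] : (1 + k) * R0 <= c /\ k < 1 by apply: e1P; rewrite k0.
    split=> //; split=> // _ _; left; rewrite exprMn R0E.
    move: k2; rewrite (ler_pdivlMr _ _ r4) => k2.
    have := mulr_gt0 k0 r0.
    have := mulr_gt0 (mulr_gt0 k0 k0) r0.
    have -> : (1 - k) ^+ 2 * rad i0 = rad i0 - 2 * (k * rad i0) + k * k * rad i0 by ring.
    lra.
  pose e2 := (rad j - rad i0) / (4 * rad i0).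
  exists (Num.min e1 e2).
    by rewrite lt_min e1_gt0 (divr_gt0 _ r4)// subr_gt0.
  move=> k; rewrite le_min => /and3P[k0 k1 k2].
  have [h1 h2] : (1 + k) * R0 <= c /\ k < 1 by apply: e1P; rewrite k0.
  split=> //; split=> // _ _; right; rewrite exprMn R0E.
  move: k2; rewrite (ler_pdivlMr _ _ r4) => k2.
  have := mulr_gt0 k0 r0.
  have h3 : 0 < 1 - k by rewrite subr_gt0.
  have := mulr_gt0 h3 (mulr_gt0 k0 r0).
  have -> : (1 + k) ^+ 2 * rad i0 = rad i0 + 3 * (k * rad i0) - (1 - k) * (k * rad i0) by ring.
  lra.
have {he} he j := he j e (etrans (congr2 andb e0 (lexx e)) erefl).
have e1 : e < 1 by case: (he i0) => _ [].
have ec : (1 + e) * R0 <= c by case: (he i0).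
(* Rescaling [v] by [z0] puts the intersection with the i0-th hyperplane at parameter 1, as
   [crossing] requires. *)
pose z0 := - F i0 p / F i0 v.
have z0E : nsq z0 = R0 ^+ 2.
  rewrite R0E; apply: root_rad => //; rewrite /z0 divfK// subrr//.
have [a aE] : exists a, z0 / R0%:C = expi a.
  apply: unit_expi; apply: (mulIf (_ : nsq R0%:C != 0)).
    by rewrite nsq_eq0 eq_complex/= gt_eqF.
  by rewrite -nsqM divfK ?eq_complex/= ?(gt_eqF R0_gt0)// mul1r z0E nsq_real.
have z0v (k : R) : k%:C *: (z0 *: v) = expi a *: ((k * R0)%:C *: v).
  have zE : z0 = expi a * R0%:C by rewrite -aE divfK// eq_complex/= gt_eqF.
  by rewrite !scalerA {1}zE rmorphM /=; congr (_ *: _); ring.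
have ring_avoid j z : j != i0 ->
    ((1 - e) * R0) ^+ 2 <= nsq z <= ((1 + e) * R0) ^+ 2 -> F j p + z * F j v != 0.
  move=> ji /andP[z_ge z_le]; have [Fv|Fv] := eqVneq (F j v) 0.
    by rewrite Fv mulr0 addr0.
  by apply/eqP => /(root_rad Fv) zr; have [_ [_ /(_ ji Fv)]] := he j; rewrite -zr; lra.
have cross : mono L p ((1 + e)%:C *: (z0 *: v)) = tau i0 * mono L p ((1 - e)%:C *: (z0 *: v)).
  apply: (@crossing _ _ _ _ _ i0).
  - by rewrite FZ /z0 divfK// opprK.
  - rewrite FZ mulf_neq0//; rewrite -nsq_gt0 z0E exprn_gt0//.
  - by rewrite e0.
  - move=> j z ji zb; rewrite FZ mulrA; apply: ring_avoid => //.
    by rewrite nsqM z0E !exprMn !ler_pM2r// exprn_gt0.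
  - by move=> p0 v0 h1 h2 h3; apply: tau_merid; split.
have outer : mono L p (c%:C *: v) = mono L p ((1 + e)%:C *: (z0 *: v)).
  have nz z i : ((1 + e) * R0) ^+ 2 <= nsq z <= c ^+ 2 -> F i p + z * F i v != 0.
    move=> /andP[zl zr]; have [Fv|Fv] := eqVneq (F i v) 0; first by rewrite Fv mulr0 addr0.
    apply/eqP => /(root_rad Fv) zE; rewrite zE in zl zr.
    have iin : i \in inside c by rewrite inside_rad// lt_neqAle touch_rad.
    have := i0max _ iin; rewrite -R0E; have : 0 < e * R0 by rewrite mulr_gt0.
    nra.
  rewrite z0v mono_rotate.
    by apply/esym; apply: mono_scale; rewrite ?mulr_gt0//; lra.
  move=> z i z1; rewrite FZ mulrA; apply: nz.
  rewrite nsqM nsq_real z1 mul1r lexx/= ler_pXn2r// nnegrE ?ltW// mulr_gt0//; lra.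
have inner : mono L p ((1 - e)%:C *: (z0 *: v)) = mono L p (((1 - e) * R0)%:C *: v).
  rewrite z0v mono_rotate// => z i z1; rewrite FZ mulrA.
  have [Fv|Fv] := eqVneq (F i v) 0; first by rewrite Fv !mulr0 addr0.
  have [->|ii] := eqVneq i i0.
    apply/eqP => /(root_rad Fv0); rewrite nsqM nsq_real z1 mul1r -R0E; nra.
  by apply: ring_avoid => //; rewrite nsqM nsq_real z1 mul1r lexx/=; nra.
have [r_in r_out] := shells e0 e1 R0_gt0; rewrite R0E in r_in r_out.
have insE : inside c = i0 |: inside ((1 - e) * R0).
  apply/finset.setP => j; rewrite in_setU1; have [->|ji] := eqVneq j i0; first exact: i0in.
  rewrite /=; have [Fv|Fv] := eqVneq (F j v) 0; first by rewrite !inside0.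
  have [_ [_ /(_ ji Fv) alt]] := he j; rewrite !inside_rad//; apply/idP/idP => h.
    case: alt => //; have := i0max j; rewrite inside_rad// => /(_ h) h1 h2.
    by have := lt_le_trans h2 h1; rewrite ltNge (ltW r_out).
  exact: lt_trans h (lt_trans r_in r0c).
have i0out : i0 \notin inside ((1 - e) * R0).
  by rewrite inside_rad// -leNgt ltW.
rewrite outer cross inner IH.
- by rewrite insE big_setU1.
- by move: cm; rewrite insE cardsU1 i0out.
- by rewrite mulr_gt0// subr_gt0.
move=> i; have [Fv|Fv] := eqVneq (F i v) 0; first by rewrite Fv nsq0 mulr0 nsq_eq0.
have [->|ii] := eqVneq i i0.
  apply/eqP => h; have : rad i0 = ((1 - e) * R0) ^+ 2 by rewrite /rad h mulfK// nsq_eq0.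
  by move=> h2; rewrite h2 ltxx in r_in.
apply/eqP => h; have h2 : rad i = ((1 - e) * R0) ^+ 2 by rewrite /rad h mulfK// nsq_eq0.
have [_ [_ /(_ ii Fv)]] := he i; rewrite h2 ltxx => -[//|].
by move=> /lt_trans/(_ (lt_trans r_in r_out)); rewrite ltxx.
Qed.

End Generic.
End MeridianProduct.

(** * Monodromy along an arbitrary round circle *)

Section MonodromyProduct.
Variables (R : realType) (n r : nat).
Local Notation C := R[i].
Local Notation X := 'rV[C]_n.
Local Notation I := (@unit_interval R).
Variable F : 'I_r -> {scalar X}.
Hypothesis F_neq0 : forall i, exists x, F i x != 0.
Hypothesis F_distinct : injective (hyperplane F).
Local Notation U := (arr_complement F).
Variable L : local_system R U.

Lemma nsqD (a b : C) (t : R) :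
  nsq (a + t%:C * b) = nsq a + 2 * (Re a * Re b + Im a * Im b) * t + nsq b * t ^+ 2.
Proof. by case: a b => [x y] [z w]; rewrite /nsq; simpc => /=; ring. Qed.

Lemma quadratic_nonroot (a b c e : R) : c != 0 -> 0 < e ->
  exists2 t, 0 < t < e & a + b * t + c * t ^+ 2 != 0.
Proof.
move=> c0 e0; pose q t := a + b * t + c * t ^+ 2.
have [h1|h1] := eqVneq (q (e / 4)) 0; last by exists (e / 4) => //; lra.
have [h2|h2] := eqVneq (q (e / 2)) 0; last by exists (e / 2) => //; lra.
have [h3|h3] := eqVneq (q (e * 3 / 4)) 0; last by exists (e * 3 / 4) => //; lra.
have /eqP : c * (e * e) = 0 by rewrite /q in h1 h2 h3; nra.
by rewrite !mulf_eq0 (negbTE c0) (gt_eqF e0).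
Qed.

(** Along its direction [q] each [phi k] is a true quadratic, so it is nonzero arbitrarily close to
    any point; the finitely many conditions are met one after another in shrinking open sets. *)
Lemma quadratic_dense (K : eqType) (s : seq K) (phi : K -> X -> R) (N : set X) :
  open N -> N !=set0 ->
  (forall k, k \in s -> continuous (phi k)) ->
  (forall k, k \in s -> exists q, forall x, exists a b c, c != 0 /\
     forall t : R, phi k (x + t%:C *: q) = a + b * t + c * t ^+ 2) ->
  exists2 p, N p & forall k, k \in s -> phi k p != 0.
Proof.
move=> No N0 phic phiq.
suff [M [Mo [p Mp] MN Mphi]] : exists M : set X, [/\ open M, M !=set0, M `<=` N &
    forall x k, M x -> k \in s -> phi k x != 0].
  by exists p; [exact: MN|move=> k ks; exact: Mphi].
elim: s phic phiq => [|k s IH] phic phiq; first by exists N; split.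
have [||M [Mo [p Mp] MN Mphi]] := IH.
- by move=> k' k's; apply: phic; rewrite inE k's orbT.
- by move=> k' k's; apply: phiq; rewrite inE k's orbT.
have kc := phic k (mem_head _ _).
have [q /(_ p)[a [b [c [c0 qE]]]]] := phiq k (mem_head _ _).
have lc : continuous (fun t : R => p + t%:C *: q).
  apply: xaddc; first exact: cstc; apply: xscalec; last exact: cstc.
  by apply: realC_continuous => t; exact: cvg_id.
have /nbhs_ballP[e /= e0 eM] : nbhs (0 : R) ((fun t : R => p + t%:C *: q) @^-1` M).
  apply: lc; apply: open_nbhs_nbhs; split=> //.
  by rewrite scale0r addr0.
have [t /andP[t0 te] ht] := quadratic_nonroot a b c0 e0.
exists (M `&` phi k @^-1` [set y | y != 0]); split.
- by apply: openI => //; apply: open_comp => // x _; exact: kc.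
- exists (p + t%:C *: q); split; last by rewrite /= qE.
  by apply: eM; rewrite -ball_normE/= sub0r normrN gtr0_norm.
- by move=> x [/MN].
- by move=> x k' [Mx kx]; rewrite inE => /orP[/eqP ->//|]; exact: Mphi.
Qed.

(** A nonzero form that vanishes on the kernel of another is proportional to it and defines the same
    hyperplane. *)
Lemma hyperplane_neq i j : i != j -> exists2 q, F i q = 0 & F j q != 0.
Proof.
move=> ij; apply: contrapT => h.
have {}h q : F i q = 0 -> F j q = 0.
  by move=> Fq; apply/eqP; apply: contrapT => /negP Fj; apply: h; exists q.
have [x0 Fx0] := F_neq0 i.
have key x : F j x = F i x / F i x0 * F j x0.
  have /h : F i (x - (F i x / F i x0) *: x0) = 0 by rewrite FB FZ divfK// subrr.
  by rewrite FB FZ => /eqP; rewrite subr_eq0 => /eqP.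
have Fjx0 : F j x0 != 0.
  by have [y Fy] := F_neq0 j; apply: contra Fy => /eqP e; rewrite key e mulr0.
move/eqP: ij; apply; apply: F_distinct; apply/seteqP; split=> x; rewrite /hyperplane/=.
  exact: h.
move=> Fx; apply/eqP; have /eqP := key x; rewrite Fx eq_sym !mulf_eq0 invr_eq0.
by rewrite (negbTE Fx0) (negbTE Fjx0) !orbF.
Qed.

Variable tau : 'I_r -> C.
Hypothesis tau_merid : forall i p v, merid F i p v -> mono L p v = tau i.

(** A small move of the centre changes neither the monodromy nor which intersection points lie
    inside, so the centre may be assumed generic. *)
Theorem mono_prod p v : (forall i, nsq (F i p) != nsq (F i v)) ->
  mono L p v = \prod_(i | nsq (F i p) < nsq (F i v)) tau i.
Proof.
move=> pv; pose Q i (y : X) : R := nsq (F i y) - nsq (F i v).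
have Fc i : continuous (fun y : X => nsq (F i y)).
  by apply: nsq_continuous; exact: F_continuous.
have Qc i : continuous (Q i) by apply: rsub; [exact: Fc|exact: cstc].
have : \forall y \near p, forall i, 0 < Q i p * Q i y.
  apply: (@filter_forall _ _ _ _ (nbhs_filter p)) => i.
  have gc : continuous (fun y => Q i p * Q i y) by apply: rmul => //; exact: cstc.
  have hn : nbhs (Q i p * Q i p) [set x : R | 0 < x].
    apply: open_nbhs_nbhs; split; first exact: open_gt.
    by rewrite /= -expr2 lt_neqAle sqr_ge0 andbT eq_sym sqrf_eq0 subr_eq0.
  exact: (gc p _ hn).
move=> /nbhs_ballP[e /= e0 eQ].
pose s := [seq ij <- enum {: 'I_r * 'I_r} | (F ij.1 v != 0) && (F ij.2 v != 0)] ++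
  [seq (i, i) | i <- enum 'I_r].
(* Diagonal pairs keep the centre off the hyperplanes; the other pairs keep the moduli of two
   intersection points distinct. *)
pose phi (ij : 'I_r * 'I_r) y : R := if ij.1 == ij.2 then nsq (F ij.1 y)
  else nsq (F ij.1 y) * nsq (F ij.2 v) - nsq (F ij.2 y) * nsq (F ij.1 v).
have [||||p' p'e p'phi] := @quadratic_dense _ s phi (ball p e).
- exact: ball_open.
- by exists p; exact: ballxx.
- move=> [i j] _; rewrite /phi/=; case: eqP => _; first exact: Fc.
  by apply: rsub; apply: rmul; try exact: Fc; exact: cstc.
- move=> [i j]; rewrite mem_cat mem_filter /= /phi/=; have [->|ij] := eqVneq i j.
    move=> _; have [q Fq] := F_neq0 j; exists q => x.
    exists (nsq (F j x)), (2 * (Re (F j x) * Re (F j q) + Im (F j x) * Im (F j q))), (nsq (F j q)).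
    by rewrite nsq_eq0; split=> // t; rewrite FD FZ nsqD.
  move=> /orP[/andP[/andP[iv jv] _]|/mapP[k _ [ik jk]]]; last by rewrite ik jk eqxx in ij.
  have [q Fq Fjq] := hyperplane_neq ij; exists q => x.
  exists (nsq (F i x) * nsq (F j v) - nsq (F j x) * nsq (F i v)),
   (- 2 * (Re (F j x) * Re (F j q) + Im (F j x) * Im (F j q)) * nsq (F i v)),
   (- (nsq (F j q) * nsq (F i v))).
  rewrite oppr_eq0 mulf_neq0 ?nsq_eq0//; split=> // t.
  by rewrite !FD !FZ Fq mulr0 addr0 nsqD; ring.
have p'0 i : F i p' != 0.
  have := p'phi (i, i); rewrite /phi/= eqxx nsq_eq0; apply.
  by rewrite mem_cat; apply/orP; right; apply/mapP; exists i => //; rewrite mem_enum.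
have p'ij i j : i != j -> F i v != 0 -> F j v != 0 ->
    nsq (F i p') * nsq (F j v) != nsq (F j p') * nsq (F i v).
  move=> ij iv jv; have := p'phi (i, j); rewrite /phi/= (negbTE ij) subr_eq0; apply.
  by rewrite mem_cat mem_filter/= iv jv mem_enum.
have side y : ball p e y -> forall i, 0 < Q i p * Q i y by exact: eQ.
have moved : mono L p v = mono L p' v.
  apply: mono_segment => u z i /andP[u0 u1] z1.
  have ub : ball p e ((1 - u)%:C *: p + u%:C *: p').
    move: p'e; rewrite -!ball_normE/=.
    have -> : p - ((1 - u)%:C *: p + u%:C *: p') = u%:C *: (p - p').
      by rewrite rmorphB/= scalerBl scale1r scalerBr opprD opprB addrA addrCA subrr addr0 addrC.
    rewrite normrZ; apply: le_lt_trans; rewrite -[leRHS]mul1r ler_wpM2r//.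
    by rewrite ger0_norm ?lecR// -[1]/(1%:C) lecR.
  have := side _ ub i; rewrite /Q FD !FZ.
  have -> : (1 - u)%:C * (F i p + z * F i v) + u%:C * (F i p' + z * F i v) =
     ((1 - u)%:C * F i p + u%:C * F i p') + z * F i v by rewrite rmorphB/=; ring.
  move=> h; apply/eqP => /eqP; rewrite addr_eq0 => /eqP e1.
  by move: h; rewrite e1 nsqN nsqM z1 mul1r subrr mulr0 ltxx.
rewrite moved -[v in LHS]scale1r -[1 in LHS]/(1%:C) (mono_prod_generic tau_merid p'0 p'ij)//.
  apply: eq_bigl => i; rewrite inE expr1n mul1r; have := side _ p'e i; rewrite /Q.
  by move=> h; apply/idP/idP => h1; rewrite -subr_lt0; nra.
move=> i; rewrite expr1n mul1r -subr_eq0; have := side _ p'e i; rewrite /Q.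
by apply: contraTneq => ->; rewrite mulr0 ltxx.
Qed.

End MonodromyProduct.

(** * Local cohomology away from the dense edges *)

Lemma nsq_inv (R : realType) (z : R[i]) : (nsq z)^-1 = nsq z^-1.
Proof.
have [->|z0] := eqVneq z 0; first by rewrite invr0 nsq0 invr0.
have nz : nsq z != 0 by rewrite nsq_eq0.
apply: (mulfI nz); rewrite divff// -nsqM divff// /nsq/= expr1n expr0n/= addr0//.
Qed.

Section SquareNorm.
Variables (R : realType) (n : nat).
Local Notation C := R[i].
Local Notation X := 'rV[C]_n.

Definition sqn (u : X) : R := \sum_j nsq (u 0 j).

Lemma sqn_ge0 u : 0 <= sqn u.
Proof. by apply: sumr_ge0 => j _; exact: nsq_ge0. Qed.

Lemma sqnZ (z : C) u : sqn (z *: u) = nsq z * sqn u.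
Proof. by rewrite /sqn mulr_sumr; apply: eq_bigr => j _; rewrite mxE nsqM. Qed.

Lemma sqn_gt0 u : u != 0 -> 0 < sqn u.
Proof.
move=> u0; rewrite lt_neqAle sqn_ge0 andbT eq_sym; apply: contra u0.
rewrite psumr_eq0; last by move=> j _; exact: nsq_ge0.
move=> /allP h; apply/eqP/matrixP => a j; rewrite (ord1 a) mxE.
by apply/eqP; rewrite -nsq_eq0; have := h j; rewrite mem_index_enum => /(_ isT).
Qed.

Lemma nsq_add_le (a b : C) : nsq (a + b) <= 2 * nsq a + 2 * nsq b.
Proof.
case: a b => [x y] [z w]; rewrite /nsq/=.
have := sqr_ge0 (x - z); have := sqr_ge0 (y - w); nra.
Qed.

Lemma sqn_add_le (u v : X) : sqn (u + v) <= 2 * sqn u + 2 * sqn v.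
Proof.
rewrite /sqn !mulr_sumr -big_split/=; apply: ler_sum => j _; rewrite mxE.
exact: nsq_add_le.
Qed.

Lemma sqn_continuous (S : topologicalType) (f : S -> X) :
  continuous f -> continuous (fun x => sqn (f x)).
Proof.
move=> fc; rewrite /sqn; elim: (index_enum _) => [|j s IH].
  by under eq_fun do rewrite big_nil; exact: cstc.
under eq_fun do rewrite big_cons; apply: radd => //; apply: nsq_continuous.
exact: (comp_continuous fc (@xcoordc _ _ j)).
Qed.

Lemma euclid_ballE (x : X) (e : R) y : euclid_ball x e y <-> sqn (y - x) < e ^+ 2.
Proof.
rewrite /euclid_ball/=; have -> : \sum_j `|y 0 j - x 0 j| ^+ 2 = (sqn (y - x))%:C.
  by rewrite /sqn rmorph_sum/=; apply: eq_bigr => j _; rewrite nsq_norm !mxE.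
by rewrite ltcR.
Qed.

Lemma norm_lt_of_nsq (z : C) (e : R) : 0 < e -> nsq z < e ^+ 2 -> `|z| < e%:C.
Proof.
move=> e0 ze; rewrite -(@ltr_pXn2r _ 2)// ?nnegrE ?normr_ge0 ?lecR ?ltW//.
by rewrite nsq_norm -rmorphXn/= ltcR.
Qed.

End SquareNorm.

(** Otherwise the zero of [F i] on the complex line would have parameter in the closed unit disc. *)
Lemma centered_root (R : realType) (n r : nat) (F : 'I_r -> {scalar 'rV[R[i]]_n})
    (x a b : 'rV[R[i]]_n) i :
  (forall z, nsq z <= 1 -> F i (x + (a + z *: b)) != 0) ->
  nsq (F i b) < nsq (F i (x + a)).
Proof.
move=> h; rewrite ltNge; apply/negP => le.
have [Fb|Fb] := eqVneq (F i b) 0.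
  have := h 0; rewrite nsq0 scale0r addr0 => /(_ ler01).
  by rewrite -nsq_gt0 ltNge (le_trans le)// Fb nsq0.
have := h (- F i (x + a) / F i b); rewrite nsqM nsqN -nsq_inv.
rewrite ler_pdivrMr ?nsq_gt0// mul1r le => /(_ isT).
by rewrite addrA FD FZ divfK// subrr eqxx.
Qed.

Section Local.
Variables (R : realType) (n r : nat).
Local Notation C := R[i].
Local Notation X := 'rV[C]_n.
Local Notation I := (@unit_interval R).
Variable F : 'I_r -> {scalar X}.
Local Notation U := (arr_complement F).

(** Only hyperplanes through [x] meet the ball of radius [e], so the local complement is that of a
    central arrangement. *)
Definition centered (x : X) (e : R) :=
  forall i u, F i x != 0 -> sqn u < e ^+ 2 -> F i (x + u) != 0.

Lemma small_ball (x : X) : exists2 e : R, 0 < e & forall d, 0 < d <= e -> centered x d.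
Proof.
suff [e e0 he] : exists2 e : R, 0 < e &
    forall i d, 0 < d <= e -> forall u, F i x != 0 -> sqn u < d ^+ 2 -> F i (x + u) != 0.
  by exists e => // d de i u; exact: he.
apply: exists_small => i; have [Fx|Fx] := eqVneq (F i x) 0; first by exists 1.
have Fc : continuous (fun u : X => nsq (F i (x + u))).
  apply: nsq_continuous; apply: (@comp_continuous _ _ _ (fun u : X => x + u) (fun u => F i u)).
    by apply: xaddc; [exact: cstc|move=> u; exact: cvg_id].
  exact: F_continuous.
have hn : nbhs (nsq (F i (x + 0))) [set t : R | 0 < t].
  by apply: open_nbhs_nbhs; split; [exact: open_gt|rewrite /= addr0 nsq_gt0].
have /nbhs_ballP[e /= e0 he] := Fc 0 _ hn.
exists (Re e).
  by move: e0; rewrite ltcE /= => /andP[].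
have eE : e = (Re e)%:C.
  by move: e0; case: e {he} => a b; rewrite ltcE/= => /andP[/eqP -> _].
move=> d /andP[d0 de] u _ ud; rewrite -nsq_gt0; apply: he; rewrite eE.
have re0 : 0 < Re e := lt_le_trans d0 de.
split; first by rewrite ltcR.
move=> a j; rewrite (ord1 a) -(@ball_normE C C^o)/= mxE sub0r normrN.
apply: norm_lt_of_nsq => //.
apply: le_lt_trans (lt_le_trans ud _); last by rewrite ler_pXn2r// nnegrE ltW.
by rewrite /sqn (bigD1 j)//= lerDl sumr_ge0// => k _; exact: nsq_ge0.
Qed.

End Local.

(** * The circle action on one block of a split arrangement *)

Section Circle.
Variables (R : realType) (n r : nat).
Local Notation C := R[i].
Local Notation X := 'rV[C]_n.
Local Notation I := (@unit_interval R).

Lemma complex_row_continuous (S : topologicalType) (h : S -> X) :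
  (forall j, continuous (fun x => h x 0 j : C)) -> continuous h.
Proof.
move=> hc x A [P xP PA].
have : \forall y \near x, forall j, P 0 j (h y 0 j).
  by apply: filter_forall => j; exact: hc (xP 0 j).
by apply: filterS => y Py; apply: PA => i j; rewrite (ord1 i).
Qed.

Lemma mulmx_continuous (M : 'M[C]_n) : continuous (fun w : X => w *m M).
Proof.
apply: complex_row_continuous => j.
pose g (s : seq 'I_n) (w : X) : C := \sum_(k <- s) w 0 k * M k j.
have gc s : continuous (g s).
  elim: s => [|k s IH].
    have -> : g [::] = fun=> 0 by apply/funext => w; rewrite /g big_nil.
    exact: cstc.
  have -> : g (k :: s) = fun w => w 0 k * M k j + g s w.
    by apply/funext => w; rewrite /g big_cons.
  apply: caddc; last exact: IH.
  by apply: cmulc; [exact: xcoordc|exact: cst_continuous].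
have -> : (fun w : X => (w *m M) 0 j) = g (index_enum 'I_n).
  by apply/funext => w; rewrite mxE.
exact: gc.
Qed.

Variable F : 'I_r -> {scalar X}.
Hypothesis F_neq0 : forall i, exists x, F i x != 0.
Hypothesis F_distinct : injective (hyperplane F).
Local Notation U := (arr_complement F).
Variable L : local_system R U.
Variable tau : 'I_r -> C.
Hypothesis tau_merid : forall i p v, merid F i p v -> mono L p v = tau i.
Variables (x : X) (e : R).
Hypothesis xe : centered F x e.
Local Notation T := (loc_complement F x e).

Lemma in_loc u : sqn u < e ^+ 2 -> (forall i, F i x = 0 -> F i u != 0) -> T (x + u).
Proof.
move=> ue ux; split; first by apply/euclid_ballE; rewrite addrC addKr.
apply/arr_complementP => i; have [Fx|Fx] := eqVneq (F i x) 0; last exact: xe.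
by rewrite FD Fx add0r ux.
Qed.

Lemma loc_in y : T y -> sqn (y - x) < e ^+ 2 /\ forall i, F i x = 0 -> F i (y - x) != 0.
Proof.
move=> [/euclid_ballE yx /arr_complementP yU]; split=> // i Fx.
by rewrite FB Fx subr0.
Qed.

Lemma mono_centered a b : sqn a < e ^+ 2 ->
  (forall z, nsq z <= 1 -> sqn (a + z *: b) < e ^+ 2) ->
  (forall i, F i x = 0 -> nsq (F i a) != nsq (F i b)) ->
  mono L (x + a) b = \prod_(i | (F i x == 0) && (nsq (F i a) < nsq (F i b))) tau i.
Proof.
move=> ae abe ab; have out i : F i x != 0 -> nsq (F i b) < nsq (F i (x + a)).
  by move=> Fx; apply: centered_root => z z1; apply: xe => //; exact: abe.
rewrite (mono_prod F_neq0 F_distinct tau_merid).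
  apply: eq_bigl => i; have [Fx|Fx] := eqVneq (F i x) 0; first by rewrite FD Fx add0r.
  by rewrite /= ltNge ltW ?out.
move=> i; have [Fx|Fx] := eqVneq (F i x) 0; first by rewrite FD Fx add0r ab.
by rewrite gt_eqF ?out.
Qed.

Variables (A : {set 'I_r}) (i0 : 'I_r) (P : 'M[C]_n).
Hypothesis i0A : i0 \in A.
Hypothesis A_x : forall i, i \in A -> F i x = 0.
Hypothesis PA : forall i, i \in A -> forall w, F i (w *m P) = F i w.
Hypothesis PnA : forall i, F i x = 0 -> i \notin A -> forall w, F i (w *m P) = 0.

(** Multiplication by [z] on the block of coordinates belonging to [A], identity on the
    complementary block. *)
Let rho (z : C) (w : X) := (w - w *m P) + z *: (w *m P).

Let F_rho i z w : F i x = 0 -> F i (rho z w) = (if i \in A then z else 1) * F i w.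
Proof.
move=> Fx; rewrite /rho FD FB FZ; case: ifP => iA.
  by rewrite PA// subrr add0r.
by rewrite PnA// ?iA// subr0 mulr0 addr0 mul1r.
Qed.

Let F_rho_neq0 i z w : nsq z = 1 -> F i x = 0 -> F i w != 0 -> F i (rho z w) != 0.
Proof.
move=> z1 Fx Fw; rewrite F_rho// mulf_neq0//; case: ifP => _; last exact: oner_neq0.
by rewrite -nsq_gt0 z1 ltr01.
Qed.

Let rho_gt0 z w : nsq z = 1 -> F i0 w != 0 -> 0 < sqn (rho z w).
Proof.
move=> z1 Fw; apply: sqn_gt0; apply/eqP => e0.
have := F_rho_neq0 z1 (A_x i0A) Fw; rewrite e0 raddf0 eqxx//.
Qed.

(** Restores the norm that [rho] may change, because the two blocks need not be orthogonal; orbits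
    thus stay in the ball. *)
Let sc (z : C) (w : X) : R := Num.sqrt (sqn w / sqn (rho z w)).

Let sc_gt0 z w : nsq z = 1 -> F i0 w != 0 -> 0 < sc z w.
Proof.
move=> z1 Fw; rewrite sqrtr_gt0 divr_gt0 ?rho_gt0// sqn_gt0//.
by apply: contra Fw => /eqP ->; rewrite raddf0.
Qed.

Let sqn_sc z w : nsq z = 1 -> F i0 w != 0 -> sqn ((sc z w)%:C *: rho z w) = sqn w.
Proof.
move=> z1 Fw; have r0 := rho_gt0 z1 Fw.
rewrite sqnZ nsq_real sqr_sqrtr ?divfK// ?gt_eqF//.
by rewrite divr_ge0 ?sqn_ge0.
Qed.

Let hf (yt : (T * I)%type) : X :=
  let z := expi (2 * pi * val yt.2) in let w := val yt.1 - x in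
  x + (sc z w)%:C *: rho z w.

Let hf_in yt : T (hf yt).
Proof.
case: yt => y t; have [yx yU] := loc_in (sub_in y); rewrite /hf /=.
have z1 := nsq_expi (2 * pi * val t).
have Fw : F i0 (val y - x) != 0 by apply: yU; exact: A_x.
apply: in_loc; first by rewrite sqn_sc.
move=> i Fx; rewrite FZ mulf_neq0//; last by apply: F_rho_neq0 => //; exact: yU.
by rewrite eq_complex/= gt_eqF// sc_gt0.
Qed.

Let hf_continuous : continuous hf.
Proof.
have wc : continuous (fun yt : (T * I)%type => val yt.1 - x : X).
  apply: gsubc; last exact: cst_continuous.
  apply: (@comp_continuous _ _ _ (fun yt : (T * I)%type => yt.1) (fun y : T => val y : X)).
    by move=> yt; exact: cvg_fst.
  exact: val_continuous.
have zc : continuous (fun yt : (T * I)%type => expi (2 * pi * val yt.2)).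
  apply: expi_continuous; apply: rmul; first exact: cstc.
  by apply: (comp_continuous _ (@uvalc R)) => yt; exact: cvg_snd.
have Pc := comp_continuous wc (@mulmx_continuous P).
have rc : continuous (fun yt : (T * I)%type =>
    rho (expi (2 * pi * val yt.2)) (val yt.1 - x)).
  by apply: xaddc; [exact: (gsubc wc Pc)|exact: (xscalec zc Pc)].
rewrite /hf; apply: xaddc; first exact: cst_continuous.
apply: xscalec; last exact: rc.
apply: realC_continuous; apply: (comp_continuous _ (@sqrt_continuous R)).
apply: rmul; first exact: (sqn_continuous wc).
apply: rinv; first exact: (sqn_continuous rc).
move=> [y t]; rewrite gt_eqF// rho_gt0 ?nsq_expi//=.
have [_ yU] := loc_in (sub_in y); exact: yU (A_x i0A).
Qed.

Let hT_continuous : continuous (fun yt => mksub (hf_in yt)).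
Proof. exact: subtype_continuous. Qed.

Let hT : continuousType (T * I)%type T := cmap hT_continuous.

Local Notation K := (pullback (incl_sub (@loc_complement_sub R n r F x e)) L).

Let hT_end (y : T) (t : I) : expi (2 * pi * val t) = 1 -> hT (y, t) = y.
Proof.
move=> z1; apply: val_inj; rewrite -[LHS]/(hf (y, t)) /hf /= z1.
have [_ yU] := loc_in (sub_in y); have Fw := yU _ (A_x i0A).
have -> : rho 1 (\val y - x) = \val y - x by rewrite /rho scale1r subrK.
have w0 : sqn (\val y - x) != 0.
  by rewrite gt_eqF// sqn_gt0//; apply: contra Fw => /eqP ->; rewrite raddf0.
have -> : sc 1 (\val y - x) = 1 by rewrite /sc /rho scale1r subrK divff// sqrtr1.
by rewrite scale1r addrC subrK.
Qed.

(** After deforming the scale to a constant [m], the orbit is a round circle with centre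
    [x + m (w - w P)] and radius vector [m w P]. The forms in [A] vanish at its centre and the
    others through [x] vanish on its radius vector, so exactly the hyperplanes of [A] are
    encircled. *)
Let track_mono (y : T) : K (track hT y) = \prod_(i in A) tau i.
Proof.
have [yx yU] := loc_in (sub_in y); set w := val y - x in yx yU.
have Fw : F i0 w != 0 := yU _ (A_x i0A).
have e0 : 0 < e ^+ 2 := le_lt_trans (sqn_ge0 w) yx.
pose a := w - w *m P; pose b := w *m P.
pose B := 1 + 2 * sqn a + 2 * sqn b.
have B1 : 1 <= B by have := sqn_ge0 a; have := sqn_ge0 b; rewrite /B; lra.
(* [B] bounds the squared norm of [a + z b] over the closed unit disc, so scaling by [m] puts the
   whole disc into the ball. *)
have [m m0 mB] : exists2 m : R, 0 < m & m ^+ 2 * B < e ^+ 2.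
  exists (Num.sqrt (e ^+ 2 / (2 * B))); first by rewrite sqrtr_gt0 divr_gt0// mulr_gt0//; lra.
  rewrite sqr_sqrtr; last by rewrite divr_ge0// ?ltW// mulr_gt0//; lra.
  rewrite invfM mulrA divfK ?gt_eqF//; last lra.
  by rewrite gtr_pMr// invf_lt1//; lra.
have mab (z : C) : nsq z <= 1 -> sqn (m%:C *: (a + z *: b)) < e ^+ 2.
  move=> z1; rewrite sqnZ nsq_real; apply: le_lt_trans mB; rewrite ler_pM2l ?exprn_gt0//.
  apply: le_trans (sqn_add_le _ _) _; rewrite sqnZ /B.
  have : 0 <= (1 - nsq z) * sqn b by rewrite mulr_ge0 ?sqn_ge0// subr_ge0.
  lra.
transitivity (mono L (x + m%:C *: a) (m%:C *: b)).
  transitivity (lp L (fun s => hf (y, s))); first exact: (@lpE _ _ _ L (incl_sub (@loc_complement_sub R n r F x e) \o track hT y)).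
  pose sg (t u : I) : R := (1 - val u) * sc (expi (2 * pi * val t)) w + val u * m.
  pose H (tu : I * I) := x + (sg tu.1 tu.2)%:C *: rho (expi (2 * pi * val tu.1)) w.
  have c1 : continuous (fun x : I * I => val x.1 : R).
    by apply: (comp_continuous _ (@uvalc R)) => tu; exact: cvg_fst.
  have c2 : continuous (fun x : I * I => val x.2 : R).
    by apply: (comp_continuous _ (@uvalc R)) => tu; exact: cvg_snd.
  have zc : continuous (fun tu : I * I => expi (2 * pi * val tu.1)).
    by apply: expi_continuous; apply: rmul; [exact: cstc|exact: c1].
  have rc : continuous (fun tu : I * I => rho (expi (2 * pi * val tu.1)) w).
    by apply: xaddc; [exact: cst_continuous|apply: xscalec; [exact: zc|exact: cst_continuous]].
  apply: (@lp_free _ _ _ L H).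
  - apply: xaddc; first exact: cst_continuous.
    apply: xscalec; last exact: rc.
    apply: realC_continuous; apply: radd; last by apply: rmul; [exact: c2|exact: cstc].
    apply: rmul; first by apply: rsub; [exact: cstc|exact: c2].
    apply: (comp_continuous _ (@sqrt_continuous R)); apply: rmul; first exact: cstc.
    apply: rinv; first exact: (sqn_continuous rc).
    by move=> tu; rewrite gt_eqF// rho_gt0// nsq_expi.
  - move=> [t u]; apply: (@loc_complement_sub _ _ _ F x e); rewrite /H.
    rewrite -[(t, u).1]/t -[(t, u).2]/u.
    have z1 := nsq_expi (2 * pi * val t); set z := expi _ in z1 *.
    have /andP[u0 u1] := unitP u.
    have s0 := sc_gt0 z1 Fw.
    have sg0 : 0 < sg t u.
      rewrite /sg -/z; have [u_lt|u_ge] := ltrP (val u) 1.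
        by rewrite ltr_wpDr ?(mulr_ge0 u0 (ltW m0))// mulr_gt0// subr_gt0.
      have -> : val u = 1 by apply/eqP; rewrite eq_le u1 u_ge.
      by rewrite subrr mul0r mul1r add0r.
    apply: in_loc.
      have hs : sc z w ^+ 2 * sqn (rho z w) < e ^+ 2.
        by have := sqn_sc z1 Fw; rewrite sqnZ nsq_real => ->.
      have hm : m ^+ 2 * sqn (rho z w) < e ^+ 2.
        by have := mab z; rewrite sqnZ nsq_real z1 lexx => /(_ isT).
      have r0 := rho_gt0 z1 Fw; rewrite sqnZ nsq_real.
      have [sm|sm] := lerP (sc z w) m.
        apply: le_lt_trans hm; rewrite ler_pM2r// ler_pXn2r ?nnegrE ?(ltW m0) ?(ltW sg0) ?(ltW s0)//.
        have -> : sg t u = m - (1 - val u) * (m - sc z w) by rewrite /sg -/z; ring.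
        by rewrite gerBl mulr_ge0// subr_ge0.
      apply: le_lt_trans hs; rewrite ler_pM2r// ler_pXn2r ?nnegrE ?(ltW m0) ?(ltW sg0) ?(ltW s0)//.
      have -> : sg t u = sc z w - val u * (sc z w - m) by rewrite /sg -/z; ring.
      by rewrite gerBl mulr_ge0// subr_ge0 ltW.
    move=> i Fx; rewrite FZ mulf_neq0//; last by apply: F_rho_neq0 => //; exact: yU.
    by rewrite eq_complex/= gt_eqF.
  - by move=> u; rewrite /H /sg/= mulr0 mulr1 expi0 expi_2pi.
  - by move=> s; rewrite /H /sg /hf/= subr0 mul1r mul0r addr0.
  - move=> s; rewrite /H /sg/= subrr mul0r mul1r add0r /rho scalerDr addrA.
    by rewrite !scalerA mulrC.
rewrite mono_centered.
- apply: eq_bigl => i; rewrite !FZ !nsqM nsq_real ltr_pM2l ?exprn_gt0//.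
  have [iA|iA] := boolP (i \in A).
    rewrite A_x// eqxx /a FB PA// subrr nsq0 nsq_gt0 /=; exact: yU (A_x iA).
  have [Fx|//] := eqVneq (F i x) 0.
  by rewrite /b PnA// nsq0 ltNge nsq_ge0.
- by have := mab 0; rewrite nsq0 scale0r addr0; apply; exact: ler01.
- by move=> z z1; rewrite scalerA mulrC -scalerA -scalerDr; exact: mab.
move=> i Fx; have m2 : m ^+ 2 != 0 by rewrite expf_neq0// gt_eqF.
rewrite !FZ !nsqM nsq_real (inj_eq (mulfI m2)).
have Fiw : F i w != 0 by exact: yU.
have [iA|iA] := boolP (i \in A).
  by rewrite /a FB PA// subrr nsq0 eq_sym nsq_eq0.
by rewrite /b PnA// nsq0 nsq_eq0 /a FB PnA// subr0.
Qed.

Lemma no_cohomology k : \prod_(i in A) tau i != 1 -> ~ cohomology_neq0 K k.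
Proof.
apply: (@cohomology_monodromy_vanish _ _ K hT) => y.
- by apply: hT_end; rewrite /= mulr0 expi0.
- by apply: hT_end; rewrite /= mulr1 expi_2pi.
exact: track_mono.
Qed.

End Circle.

(** * Representatives of local systems and the equation of the dense edges *)

Section MonodromyOfMeridians.
Variables (R : realType) (n r : nat).
Local Notation C := R[i].
Local Notation X := 'rV[C]_n.
Variable F : 'I_r -> {scalar X}.
Local Notation U := (arr_complement F).

Lemma norm_le1_nsq (z : C) : (`|z| <= 1) = (nsq z <= 1).
Proof. by rewrite -(@expr_le1 _ 2)// nsq_norm -[1 in LHS]/(1%:C) lecR. Qed.

Lemma meridian_tau (L : local_system R U) (g : 'I_r -> cpath R U) :
  (forall i, is_meridian i (g i)) -> forall i p v, merid F i p v -> mono L p v = L (g i).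
Proof.
move=> gm i p v pv; have [p0 [v0 [Fp Fv Fj gE]]] := gm i.
rewrite (meridian_mono L pv (_ : merid F i p0 v0)).
  by apply/esym; apply: lpE => s; exact: gE.
split=> // j z ji z1; have := Fj j z ji; rewrite norm_le1_nsq FD FZ; exact.
Qed.

Lemma repr_isomorphic (T : topologicalType) (K : local_system R T) :
  isomorphic (repr (\pi_(M_B R T)%qT K)) K.
Proof.
have /eqmodP h : (repr (\pi_(M_B R T) K) = K %[mod M_B R T])%qT by exact: reprK.
exact/asboolP.
Qed.

Lemma isomorphic_sym (T : topologicalType) (K K' : local_system R T) :
  isomorphic K K' -> isomorphic K' K.
Proof. by move=> /asboolP; rewrite -/(isomorphicb _ _) isomorphicb_sym => /asboolP. Qed.

Lemma isomorphic_trans (T : topologicalType) (K1 K2 K3 : local_system R T) :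
  isomorphic K1 K2 -> isomorphic K2 K3 -> isomorphic K1 K3.
Proof.
move=> h1 h2; apply/asboolP; apply: (@isomorphicb_trans R T K2); exact/asboolP.
Qed.

(** [V_locus] and [restriction] each pick representatives of classes; nonvanishing of cohomology is
    insensitive to the choice. *)
Lemma V_locus_restriction (X' : topologicalType) (A B : set X') (AB : A `<=` B) (l : M_B R B) :
  V_locus A (restriction AB l) <-> exists k, cohomology_neq0 (pullback (incl_sub AB) (repr l)) k.
Proof.
split=> -[k hk]; exists k; move: hk; apply: cohomology_iso.
  exact: repr_isomorphic.
exact/isomorphic_sym/repr_isomorphic.
Qed.

(** An edge is determined by the set of hyperplanes containing it, so the product in
    [dense_equation] is a genuine finite product. *)
Lemma dense_edges_finite : finite_set [set W : {vspace X} | dense_edge F W].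
Proof.
apply: (@sub_finite_set _ _ ((fun S : {set 'I_r} =>
   xget 0%VS [set W : {vspace X} | edge F W /\ above F W = S]) @` setT)).
  move=> W /= [eW _]; exists (above F W) => //.
  case: xgetP => [W' _ [eW' aW']|/(_ W)[]//].
  apply/vspaceP => w; apply/idP/idP.
    by move=> /(edgeP w eW'); rewrite aW' => h; exact/(edgeP w eW).
  by move=> /(edgeP w eW); rewrite -aW' => h; exact/(edgeP w eW').
exact/finite_image/finite_finset.
Qed.

Lemma dense_equation_eq0 (t : 'I_r -> C) : dense_equation F t = 0 <->
  exists2 W, dense_edge F W & \prod_(i in above F W) t i = 1.
Proof.
have aE W : \prod_(i | vanishes_on F i W) t i = \prod_(i in above F W) t i.
  by apply: eq_bigl => i; rewrite inE.
rewrite /dense_equation (fsbig_finite _ _ dense_edges_finite) /=.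
split=> [/eqP|[W dW tW]].
  rewrite prodf_seq_eq0 => /hasP[W /=]; rewrite (in_fset_set dense_edges_finite) => /set_mem dW.
  by rewrite subr_eq0 aE => /eqP tW; exists W.
rewrite (big_rem W)/= ?aE ?tW ?subrr ?mul0r//.
by rewrite (in_fset_set dense_edges_finite); exact: mem_set.
Qed.

End MonodromyOfMeridians.

(** * Nonvanishing local cohomology produces a dense edge *)

Section VanishingOutside.
Variables (R : realType) (n r : nat).
Local Notation C := R[i].
Local Notation X := 'rV[C]_n.
Variable F : 'I_r -> {scalar X}.
Hypothesis F_neq0 : forall i, exists x, F i x != 0.
Hypothesis F_distinct : injective (hyperplane F).
Local Notation U := (arr_complement F).

Lemma intersection_vspace (A : {set 'I_r}) :
  exists W : {vspace X}, forall x, x \in W <-> forall i, i \in A -> F i x = 0.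
Proof.
pose M : 'M[C]_(n, r) := \matrix_(j, i) (if i \in A then F i (delta_mx 0 j) else 0).
have ME (x : X) i : (x *m M) 0 i = if i \in A then F i x else 0.
  rewrite !mxE; case: ifP => iA; last by rewrite big1// => j _; rewrite !mxE iA mulr0.
  rewrite [in RHS](row_sum_delta x) linear_sum; apply: eq_bigr => j _.
  by rewrite !mxE iA FZ.
exists (lker (linfun (mulmxr M : X -> 'rV[C]_r))) => x; rewrite memv_ker lfunE /=.
split=> [/eqP e i iA|h].
  by have := ME x i; rewrite e mxE iA.
apply/eqP/matrixP => a i; rewrite (ord1 a) ME mxE; case: ifP => // iA; exact: h.
Qed.

Lemma rkF_set0 : rkF F finset.set0 = 0%N.
Proof. by rewrite /rkF /spanF big_set0 mxrank0. Qed.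

Lemma rkF_subadd A B : (rkF F (A :|: B) <= rkF F A + rkF F B)%N.
Proof. by rewrite (leq_trans _ (rkF_submod F A B))// leq_addr. Qed.

(** A summand of a summand is a summand, by subadditivity of ranks, so one of least cardinality
    cannot be separated. *)
Lemma minimal_summand (S : {set 'I_r}) : S != finset.set0 ->
  exists A : {set 'I_r}, [/\ A != finset.set0, A \subset S,
     (rkF F A + rkF F (S :\: A) <= rkF F S)%N & ~ separable F A].
Proof.
move=> S0; pose good (A : {set 'I_r}) := [&& A != finset.set0, A \subset S &
  (rkF F A + rkF F (S :\: A) <= rkF F S)%N].
have gS : good S by rewrite /good S0 fintype.subxx finset.setDv rkF_set0 addn0 leqnn.
pose A := [arg min_(A < S | good A) #|A|].
have [/and3P[A0 AS Ark] Amin] : good A /\ forall B, good B -> (#|A| <= #|B|)%N.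
  by rewrite /A; case: arg_minnP.
exists A; split=> // -[B [BA [i1 i1B [i2 i2A i2B]] Brk]].
have BsA : B \subset A by apply/fintype.subsetP.
have : good B.
  apply/and3P; split; first by apply/set0Pn; exists i1.
    exact: fintype.subset_trans BsA AS.
  have := rkF_subadd (A :\: B) (S :\: A).
  have -> : (A :\: B) :|: (S :\: A) = S :\: B.
    apply/finset.setP => i; rewrite !inE.
    have /implyP := BA i; have /implyP := fintype.subsetP AS i.
    by case: (i \in A); case: (i \in B); case: (i \in S).
  by move: Ark Brk; lia.
move=> /Amin; rewrite leqNgt proper_card// properE BsA/=.
by apply/negP => /fintype.subsetP/(_ _ i2A); rewrite (negbTE i2B).
Qed.

Variables (L : local_system R U) (tau : 'I_r -> C).
Hypothesis tau_merid : forall i p v, merid F i p v -> mono L p v = tau i.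

Lemma cohomology_dense_edge (x : X) (e : R) k : centered F x e -> arr_poly F x = 0 ->
  cohomology_neq0 (pullback (incl_sub (@loc_complement_sub R n r F x e)) L) k ->
  exists2 W, dense_edge F W & \prod_(i in above F W) tau i = 1.
Proof.
move=> xe x0 Hk; pose S : {set 'I_r} := [set i | F i x == 0]%SET.
have S0 : S != finset.set0.
  move/eqP: x0; rewrite /arr_poly => /prodf_eq0[i _ Fi].
  by apply/set0Pn; exists i; rewrite inE.
have [A [A0 AS Ark Asep]] := minimal_summand S0.
have [W WA] := intersection_vspace A.
have eW : edge F W by exists A.
have [P [PA PB]] : exists P : 'M[C]_n, (forall i, i \in A -> forall x, F i (x *m P) = F i x) /\
    (forall i, i \in S :\: A -> forall x, F i (x *m P) = 0).
  apply: split_proj => //; apply: leq_trans Ark _; apply: rkF_mono.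
  by apply/fintype.subsetP => i iS; rewrite finset.in_setU finset.in_setD iS andbT orbN.
have xA i : i \in A -> F i x = 0.
  by move=> iA; have := fintype.subsetP AS i iA; rewrite inE => /eqP.
(* A hyperplane outside [A] containing [W] passes through [x], so its form is killed by [P]; as [W]
   contains every [y - y P], the form would vanish everywhere. *)
have aW : above F W = A.
  apply/finset.setP => i; apply/aboveP/idP => [h|iA w /WA]; last exact.
  apply/negPn/negP => iA; have Fx : F i x = 0 by apply: h; apply/WA.
  have [y Fy] := F_neq0 i; move/eqP: Fy; apply.
  have iSA : i \in S :\: A by rewrite !inE iA Fx eqxx.
  have : F i (y - y *m P) = 0 by apply: h; apply/WA => j jA; rewrite FB PA// subrr.
  by rewrite FB PB// subr0.
exists W; first by split=> // /(decomposable_separable F_neq0 eW); rewrite aW.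
rewrite aW; apply/eqP; apply: contrapT => /negP prod1.
have [i0 i0A] := set0Pn _ A0.
apply: (@no_cohomology _ _ _ F F_neq0 F_distinct L tau tau_merid x e xe A i0 P i0A xA PA _ k) Hk => //.
by move=> i Fi iA w; apply: PB; rewrite !inE iA Fi eqxx.
Qed.

End VanishingOutside.

(** * Local cohomology at a dense edge *)

Section LocallyConstant.
Variable R : realType.

(** The intermediate value theorem for the indicator of the set where [f] differs from [f 0]. *)
Lemma locally_constant_interval (Z : eqType) (f : R -> Z) :
  (forall t, exists2 d, 0 < d & forall s, `|s - t| < d -> f s = f t) -> f 0 = f 1.
Proof.
move=> fl; pose h t : R := if f t == f 0 then 0 else 1.
have hc : continuous h.
  move=> t A /= At; have [d d0 dt] := fl t.
  apply/nbhs_ballP; exists d => // s; rewrite -ball_normE/= distrC => st.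
  by rewrite /h /= (dt _ st); apply: nbhs_singleton.
apply/eqP; rewrite eq_sym; apply/negPn/negP => f10.
have h0 : h 0 = 0 by rewrite /h eqxx.
have h1 : h 1 = 1 by rewrite /h (negbTE f10).
have [||c _] := @IVT R h 0 1 (1 / 2) ler01.
- by apply: continuous_subspaceT.
- by rewrite h0 h1 ge_min le_max; apply/andP; split; apply/orP; [left|right]; lra.
by rewrite /h; case: ifP => _; lra.
Qed.

Lemma unit_expi_pi (w : R[i]) : nsq w = 1 -> exists2 a, `|a| <= pi & w = expi a.
Proof.
case: w => x y; rewrite /nsq/= => xy.
have x1 : -1 <= x <= 1 by apply/andP; split; nra.
have a0 := acos_ge0 x1; have a1 := acos_lepi x1.
have sq : Num.sqrt (1 - x ^+ 2) = `|y| by rewrite -sqrtr_sqr -xy; congr Num.sqrt; ring.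
have [y0|y0] := lerP 0 y.
  by exists (acos x); rewrite ?ger0_norm// /expi acosK// sin_acos// sq ger0_norm.
exists (- acos x); first by rewrite normrN ger0_norm.
by rewrite /expi cosN sinN acosK// sin_acos// sq ltr0_norm// opprK.
Qed.

(** The half-angle formula gives [sin (d / 2) = 0] for the difference [d], and [d / 2] has absolute
    value less than [2 * pi]. *)
Lemma expi_eq (s t : R) : expi s = expi t -> `|s - t| < 4 * pi ->
  [\/ s = t, s = t + 2 * pi | t = s + 2 * pi].
Proof.
move=> e; have p0 := @pi_gt0 R.
have : expi (s - t) = 1.
  by rewrite expiD e -expiD subrr expi0.
have [d dE] : exists d, d = s - t by exists (s - t).
rewrite -dE => d1; rewrite ltr_norml => /andP[l1 l2].
have s0 : sin (d / 2) = 0.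
  have dd : d = d / 2 + d / 2 by lra.
  have := congr1 Re d1; rewrite /= {1}dd cosD -!expr2 cos2sin2 => h.
  by apply/eqP; rewrite -sqrf_eq0; apply/eqP; lra.
have pos (x : R) : 0 < x < 2 * pi -> sin x = 0 -> x = pi.
  move=> /andP[x0 x1] sx; have [xp|xp|//] := ltgtP x pi.
    by have := @sin_gt0_pi R x; rewrite x0 xp sx ltxx => /(_ isT).
  have := @sin_gt0_pi R (x - pi); rewrite sinB cospi sinpi sx mulr0 mul0r subr0 ltxx.
  have -> : 0 < x - pi < pi by lra.
  by move=> /(_ isT).
have [d0|d0|d0] := ltgtP d 0.
- apply: Or33; have := pos (- (d / 2)); rewrite sinN s0 oppr0 => /(_ _ erefl) h.
  have dpi : - (d / 2) = pi by apply: h; lra.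
  lra.
- apply: Or32; have dpi : d / 2 = pi by apply: pos s0; lra.
  lra.
- by apply: Or31; lra.
Qed.

Lemma expi_atan (z : R[i]) : nsq z = 1 -> 0 < Re z -> expi (atan (Im z / Re z)) = z.
Proof.
case: z => x y; rewrite /nsq/= => xy x0.
have c1 : cos (atan (y / x)) = x.
  rewrite cos_atan; have -> : 1 + (y / x) ^+ 2 = (x^-1) ^+ 2.
    by apply: (mulIf (_ : x ^+ 2 != 0)); rewrite ?expf_neq0 ?gt_eqF// mulrDl mul1r expr_div_n
      divfK ?exprVn ?mulVf ?expf_neq0 ?gt_eqF.
  by rewrite sqrtr_sqr normfV gtr0_norm// invrK.
rewrite /expi c1; congr (_ +i* _).
have : tan (atan (y / x)) = y / x by rewrite atanK.
by rewrite /tan c1 => /(mulIf (invr_neq0 (lt0r_neq0 x0))).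
Qed.

End LocallyConstant.

(** * Pulling back along a point-dependent rotation *)

Section Rotation.
Variables (R : realType) (X : topologicalType) (T : set X) (K : local_system R T).
Local Notation C := R[i].
Local Notation I := (@unit_interval R).
Variable rot : T -> R -> X.
Hypothesis rot_continuous : continuous (fun yt : T * R => rot yt.1 yt.2).
Hypothesis rotT : forall y t, T (rot y t).
Hypothesis rot0 : forall y, rot y 0 = val y.
Hypothesis rot_period : forall y t, tp K (rot y) t (t + 2 * pi) = 1.
Variables (om : T -> C) (f : continuousType T T).
Hypothesis om_continuous : continuous om.
Hypothesis om1 : forall y, nsq (om y) = 1.
Hypothesis fE : forall y t, expi t = om y -> val (f y) = rot y t.

Let rotc y : continuous (rot y).
Proof.
apply: (@comp_continuous _ _ _ (fun t : R => (y, t)) (fun yt : T * R => rot yt.1 yt.2)).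
  by apply: pair_continuous; [exact: cst_continuous|move=> t; exact: cvg_id].
exact: rot_continuous.
Qed.

Lemma tp_rotM y a b c : tp K (rot y) a c = tp K (rot y) b c * tp K (rot y) a b.
Proof.
pose m := `|a| + `|b| + `|c|.
have na := ler_norm a; have nb := ler_norm b; have nc := ler_norm c.
have na' := ler_norm (- a); have nb' := ler_norm (- b); have nc' := ler_norm (- c).
rewrite !normrN in na' nb' nc'.
have := normr_ge0 a; have := normr_ge0 b; have := normr_ge0 c => c0 b0 a0.
have rT t : - m <= t <= m -> T (rot y t) by [].
by apply: (tpM K (@rotc y) rT); rewrite /m; lra.
Qed.

Lemma tp_rot_neq0 y a b : tp K (rot y) a b != 0.
Proof.
have na := ler_norm a; have nb := ler_norm b.
have na' := ler_norm (- a); have nb' := ler_norm (- b).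
rewrite !normrN in na' nb'.
have := normr_ge0 a; have := normr_ge0 b => b0 a0.
have rT t : - (`|a| + `|b|) <= t <= `|a| + `|b| -> T (rot y t) by [].
by apply: (tp_neq0 K (@rotc y) rT); lra.
Qed.

Lemma tp_rot_angle y s t : expi s = expi t -> `|s - t| < 4 * pi ->
  tp K (rot y) 0 s = tp K (rot y) 0 t.
Proof.
move=> st /(expi_eq st)[->//| ->|->].
  by rewrite (tp_rotM y 0 t) rot_period mul1r.
by rewrite (tp_rotM y 0 s (s + _)) rot_period mul1r.
Qed.

Let arg y : R := projT1 (cid2 (unit_expi_pi (om1 y))).

Let arg_le y : `|arg y| <= pi. Proof. by rewrite /arg; case: cid2. Qed.

Let argE y : om y = expi (arg y). Proof. by rewrite /arg; case: cid2. Qed.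

(** Transport from [y] to [f y] along the rotation. The angle [arg] is not continuous, but a full
    turn has trivial transport, so its jumps do not matter. *)
Let g y := tp K (rot y) 0 (arg y).

(** While [om] stays in an open half plane along the path, [atan] provides a continuous angle [th],
    and rotating by [th] is a homotopy to which [track_natural] applies. *)
Let local_naturality (b : cpath R T) (t0 : R) : `|t0| <= pi ->
  (forall s, 0 < Re (om (b s) * expi (- t0))) ->
  K (f \o b) * g (b (@I0 R)) = g (b (@I1 R)) * K b.
Proof.
move=> t0pi pos; pose z s := om (b s) * expi (- t0).
pose th s := t0 + atan (Im (z s) / Re (z s)).
have zpos s : 0 < Re (z s) := pos s.
have bc : continuous b by exact: cts_fun.
have zc : continuous z.
  by apply: cmulc; [exact: (comp_continuous bc om_continuous)|exact: cst_continuous].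
have /cplx_continuousP[zr zi] := zc.
have thc : continuous th.
  apply: radd; first exact: cstc.
  apply: (comp_continuous _ (@continuous_atan R)).
  by apply: rmul; [exact: zi|apply: rinv; [exact: zr|move=> s; rewrite (gt_eqF (zpos s))]].
have thE s : expi (th s) = om (b s).
  rewrite /th expiD expi_atan; last exact: pos.
    by rewrite /z mulrCA -expiD subrr expi0 mulr1.
  by rewrite nsqM om1 nsq_expi mulr1.
have th_le s : `|th s - arg (b s)| < 4 * pi.
  have p0 := @pi_gt0 R; have := @atan_gtNpi2 R (Im (z s) / Re (z s)).
  have := @atan_ltpi2 R (Im (z s) / Re (z s)); have := arg_le (b s).
  rewrite /th; move: t0pi; rewrite !ler_norml ltr_norml.
  move: (atan _) (arg _) => u v; lra.
have gE s : g (b s) = tp K (rot (b s)) 0 (th s).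
  by apply: tp_rot_angle; rewrite ?thE ?argE// distrC.
have c1 : continuous (fun su : I * I => b su.1).
  by apply: (comp_continuous _ bc) => su; exact: cvg_fst.
have c2 : continuous (fun su : I * I => val su.2 : R).
  by apply: (comp_continuous _ (@uvalc R)) => su; exact: cvg_snd.
have c3 : continuous (fun su : I * I => th su.1).
  by apply: (comp_continuous _ thc) => su; exact: cvg_fst.
have Hc : continuous (fun su : I * I => mksub (rotT (b su.1) (val su.2 * th su.1))).
  apply: subtype_continuous => /=.
  apply: (@comp_continuous _ _ _ (fun su : I * I => (b su.1, val su.2 * th su.1 : R))
    (fun yt : T * R => rot yt.1 yt.2)); last exact: rot_continuous.
  by apply: pair_continuous; [exact: c1|exact: rmul].
have idc : continuous (fun s : I => s) by move=> s; exact: cvg_id.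
have trE s : K (track (cmap Hc) s) = g (b s).
  rewrite gE; apply: lpE => u /=; congr (rot _ _); ring.
have := @track_natural _ _ _ K (cmap Hc) b (f \o b) (cmap idc).
rewrite !trE /=; have -> : f \o b \o cmap idc = f \o b :> cpath R T.
  exact/continuousEP.
have -> : b \o cmap idc = b :> cpath R T by exact/continuousEP.
apply=> s; apply: val_inj => /=.
  by rewrite mul0r rot0.
by rewrite mul1r (fE (thE s)).
Qed.

(** Naturality of [g] holds on short pieces of a path, and a connectedness argument on the parameter
    extends it to whole paths. *)
Lemma rotation_isomorphic : isomorphic K (pullback f K).
Proof.
exists g; split=> [y|a]; first exact: tp_rot_neq0.
rewrite -[pullback f K a]/(K (f \o a)).
have ac : continuous (fun t : R => a (clamp t)).
  by apply: (comp_continuous (@clamp_continuous R)); exact: cts_fun.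
have fc : continuous (fun t : R => f (a (clamp t))).
  by apply: (comp_continuous ac); exact: cts_fun.
pose F1 t : X := val (a (clamp t)); pose F2 t : X := val (f (a (clamp t))).
have F1c : continuous F1 by exact: (comp_continuous ac (@val_continuous _ T)).
have F2c : continuous F2 by exact: (comp_continuous fc (@val_continuous _ T)).
have F1T t : T (F1 t) by exact: sub_in.
have F2T t : T (F2 t) by exact: sub_in.
have big (G : R -> X) b c : continuous G -> (forall t, T (G t)) ->
    [/\ tp K G 0 c = tp K G b c * tp K G 0 b, tp K G 0 b != 0 & tp K G 0 0 = 1].
  move=> Gc GT; pose m := `|b| + `|c|.
  have nb := ler_norm b; have nc := ler_norm c.
  have nb' := ler_norm (- b); have nc' := ler_norm (- c).
  rewrite !normrN in nb' nc'.
  have c0 := normr_ge0 c; have b0 := normr_ge0 b.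
  have GT' t : - m <= t <= m -> T (G t) by [].
  split; [apply: (tpM K Gc GT')|apply: (tp_neq0 K Gc GT')|apply: (tp_refl K Gc GT')];
    rewrite /m; lra.
(* [phi t = 1] expresses naturality for the part of the path up to time [t]; [loc] makes [phi]
   locally constant. *)
pose phi t := tp K F2 0 t * g (a (clamp 0)) / (g (a (clamp t)) * tp K F1 0 t).
have loc t0 : exists2 d, 0 < d & forall t, `|t - t0| < d ->
    tp K F2 t0 t * g (a (clamp t0)) = g (a (clamp t)) * tp K F1 t0 t.
  have [th0 th0pi th0E] := unit_expi_pi (om1 (a (clamp t0))).
  pose q t := Re (om (a (clamp t)) * expi (- th0)).
  have qc : continuous q.
    have : continuous (fun t => om (a (clamp t)) * expi (- th0)).
      by apply: cmulc; [exact: (comp_continuous ac om_continuous)|exact: cst_continuous].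
    by move=> /cplx_continuousP[].
  have hn : nbhs (q t0) [set y : R | 0 < y].
    apply: open_nbhs_nbhs; split; first exact: open_gt.
    by rewrite /q /= th0E -expiD subrr expi0 /= ltr01.
  have /nbhs_ballP[d /= d0 dq] := qc t0 _ hn; exists d => // t td.
  have bc : continuous (fun u : I => a (clamp ((1 - val u) * t0 + val u * t))).
    by apply: (comp_continuous _ ac); exact: sub_interval_continuous.
  have qpos (s : I) : 0 < q ((1 - val s) * t0 + val s * t).
    apply: dq; rewrite -ball_normE/=; have /andP[s0 s1] := unitP s.
    have -> : t0 - ((1 - val s) * t0 + val s * t) = val s * (t0 - t) by ring.
    by rewrite normrM ger0_norm// distrC (le_lt_trans _ td)// ler_piMl.
  have b0 : cmap bc (@I0 R) = a (clamp t0).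
    rewrite -[LHS]/(a (clamp ((1 - 0) * t0 + 0 * t))).
    by rewrite subr0 mul1r mul0r addr0.
  have b1 : cmap bc (@I1 R) = a (clamp t).
    rewrite -[LHS]/(a (clamp ((1 - 1) * t0 + 1 * t))).
    by rewrite subrr mul1r mul0r add0r.
  have := @local_naturality (cmap bc) th0 th0pi qpos; rewrite b0 b1 => e.
  have e1 : K (f \o cmap bc) = tp K F2 t0 t by exact: lpE.
  have e2 : K (cmap bc) = tp K F1 t0 t by exact: lpE.
  by rewrite -e1 -e2.
have phi_const : phi 0 = phi 1.
  apply: locally_constant_interval => t0; have [d d0 dt] := loc t0.
  exists d => // t /dt e; rewrite /phi.
  have [e1 n1 _] := big F1 t0 t F1c F1T; have [e2 n2 _] := big F2 t0 t F2c F2T.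
  have [_ n1' _] := big F1 t t F1c F1T.
  apply/eqP; rewrite eqr_div ?mulf_neq0 ?tp_rot_neq0//; apply/eqP.
  rewrite e1 e2; transitivity (tp K F2 t0 t * g (a (clamp t0)) *
    (tp K F2 0 t0 * g (a (clamp 0)) * tp K F1 0 t0)); first ring.
  rewrite e; ring.
have [_ n1 r1] := big F1 1 0 F1c F1T; have [_ n2 r2] := big F2 0 0 F2c F2T.
have phi0 : phi 0 = 1 by rewrite /phi r1 r2 mul1r mulr1 divff// tp_rot_neq0.
have aE (s : I) : a (clamp ((1 - val s) * 0 + val s * 1)) = a s.
  by rewrite mulr0 add0r mulr1 clamp_val.
have KaE : K a = tp K F1 0 1 by apply: lpE => s; rewrite /F1 aE.
have KfaE : K (f \o a) = tp K F2 0 1 by apply: lpE => s; rewrite /F2 aE.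
have c0 : clamp 0 = @I0 R by rewrite -[RHS]clamp_val.
have c1 : clamp 1 = @I1 R by rewrite -[RHS]clamp_val.
move: phi_const; rewrite phi0 /phi -KaE -KfaE c0 c1 => /esym.
move=> /(congr1 (fun z => z * (g (a (@I1 R)) * K a))).
by rewrite divfK ?mul1r// mulf_neq0 ?tp_rot_neq0 ?transport_neq0.
Qed.

End Rotation.

(** * Nonvanishing cohomology at a dense edge, via a slice *)

Section Superset.
Variables (R : realType) (n r : nat).
Local Notation C := R[i].
Local Notation X := 'rV[C]_n.
Local Notation I := (@unit_interval R).
Variable F : 'I_r -> {scalar X}.
Hypothesis F_neq0 : forall i, exists x, F i x != 0.
Hypothesis F_distinct : injective (hyperplane F).
Local Notation U := (arr_complement F).

Lemma cinvc (S : topologicalType) (f : S -> C) :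
  continuous f -> (forall x, f x != 0) -> continuous (fun x => (f x)^-1).
Proof. by move=> fc f0 x; apply: (@cvgV C); [exact: f0|exact: fc]. Qed.

Lemma lp_pullback_incl (A B : set X) (AB : A `<=` B) (L : local_system R B) (f : I -> X) :
  continuous f -> (forall s, A (f s)) -> lp (pullback (incl_sub AB) L) f = lp L f.
Proof.
move=> fc fA; rewrite -(@lpE _ _ _ _ (cmap (path_in_continuous (fY := fA) fc)))//.
exact: (@lpE _ _ _ L (incl_sub AB \o cmap (path_in_continuous (fY := fA) fc))).
Qed.

Lemma good_affine i (S : {set 'I_r}) :
  good [set m : X | F i m = 1 /\ forall j, j \in S -> F j m = 0].
Proof.
split=> [p q t [p1 p0] [q1 q0] t01|p q z [p1 p0] [q1 q0]].
  split=> [|j jS]; first by rewrite /= FP FZ p1 q1 !mulr1 rmorphB/= subrK.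
  by rewrite FP FZ p0 ?q0// !mulr0 addr0.
exists 1 => // e _; split=> [|j jS]; first by rewrite /= FD FZ FB p1 q1 subrr mulr0 addr0.
by rewrite FD FZ FB p0// q0// subrr mulr0 addr0.
Qed.

Lemma rkF1 i : (rkF F finset.set0 < rkF F (i |: finset.set0))%N.
Proof.
rewrite rkF_set0 lt0n mxrank_eq0; apply/eqP => e; have [y Fy] := F_neq0 i.
move/eqP: Fy; apply; have := grad_spanF F (setU11 i finset.set0).
rewrite e => h; have {}h : (grad F i <= spanF F finset.set0)%MS.
  by apply: submx_trans h _; exact: sub0mx.
by move/dualF: h; apply => j; rewrite finset.in_set0.
Qed.

Lemma inseparable_connected (A : {set 'I_r}) i : i \in A -> ~ separable F A ->
  connectedM (rkF F) i finset.set0 (enum (A :\ i)).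
Proof.
move=> iA nsep; split=> [|B BA [j1 j1B] [j2 j2A j2B]]; first exact: rkF1.
have memA z : (z \in i :: enum (A :\ i)) = (z \in A).
  by rewrite inE mem_enum finset.in_setD1; case: eqVneq => [->|].
rewrite finset.setU0 rkF_set0 addn0 ltnNge; apply/negP => h; apply: nsep.
have e1 : span_seq (i :: enum (A :\ i)) finset.set0 = A.
  by apply/finset.setP => z; rewrite finset.inE memA finset.in_set0 orbF.
have e2 : span_seq [seq z <- i :: enum (A :\ i) | z \notin B] finset.set0 = A :\: B.
  by apply/finset.setP => z; rewrite !finset.inE mem_filter memA orbF.
rewrite e1 e2 in h; exists B; split; last exact: h.
- by move=> z /BA; rewrite memA.
- by exists j1.
- by exists j2; rewrite -?memA.
Qed.

Variables (x : X) (e : R) (L : local_system R U) (tau : 'I_r -> C).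
Hypothesis tau_merid : forall i p v, merid F i p v -> mono L p v = tau i.
Hypotheses (xe : centered F x e) (e0 : 0 < e).
Variables (A : {set 'I_r}) (i0 : 'I_r).
Hypothesis AE : forall i, (i \in A) = (F i x == 0).
Hypothesis i0A : i0 \in A.
Hypothesis Ainsep : ~ separable F A.
Hypothesis tauA : \prod_(i in A) tau i = 1.
Local Notation T := (loc_complement F x e).
Local Notation K := (pullback (incl_sub (@loc_complement_sub R n r F x e)) L).

Let s := enum (A :\ i0).
Let K0 : set X := [set m | F i0 m = 1 /\ forall j, j \in finset.set0 -> F j m = 0].
(** An affine chart of the projectivised complement: the slice where [F i0] equals 1. *)
Let Y : set X := K0 `&` off F s.

Let Y_neq0 m i : Y m -> i \in A -> F i m != 0.
Proof.
move=> [[m1 _] ms] iA; have [->|ii] := eqVneq i i0; first by rewrite m1 oner_neq0.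
by apply: ms; rewrite mem_enum finset.in_setD1 ii.
Qed.

Let Y1 m : Y m -> F i0 m = 1. Proof. by case=> -[]. Qed.

Let e2 : 0 < e ^+ 2. Proof. by rewrite exprn_gt0. Qed.

(** Positive scaling that draws the unbounded slice into the ball of radius [e]. *)
Let sc (m : X) : R := e / (1 + sqn m).

Let den (m : X) : 0 < 1 + sqn m :> R. Proof. by have := sqn_ge0 m; lra. Qed.

Let sc_gt0 (m : X) : 0 < sc m. Proof. exact: divr_gt0. Qed.

Let sqn_sc (m : X) : sqn ((sc m)%:C *: m) < e ^+ 2.
Proof.
rewrite sqnZ nsq_real /sc expr_div_n mulrAC ltr_pdivrMr ?exprn_gt0//.
by rewrite ltr_pM2l//; have := sqn_ge0 m; nra.
Qed.

Let realC_neq0 (a : R) : 0 < a -> a%:C != 0 :> C.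
Proof. by move=> a0; rewrite eq_complex/= gt_eqF. Qed.

Let iota_in (m : Y) : T (x + (sc (val m))%:C *: val m).
Proof.
apply: in_loc => // i /eqP; rewrite -AE => iA.
by rewrite FZ mulf_neq0 ?realC_neq0// (Y_neq0 (sub_in m)).
Qed.

Let sc_continuous (S : topologicalType) (h : S -> X) :
  continuous h -> continuous (fun z => sc (h z)).
Proof.
move=> hc; apply: rmul; first exact: cstc.
apply: rinv; last by move=> z; rewrite gt_eqF.
by apply: radd; [exact: cstc|exact: (sqn_continuous hc)].
Qed.

Let iota_continuous : continuous (fun m : Y => mksub (iota_in m)).
Proof.
have vc : continuous (fun m : Y => val m : X) by exact: val_continuous.
apply: subtype_continuous; apply: xaddc; first exact: cst_continuous.
by apply: xscalec; [apply: realC_continuous; exact: (sc_continuous vc)|exact: vc].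
Qed.

Let iota : continuousType Y T := cmap iota_continuous.

Let Fw (y : T) : F i0 (val y - x) != 0.
Proof. by have [_ yU] := loc_in (sub_in y); apply: yU; apply/eqP; rewrite -AE. Qed.

Let p_in (y : T) : Y ((F i0 (val y - x))^-1 *: (val y - x)).
Proof.
have [_ yU] := loc_in (sub_in y); split=> [|i].
  by split=> [|j]; rewrite ?finset.in_set0//= FZ mulVf// Fw.
rewrite mem_enum finset.in_setD1 => /andP[_ iA].
by rewrite FZ mulf_neq0 ?invr_eq0 ?Fw// yU//; apply/eqP; rewrite -AE.
Qed.

Let wc : continuous (fun y : T => val y - x : X).
Proof. by apply: gsubc; [exact: val_continuous|exact: cst_continuous]. Qed.

Let Fwc : continuous (fun y : T => F i0 (val y - x) : C).
Proof. exact: (comp_continuous wc (@F_continuous R n r F i0)). Qed.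

Let p_continuous : continuous (fun y : T => mksub (p_in y)).
Proof.
apply: subtype_continuous; apply: xscalec; last exact: wc.
by apply: cinvc; [exact: Fwc|exact: Fw].
Qed.

Let p : continuousType T Y := cmap p_continuous.

Let p_iota m : p (iota m) = m.
Proof.
apply: val_inj; rewrite -[LHS]/((F i0 (x + (sc (val m))%:C *: val m - x))^-1 *:
  (x + (sc (val m))%:C *: val m - x)).
rewrite addrAC subrr add0r FZ (Y1 (sub_in m)) mulr1 scalerA mulVf ?scale1r//.
exact: realC_neq0.
Qed.

Let modF (y : T) : R := Num.sqrt (nsq (F i0 (val y - x))).

Let modF_gt0 y : 0 < modF y.
Proof. by rewrite sqrtr_gt0 nsq_gt0 Fw. Qed.

Let modFc : continuous modF.
Proof. exact: (comp_continuous (nsq_continuous Fwc) (@sqrt_continuous R)). Qed.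

(** The unit factor that makes the value of [F i0] on [val y - x] real and positive. *)
Let om (y : T) : C := (modF y)%:C * (F i0 (val y - x))^-1.

Let om_continuous : continuous om.
Proof.
apply: cmulc; first exact: (realC_continuous modFc).
by apply: cinvc; [exact: Fwc|exact: Fw].
Qed.

Let om1 y : nsq (om y) = 1.
Proof.
rewrite nsqM nsq_real sqr_sqrtr ?nsq_ge0// -nsq_inv divff// nsq_eq0; exact: Fw.
Qed.

Let circle_in (y : T) (z : C) : nsq z = 1 -> T (x + z *: (val y - x)).
Proof.
move=> z1; have [ye yU] := loc_in (sub_in y).
apply: in_loc => //; first by rewrite sqnZ z1 mul1r.
by move=> i Fx; rewrite FZ mulf_neq0 ?yU// -nsq_gt0 z1 ltr01.
Qed.

Let f2_continuous : continuous (fun y : T => mksub (circle_in y (om1 y))).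
Proof.
apply: subtype_continuous; apply: xaddc; first exact: cst_continuous.
by apply: xscalec; [exact: om_continuous|exact: wc].
Qed.

Let f2 : continuousType T T := cmap f2_continuous.

Let rot (y : T) (t : R) : X := x + expi t *: (val y - x).

Let rot_c : continuous (fun yt : T * R => rot yt.1 yt.2).
Proof.
apply: xaddc; first exact: cst_continuous; apply: xscalec.
  by apply: expi_continuous => yt; exact: cvg_snd.
by apply: (comp_continuous _ wc) => yt; exact: cvg_fst.
Qed.

(** A full turn about [x] encircles each hyperplane of [A] once and no other, and the product of
    these monodromies is 1 by [tauA]. *)
Let rot_period y t : tp K (rot y) t (t + 2 * pi) = 1.
Proof.
have [ye yU] := loc_in (sub_in y).
transitivity (mono L (x + 0) (expi t *: (val y - x))).
  rewrite /tp lp_pullback_incl.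
  - apply: lp_ext => u; rewrite /rot addr0 scalerA -expiD; congr (_ + expi _ *: _); ring.
  - apply: (@comp_continuous _ _ _ (fun u : I => (y, (1 - val u) * t + val u * (t + 2 * pi)))
      (fun yt : T * R => rot yt.1 yt.2)); last exact: rot_c.
    by apply: pair_continuous; [exact: cst_continuous|exact: sub_interval_continuous].
  - by move=> u; apply: circle_in; exact: nsq_expi.
rewrite (mono_centered F_neq0 F_distinct tau_merid xe).
- rewrite -[RHS]tauA; apply: eq_bigl => i; rewrite AE raddf0 nsq0 FZ nsqM nsq_expi mul1r.
  have [Fx|//] := eqVneq (F i x) 0; rewrite /= nsq_gt0; exact: yU.
- by rewrite -(scale0r 0) sqnZ nsq0 mul0r.
- move=> z z1; rewrite add0r !sqnZ nsq_expi mul1r; apply: le_lt_trans ye.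
  by rewrite ler_piMl// sqn_ge0.
move=> i Fx; rewrite raddf0 nsq0 FZ nsqM nsq_expi mul1r eq_sym nsq_eq0; exact: yU.
Qed.

Let f2_iso : isomorphic K (pullback f2 K).
Proof.
apply: (@rotation_isomorphic _ _ _ K rot rot_c _ _ rot_period om f2 om_continuous om1).
- by move=> y t; apply: circle_in; exact: nsq_expi.
- by move=> y; rewrite /rot expi0 scale1r addrC subrK.
by move=> y t te; rewrite /rot te.
Qed.

(** The positive factor by which [iota (p y)] and [f2 y] differ as vectors from [x]; interpolating
    it to 1 is a homotopy inside the local complement. *)
Let ratio (y : T) : R := sc (val (p y)) / modF y.

Let ratio_gt0 y : 0 < ratio y. Proof. by rewrite divr_gt0. Qed.

Let ratioE y : (ratio y)%:C * om y = (sc (val (p y)))%:C * (F i0 (val y - x))^-1.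
Proof.
by rewrite mulrA -rmorphM/= divfK// gt_eqF.
Qed.

Let modulus (y : T) (u : I) : R := (1 - val u) * ratio y + val u.

Let modulus_gt0 y u : 0 < modulus y u.
Proof.
have /andP[u0 u1] := unitP u; rewrite /modulus.
have := ratio_gt0 y; move: (ratio y) (val u) u0 u1 => a v v0 v1 a0.
have [v_lt|v_ge] := ltrP v 1; last by have -> : v = 1; lra.
by rewrite ltr_wpDr// mulr_gt0// subr_gt0.
Qed.

Let modulus_in (yu : (T * I)%type) :
  T (x + ((modulus yu.1 yu.2)%:C * om yu.1) *: (val yu.1 - x)).
Proof.
case: yu => y u /=; have [ye yU] := loc_in (sub_in y).
apply: in_loc => //; last first.
  move=> i Fx; rewrite FZ !mulf_neq0 ?yU// ?realC_neq0 ?modulus_gt0//.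
  by rewrite invr_eq0; exact: Fw.
have re : ratio y ^+ 2 * sqn (val y - x) < e ^+ 2.
  have eqn : (sc (val (p y)))%:C *: val (p y) = ((ratio y)%:C * om y) *: (val y - x).
    by rewrite ratioE -scalerA.
  by have := sqn_sc (val (p y)); rewrite eqn sqnZ nsqM om1 mulr1 nsq_real.
rewrite sqnZ nsqM om1 mulr1 nsq_real.
have m0 := modulus_gt0 y u; have r0 := ratio_gt0 y; have /andP[u0 u1] := unitP u.
have w0 := sqn_ge0 (val y - x).
have [r1|r1] := lerP (ratio y) 1.
  apply: le_lt_trans ye; rewrite ler_piMl// expr_le1// ?(ltW m0)//.
  by rewrite /modulus; nra.
apply: le_lt_trans re; rewrite ler_wpM2r// ler_pXn2r// ?nnegrE ?(ltW m0) ?(ltW r0)//.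
by rewrite /modulus; nra.
Qed.

Let modulus_continuous : continuous (fun yu => mksub (modulus_in yu)).
Proof.
have c1 : continuous (fun yu : (T * I)%type => yu.1) by move=> yu; exact: cvg_fst.
have c2 : continuous (fun yu : (T * I)%type => val yu.2 : R).
  by apply: (comp_continuous _ (@uvalc R)) => yu; exact: cvg_snd.
have pc : continuous (fun y : T => val (p y) : X).
  exact: (comp_continuous p_continuous (@val_continuous _ Y)).
have ratioc : continuous ratio.
  apply: rmul; first exact: (sc_continuous pc).
  by apply: rinv; [exact: modFc|move=> y; rewrite gt_eqF].
apply: subtype_continuous; apply: xaddc; first exact: cst_continuous.
apply: xscalec; last exact: (comp_continuous c1 wc).
apply: cmulc; last exact: (comp_continuous c1 om_continuous).
apply: realC_continuous; apply: radd; last exact: c2.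
apply: rmul; first by apply: rsub; [exact: cstc|exact: c2].
exact: (comp_continuous c1 ratioc).
Qed.

Let iota_p_iso : isomorphic (pullback p (pullback iota K)) (pullback f2 K).
Proof.
apply: (@isomorphic_trans _ _ _ (pullback (iota \o p) K)).
  exists (fun=> 1); split=> [_|a]; first exact: oner_neq0.
  rewrite mulr1 mul1r.
  exact: (@transport_ext _ _ K ((iota \o p) \o a) (iota \o (p \o a)) (fun=> erefl)).
apply: (@isomorphic_pullback_homotopy _ _ _ K (cmap modulus_continuous)) => y; apply: val_inj.
  rewrite -[LHS]/(x + (((1 - 0) * ratio y + 0)%:C * om y) *: (val y - x)).
  by rewrite subr0 mul1r addr0 ratioE -scalerA.
rewrite -[LHS]/(x + (((1 - 1) * ratio y + 1)%:C * om y) *: (val y - x)).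
by rewrite subrr mul0r add0r mul1r.
Qed.

(** The pullback of [K] along [iota \o p] is isomorphic to [K] through [f2], and the slice is a
    retract, so its cohomology embeds. The slice has cohomology because its Euler characteristic is
    a nonzero beta invariant. *)
Lemma local_cohomology_neq0 : exists k, cohomology_neq0 K k.
Proof.
have [k hk] : exists k, cohomology_neq0 (pullback iota K) k.
  have KY : K0 `&` off F s `<=` Y by [].
  have := eulerS_chi (pullback iota K) (good_affine i0 finset.set0) KY.
  have -> : part (K0 `&` off F s) = setT :> set Y.
    by apply/seteqP; split=> // y _; exact: sub_in.
  rewrite chi_chiM => h; apply: (eulerS_neq0 h).
  have us : uniq (i0 :: s).
    by rewrite /= enum_uniq mem_enum finset.in_setD1 eqxx.
  have [_] := chiM_sign (rkF_mono F) (rkF_submod F) (rkF_step F) finset.set0 us.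
  by apply; exact: inseparable_connected.
exists k; have := cohomology_retract p_iota hk; apply: cohomology_iso.
exact: isomorphic_trans iota_p_iso (isomorphic_sym f2_iso).
Qed.

End Superset.

Theorem theorem1p2 (R : realType) (n r : nat)
    (F : 'I_r -> {scalar 'rV[R[i]]_n})
    (F_neq0 : forall i, exists x, F i x != 0)
    (F_distinct : injective (hyperplane F))
    (g : 'I_r -> cpath R (arr_complement F))
    (g_meridian : forall i, is_meridian i (g i)) :
  V_UX F = [set l | zero_locus (dense_equation F) (monodromy g l)].
Proof.
apply/seteqP; split=> l.
  move=> [x /= x0 Hl]; split; first by move=> i; exact: transport_neq0.
  (* Nonvanishing holds for all small radii; one is picked at which the ball meets only hyperplanes
     through [x]. *)
  apply/dense_equation_eq0; have [e e0 he] := small_ball F x.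
  have [d [d0 de Hd]] : exists d, [/\ 0 < d, d <= e &
      V_locus _ (restriction (@loc_complement_sub R n r F x d) l)].
    apply: (@filter_ex _ (0 : R)^'+); near=> d; split; near: d => //.
      exact: nbhs_right_gt.
    exact: nbhs_right_le.
  have [k Hk] := (V_locus_restriction _ _).1 Hd.
  apply: (@cohomology_dense_edge R n r F F_neq0 F_distinct (repr l) (monodromy g l)
    (@meridian_tau R n r F (repr l) g g_meridian) x d k _ x0 Hk).
  by apply: he; rewrite d0.
move=> [_ /= /dense_equation_eq0[W [eW ndW] tauW]].
(* A generic point of the edge: the hyperplanes through it are exactly those containing [W]. *)
have [|||x xW xF] := @forms_common_nonzero R n r F [set x | x \in W]
    (enum (finset.setC (above F W))).
- exact: mem0v.
- by move=> t x y xW yW /=; rewrite rpredD// rpredZ.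
- move=> i; rewrite mem_enum finset.in_setC => /aboveP h; apply: contrapT => nw; apply: h.
  by move=> w wW; apply/eqP; apply: contrapT => /negP Fw; apply: nw; exists w.
have AE i : (i \in above F W) = (F i x == 0).
  apply/idP/idP => [/aboveP h|]; first by rewrite h.
  by apply: contraTT => iW; apply: xF; rewrite mem_enum finset.in_setC.
have [i0 i0W] := edge_neq0 eW.
exists x => /=; first by rewrite /arr_poly (bigD1 i0)//= (eqP (_ : F i0 x == 0)) ?mul0r// -AE.
have [e e0 he] := small_ball F x.
near=> d; apply/V_locus_restriction.
have d0 : 0 < d by near: d; exact: nbhs_right_gt.
have de : d <= e by near: d; exact: nbhs_right_le.
apply: (@local_cohomology_neq0 _ _ _ F F_neq0 F_distinct x d (repr l)
  (monodromy g l) (@meridian_tau R n r F (repr l) g g_meridian) _ d0 (above F W) i0 AE i0W _ tauW).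
  by apply: he; rewrite d0.
by move=> /(separable_decomposable F_neq0 eW).
Unshelve. all: by end_near.
Qed.
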